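(* Suppose that $m=\sum_{k\ge 0}kp_k\in(0,1)$, that $\sum_{k=1}^\infty k(\log k)p_k<\infty$, and let $x>0$. (i) If $\rho=0$, then $$\lim_{t\to\infty}\sqrt{t}\,e^{\alpha t}\,\mathbb{P}_x\big(\widetilde{\zeta}^{-\rho}>t\big)=\sqrt{\tfrac{2}{\pi}}\,C_{sub}\,x.$$ (ii) If $\rho<0$, then $$\lim_{t\to\infty}e^{\alpha t}\,\mathbb{P}_x\big(\widetilde{\zeta}^{-\rho}>t\big)=C_{sub}\,(1-e^{2\rho x}).$$ (iii) If $\rho>0$, then $$\lim_{t\to\infty}t^{3/2}e^{(\alpha+\frac{\rho^2}{2})t}\,\mathbb{P}_x\big(\widetilde{\zeta}^{-\rho}>t\big)=\sqrt{\tfrac{2}{\pi}}\,C_0(\rho)\,x\,e^{\rho x},$$ where the limit $C_0(\rho):=\lim_{N\to\infty}e^{(\alpha+\frac{\rho^2}{2})N}\int_0^\infty y e^{-\rho y}\,\mathbb{P}_y\big(\widetilde{\zeta}^{-\rho}>N\big)\,\mathrm{d}y$ exists and belongs to $(0,\infty)$. Furthermore, for any $\rho\in\mathbb{R}$, as $t\to\infty$, $$\mathbb{P}_x\big(\widetilde{\zeta}^{-\rho}>t\big)\sim\Gamma_\rho\,\mathbb{E}_x\big(\widetilde{Z}_t^{-\rho}((0,\infty))\big),$$ where $\Gamma_\rho=C_{sub}$ when $\rho\le 0$ and $\Gamma_\rho=\rho^2C_0(\rho)$ when $\rho>0$.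
   Context: Branching Brownian motion with drift $-\rho\in\mathbb{R}$: at time $0$ there is one particle at $x$, which moves as a Brownian motion with drift $-\rho$ (unit variance). After an exponential time of parameter $\beta>0$, independent of the motion, it dies and is replaced at its death position by $k$ offspring with probability $p_k$, $k\ge0$; the offspring evolve independently in the same way. $\mathbb{P}_x,\mathbb{E}_x$ denote the law and expectation. $N_t^{-\rho}$ is the set of particles alive at time $t$; for $u\in N_t^{-\rho}$ and $s\le t$, $X_u(s)$ is the position at time $s$ of $u$ or of its ancestor alive at time $s$. $\zeta:=\inf\{t>0: N_t^{-\rho}=\emptyset\}$ is the extinction time (its law depends neither on $\rho$ nor on $x$). $m:=\sum_{k\ge0}kp_k$ is the mean offspring number, assumed to satisfy $m\in(0,1)$ (subcritical case), and $\alpha:=\beta(1-m)\in(0,\infty)$. Under $\sum_{k\ge1}k(\log k)p_k<\infty$ it is known that the limit $C_{sub}:=\lim_{t\to\infty}e^{\alpha t}\mathbb{P}_0(\zeta>t)$ exists and lies in $(0,\infty)$. The branching killed Brownian motion with drift $-\rho$ (particles are killed, along with their descendants, upon hitting the origin) is $\widetilde{Z}_t^{-\rho}:=\sum_{u\in N_t^{-\rho}}1_{\{\min_{s\le t}X_u(s)>0\}}\delta_{X_u(t)}$, and its extinction time is $\widetilde{\zeta}^{-\rho}:=\inf\{t\ge0:\widetilde{Z}_t^{-\rho}((0,\infty))=0\}$. The notation $f(t)\sim g(t)$ as $t\to\infty$ means $\lim_{t\to\infty}f(t)/g(t)=1$. *)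

(* Defs.v *)
From HB Require Import structures.
From mathcomp Require Import all_boot all_order all_algebra.
From mathcomp Require Import all_classical all_reals all_analysis.

Set Implicit Arguments.
Unset Strict Implicit.
Unset Printing Implicit Defensive.

Import Order.TTheory GRing.Theory Num.Theory.
Import numFieldNormedType.Exports.

Local Open Scope classical_set_scope.
Local Open Scope ring_scope.

Section Probability.
Context {R : realType} {d : measure_display} {T : measurableType d}.
Variable P : probability T R.

Definition mutually_independent (I : eqType) (F : I -> set_system T) : Prop :=
  forall (J : seq I) (A : I -> set T), uniq J ->
    (forall i, i \in J -> F i (A i)) ->
    P (\bigcap_(i in [set` J]) A i) = (\prod_(i <- J) P (A i))%E.

Definition sigma_of_process (W : R -> T -> R) : set_system T :=
  <<s \bigcup_(t in `[0, +oo[) g_sigma_algebra_preimage (W t) >>.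

(* Standard Brownian motion on [0, +oo[ started at 0; nothing is required of
   W t for t < 0. The second argument of normal_prob is the standard
   deviation. *)
Definition is_brownian_motion (W : R -> {RV P >-> R}) : Prop :=
  [/\ forall w, W 0 w = 0,
      forall w, {within `[0, +oo[, continuous (fun t => W t w)},
      (forall s t, 0 <= s -> s < t -> forall A, measurable A ->
         P ((fun w => W t w - W s w) @^-1` A) =
         normal_prob 0 (Num.sqrt (t - s)) A)
    & forall t : nat -> R, 0 <= t 0%N -> nondecreasing_seq t ->
        mutually_independent (fun n : nat =>
          g_sigma_algebra_preimage (fun w => W (t n.+1) w - W (t n) w))].

End Probability.

(* Ulam-Harris labels: [::] is the initial particle, and i :: v is the i-th
   child (counting from 0) of the particle v. *)
Definition label : Type := seq nat.

(* The randomness driving a branching Brownian motion with branching rate beta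
   and offspring distribution p: each label carries a lifetime, an offspring
   number and a Brownian motion, all of them independent. The drift and the
   starting point only enter in the positions of the particles below. *)
Record bbm {R : realType} {d : measure_display} {T : measurableType d}
    (P : probability T R) (beta : R) (p : nat -> R) := Bbm {
  lifetime : label -> {RV P >-> R} ;
  offspring : label -> {RV P >-> nat} ;
  motion : label -> R -> {RV P >-> R} ;
  lifetime_ge0 : forall u w, 0 <= lifetime u w ;
  lifetime_law : forall u A, measurable A ->
    P (lifetime u @^-1` A) = exponential_prob beta A ;
  offspring_law : forall u k, P (offspring u @^-1` [set k]) = (p k)%:E ;
  motion_law : forall u, is_brownian_motion (motion u) ;
  bbm_independent : mutually_independent P
    (fun j : (seq nat + seq nat + seq nat)%type =>
       match j with
       | inl (inl u) => g_sigma_algebra_preimage (lifetime u)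
       | inl (inr u) => g_sigma_algebra_preimage (offspring u)
       | inr u => sigma_of_process (fun t => motion u t)
       end) }.

Section BranchingBrownianMotion.
Context {R : realType} {d : measure_display} {T : measurableType d}.
Context {P : probability T R} {beta : R} {p : nat -> R}.
Variable Y : bbm P beta p.

Fixpoint in_tree (u : label) (w : T) : Prop :=
  if u is i :: v then in_tree v w /\ (i < offspring Y v w)%N else True.

Fixpoint birth (u : label) (w : T) : R :=
  if u is _ :: v then birth v w + lifetime Y v w else 0.

Definition death (u : label) (w : T) : R := birth u w + lifetime Y u w.

(* The population at time t. It depends neither on the drift nor on the
   starting point. *)
Definition alive (t : R) (w : T) : set label :=
  [set u | in_tree u w /\ birth u w <= t < death u w].

(* Extinction time; it is +oo if the population never dies out. *)
Definition zeta (w : T) : \bar R :=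
  ereal_inf [set t%:E | t in [set t : R | 0 < t /\ alive t w = set0]].

Definition survival_prob (t : R) : R := fine (P [set w | (t%:E < zeta w)%E]).

Section Killed.
(* The drift is - rho and the initial particle starts at x. *)
Variables rho x : R.

(* Position at time s of u or, before the birth of u, of its ancestor alive at
   time s. *)
Fixpoint position (u : label) (s : R) (w : T) : R :=
  if u is _ :: v then
    if s < birth u w then position v s w
    else position v (birth u w) w
         + (motion Y u (s - birth u w) w - rho * (s - birth u w))
  else x + (motion Y [::] s w - rho * s).

(* The minimum over [0, t] is attained, the path being continuous. *)
Definition killed_alive (t : R) (w : T) : set label :=
  [set u | alive t w u /\ 0 < inf [set position u s w | s in `[0, t]]].

Definition killed_bbm (t : R) (w : T) (A : set R) : \bar R :=
  (\esum_(u in killed_alive t w) \d_(position u t w) A)%E.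

Definition killed_zeta (w : T) : \bar R :=
  ereal_inf [set t%:E | t in
    [set t : R | 0 <= t /\ killed_bbm t w `]0%R, +oo[ = 0%E]].

Definition killed_survival_prob (t : R) : R :=
  fine (P [set w | (t%:E < killed_zeta w)%E]).

Definition killed_mean (t : R) : \bar R :=
  (\int[P]_w killed_bbm t w `]0%R, +oo[)%E.

End Killed.

End BranchingBrownianMotion.

Section Constants.
Context {R : realType}.

Definition offspring_distribution (p : nat -> R) : Prop :=
  (forall k, 0 <= p k) /\ (\sum_(0 <= k <oo) (p k)%:E = 1)%E.

Definition mean_offspring (p : nat -> R) : \bar R :=
  (\sum_(0 <= k <oo) (k%:R * p k)%:E)%E.

Definition decay_rate (beta : R) (p : nat -> R) : R :=
  beta * (1 - fine (mean_offspring p)).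

Context {d : measure_display} {T : measurableType d}.
Context {P : probability T R} {beta : R} {p : nat -> R}.
Variable Y : bbm P beta p.

Definition C_sub : R :=
  lim (expR (decay_rate beta p * t) * survival_prob Y t @[t --> +oo]).

Definition C_0_approx (rho N : R) : R :=
  expR ((decay_rate beta p + rho ^+ 2 / 2) * N) *
  (\int[lebesgue_measure]_(y in `]0%R, +oo[)
     (y * expR (- rho * y) * killed_survival_prob Y rho y N)).

Definition C_0 (rho : R) : R := lim (C_0_approx rho N @[N --> +oo]).

Definition Gamma (rho : R) : R :=
  if rho <= 0 then C_sub else rho ^+ 2 * C_0 rho.

End Constants.

Definition asymp_equiv {R : realType} (f g : R -> R) : Prop :=
  f t / g t @[t --> +oo] --> (1 : R).

(* Main.v *)
(* Write V(t, y) for the survival probability, Q for the semigroup of the killed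
   Brownian motion with drift, whose kernel is given by the reflection principle,
   and alpha = beta (1 - m). Conditioning on the first branching event,
     V(t) = e^(-beta t) Q_t 1 + int_0^t beta e^(-beta s) Q_s G(V(t - s)) ds,
     G(v) = sum_k p_k (1 - (1 - v)^k).
   As G(v) <= m v, with a relative defect that is summable along v = e^(-alpha n)
   thanks to the k log k moment, comparison with the linear equation gives
     theta(N) e^(-alpha (t - N)) Q_(t - N) V(N) <= V(t)
                                     <= e^(-alpha (t - N)) Q_(t - N) V(N)
   with theta(N) -> 1. For fixed N, e^(alpha N) Q_(t - N) V(N) / Q_t 1 tends to
   a limit l(N) as t grows, by the explicit kernel: l(N) is the value at infinity
   of e^(alpha N) V(N) if rho <= 0, and the integral of
   rho^2 y e^(-rho y) e^((alpha + rho^2 / 2) N) V(N, y) if rho > 0. Hence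
   e^(alpha t) V(t) / Q_t 1 and l(N) converge to the same positive limit. *)
Require Import Defs.
From HB Require Import structures.
From mathcomp Require Import all_boot all_order all_algebra.
From mathcomp Require Import all_classical all_reals all_analysis.
From mathcomp Require Import measurable_realfun.
From mathcomp Require Import ring lra.
Import Order.TTheory GRing.Theory Num.Theory.
Import numFieldNormedType.Exports.
Local Open Scope classical_set_scope.
Local Open Scope ring_scope.
Set Implicit Arguments.
Unset Strict Implicit.
Unset Printing Implicit Defensive.

(** * The heat kernel of killed Brownian motion with drift *)

(** Three devices carry the proof. The kernel of [Q] is derived from the axioms of Brownian motion:
    a path is stopped at the first point of a finite time grid where it is at or below a level
    [c > 0], the drift is removed by an exponential weight on one Gaussian increment, and Lipschitz
    test functions control the overshoot, so that first the mesh and then [c] may tend to 0. The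
    renewal equation closes only if the subtree of a child has the survival function of the whole
    tree; as the subtree is another object of type [bbm], this is proved by induction on the number
    of generations, with the label sets kept in [some_killed_alive] as truncation. The lower bound
    is obtained on unit time intervals: from time N on, the survival probability is at most
    e^(-alpha N) uniformly in the starting point, so the nonlinear term is bounded below by a linear
    one whose rate is lowered by a [loss], and these losses add up to a tail of a convergent series.
    As theta(N) l(N) <= l(M) for all large N and M, convergence of l needs no monotonicity in N. The
    mean comes from the same renewal equation, used for one label at a time. *)

Lemma measurable_invr (R : realType) :
  measurable_fun [set: R] (fun x : R => x^-1).
Proof.
have -> : (fun x : R => x^-1) = (fun x : R => if x == 0 then 0 else x^-1).
  by apply/funext => x; case: eqP => // ->; rewrite invr0.
apply: measurable_fun_if => //=.
- by apply: measurable_fun_eqr => //; exact: measurable_cst.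
- rewrite setTI.
  rewrite (_ : _ @^-1` _ = ~` [set (0:R)]); last first.
    by apply/seteqP; split => x /=; case: eqP.
  apply: open_continuous_measurable_fun; first exact/closed_openC/closed_eq.
  by move=> x; rewrite inE /= => x0; apply: inv_continuous; exact/eqP.
Qed.

Lemma measurable_sqrtr (R : realType) : measurable_fun [set: R] (@Num.sqrt R).
Proof. by apply: continuous_measurable_fun => x; exact: sqrt_continuous. Qed.

(** Bundles a measurable map with its proof, the form in which [distribution] takes its argument. *)
Definition mfun_of d1 d2 (X : measurableType d1) (Y : measurableType d2)
    (f : X -> Y) (mf : measurable_fun setT f) : {mfun X >-> Y} :=
  HB.pack f (isMeasurableFun.Build _ _ _ _ f mf).

Section change_of_variables.
Context {R : realType}.
Local Notation mu := (@lebesgue_measure R).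
Local Open Scope ereal_scope.

(** The image of Lebesgue measure under a translation agrees with it on half-open intervals, hence
    everywhere by uniqueness. *)
Lemma ge0_integral_shift (c : R) (f : R -> \bar R) :
  measurable_fun [set: R] f -> (forall x, 0 <= f x) ->
  \int[mu]_x f (x + c)%R = \int[mu]_x f x.
Proof.
move=> mf f0.
have mphi : measurable_fun [set: measurableTypeR R]
    ((fun x => x + c)%R : measurableTypeR R -> measurableTypeR R).
  exact: measurable_funD.
pose phi := mfun_of mphi.
rewrite -[LHS]/(\int[mu]_(x in phi @^-1` setT) (f \o phi) x).
rewrite -ge0_integral_pushforward//.
apply: eq_measure_integral => A mA _; apply/esym.
apply: lebesgue_measure_unique => //= _ [[a b]] _ <-.
have -> : pushforward mu phi `]a, b]%classic = mu `](a - c)%R, (b - c)%R]%classic.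
  rewrite /pushforward; congr (mu _); apply/seteqP; split => x /=;
    by rewrite !in_itv /= ltrBlDr lerBrDr.
rewrite !lebesgue_measure_itv /= !lte_fin ltrD2r -!EFinD.
by case: ifP => // _; congr EFin; ring.
Qed.

Lemma ge0_integral_opp (A : set R) (f : R -> \bar R) : measurable A ->
  measurable_fun [set: R] f -> (forall x, 0 <= f x) ->
  \int[mu]_(x in -%R @^-1` A) f (- x)%R = \int[mu]_(x in A) f x.
Proof.
move=> mA mf f0.
have mphi : measurable_fun [set: measurableTypeR R]
    (-%R : measurableTypeR R -> measurableTypeR R).
  by apply: continuous_measurable_fun; exact: opp_continuous.
pose phi := mfun_of mphi.
rewrite -[LHS]/(\int[mu]_(x in phi @^-1` A) (f \o phi) x).
rewrite -ge0_integral_pushforward//; last by apply: measurable_funTS.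
by apply: eq_measure_integral => B mB _; exact: lebesgue_measureN.
Qed.

(** Brings an integral over the line to the half-line where the killed process lives; in [kp_CK] the
    two summands become the direct and the reflected contribution. *)
Lemma ge0_integral_fold (f : R -> \bar R) :
  measurable_fun [set: R] f -> (forall x, 0 <= f x) ->
  \int[mu]_x f x = \int[mu]_(x in `]0%R, +oo[) (f x + f (- x)%R).
Proof.
move=> mf f0.
rewrite ge0_integralD//=; last 2 first.
- exact: measurable_funTS.
- by apply: measurable_funTS; apply: measurableT_comp.
have -> : \int[mu]_(x in `]0%R, +oo[) f (- x)%R = \int[mu]_(x in `]-oo, 0%R]) f x.
  rewrite integral_itv_obnd_cbnd; last by apply: measurable_funTS; apply: measurableT_comp.
  have -> : `]-oo, 0%R]%classic = (-%R : R -> R) @^-1` `[0%R, +oo[.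
    by rewrite opp_preimage_itvbndy oppr0.
  rewrite -(@ge0_integral_opp `[0%R, +oo[%classic (fun x => f (- x)%R)) //; last first.
    by apply: measurableT_comp.
  by apply: eq_integral => x _; rewrite opprK.
rewrite addeC -ge0_integral_setU//=.
- by rewrite -setCitvr setUC setUv.
- exact: measurable_funTS.
- apply/disj_setPS => x [] /=; rewrite !in_itv/= andbT => x0 /(le_lt_trans x0); by rewrite ltxx.
Qed.

End change_of_variables.

Section gauss.
Context {R : realType}.
Implicit Types s x y : R.
Local Notation mu := (@lebesgue_measure R).

(** The centred normal density with [s] as variance, not standard deviation. For [s <= 0] the square
    root is 0 and so is its inverse, whence [gauss0]: the kernel vanishes at nonpositive times. *)
Definition gauss s z : R := (Num.sqrt (2 * pi * s))^-1 * expR (- z ^+ 2 / (2 * s)).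

Lemma gauss_ge0 s z : 0 <= gauss s z.
Proof. by rewrite mulr_ge0 ?expR_ge0// invr_ge0 sqrtr_ge0. Qed.

Lemma gaussN s z : gauss s (- z) = gauss s z.
Proof. by rewrite /gauss sqrrN. Qed.

Lemma gauss0 s z : s <= 0 -> gauss s z = 0.
Proof.
move=> s0; rewrite /gauss ler0_sqrtr ?invr0 ?mul0r//.
by rewrite mulr_ge0_le0// mulr_ge0 ?pi_ge0.
Qed.

Lemma normal_pdf_gauss m s z : 0 < s -> normal_pdf m (Num.sqrt s) z = gauss s (z - m).
Proof.
move=> s0; rewrite normal_pdfE ?gt_eqF ?sqrtr_gt0// /normal_peak /normal_fun /gauss.
rewrite sqr_sqrtr ?ltW//; congr (_ * expR _); first congr (Num.sqrt _)^-1.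
- by rewrite -mulr_natr; ring.
- by rewrite -mulr_natr (mulrC s).
Qed.

Lemma measurable_gauss d (T : measurableType d) (f g : T -> R) :
  measurable_fun setT f -> measurable_fun setT g ->
  measurable_fun setT (fun t => gauss (f t) (g t)).
Proof.
move=> mf mg; apply: measurable_funM.
  apply: measurableT_comp; first exact: measurable_invr.
  apply: measurableT_comp; first exact: measurable_sqrtr.
  by apply: measurable_funM.
apply: measurableT_comp => //; apply: measurable_funM.
  by apply: measurableT_comp => //; exact: measurable_funX.
by apply: measurableT_comp; [exact: measurable_invr|exact: measurable_funM].
Qed.

Lemma integral_gauss s : 0 < s -> (\int[mu]_z (gauss s z)%:E = 1)%E.
Proof.
move=> s0; rewrite -(integral_normal_pdf 0 (Num.sqrt s)).
by apply: eq_integral => z _; rewrite normal_pdf_gauss// subr0.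
Qed.

Lemma integral_gaussB s y : 0 < s -> (\int[mu]_z (gauss s (z - y))%:E = 1)%E.
Proof.
move=> s0; rewrite (@ge0_integral_shift _ (- y) (fun z => (gauss s z)%:E)).
- exact: integral_gauss.
- by apply/measurable_EFinP; apply: measurable_gauss.
- by move=> z; rewrite lee_fin gauss_ge0.
Qed.

(** Completing the square in [z]: the exponents combine into one in [x - y] and one in the distance
    of [z] from a weighted mean of [x] and [y]. Integrating out [z] then gives [gauss_conv]. *)
Lemma gauss_mul s r x y z : 0 < s -> 0 < r ->
  gauss s (x - z) * gauss r (z - y) =
  gauss (s + r) (x - y) * gauss (s * r / (s + r)) (z - (r * x + s * y) / (s + r)).
Proof.
move=> s0 r0; rewrite /gauss.
have sr0 : 0 < s + r by exact: addr_gt0.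
rewrite mulrACA [RHS]mulrACA -!invfM -!expRD; congr (_^-1 * expR _).
  rewrite -!sqrtrM; [|by rewrite !mulr_ge0 ?pi_ge0 ?ltW..].
  by congr (Num.sqrt _); field; rewrite gt_eqF.
by field; rewrite !gt_eqF.
Qed.

Lemma gauss_conv s r x y : 0 < s -> 0 < r ->
  (\int[mu]_z (gauss s (x - z) * gauss r (z - y))%:E = (gauss (s + r) (x - y))%:E)%E.
Proof.
move=> s0 r0; under eq_integral do rewrite gauss_mul// EFinM.
rewrite ge0_integralZl//=.
- by rewrite integral_gaussB ?mule1// divr_gt0 ?addr_gt0 ?mulr_gt0.
- by apply/measurable_EFinP; apply: measurable_gauss => //; exact: measurable_funB.
- by move=> z _; rewrite lee_fin gauss_ge0.
- by rewrite lee_fin gauss_ge0.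
Qed.

(** Transition density at time [s] of the Brownian motion with drift [- rho] killed at 0: the
    difference is the method of images, the exponential is the Cameron-Martin density that adds the
    drift. That it is this density is the content of [killed_law]. *)
Definition kp (rho s x y : R) : R :=
  expR (rho * (x - y) - rho ^+ 2 * s / 2) * (gauss s (x - y) - gauss s (x + y)).

Lemma gauss_sub s x y : gauss s (x - y) - gauss s (x + y) =
  (Num.sqrt (2 * pi * s))^-1 *
  (expR (- (x - y) ^+ 2 / (2 * s)) - expR (- (x + y) ^+ 2 / (2 * s))).
Proof. by rewrite /gauss mulrBr. Qed.

Lemma gauss_sub_ge0 s x y : 0 <= x -> 0 <= y -> 0 <= gauss s (x - y) - gauss s (x + y).
Proof.
move=> x0 y0; have [s0|s0] := leP s 0; first by rewrite !gauss0 ?subrr.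
rewrite gauss_sub mulr_ge0 ?invr_ge0 ?sqrtr_ge0// subr_ge0 ler_expR.
rewrite ler_pM2r ?invr_gt0 ?mulr_gt0// lerN2 -subr_ge0.
by rewrite [leRHS](_ : _ = 4 * (x * y)) ?mulr_ge0//; ring.
Qed.

Lemma kp_ge0 rho s x y : 0 <= x -> 0 <= y -> 0 <= kp rho s x y.
Proof. by move=> x0 y0; rewrite mulr_ge0 ?expR_ge0 ?gauss_sub_ge0. Qed.

(** Without the image term, completing the square turns the exponential times a Gaussian into the
    density of the drifted motion without killing, of mean [x - rho * s]. *)
Lemma kp_le rho s x y : kp rho s x y <= gauss s (y - (x - rho * s)).
Proof.
have [s0|s0] := leP s 0; first by rewrite /kp !gauss0// subrr mulr0.
apply: (@le_trans _ _ (expR (rho * (x - y) - rho ^+ 2 * s / 2) * gauss s (x - y))).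
  by rewrite ler_wpM2l ?expR_ge0// gerBl gauss_ge0.
rewrite /gauss mulrCA -expRD ler_wpM2l ?invr_ge0 ?sqrtr_ge0//.
by rewrite le_eqVlt; apply/orP; left; apply/eqP; congr expR; field; rewrite gt_eqF.
Qed.

Lemma measurable_kp d (T : measurableType d) rho (f g h : T -> R) :
  measurable_fun setT f -> measurable_fun setT g -> measurable_fun setT h ->
  measurable_fun setT (fun t => kp rho (f t) (g t) (h t)).
Proof.
move=> mf mg mh; apply: measurable_funM.
  apply: measurableT_comp => //; apply: measurable_funB.
    by apply: measurable_funM => //; exact: measurable_funB.
  by apply: measurable_funM => //; exact: measurable_funM.
apply: measurable_funB; apply: measurable_gauss => //.
  exact: measurable_funB.
exact: measurable_funD.
Qed.

Local Open Scope ereal_scope.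

(** The exponential factors multiply to that of time [s + r]. Of the four products of Gaussians, the
    two with positive sign form a convolution over the whole line folded at 0, with end point [y];
    the other two form the one with end point [- y]. *)
Lemma kp_CK rho s r x y : (0 < s)%R -> (0 < r)%R -> (0 < x)%R -> (0 < y)%R ->
  \int[mu]_(z in `]0%R, +oo[) (kp rho s x z * kp rho r z y)%:E =
  (kp rho (s + r) x y)%:E.
Proof.
move=> s0 r0 x0 y0.
pose E := expR (rho * (x - y) - rho ^+ 2 * (s + r) / 2).
have EE z : (kp rho s x z * kp rho r z y = E * ((gauss s (x - z) - gauss s (x + z)) *
   (gauss r (z - y) - gauss r (z + y))))%R.
  by rewrite /kp mulrACA -expRD; congr (expR _ * _)%R; field.
under eq_integral do rewrite EE EFinM.
have pp z : `]0%R, +oo[%classic z -> (0 <= (gauss s (x - z) - gauss s (x + z)) *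
   (gauss r (z - y) - gauss r (z + y)))%R.
  rewrite /= in_itv/= andbT => z0; rewrite mulr_ge0// gauss_sub_ge0//; exact: ltW.
have mg t (c : R) : measurable_fun [set: R] (fun z => gauss t (c - z)).
  by apply: measurable_gauss => //; exact: measurable_funB.
have mg1 t (c : R) : measurable_fun [set: R] (fun z => gauss t (c + z)).
  by apply: measurable_gauss => //; exact: measurable_funD.
have mg2 t (c : R) : measurable_fun [set: R] (fun z => gauss t (z - c)).
  by apply: measurable_gauss => //; exact: measurable_funB.
have mg3 t (c : R) : measurable_fun [set: R] (fun z => gauss t (z + c)).
  by apply: measurable_gauss => //; exact: measurable_funD.
have mGG : measurable_fun [set: R] (fun z => (gauss s (x - z) - gauss s (x + z)) *
    (gauss r (z - y) - gauss r (z + y)))%R.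
  by apply: measurable_funM; apply: measurable_funB.
rewrite ge0_integralZl//=; last 2 first.
- apply/measurable_EFinP/measurable_funTS.
  exact: mGG.
- by rewrite lee_fin expR_ge0.
rewrite /kp -/E EFinM; congr (_ * _).
have A w : \int[mu]_(z in `]0%R, +oo[)
    (gauss s (x - z) * gauss r (z - w) + gauss s (x + z) * gauss r (z + w))%:E =
    (gauss (s + r) (x - w))%:E.
  rewrite -(gauss_conv x w)//.
  rewrite (@ge0_integral_fold _ (fun z => (gauss s (x - z) * gauss r (z - w))%:E)).
  - apply: eq_integral => z _; rewrite opprK -EFinD; congr (_ + _ * _)%:E.
    by rewrite -[LHS]gaussN opprD.
  - by apply/measurable_EFinP; apply: measurable_funM.
  - by move=> z; rewrite lee_fin mulr_ge0// gauss_ge0.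
apply/esym/eqP; rewrite EFinB sube_eq//.
rewrite -(A y); have := A (- y)%R; rewrite opprK => <-.
rewrite -ge0_integralD//=.
- apply/eqP/eq_integral => z _; rewrite -EFinD; congr EFin; ring.
- by apply/measurable_EFinP/measurable_funTS; exact: mGG.
- by move=> z _; rewrite lee_fin addr_ge0// mulr_ge0// gauss_ge0.
- have mG2 : measurable_fun [set: R] (fun z => gauss s (x - z) * gauss r (z + y) +
      gauss s (x + z) * gauss r (z - y))%R.
    by apply: measurable_funD; apply: measurable_funM.
  by apply/measurable_EFinP/measurable_funTS; exact: mG2.
by rewrite fin_num_adde_defl.
Qed.

Definition Q rho s (phi : R -> \bar R) x : \bar R :=
  \int[mu]_(y in `]0%R, +oo[) ((kp rho s x y)%:E * phi y).

Lemma Q_ge0 rho s phi x : (forall y, (0 < y)%R -> 0 <= phi y) -> (0 <= x)%R ->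
  0 <= Q rho s phi x.
Proof.
move=> p0 x0; apply: integral_ge0 => y /=; rewrite in_itv/= andbT => y0.
by rewrite mule_ge0 ?p0// lee_fin kp_ge0// ltW.
Qed.

Lemma measurable_kpM rho s x (phi : R -> \bar R) :
  measurable_fun [set: R] phi -> measurable_fun [set: R] (fun y => (kp rho s x y)%:E * phi y).
Proof.
move=> mphi; apply: emeasurable_funM => //; apply/measurable_EFinP.
by apply: measurable_kp.
Qed.

Lemma le_Q rho s (phi psi : R -> \bar R) x :
  measurable_fun [set: R] phi -> measurable_fun [set: R] psi ->
  (forall y, (0 < y)%R -> 0 <= phi y) ->
  (forall y, (0 < y)%R -> phi y <= psi y) -> (0 <= x)%R ->
  Q rho s phi x <= Q rho s psi x.
Proof.
move=> mphi mpsi p0 pp x0; apply: ge0_le_integral => //=.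
- move=> y; rewrite in_itv/= andbT => y0.
  by rewrite mule_ge0 ?p0// lee_fin kp_ge0// ltW.
- by apply: measurable_funTS; exact: measurable_kpM.
- by apply: measurable_funTS; exact: measurable_kpM.
- move=> y; rewrite in_itv/= andbT => y0.
  by rewrite lee_wpmul2l ?pp// lee_fin kp_ge0// ltW.
Qed.

Lemma QZ rho s (k : R) (phi : R -> \bar R) x :
  measurable_fun [set: R] phi -> (0 <= k)%R ->
  (forall y, (0 < y)%R -> 0 <= phi y) -> (0 <= x)%R ->
  Q rho s (fun y => k%:E * phi y) x = k%:E * Q rho s phi x.
Proof.
move=> mphi k0 p0 x0; rewrite /Q.
under eq_integral do rewrite muleCA.
rewrite ge0_integralZl//.
- by apply: measurable_funTS; exact: measurable_kpM.
- move=> y /=; rewrite in_itv/= andbT => y0.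
  by rewrite mule_ge0 ?p0// lee_fin kp_ge0// ltW.
Qed.

Lemma QD rho s (phi psi : R -> \bar R) x :
  measurable_fun [set: R] phi -> measurable_fun [set: R] psi ->
  (forall y, (0 < y)%R -> 0 <= phi y) -> (forall y, (0 < y)%R -> 0 <= psi y) ->
  (0 <= x)%R ->
  Q rho s (fun y => phi y + psi y) x = Q rho s phi x + Q rho s psi x.
Proof.
move=> mphi mpsi p0 q0 x0; rewrite /Q -ge0_integralD//=.
- apply: eq_integral => y; rewrite inE/= in_itv/= andbT => y0.
  by rewrite ge0_muleDr// ?p0 ?q0.
- move=> y; rewrite in_itv/= andbT => y0.
  by rewrite mule_ge0 ?p0// lee_fin kp_ge0// ltW.
- by apply: measurable_funTS; exact: measurable_kpM.
- move=> y; rewrite in_itv/= andbT => y0.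
  by rewrite mule_ge0 ?q0// lee_fin kp_ge0// ltW.
- by apply: measurable_funTS; exact: measurable_kpM.
Qed.

Lemma eq_Q rho s (phi psi : R -> \bar R) x :
  (forall y, (0 < y)%R -> phi y = psi y) -> Q rho s phi x = Q rho s psi x.
Proof.
move=> pp; apply: eq_integral => y; rewrite inE/= in_itv/= andbT => y0.
by rewrite pp.
Qed.

(** The semigroup is sub-Markov, as the kernel lies below a probability density by [kp_le]; at
    nonpositive times it is identically 0. *)
Lemma Q_cst_le rho s (k : \bar R) x : 0 <= k -> (0 <= x)%R ->
  Q rho s (cst k) x <= k.
Proof.
move=> k0 x0; have [s0|s0] := leP s 0%R.
  rewrite /Q integral0_eq// => y _.
  by rewrite /kp !gauss0// subrr mulr0 mul0e.
rewrite /Q ge0_integralZr//=; last 2 first.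
- by apply/measurable_EFinP/measurable_funTS; exact: measurable_kp.
- by move=> y; rewrite in_itv/= andbT => y0; rewrite lee_fin kp_ge0// ltW.
rewrite -[leRHS]mul1e lee_wpmul2r// -(integral_gaussB (x - rho * s) s0).
apply: (@le_trans _ _ (\int[mu]_(y in `]0%R, +oo[) (gauss s (y - (x - rho * s)))%:E)).
  apply: ge0_le_integral => //=.
  - by move=> y; rewrite in_itv/= andbT => y0; rewrite lee_fin kp_ge0// ltW.
  - by apply/measurable_EFinP/measurable_funTS; exact: measurable_kp.
  - apply/measurable_EFinP/measurable_funTS; apply: measurable_gauss => //.
    exact: measurable_funB.
  - by move=> y _; rewrite lee_fin kp_le.
apply: ge0_subset_integral => //=.
- apply/measurable_EFinP; apply: measurable_gauss => //.
  exact: measurable_funB.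
- by move=> y _; rewrite lee_fin gauss_ge0.
Qed.

(** Measurability in the parameter is part of Tonelli's theorem; the condition [0 <= g t] keeps the
    starting point where the kernel is nonnegative. *)
Lemma measurable_Q d (T : measurableType d) rho (f g : T -> R) (phi : T * R -> \bar R) :
  measurable_fun setT f -> measurable_fun setT g -> measurable_fun setT phi ->
  (forall t y, (0 < y)%R -> 0 <= phi (t, y)) -> (forall t, (0 <= g t)%R) ->
  measurable_fun setT (fun t => Q rho (f t) (fun y => phi (t, y)) (g t)).
Proof.
move=> mf mg mphi p0 g0.
under eq_fun do rewrite /Q integral_mkcond.
(* The indicator makes the integrand nonnegative on the whole product space, not only for
   [0 < z.2]. *)
pose F (z : T * R) := ((kp rho (f z.1) (g z.1) z.2)%:E * phi z) * (\1_`]0%R, +oo[ z.2)%:E.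
have F0 z : 0 <= F z.
  rewrite /F indicE; case: (boolP (z.2 \in _)) => [|_]; last by rewrite mule0.
  rewrite inE/= in_itv/= andbT => z0; rewrite mule1 mule_ge0//.
    by rewrite lee_fin kp_ge0// ltW.
  by case: z z0 => t y /= y0; apply: p0.
have mF : measurable_fun setT F.
  apply: emeasurable_funM; last first.
    have mI : measurable_fun [set: R] (\1_`]0%R, +oo[ : R -> R) by [].
    by apply/measurable_EFinP; apply: (measurableT_comp mI).
  apply: emeasurable_funM => //; apply/measurable_EFinP.
  by apply: measurable_kp => //; exact: measurableT_comp.
have := @measurable_fun_fubini_tonelli_F _ _ _ _ _ mu F mF F0.
congr measurable_fun; apply/funext => t; apply: eq_integral => y _.
rewrite /F patchE indicE /=; case: ifPn; rewrite ?mule1 ?mule0//.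
Qed.

(** Tonelli exchanges the two integrations for any nonnegative [phi], infinite values included, and
    [kp_CK] does the inner one. *)
Lemma Q_semigroup rho s r (phi : R -> \bar R) x :
  measurable_fun [set: R] phi -> (forall y, (0 < y)%R -> 0 <= phi y) ->
  (0 < s)%R -> (0 < r)%R -> (0 < x)%R ->
  Q rho s (Q rho r phi) x = Q rho (s + r) phi x.
Proof.
move=> mphi p0 s0 r0 x0.
pose I : R -> R := \1_`]0%R, +oo[.
have I0 z : (0 <= I z)%R by rewrite /I indicE.
have mI : measurable_fun [set: R] I by exact: measurable_indic.
pose F (z : R * R) := (kp rho s x z.1 * kp rho r z.1 z.2 * I z.1 * I z.2)%:E * phi z.2.
have F0 z : 0 <= F z.
  rewrite /F /I !indicE.
  case: (boolP (z.1 \in _)) => [|_]; last by rewrite mulr0 mul0r mul0e.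
  case: (boolP (z.2 \in _)) => [|_]; last by rewrite mulr0 mul0e.
  rewrite !inE/= !in_itv/= !andbT !mulr1 => z2 z1; rewrite mule_ge0 ?p0// lee_fin.
  by rewrite mulr_ge0// kp_ge0// ltW.
have mF : measurable_fun setT F.
  apply: emeasurable_funM; last exact: measurableT_comp.
  apply/measurable_EFinP; apply: measurable_funM; last exact: measurableT_comp.
  apply: measurable_funM; last exact: measurableT_comp.
  by apply: measurable_funM; apply: measurable_kp.
transitivity (\int[mu]_z \int[mu]_y F (z, y)).
  rewrite /Q integral_mkcond; apply: eq_integral => z _; rewrite patchE.
  case: ifPn => [|zn]; last first.
    rewrite integral0_eq// => y _; rewrite /F/= /I !indicE (negbTE zn).
    by rewrite mulr0 mul0r mul0e.
  rewrite inE/= in_itv/= andbT => z0.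
  rewrite -ge0_integralZl//; last 3 first.
  - by apply: measurable_funTS; exact: measurable_kpM.
  - move=> y /=; rewrite in_itv/= andbT => y0.
    by rewrite mule_ge0 ?p0// lee_fin kp_ge0// ltW.
  - by rewrite lee_fin kp_ge0// ltW.
  rewrite integral_mkcond; apply: eq_integral => y _; rewrite patchE /F /I /=.
  rewrite !indicE [z \in _]mem_set/=; last by rewrite in_itv/= z0.
  by case: ifPn => yy; rewrite ?mulr0 ?mul0e// !mulr1 EFinM muleA.
rewrite fubini_tonelli//; rewrite /Q [RHS]integral_mkcond; apply: eq_integral => y _.
rewrite patchE; case: ifPn => [|yn]; last first.
  rewrite integral0_eq// => z _; rewrite /F/= /I !indicE (negbTE yn).
  by rewrite mulr0 mul0e.
rewrite inE/= in_itv/= andbT => y0.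
rewrite -(kp_CK rho s0 r0 x0 y0) -ge0_integralZr//; last 3 first.
- by apply/measurable_EFinP/measurable_funTS; apply: measurable_funM; apply: measurable_kp.
- move=> z /=; rewrite in_itv/= andbT => z0.
  by rewrite lee_fin mulr_ge0// kp_ge0// ltW.
- exact: p0.
rewrite [RHS]integral_mkcond; apply: eq_integral => z _; rewrite patchE /F /I /=.
rewrite !indicE [y \in _]mem_set/=; last by rewrite in_itv/= y0.
by case: (z \in _); rewrite !(mulr1, mulr0, mul0r, mul0e).
Qed.

End gauss.

(** * Independence and freezing *)

Section independence.
Context {R : realType} {d : measure_display} {T : measurableType d}.
Variable P : probability T R.
Local Open Scope ereal_scope.

Lemma sigma_algebra_measurable_preimage d' (T' : measurableType d') (f : T -> T') :
  sigma_algebra setT (g_sigma_algebra_preimage f).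
Proof. exact: sigma_algebra_preimage (sigma_algebra_measurable T'). Qed.

(** For fixed [B] both sides are finite measures of [A] that agree on the pi-system [G], so they
    agree on the generated sigma-algebra; the same argument in [B] finishes. *)
Lemma indep_sigma_of_pi (G H : set_system T) :
  G `<=` measurable -> H `<=` measurable -> setI_closed G -> setI_closed H ->
  G setT -> H setT ->
  (forall A B, G A -> H B -> P (A `&` B) = P A * P B) ->
  forall A B, <<s G >> A -> <<s H >> B -> P (A `&` B) = P A * P B.
Proof.
move=> Gm Hm GI HI GT HT GH.
have sub (G' : set_system T) : G' `<=` measurable -> <<s G' >> `<=` measurable.
  by move=> G'm; apply: smallest_sub => //; exact: sigma_algebra_measurable.
have step (G' : set_system T) (B : set T) : G' `<=` measurable -> setI_closed G' ->
    G' setT -> measurable B ->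
    (forall A, G' A -> P (A `&` B) = P A * P B) ->
    forall A, <<s G' >> A -> P (A `&` B) = P A * P B.
  move=> G'm G'I G'T mB PAB A sA.
  have fB : P B = (fine (P B))%:E by rewrite fineK// fin_num_measure.
  have B0 : (0 <= fine (P B))%R by rewrite fine_ge0.
  have := @g_sigma_algebra_measure_unique _ _ _ G' G'm (fun=> setT) (fun=> G'T).
  have cov : \bigcup_(k in [set: nat]) [set: T] = [set: T].
    by apply/seteqP; split => // x _; exists 0%N.
  move=> /(_ _ cov (mrestr P mB) (mscale (NngNum B0) P) G'I) uniq.
  have scE C : mscale (NngNum B0) P C = P C * P B by rewrite muleC [in RHS]fB.
  transitivity (mrestr P mB A) => //; rewrite uniq//; first exact: scE.
  - by move=> C G'C; rewrite [RHS]scE -PAB.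
  - move=> _; apply: (@le_lt_trans _ _ 1); last exact: ltry.
    by apply: probability_le1; exact: measurableI.
move=> A B sA sB; have mB : measurable B by exact: (sub _ Hm).
apply: (step G) => // A' GA'.
rewrite setIC muleC; apply: (step H) => //; first exact: Gm.
by move=> B' HB'; rewrite setIC muleC; exact: GH.
Qed.

(** The finite intersections of events taken from one block form a pi-system that generates the
    sigma-algebra of the block, and for two such intersections with disjoint index lists the product
    formula is the hypothesis. *)
Lemma mutually_independent_blocks (I : eqType) (F : I -> set_system T) (K L : set I) :
  (forall i, F i `<=` measurable) -> (forall i, sigma_algebra setT (F i)) ->
  mutually_independent P F -> K `&` L = set0 ->
  forall A B, <<s \bigcup_(i in K) F i >> A -> <<s \bigcup_(i in L) F i >> B ->
  P (A `&` B) = P A * P B.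
Proof.
move=> Fm sF indF KL.
pose Pi (K : set I) : set_system T := [set X | exists J : seq I, exists A : I -> set T,
  [/\ uniq J, forall i, i \in J -> K i, forall i, i \in J -> F i (A i) &
      X = \bigcap_(i in [set` J]) A i]].
have FT i : F i setT by have := (sF i); case=> s0 sC _; rewrite -setC0 -setTD; exact: sC.
have FI i : setI_closed (F i).
  move=> A B FA FB; rewrite -(sigma_algebra_id (sF i)).
  by apply: (@measurableI _ (g_sigma_algebraType (F i)));
    rewrite /measurable/= sigma_algebra_id.
have PiI K' : setI_closed (Pi K').
  move=> _ _ [J [A [uJ KJ FA ->]]] [J' [A' [uJ' KJ' FA' ->]]].
  (* Padding with the full set outside its own list lets both intersections run over the same
     indices. *)
  exists (undup (J ++ J')).
  exists (fun i => (if i \in J then A i else setT) `&` (if i \in J' then A' i else setT)).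
  split; first exact: undup_uniq.
  - by move=> i; rewrite mem_undup mem_cat => /orP[/KJ|/KJ'].
  - move=> i _; apply: FI; case: ifPn => ? //; [exact: FA|exact: FA'].
  - apply/seteqP; split => w.
      move=> [w1 w2] i /= _; split; case: ifPn => // iJ; [exact: w1|exact: w2].
    move=> ww; split => i /= iJ.
      have := ww i; rewrite /= mem_undup mem_cat iJ => /(_ isT)[].
      by [].
    by have := ww i; rewrite /= mem_undup mem_cat iJ orbT => /(_ isT)[].
have PiT K' : Pi K' setT.
  exists [::], (fun=> setT); split => //.
  by apply/seteqP; split.
have bigI (J : seq I) (A : I -> set T) : (forall i, i \in J -> F i (A i)) ->
    measurable (\bigcap_(i in [set` J]) A i).
  elim: J => [_|i J IH FA].
    by rewrite (_ : \bigcap_(_ in _) _ = setT)//; apply/seteqP; split.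
  rewrite (_ : \bigcap_(_ in _) _ = A i `&` \bigcap_(j in [set` J]) A j).
    apply: measurableI; first by apply: (Fm i); apply: FA; rewrite mem_head.
    by apply: IH => j jJ; apply: FA; rewrite inE jJ orbT.
  apply/seteqP; split => w.
    move=> wA; split; first by apply: wA; rewrite /= mem_head.
    by move=> j /= jJ; apply: wA; rewrite /= inE jJ orbT.
  by move=> [wi wJ] j /=; rewrite inE => /orP[/eqP->//|]; exact: wJ.
have Pim K' : Pi K' `<=` measurable.
  by move=> _ [J [A [uJ KJ FA ->]]]; exact: bigI.
have sPi K' : <<s \bigcup_(i in K') F i >> `<=` <<s Pi K' >>.
  apply: smallest_sub; first exact: smallest_sigma_algebra.
  move=> X [i Ki FX]; apply: sub_sigma_algebra.
  exists [:: i], (fun=> X); split => //.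
  - by move=> j; rewrite inE => /eqP->.
  - by move=> j; rewrite inE => /eqP->.
  - by apply/seteqP; split => [w wX j //|w /(_ i)]; apply; rewrite /= mem_head.
move=> A B sA sB.
apply: (@indep_sigma_of_pi (Pi K) (Pi L)); try by [|exact: sPi].
move=> {sA sB}_ _ [J [A' [uJ KJ FA ->]]] [J' [A'' [uJ' LJ' FA' ->]]].
have JJ' i : i \in J -> i \in J' -> False.
  move=> /KJ Ki /LJ' Li; have : (K `&` L) i by [].
  by rewrite KL.
pose C i := if i \in J then A' i else A'' i.
have CE1 : \bigcap_(i in [set` J]) A' i = \bigcap_(i in [set` J]) C i.
  by apply: eq_bigcapr => i /= iJ; rewrite /C iJ.
have CE2 : \bigcap_(i in [set` J']) A'' i = \bigcap_(i in [set` J']) C i.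
  apply: eq_bigcapr => i /= iJ; rewrite /C; case: ifPn => // /JJ'.
  by move=> /(_ iJ).
have FC1 i : i \in J -> F i (C i) by move=> iJ; rewrite /C iJ; exact: FA.
have FC2 i : i \in J' -> F i (C i).
  move=> iJ; rewrite /C; case: ifPn => [/JJ' /(_ iJ)//|_]; exact: FA'.
rewrite CE1 CE2 (_ : _ `&` _ = \bigcap_(i in [set` J ++ J']) C i); last first.
  apply/seteqP; split => w.
    by move=> [w1 w2] i /=; rewrite mem_cat => /orP[/w1|/w2].
  by move=> w1; split => i /= ij; apply: w1; rewrite /= mem_cat ij ?orbT.
rewrite !indF//; first by rewrite big_cat.
- rewrite cat_uniq uJ uJ' andbT/=; apply/hasPn => i iJ'; apply/negP => iJ.
  exact: JJ' iJ iJ'.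
- by move=> i; rewrite mem_cat => /orP[/FC1|/FC2].
Qed.

Section freezing.
Context {d1 d2 : measure_display} {S1 : measurableType d1} {S2 : measurableType d2}.
Variables (Z1 : T -> S1) (Z2 : T -> S2).
Hypotheses (mZ1 : measurable_fun setT Z1) (mZ2 : measurable_fun setT Z2).
Hypothesis Z12 : forall A B, measurable A -> measurable B ->
  P (Z1 @^-1` A `&` Z2 @^-1` B) = P (Z1 @^-1` A) * P (Z2 @^-1` B).

(** Freezing: independence says that the law of the pair is the product of the laws, so by Tonelli
    the first variable can be held fixed while the second is averaged. It takes the place of
    conditional expectation in the Markov-type arguments below. *)
Lemma integral_indep (F : S1 * S2 -> \bar R) :
  measurable_fun setT F -> (forall z, 0 <= F z) ->
  \int[P]_w F (Z1 w, Z2 w) = \int[P]_w \int[P]_w' F (Z1 w, Z2 w').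
Proof.
move=> mF F0.
have mZ : measurable_fun setT (fun w => (Z1 w, Z2 w)) by exact: measurable_fun_pair.
pose D1 := distribution P (mfun_of mZ1).
pose D2 := distribution P (mfun_of mZ2).
pose D := distribution P (mfun_of mZ).
transitivity (\int[D]_z F z).
  by rewrite /D /distribution ge0_integral_pushforward.
transitivity (\int[D1 \x D2]_z F z).
  apply: eq_measure_integral => A mA _.
  apply/esym; apply: product_measure_unique => //.
rewrite fubini_tonelli1// /D1 /distribution ge0_integral_pushforward//=.
- apply: eq_integral => w _.
  rewrite /D2 /distribution /fubini_F ge0_integral_pushforward//=.
  exact: measurableT_comp.
- exact: (measurable_fun_fubini_tonelli_F F).
- by move=> z _; exact: integral_ge0.
Qed.

Lemma measure_indep (C : set (S1 * S2)) : measurable C ->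
  P [set w | C (Z1 w, Z2 w)] = \int[P]_w P [set w' | C (Z1 w, Z2 w')].
Proof.
move=> mC; pose F (z : S1 * S2) : \bar R := (\1_C z)%:E.
have mF : measurable_fun setT F by apply/measurable_EFinP; exact: measurable_indic.
have F0 z : 0 <= F z by rewrite lee_fin indicE.
have mZ : measurable_fun setT (fun w => (Z1 w, Z2 w)) by exact: measurable_fun_pair.
have := integral_indep mF F0; congr (_ = _).
  transitivity (\int[P]_w (\1_[set w | C (Z1 w, Z2 w)] w)%:E) => //.
  rewrite integral_indic//= ?setIT//.
  by rewrite -[X in measurable X]setTI; exact: mZ.
apply: eq_integral => w _.
transitivity (\int[P]_w' (\1_[set w' | C (Z1 w, Z2 w')] w')%:E) => //.
rewrite integral_indic//= ?setIT//.
have mZ' : measurable_fun setT (fun w' => (Z1 w, Z2 w')) by exact: measurable_fun_pair.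
by rewrite -[X in measurable X]setTI; exact: mZ'.
Qed.
End freezing.

(** A sub-sigma-algebra becomes a random variable, namely the identity into the outcome space with
    fewer measurable sets; freezing then applies to everything measurable for it. *)
Lemma measurable_idtype (G : set_system T) : G `<=` measurable ->
  measurable_fun setT (idfun : T -> g_sigma_algebraType G).
Proof.
move=> Gm _ A mA; rewrite setTI preimage_id.
by apply: (smallest_sub _ Gm) mA; exact: sigma_algebra_measurable.
Qed.

End independence.

(** * Integration against a density *)

Section density.
Context {R : realType} {d : measure_display} {T : measurableType d}.
Variables (mu nu : {measure set T -> \bar R}) (g : T -> R).
Hypotheses (mg : measurable_fun setT g) (g0 : forall x, 0 <= g x).
Local Open Scope ereal_scope.
Hypothesis nuE : forall A, measurable A -> nu A = \int[mu]_(x in A) (g x)%:E.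
Import HBNNSimple.

(** Both sides are monotone limits along simple functions, and for an indicator the claim is
    [nuE]. *)
Lemma integral_density (f : T -> \bar R) : measurable_fun setT f ->
  (forall x, 0 <= f x) -> \int[nu]_x f x = \int[mu]_x (f x * (g x)%:E).
Proof.
move=> mf f0.
pose h := nnsfun_approx measurableT mf.
have hf x : (EFin \o h n) x @[n --> \oo] --> f x by exact: cvg_nnsfun_approx.
have mgE : measurable_fun setT (EFin \o g) by exact/measurable_EFinP.
have -> : \int[nu]_x f x = lim (\int[nu]_x (EFin \o h n) x @[n --> \oo]).
  under eq_integral => x _ do rewrite -(cvg_lim _ (hf x))//.
  apply: monotone_convergence => //.
  - by move=> n; exact/measurable_EFinP.
  - by move=> n x _ /=; rewrite lee_fin.
  - by move=> x _ a b ab; rewrite lee_fin; exact/lefP/nd_nnsfun_approx.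
have hgf x : (EFin \o h n) x * (g x)%:E @[n --> \oo] --> f x * (g x)%:E.
  by apply: cvgeZr => //; exact: hf.
have -> : \int[mu]_x (f x * (g x)%:E) =
    lim (\int[mu]_x ((EFin \o h n) x * (g x)%:E) @[n --> \oo]).
  under eq_integral => x _ do rewrite -(cvg_lim _ (hgf x))//.
  apply: monotone_convergence => //.
  - by move=> n; apply/emeasurable_funM => //; exact/measurable_EFinP.
  - by move=> n x _ /=; rewrite mule_ge0 ?lee_fin.
  - move=> x _ a b ab/=; rewrite lee_wpmul2r ?lee_fin//.
    exact/lefP/nd_nnsfun_approx.
apply/congr_lim/funext => n.
transitivity (\int[nu]_x (\sum_(y \in range (h n)) (y * \1_(h n @^-1` [set y]) x)%:E)).
  by apply: eq_integral => t _; rewrite /= fimfunE -fsumEFin.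
have indich m r : measurable_fun setT (fun x => (r * \1_(h m @^-1` [set r]) x)%:E).
  by apply/measurable_EFinP; exact: measurable_funM.
rewrite ge0_integral_fsum//; last by move=> m y _; exact: nnfun_muleindic_ge0.
transitivity (\int[mu]_x (\sum_(y \in range (h n))
    (y * \1_(h n @^-1` [set y]) x)%:E * (g x)%:E)); last first.
  apply: eq_integral => x _.
  rewrite -ge0_mule_fsuml => [|y]; last exact: nnfun_muleindic_ge0.
  by rewrite fsumEFin // -(fimfunE _ x).
rewrite ge0_integral_fsum//; last 2 first.
  - by move=> y; apply: emeasurable_funM.
  - move=> m y _; apply: mule_ge0; last by rewrite lee_fin.
    exact: nnfun_muleindic_ge0.
apply: eq_fsbigr => r rhn.
under eq_integral do rewrite EFinM.
rewrite integralZl_indic_nnsfun => //.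
under [RHS]eq_integral do rewrite EFinM -muleA.
rewrite ge0_integralZl//.
- rewrite integral_indic// setIT nuE//; congr (_ * _).
  rewrite integral_mkcond; apply: eq_integral => x _.
  by rewrite muleC epatch_indic.
- by apply: emeasurable_funM => //; exact/measurable_EFinP.
- by move=> x _; rewrite mule_ge0// lee_fin// indicE.
- move: rhn; rewrite inE => -[x _ <-]; by rewrite lee_fin.
Qed.

End density.

(** * Continuity and uniform continuity of paths *)

Lemma within_cts_eps (R : realType) (f : R -> R) :
  {within `[0, +oo[, continuous f} -> forall r e, 0 <= r -> 0 < e ->
  exists2 h, 0 < h & forall r', 0 <= r' -> `|r - r'| < h -> `|f r - f r'| < e.
Proof.
move=> cf r e r0 e0.
have rI : [set` `[0, +oo[] r by rewrite /= in_itv/= r0.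
have /continuous_within_itvcyP[cf1 cf0] := cf.
have : f x @[x --> within [set` `[0, +oo[] (nbhs r)] --> f r.
  have := cf r; rewrite /continuous_at.
  by rewrite /= nbhs_subspace_in.
move/cvgrPdist_lt => /(_ e e0); rewrite near_withinE /= => -[h /= h0 hP].
exists h => // r' r'0 rr'; apply: hP => //=; first by rewrite in_itv/= r'0.
Qed.

(** Compactness of the segment, in its covering form, gives one [h] for all [r]; the point [r'] may
    also lie beyond [s]. *)
Lemma heine (R : realType) (f : R -> R) (s : R) :
  (forall r e, 0 <= r -> 0 < e ->
    exists2 h, 0 < h & forall r', 0 <= r' -> `|r - r'| < h -> `|f r - f r'| < e) ->
  forall e, 0 < e -> exists2 h, 0 < h &
    forall r r', 0 <= r <= s -> 0 <= r' -> `|r - r'| < h -> `|f r - f r'| < e.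
Proof.
move=> cf e e0.
have := @segment_compact R 0 s => /compact_near_coveringP.
move=> /(_ R (0^'+)
  (fun h r => 0 <= r -> forall r', 0 <= r' -> `|r - r'| < h -> `|f r - f r'| < e)).
have : forall x, `[0, s]%classic x -> \forall x' \near x & i \near 0^'+,
    0 <= x' -> forall r', 0 <= r' -> `|x' - r'| < i -> `|f x' - f r'| < e.
  move=> r /=; rewrite in_itv/= => /andP[r0 _].
  have e20 : 0 < e / 2 by rewrite divr_gt0.
  have [h h0 hP] := cf r (e / 2) r0 e20.
  exists ([set x | `|r - x| < h / 2], [set i | i < h / 2]).
    split => /=.
      by exists (h / 2) => /=; [rewrite divr_gt0|].
    by apply: nbhs_right_lt; rewrite divr_gt0.
  move=> [x i] [/= rx ih] x0 r' r'0 xr'.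
  have := hP x x0; have := hP r' r'0.
  have h2 : h / 2 < h by rewrite ltr_pdivrMr// mulr_natr mulr2n ltrDl.
  have rr' : `|r - r'| < h.
    rewrite (_ : r - r' = (r - x) + (x - r')); last by ring.
    apply: le_lt_trans (ler_normD _ _) _.
    by rewrite [ltRHS](_ : _ = h / 2 + h / 2); [rewrite ltrD// (lt_trans xr')|field].
  move=> /(_ rr') A /(_ (lt_trans rx h2)) B.
  rewrite (_ : f x - f r' = - (f r - f x) + (f r - f r')); last by ring.
  apply: le_lt_trans (ler_normD _ _) _.
  by rewrite normrN [ltRHS](_ : _ = e / 2 + e / 2); [rewrite ltrD|field].
move=> cov /(_ _ cov) near0.
have : \forall h \near (0:R)^'+, `[0, s] `<=` (fun r => 0 <= r ->
    forall r', 0 <= r' -> `|r - r'| < h -> `|f r - f r'| < e) by exact: near0.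
move=> [h /= h0 hP].
exists (h / 2); first by rewrite divr_gt0.
move=> r r' /andP[r0 rs] r'0 rr'.
apply: (hP (h / 2)) => //=.
- by rewrite sub0r normrN gtr0_norm ?divr_gt0// ltr_pdivrMr// mulr_natr mulr2n ltrDl.
- by rewrite divr_gt0.
- by rewrite in_itv/= r0.
Qed.

(** * Gaussian increments: symmetry and change of drift *)

Section reflection.
Context {R : realType} {d : measure_display} {T : measurableType d}.
Context {P : probability T R}.
Variable W : R -> {RV P >-> R}.
Hypothesis HW : is_brownian_motion W.
Local Notation mu := (@lebesgue_measure R).

Let W0 : forall w, W 0 w = 0. Proof. by case: HW. Qed.

Lemma bm_cts w r e : 0 <= r -> 0 < e ->
  exists2 h, 0 < h & forall r', 0 <= r' -> `|r - r'| < h -> `|W r w - W r' w| < e.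
Proof. by case: HW => _ cW _ _; exact: (within_cts_eps (cW w)). Qed.

Local Open Scope ereal_scope.

Lemma bm_law s t (F : R -> \bar R) : (0 <= s)%R -> (s < t)%R ->
  measurable_fun setT F -> (forall z, 0 <= F z) ->
  \int[P]_w F (W t w - W s w)%R = \int[mu]_z (F z * (gauss (t - s) z)%:E).
Proof.
move=> s0 st mF F0; case: HW => _ _ iW _.
have mZ : measurable_fun setT ((fun w => W t w - W s w)%R : T -> measurableTypeR R).
  exact: measurable_funB.
transitivity (\int[distribution P (mfun_of mZ)]_z F z).
  by rewrite /distribution ge0_integral_pushforward.
have ts0 : (0 < t - s)%R by rewrite subr_gt0.
have mg : measurable_fun [set: R] (gauss (t - s)) by exact: measurable_gauss.
apply: (@integral_density R _ (measurableTypeR R) mu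
  (distribution P (mfun_of mZ)) _ mg (gauss_ge0 _)) => // A mA.
rewrite -[LHS]/(P ((fun w => W t w - W s w)%R @^-1` A)).
rewrite iW// /normal_prob; apply: eq_integral => z _.
by rewrite normal_pdf_gauss// subr0.
Qed.

Lemma bm_sym s t (F : R -> \bar R) : (0 <= s)%R -> (s <= t)%R ->
  measurable_fun setT F -> (forall z, 0 <= F z) ->
  \int[P]_w F (- (W t w - W s w))%R = \int[P]_w F (W t w - W s w)%R.
Proof.
move=> s0; rewrite le_eqVlt => /orP[/eqP<- _ _|st mF F0].
  by apply: eq_integral => w _; rewrite subrr oppr0.
have mF' : measurable_fun [set: R] (fun z : R => F (- z)%R) by exact: measurableT_comp.
rewrite (@bm_law s t (fun z => F (- z)%R))// (@bm_law s t F)//.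
transitivity (\int[mu]_(z in -%R @^-1` setT) (F (- z)%R * (gauss (t - s) (- z))%:E)).
  by rewrite preimage_setT; apply: eq_integral => z _; rewrite gaussN.
apply: (@ge0_integral_opp R setT (fun z => F z * (gauss (t - s) z)%:E)) => //.
- by apply: emeasurable_funM => //; apply/measurable_EFinP; exact: measurable_gauss.
- by move=> z; rewrite mule_ge0// lee_fin gauss_ge0.
Qed.

(** The Cameron-Martin formula for a single increment: after a translation by [rho * (t - s)] it
    amounts to completing the square in the Gaussian exponent. The reflection argument needs it for
    one increment at a time only, so no change of measure on path space is made. *)
Lemma bm_girsanov rho s t (F : R -> \bar R) : (0 <= s)%R -> (s <= t)%R ->
  measurable_fun setT F -> (forall z, 0 <= F z) ->
  \int[P]_w ((expR (rho * (W t w - W s w - rho * (t - s))))%:E *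
              F (W t w - W s w - rho * (t - s))%R) =
  (expR (- (rho ^+ 2 * (t - s) / 2)))%:E * \int[P]_w F (W t w - W s w)%R.
Proof.
move=> s0; rewrite le_eqVlt => /orP[/eqP<- mF F0|st mF F0].
  have FE (w : T) : (W s w - W s w)%R = 0%R by rewrite subrr.
  under eq_integral do rewrite FE !subrr mulr0 subr0 mulr0 expR0 mul1e.
  under [in RHS]eq_integral do rewrite FE.
  by rewrite subrr mulr0 mul0r oppr0 expR0 mul1e.
set v := (t - s)%R; have v0 : (0 < v)%R by rewrite subr_gt0.
pose H (z : R) := (expR (rho * (z - rho * v)))%:E * F (z - rho * v)%R.
have mH : measurable_fun [set: R] H.
  apply: emeasurable_funM; last by apply: measurableT_comp => //; exact: measurable_funB.
  apply/measurable_EFinP; apply: measurableT_comp => //.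
  by apply: measurable_funM => //; exact: measurable_funB.
have H0 z : 0 <= H z by rewrite mule_ge0// lee_fin expR_ge0.
rewrite (@bm_law s t H)// (@bm_law s t F)// -/v.
rewrite -(@ge0_integral_shift _ (rho * v) (fun z => H z * (gauss v z)%:E)); last 2 first.
- by apply: emeasurable_funM => //; apply/measurable_EFinP; exact: measurable_gauss.
- by move=> z; rewrite mule_ge0// lee_fin gauss_ge0.
rewrite -ge0_integralZl//=.
- apply: eq_integral => z _; rewrite /H addrK muleC muleA -EFinM muleC [RHS]muleCA -EFinM.
  congr (_ * _%:E); rewrite /gauss -[LHS]mulrA -expRD [RHS]mulrCA -expRD; congr (_ * expR _)%R.
  by field; rewrite gt_eqF.
- by apply: emeasurable_funM => //; apply/measurable_EFinP; exact: measurable_gauss.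
- by move=> z _; rewrite mule_ge0// lee_fin gauss_ge0.
Qed.

End reflection.

(** * The reflection principle on a time grid *)

Lemma g_sigma_sub d (T : measurableType d) (G : set_system T) :
  G `<=` measurable -> <<s G >> `<=` measurable.
Proof. by move=> Gm; apply: smallest_sub => //; exact: sigma_algebra_measurable. Qed.

(** Positivity on [0, t] with a margin 1 / (j + 1). It is the infimum condition of [killed_alive]
    written as a countable union, which suits measurability; for [t < 0] it holds vacuously. *)
Definition posev (R : realType) (f : R -> R) (t : R) : Prop :=
  exists j : nat, forall r, 0 <= r <= t -> j.+1%:R^-1 <= f r.

Lemma inf_gt0P (R : realType) (f : R -> R) (t : R) : 0 <= t ->
  (0 < inf [set f s | s in `[0, t]]) <-> posev f t.
Proof.
move=> t0; split=> [i0|[j fj]].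
  (* Without an infimum, [inf] would take the default value 0, against [i0]. *)
  have hi : has_inf [set f s | s in `[0, t]].
    by apply: contrapT => /inf_out i0'; move: i0; rewrite i0' ltxx.
  have [j jP] : exists j : nat, j.+1%:R^-1 < inf [set f s | s in `[0, t]].
    have := @ltr_add_invr R 0 _ i0 => -[j jP]; exists j; by rewrite add0r in jP.
  exists j => r /andP[r0 rt]; apply: (le_trans (ltW jP)).
  apply: ge_inf; first by case: hi.
  by exists r => //=; rewrite in_itv/= r0.
apply: (@lt_le_trans _ _ j.+1%:R^-1); first by rewrite invr_gt0.
apply: lb_le_inf; first by exists (f 0), 0 => //=; rewrite in_itv/= lexx.
by move=> _ /= [r + <-]; rewrite in_itv/= => rt; exact: fj.
Qed.

Lemma reflected_norm_le (R : realType) (c z : R) :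
  0 < c -> c < 2 * c - z -> `|z| <= 2 * c - z + 2.
Proof. by move=> c0 cz; rewrite ler_norml; apply/andP; split; lra. Qed.

Lemma integral_prob_cst (R : realType) d (T : measurableType d) (P : probability T R)
  (k : R) : (\int[P]_w (cst k%:E) w = k%:E)%E.
Proof.
rewrite integral_cst// -[RHS]mule1; congr (_ * _)%E; exact: probability_setT.
Qed.

Section grid.
Context {R : realType} {d : measure_display} {T : measurableType d}.
Context {P : probability T R}.
Variable W : R -> {RV P >-> R}.
Hypothesis HW : is_brownian_motion W.
Local Open Scope ereal_scope.

Section past.
Variable t : nat -> R.
Hypotheses (t0 : t 0%N = 0%R) (ndt : nondecreasing_seq t).
Variable k : nat.

Let incr n w := (W (t n.+1) w - W (t n) w)%R.
Let F n := g_sigma_algebra_preimage (incr n).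
Let G := \bigcup_(i in [set i : nat | (i < k)%N]) F i.

Let mincr n : measurable_fun setT (incr n).
Proof. exact: measurable_funB. Qed.

Let Fm n : F n `<=` measurable.
Proof.
move=> A [B mB <-]; exact: mincr.
Qed.

Let Gm : G `<=` measurable.
Proof. by move=> A [i _]; exact: Fm. Qed.

(** As [W 0 = 0], the value at a grid time is the sum of the increments before it. *)
Lemma measurable_bm_past j : (j <= k)%N ->
  measurable_fun (setT : set (g_sigma_algebraType G)) (W (t j) : g_sigma_algebraType G -> R).
Proof.
elim: j => [_|j IH jk].
  rewrite t0; have -> : (W 0 : T -> R) = cst 0%R.
    by apply/funext => w; case: HW => ->.
  exact: measurable_cst.
have -> : (W (t j.+1) : T -> R) = (fun w => W (t j) w + incr j w)%R.
  by apply/funext => w; rewrite /incr addrC subrK.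
apply: measurable_funD; first by apply: IH; exact: ltnW.
move=> _ B mB; apply: sub_sigma_algebra.
by exists j => //; exists B.
Qed.

Lemma integral_bm_past d' (S : measurableType d') (Z : T -> S) (H : S * R -> \bar R) :
  measurable_fun (setT : set (g_sigma_algebraType G)) (Z : g_sigma_algebraType G -> S) ->
  measurable_fun setT H -> (forall z, 0 <= H z) ->
  \int[P]_w H (Z w, (W (t k.+1) w - W (t k) w)%R) =
  \int[P]_w \int[P]_w' H (Z w, (W (t k.+1) w' - W (t k) w')%R).
Proof.
move=> mZ mH H0.
have mZ' : measurable_fun setT Z.
  by move=> _ B mB; apply: (g_sigma_sub Gm); exact: mZ.
apply: (@integral_indep _ _ _ P _ _ _ _ Z (incr k)) => // A B mA mB.
case: HW => _ _ _ iW.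
have indF : mutually_independent P F.
  by apply: iW => //; rewrite t0.
apply: (mutually_independent_blocks (K := [set i | (i < k)%N]) (L := [set k]) _ _ indF).
- exact: Fm.
- by move=> i; exact: sigma_algebra_measurable_preimage.
- by rewrite -subset0 => i [/= + ik]; rewrite ik ltnn.
- by rewrite -[X in <<s _ >> X]setTI; exact: mZ.
- by apply: sub_sigma_algebra; exists k => //; exists B => //; rewrite setTI.
Qed.

End past.

Section stopping.
Variables (rho x s : R).
Hypothesis s0 : (0 < s)%R.
Variables (N : nat).
Hypothesis N0 : (0 < N)%N.
Variable c : R.

Let X r w : R := (x + (W r w - rho * r))%R.
Let t j : R := (s * j%:R / N%:R)%R.

(** [stay k] looks only at the grid points before the k-th, so [stop k] says that the k-th grid
    point is the first one at or below [c]. *)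
Fixpoint stay k w : bool :=
  if k is k'.+1 then stay k' w && (c < X (t k') w)%R else true.
Definition stop k w : bool := stay k w && (X (t k) w <= c)%R.

Lemma stay_stop n w : ((stay n w)%:R + \sum_(k < n) (stop k w)%:R = 1 :> R)%R.
Proof.
elim: n => [|n IH]; first by rewrite big_ord0 addr0.
rewrite big_ord_recr/= /stop -[RHS]IH; case: (stay n w) => /=; last by rewrite addr0.
by rewrite ltNge; case: (X _ _ <= c)%R; rewrite /= !(addr0, add0r) addrC.
Qed.

Lemma stayP n w : stay n w <-> forall k, (k < n)%N -> (c < X (t k) w)%R.
Proof.
elim: n => [|n IH]; first by split.
rewrite /=; split => [/andP[/IH sn cX] k|H].
  by rewrite ltnS leq_eqVlt => /orP[/eqP->//|/sn].
by apply/andP; split; [apply/IH => k kn; apply: H; exact: ltnW|exact: H].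
Qed.

Section fixed_time.
Variable k : nat.
Hypothesis kN : (k <= N)%N.

(** The grid with all times after the k-th replaced by [s]. The increment from [t k] to [s] is then
    increment number [k] of this sequence, independent of the earlier ones, which decide
    [stop k]. *)
Let u j : R := if (j <= k)%N then t j else s.

Let t_le j : (j <= N)%N -> (t j <= s)%R.
Proof.
move=> jN; rewrite /t -mulrA ger_pMr//.
by rewrite ler_pdivrMr ?ltr0n// mul1r ler_nat.
Qed.

Let le_t i j : (i <= j)%N -> (t i <= t j)%R.
Proof.
by move=> ij; rewrite /t ler_pM2r ?invr_gt0 ?ltr0n// ler_pM2l// ler_nat.
Qed.

Let u0 : u 0%N = 0%R. Proof. by rewrite /u leq0n /t mulr0 mul0r. Qed.

Let ndu : nondecreasing_seq u.
Proof.
move=> i j ij; rewrite /u; case: (leqP i k) => ik; case: (leqP j k) => jk.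
- exact: le_t.
- by apply: t_le; exact: leq_trans kN.
- by have := leq_trans ij jk; rewrite leqNgt ik.
- exact: lexx.
Qed.

(** The strong Markov property on the event that stopping occurs at [t k]: given the past, the
    position at [s] is the stopped position plus a fresh drifted increment. *)
Lemma integral_stop (phi : R -> R) : measurable_fun setT phi ->
  (forall z, (0 <= phi z)%R) ->
  \int[P]_w ((stop k w)%:R * phi (X s w))%:E =
  \int[P]_w ((stop k w)%:R%:E *
    \int[P]_w' (phi (X (t k) w + (W s w' - W (t k) w' - rho * (s - t k))))%:E).
Proof.
move=> mphi phi0.
pose H (z : (bool * R) * R) : \bar R :=
  (z.1.1%:R * phi (z.1.2 + (z.2 - rho * (s - t k))))%:E.
pose Z w : bool * R := (stop k w, X (t k) w).
have uk : u k = t k by rewrite /u leqnn.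
have uk1 : u k.+1 = s by rewrite /u ltnn.
have mbool : measurable_fun [set: bool] (fun b : bool => b%:R : R) by [].
have mH : measurable_fun setT H.
  apply/measurable_EFinP; apply: measurable_funM.
    by apply: (measurableT_comp mbool); apply: measurableT_comp.
  apply: measurableT_comp => //; apply: measurable_funD.
    exact: measurableT_comp.
  exact: measurable_funB.
have H0 z : 0 <= H z by rewrite lee_fin mulr_ge0.
have mX j : (j <= k)%N -> measurable_fun
    (setT : set (g_sigma_algebraType (\bigcup_(i in [set i : nat | (i < k)%N])
      g_sigma_algebra_preimage (fun w => W (u i.+1) w - W (u i) w)%R))) (X (t j)).
  move=> jk; apply: measurable_funD => //; apply: measurable_funB => //.
  have uj : u j = t j by rewrite /u jk.
  by have := measurable_bm_past u0 jk; rewrite uj.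
have mstay j : (j <= k)%N -> measurable_fun
    (setT : set (g_sigma_algebraType (\bigcup_(i in [set i : nat | (i < k)%N])
      g_sigma_algebra_preimage (fun w => W (u i.+1) w - W (u i) w)%R))) (stay j).
  elim: j => [|j IH] jk; first exact: measurable_cst.
  apply: measurable_and; first by apply: IH; exact: ltnW.
  apply: measurable_fun_ltr => //; apply: mX; exact: ltnW.
have mZ : measurable_fun
    (setT : set (g_sigma_algebraType (\bigcup_(i in [set i : nat | (i < k)%N])
      g_sigma_algebra_preimage (fun w => W (u i.+1) w - W (u i) w)%R))) Z.
  apply: measurable_fun_pair; last exact: mX.
  apply: measurable_and; first exact: mstay.
  by apply: measurable_fun_ler => //; exact: mX.
have := integral_bm_past u0 ndu mZ mH H0; rewrite uk uk1 /H /Z/=.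
have XE w : (X (t k) w + (W s w - W (t k) w - rho * (s - t k)))%R = X s w.
  by rewrite /X; ring.
under eq_integral do rewrite XE.
move=> ->; apply: eq_integral => w _.
case: (stop k w); last first.
  by rewrite mul0e integral0_eq// => w' _; rewrite mul0r.
by rewrite mul1e; apply: eq_integral => w' _; rewrite mul1r.
Qed.

End fixed_time.

(** * Reflection of the stopped path *)

Section test_function.
Variables (G : R -> R) (a b K L : R).
Hypotheses (mG : measurable_fun setT G) (G0 : forall z, (0 <= G z <= K)%R).
Hypotheses (L0 : (0 <= L)%R) (GL : forall y z, (`|G y - G z| <= L * `|y - z|)%R).
Hypothesis Gsupp : forall z, ~~ (a <= z <= b)%R -> G z = 0%R.
Hypotheses (c0 : (0 < c)%R) (c1 : (c <= 1)%R) (cx : (c < x)%R) (ca : (c < a)%R).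

(* [tpsi] is [tphi] reflected at the level [c], in the form that undoes the drift;
   [terr] bounds the error made when the path is reflected at a grid time, where
   it may have overshot [c]. *)
Definition tphi z : R := (expR (rho * z) * G z)%R.
Definition tpsi z : R := (expR (rho * z) * G (2 * c - z))%R.
Definition tC : R := (K * expR (`|rho| * (`|b| + 2)))%R.
Definition terr y : R := Num.min (expR (rho * y) * (2 * L * `|y - c|))%R tC.

Let K0 : (0 <= K)%R. Proof. by have /andP[/le_trans] := G0 0%R; apply. Qed.
Let tC0 : (0 <= tC)%R. Proof. by rewrite mulr_ge0 ?expR_ge0. Qed.

Let expb z y : (a <= z <= b)%R -> (`|y| <= z + 2)%R -> (expR (rho * y) <= expR (`|rho| * (`|b| + 2)))%R.
Proof.
move=> /andP[az zb] yz; rewrite ler_expR; apply: (le_trans (ler_norm _)).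
rewrite normrM ler_wpM2l//; apply: (le_trans yz); rewrite lerD2r.
exact: (le_trans zb (ler_norm _)).
Qed.

Lemma tphi_ge0 z : (0 <= tphi z)%R.
Proof. by rewrite mulr_ge0 ?expR_ge0//; have /andP[] := G0 z. Qed.

Lemma tpsi_ge0 z : (0 <= tpsi z)%R.
Proof. by rewrite mulr_ge0 ?expR_ge0//; have /andP[] := G0 (2 * c - z)%R. Qed.

Lemma tphi_le z : (tphi z <= tC)%R.
Proof.
have [abz|/Gsupp Gz] := boolP (a <= z <= b)%R; last by rewrite /tphi Gz mulr0.
rewrite /tphi /tC mulrC ler_pM ?expR_ge0//.
- by have /andP[] := G0 z.
- by have /andP[] := G0 z.
- apply: (expb abz); case/andP: abz => az _.
  by rewrite ger0_norm; [rewrite lerDl|exact: le_trans (ltW (lt_trans c0 ca)) az].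
Qed.

Lemma tpsi_le z : (tpsi z <= tC)%R.
Proof.
have [abz|/Gsupp Gz] := boolP (a <= 2 * c - z <= b)%R; last by rewrite /tpsi Gz mulr0.
rewrite /tpsi /tC mulrC ler_pM ?expR_ge0//.
- by have /andP[] := G0 (2 * c - z)%R.
- by have /andP[] := G0 (2 * c - z)%R.
- apply: (expb abz); case/andP: abz => az _.
  have h : (c < 2 * c - z)%R := lt_le_trans ca az.
  exact: reflected_norm_le.
Qed.

Let mexp : measurable_fun setT (fun z : R => expR (rho * z)%R).
Proof. by apply: measurableT_comp => //; exact: measurable_funM. Qed.

Lemma measurable_tphi : measurable_fun setT tphi.
Proof. exact: measurable_funM. Qed.

Lemma measurable_tpsi : measurable_fun setT tpsi.
Proof.
apply: measurable_funM => //; apply: measurableT_comp => //.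
exact: measurable_funB.
Qed.

Lemma integral_le_cst (f : T -> R) (k : R) : measurable_fun setT f ->
  (forall w, (0 <= f w <= k)%R) -> \int[P]_w (f w)%:E <= k%:E.
Proof.
move=> mf fk.
apply: (@le_trans _ _ (\int[P]_w (cst k%:E) w)).
  apply: ge0_le_integral => //.
  - by move=> w _; rewrite lee_fin; have /andP[] := fk w.
  - exact/measurable_EFinP.
  - by move=> w _; rewrite lee_fin; have /andP[] := fk w.
by rewrite integral_prob_cst.
Qed.

Lemma integral_close (f g : T -> R) (k : R) :
  measurable_fun setT f -> measurable_fun setT g -> (0 <= k)%R ->
  (forall w, (0 <= f w)%R) -> (forall w, (0 <= g w)%R) ->
  (forall w, (f w <= g w + k)%R) ->
  \int[P]_w (f w)%:E <= \int[P]_w (g w)%:E + k%:E.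
Proof.
move=> mf mg k0 f0 g0 fg.
have -> : k%:E = \int[P]_w (cst k%:E) w by rewrite integral_prob_cst.
rewrite -ge0_integralD//; [|by move=> w _; rewrite lee_fin|exact/measurable_EFinP].
apply: ge0_le_integral => //.
- by move=> w _; rewrite lee_fin.
- exact/measurable_EFinP.
- by apply: emeasurable_funD => //; exact/measurable_EFinP.
- by move=> w _; rewrite -EFinD lee_fin.
Qed.

Section inner.
Variables (r y : R).
Hypotheses (r0 : (0 <= r)%R) (rs : (r <= s)%R).
Let Z w : R := (W s w - W r w)%R.
Let v := (s - r)%R.
Let mZ : measurable_fun setT Z. Proof. exact: measurable_funB. Qed.
Let E : R := (expR (rho * y) * expR (- (rho ^+ 2 * v / 2)))%R.

Let mGD k : measurable_fun setT (fun z : R => G (k + z)%R).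
Proof. by apply: measurableT_comp => //; exact: measurable_funD. Qed.

Let mGB k : measurable_fun setT (fun z : R => G (k - z)%R).
Proof. by apply: measurableT_comp => //; exact: measurable_funB. Qed.

Lemma inner_tphi : \int[P]_w (tphi (y + (Z w - rho * v)))%:E =
  E%:E * \int[P]_w (G (y + Z w))%:E.
Proof.
rewrite /E EFinM -muleA.
have mF : measurable_fun [set: R] (fun z : R => (G (y + z))%:E).
  exact/measurable_EFinP.
have F0 (z : R) : 0 <= (G (y + z))%:E by rewrite lee_fin; have /andP[] := G0 (y + z)%R.
rewrite -(bm_girsanov HW rho r0 rs mF F0) -ge0_integralZl//.
- by apply: eq_integral => w _; rewrite /tphi mulrDr expRD !EFinM muleA.
- apply: emeasurable_funM; apply/measurable_EFinP.
    by apply: (measurableT_comp mexp); exact: measurable_funB.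
  by apply: (measurableT_comp (mGD y)); exact: measurable_funB.
- by move=> w _; rewrite mule_ge0// lee_fin expR_ge0.
Qed.

(** Removing the drift and then flipping the symmetric increment gives the same factor [E] as in
    [inner_tphi]; the two expectations differ only in that [y] is replaced by its mirror image
    [2 * c - y]. *)
Lemma inner_tpsi : \int[P]_w (tpsi (y + (Z w - rho * v)))%:E =
  E%:E * \int[P]_w (G (2 * c - y + Z w))%:E.
Proof.
rewrite /E EFinM -muleA.
have mF : measurable_fun [set: R] (fun z : R => (G (2 * c - y - z))%:E).
  exact/measurable_EFinP.
have mF' : measurable_fun [set: R] (fun z : R => (G (2 * c - y + z))%:E).
  exact/measurable_EFinP.
have F0 (z : R) : 0 <= (G (2 * c - y - z))%:E.
  by rewrite lee_fin; have /andP[] := G0 (2 * c - y - z)%R.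
have F0' (z : R) : 0 <= (G (2 * c - y + z))%:E.
  by rewrite lee_fin; have /andP[] := G0 (2 * c - y + z)%R.
rewrite -(bm_sym HW r0 rs mF' F0') -(bm_girsanov HW rho r0 rs mF F0) -ge0_integralZl//.
- apply: eq_integral => w _; rewrite /tpsi mulrDr expRD !EFinM muleA.
  by congr (_ * (G _)%:E); rewrite opprD addrA.
- apply: emeasurable_funM; apply/measurable_EFinP.
    by apply: (measurableT_comp mexp); exact: measurable_funB.
  by apply: (measurableT_comp (mGB (2 * c - y))); exact: measurable_funB.
- by move=> w _; rewrite mule_ge0// lee_fin expR_ge0.
Qed.

Let E0 : (0 <= E)%R. Proof. by rewrite mulr_ge0 ?expR_ge0. Qed.
Let Ele : (E <= expR (rho * y))%R.
Proof.
rewrite /E ger_pMr ?expR_gt0// -expR0 ler_expR oppr_le0.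
by apply: mulr_ge0 => //; apply: mulr_ge0; rewrite ?sqr_ge0// subr_ge0.
Qed.

Let mGy k : measurable_fun setT (fun w => G (k + Z w)%R).
Proof. exact: (measurableT_comp (mGD k)). Qed.

Let close (k1 k2 : R) : (`|k1 - k2| <= 2 * `|y - c|)%R ->
  E%:E * \int[P]_w (G (k1 + Z w))%:E <=
  E%:E * \int[P]_w (G (k2 + Z w))%:E + (expR (rho * y) * (2 * L * `|y - c|))%:E.
Proof.
move=> k12.
have H : \int[P]_w (G (k1 + Z w))%:E <= \int[P]_w (G (k2 + Z w))%:E + (2 * L * `|y - c|)%:E.
  apply: integral_close => //.
  - by rewrite !mulr_ge0.
  - by move=> w; have /andP[] := G0 (k1 + Z w)%R.
  - by move=> w; have /andP[] := G0 (k2 + Z w)%R.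
  - move=> w; rewrite -lerBlDl; apply: (le_trans (ler_norm _)).
    apply: (le_trans (GL _ _)); rewrite [leRHS](_ : _ = L * (2 * `|y - c|))%R; last by ring.
    by rewrite ler_wpM2l// (_ : _ - _ = k1 - k2)%R//; ring.
apply: (@le_trans _ _ (E%:E * (\int[P]_w (G (k2 + Z w))%:E + (2 * L * `|y - c|)%:E))).
  by rewrite lee_wpmul2l// lee_fin.
rewrite ge0_muleDr//.
- by rewrite leeD2l// -EFinM lee_fin ler_wpM2r// !mulr_ge0.
- by apply: integral_ge0 => w _; rewrite lee_fin; have /andP[] := G0 (k2 + Z w)%R.
- by rewrite lee_fin !mulr_ge0.
Qed.

Let I1 := \int[P]_w (tphi (y + (Z w - rho * v)))%:E.
Let I2 := \int[P]_w (tpsi (y + (Z w - rho * v)))%:E.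

Let mYZ : measurable_fun setT (fun w => y + (Z w - rho * v))%R.
Proof. by apply: measurable_funD => //; exact: measurable_funB. Qed.

(** Of the two bounds in [terr], the Lipschitz one is small when the overshoot is small, since [y]
    and its mirror image are twice the overshoot apart; the other, [tC], bounds [tphi] outright and
    provides domination in the limit of fine grids. *)
Lemma inner_le12 : I1 <= I2 + (terr y)%:E.
Proof.
have I20 : 0 <= I2 by apply: integral_ge0 => w _; rewrite lee_fin tpsi_ge0.
rewrite /terr /Num.min; case: ifPn => _.
  rewrite /I1 /I2 inner_tphi inner_tpsi; apply: close.
  by rewrite (_ : y - (2 * c - y) = 2 * (y - c))%R; [rewrite normrM gtr0_norm|ring].
apply: (@le_trans _ _ tC%:E); last exact: leeDr.
apply: integral_le_cst; first exact: (measurableT_comp measurable_tphi).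
by move=> w; rewrite tphi_ge0 tphi_le.
Qed.

Lemma inner_le21 : I2 <= I1 + (terr y)%:E.
Proof.
have I10 : 0 <= I1 by apply: integral_ge0 => w _; rewrite lee_fin tphi_ge0.
rewrite /terr /Num.min; case: ifPn => _.
  rewrite /I1 /I2 inner_tphi inner_tpsi; apply: close.
  rewrite (_ : (2 * c - y) - y = - (2 * (y - c)))%R; last by ring.
  by rewrite normrN normrM gtr0_norm.
apply: (@le_trans _ _ tC%:E); last exact: leeDr.
apply: integral_le_cst; first exact: (measurableT_comp measurable_tpsi).
by move=> w; rewrite tpsi_ge0 tpsi_le.
Qed.

End inner.

Lemma terr_ge0 y : (0 <= terr y)%R.
Proof.
rewrite /terr /Num.min; case: ifP => _ //.
by rewrite mulr_ge0 ?expR_ge0// !mulr_ge0.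
Qed.

Let mX r : measurable_fun setT (X r).
Proof. by apply: measurable_funD => //; exact: measurable_funB. Qed.

Let mstay k : measurable_fun setT (stay k).
Proof.
elim: k => [|k IH]; first exact: measurable_cst.
apply: measurable_and => //; exact: measurable_fun_ltr.
Qed.

Let mstop k : measurable_fun setT (fun w => (stop k w)%:R : R).
Proof.
have mbool : measurable_fun [set: bool] (fun b : bool => b%:R : R) by [].
apply: (measurableT_comp mbool); apply: measurable_and => //.
exact: measurable_fun_ler.
Qed.

Lemma measurable_terr : measurable_fun setT terr.
Proof.
apply: measurable_minr; last exact: measurable_cst.
apply: measurable_funM; first exact: mexp.
apply: measurable_funM; first exact: measurable_cst.
by apply: measurableT_comp => //; exact: measurable_funB.
Qed.

Let mtt (f : R -> R) k : measurable_fun setT f -> measurable_fun setT (fun w => (stop k w)%:R * f (X s w))%R.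
Proof. by move=> mf; apply: measurable_funM => //; exact: measurableT_comp. Qed.

Let merr k : measurable_fun setT (fun w => (stop k w)%:R * terr (X (t k) w))%R.
Proof. by apply: measurable_funM => //; apply: measurableT_comp => //; exact: measurable_terr. Qed.

Let minner r (f : R -> R) : measurable_fun setT f -> (forall z, (0 <= f z)%R) ->
  measurable_fun [set: R] (fun y => \int[P]_w (f (y + (W s w - W r w - rho * (s - r))))%:E).
Proof.
move=> mf f0.
pose H (z : R * T) : \bar R := (f (z.1 + (W s z.2 - W r z.2 - rho * (s - r))))%:E.
have mH : measurable_fun setT H.
  apply/measurable_EFinP; apply: measurableT_comp => //; apply: measurable_funD => //.
  by apply: measurable_funB => //; apply: measurable_funB => //; exact: measurableT_comp.
apply: (measurable_fun_fubini_tonelli_F H) => //.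
by move=> z; rewrite lee_fin.
Qed.

Let t_ge0 j : (0 <= t j)%R.
Proof. by rewrite /t !mulr_ge0 ?invr_ge0 ?ler0n// ltW. Qed.

Let t_le j : (j <= N)%N -> (t j <= s)%R.
Proof.
move=> jN; rewrite /t -mulrA ger_pMr//.
by rewrite ler_pdivrMr ?ltr0n// mul1r ler_nat.
Qed.

Let stop_le (f g : R -> R) k : (k <= N)%N ->
  measurable_fun setT f -> measurable_fun setT g ->
  (forall z, (0 <= f z)%R) -> (forall z, (0 <= g z)%R) ->
  (forall y, \int[P]_w (f (y + (W s w - W (t k) w - rho * (s - t k))))%:E <=
    \int[P]_w (g (y + (W s w - W (t k) w - rho * (s - t k))))%:E + (terr y)%:E) ->
  \int[P]_w ((stop k w)%:R * f (X s w))%:E <=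
  \int[P]_w ((stop k w)%:R * g (X s w))%:E +
  \int[P]_w ((stop k w)%:R * terr (X (t k) w))%:E.
Proof.
move=> kN mf mg f0 g0 fg.
rewrite (integral_stop kN mf f0) (integral_stop kN mg g0).
have mi (h : R -> R) : measurable_fun setT h -> (forall z, (0 <= h z)%R) ->
    measurable_fun setT (fun w => (stop k w)%:R%:E *
      \int[P]_w' (h (X (t k) w + (W s w' - W (t k) w' - rho * (s - t k))))%:E).
  move=> mh h0; apply: emeasurable_funM; first exact/measurable_EFinP.
  exact: (measurableT_comp (minner (t k) mh h0) (mX (t k))).
have i0 (h : R -> R) w : (forall z, (0 <= h z)%R) -> 0 <= (stop k w)%:R%:E *
      \int[P]_w' (h (X (t k) w + (W s w' - W (t k) w' - rho * (s - t k))))%:E.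
  by move=> h0; rewrite mule_ge0//; apply: integral_ge0 => w' _; rewrite lee_fin.
rewrite -ge0_integralD//.
- apply: ge0_le_integral => //.
  + by move=> w _; exact: i0.
  + exact: mi.
  + by apply: emeasurable_funD; [exact: mi|exact/measurable_EFinP].
  + move=> w _; case: (stop k w); last by rewrite !mul0e mul0r adde0.
    by rewrite !mul1e mul1r.
- by move=> w _; exact: i0.
- exact: mi.
- by move=> w _; rewrite lee_fin mulr_ge0// terr_ge0.
- exact/measurable_EFinP.
Qed.

Definition terr_sum w : R := (\sum_(k < N.+1) (stop k w)%:R * terr (X (t k) w))%R.

Let tN : t N = s.
Proof. by rewrite /t mulfK// pnatr_eq0 -lt0n. Qed.

Let sum_stop (f : R -> R) : measurable_fun setT f -> (forall z, (0 <= f z)%R) ->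
  \int[P]_w (f (X s w))%:E = \int[P]_w ((stay N.+1 w)%:R * f (X s w))%:E +
   \sum_(k < N.+1) \int[P]_w ((stop k w)%:R * f (X s w))%:E.
Proof.
move=> mf f0.
have mfX : measurable_fun setT (fun w => f (X s w)) by exact: measurableT_comp.
have mbool : measurable_fun [set: bool] (fun b : bool => b%:R : R) by [].
have mst : measurable_fun setT (fun w => (stay N.+1 w)%:R * f (X s w))%R.
  by apply: measurable_funM => //; apply: (measurableT_comp mbool).
rewrite -ge0_integral_sum//; last 2 first.
- by move=> k; apply/measurable_EFinP; exact: mtt.
- by move=> k w _; rewrite lee_fin mulr_ge0.
rewrite -ge0_integralD//; last 4 first.
- by move=> w _; rewrite lee_fin mulr_ge0.
- exact/measurable_EFinP.
- by move=> w _; apply: sume_ge0 => k _; rewrite lee_fin mulr_ge0.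
- by apply: emeasurable_sum => k; apply/measurable_EFinP; exact: mtt.
apply: eq_integral => w _; rewrite sumEFin -EFinD -mulr_suml -mulrDl.
by rewrite stay_stop mul1r.
Qed.

Let int_terr_sum : \int[P]_w (terr_sum w)%:E =
  \sum_(k < N.+1) \int[P]_w ((stop k w)%:R * terr (X (t k) w))%:E.
Proof.
rewrite -ge0_integral_sum//.
- by apply: eq_integral => w _; rewrite /terr_sum sumEFin.
- by move=> k; apply/measurable_EFinP; exact: merr.
- by move=> k w _; rewrite lee_fin mulr_ge0// terr_ge0.
Qed.

(** On a path still above [c] at time [s] the reflected end point lies below [c], hence below [a],
    outside the support of [G]. So [tpsi] only sees paths that were stopped. *)
Let stay_tpsi w : ((stay N.+1 w)%:R * tpsi (X s w) = 0)%R.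
Proof.
case: (boolP (stay N.+1 w)) => [/= /andP[_]|_]; last by rewrite mul0r.
rewrite tN mul1r => cX; rewrite /tpsi Gsupp ?mulr0//.
apply/negP => /andP[aX _]; have := lt_le_trans ca aX.
by rewrite ltrBrDr mulr_natl mulr2n ltrD2l ltNge (ltW cX).
Qed.

(** On each event [stop k] the function [tphi] is exchanged for [tpsi] at the cost of [terr]; on the
    remaining event [tpsi] vanishes and [tphi] is kept. *)
Lemma reflection_le : \int[P]_w (tphi (X s w))%:E <=
  \int[P]_w ((stay N.+1 w)%:R * tphi (X s w))%:E +
  (\int[P]_w (tpsi (X s w))%:E + \int[P]_w (terr_sum w)%:E).
Proof.
rewrite (sum_stop measurable_tphi tphi_ge0) leeD2l//.
rewrite (sum_stop measurable_tpsi tpsi_ge0) integral0_eq ?add0e//; last first.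
  by move=> w _; rewrite stay_tpsi.
rewrite int_terr_sum -big_split/=; apply: lee_sum => k _.
have kN : (k <= N)%N by rewrite -ltnS.
apply: stop_le => //; [exact: measurable_tphi|exact: measurable_tpsi|exact: tphi_ge0|exact: tpsi_ge0|].
by move=> y; apply: inner_le12 => //; exact: t_le.
Qed.

Lemma reflection_ge : \int[P]_w ((stay N.+1 w)%:R * tphi (X s w))%:E +
  \int[P]_w (tpsi (X s w))%:E <=
  \int[P]_w (tphi (X s w))%:E + \int[P]_w (terr_sum w)%:E.
Proof.
rewrite (sum_stop measurable_tphi tphi_ge0) -addeA leeD2l//.
rewrite (sum_stop measurable_tpsi tpsi_ge0) integral0_eq ?add0e//; last first.
  by move=> w _; rewrite stay_tpsi.
rewrite int_terr_sum -big_split/=; apply: lee_sum => k _.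
have kN : (k <= N)%N by rewrite -ltnS.
apply: stop_le => //; [exact: measurable_tpsi|exact: measurable_tphi|exact: tpsi_ge0|exact: tphi_ge0|].
by move=> y; apply: inner_le21 => //; exact: t_le.
Qed.

Lemma terr_sum_ge0 w : (0 <= terr_sum w)%R.
Proof. by apply: sumr_ge0 => k _; rewrite mulr_ge0// terr_ge0. Qed.

Lemma measurable_terr_sum : measurable_fun setT terr_sum.
Proof. by apply: measurable_sum => k; exact: merr. Qed.

(** At most one of the events [stop k] occurs, so the errors do not accumulate with the number of
    grid points. *)
Lemma terr_sum_le w (e : R) : (0 <= e)%R ->
  (forall k, (k <= N)%N -> stop k w -> (terr (X (t k) w) <= e)%R) ->
  (terr_sum w <= e)%R.
Proof.
move=> e0 H; apply: (@le_trans _ _ (\sum_(k < N.+1) (stop k w)%:R * e)%R).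
  apply: ler_sum => k _; have := H k; case: (stop k w) => Hk; last by rewrite !mul0r.
  by rewrite !mul1r; apply: Hk => //; rewrite -ltnS.
by rewrite -mulr_suml ler_piMl// -[leRHS](stay_stop N.+1 w) lerDr.
Qed.

End test_function.
End stopping.
End grid.

(** * The reflection principle *)

Lemma norm_le_of_near (R : realType) (y c : R) : 0 < c -> `|y - c| < 1 -> `|y| <= c + 1.
Proof.
move=> c0 yc; rewrite -[y in leLHS](subrK c) addrC (le_trans (ler_normD _ _))//.
by rewrite gtr0_norm// lerD2l ltW.
Qed.

Lemma lt_of_oppB_lt (R : realType) (a b c : R) : - (c - a) < a - b -> b < c.
Proof. lra. Qed.

(** * Continuous paths on time grids *)

Section paths.
Context {R : realType}.
Implicit Type f : R -> R.

Definition cts_path f := forall r e : R, 0 <= r -> 0 < e ->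
  exists2 h : R, 0 < h & forall r' : R, 0 <= r' -> `|r - r'| < h -> `|f r - f r'| < e.

Lemma grid_approx (s r h : R) : 0 < s -> 0 <= r <= s -> 0 < h ->
  exists n, forall N, (n <= N)%N ->
    exists2 k, (k <= N.+1)%N & `|r - s * k%:R / N.+1%:R| < h.
Proof.
move=> s0 /andP[r0 rs] h0.
have [n nP] : exists n, s / h < n%:R.
  by exists (Num.truncn (s / h)).+1; exact: truncnS_gt.
exists n => N nN.
have N0 : 0 < N.+1%:R :> R by rewrite ltr0n.
pose k := Num.truncn (r * N.+1%:R / s).
have q0 : 0 <= r * N.+1%:R / s by rewrite !mulr_ge0 ?invr_ge0// ltW.
have k1 : k%:R <= r * N.+1%:R / s by rewrite truncn_le.
have k2 : r * N.+1%:R / s < k.+1%:R by exact: truncnS_gt.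
have k1' : s * k%:R / N.+1%:R <= r.
  by rewrite ler_pdivrMr// [leLHS]mulrC -ler_pdivlMr.
have k2' : r < s * k.+1%:R / N.+1%:R.
  by rewrite ltr_pdivlMr// [ltRHS]mulrC -ltr_pdivrMr.
exists k.
  rewrite -(ler_nat R); apply: (le_trans k1).
  by rewrite ler_pdivrMr// mulrC ler_wpM2l.
rewrite ger0_norm ?subr_ge0//.
have -> : r - s * k%:R / N.+1%:R = (r - s * k.+1%:R / N.+1%:R) + s / N.+1%:R.
  by rewrite -natr1; field; rewrite gt_eqF.
apply: (@lt_trans _ _ (s / N.+1%:R)); first by rewrite gtrDr subr_lt0.
rewrite ltr_pdivrMr// mulrC -ltr_pdivrMr//; apply: (lt_le_trans nP).
by rewrite ler_nat ltnW// ltnS.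
Qed.

(** A violated bound is violated on a neighbourhood, which meets every fine enough grid. A condition
    at uncountably many times becomes countable, which is how path events are shown to be
    measurable. *)
Lemma cts_grid_lb f s c : 0 <= s -> cts_path f ->
  (forall r, 0 <= r <= s -> c <= f r) <->
  (forall N k, (k <= N.+1)%N -> c <= f (s * k%:R / N.+1%:R)).
Proof.
move=> s0 cf; split => [H N k kN|H r rs].
  apply: H; rewrite !mulr_ge0 ?invr_ge0//= -mulrA ler_piMr//.
  by rewrite ler_pdivrMr// mul1r ler_nat.
rewrite leNgt; apply/negP => fr.
move: s0; rewrite le_eqVlt => /orP[/eqP s0|s0].
  move: rs; rewrite -s0 => r0; have := H 0%N 0%N (leq0n _).
  by rewrite -s0 !mul0r (le_anti r0) leNgt fr.
have cfr : 0 < c - f r by rewrite subr_gt0.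
have r0 : 0 <= r by case/andP: rs.
have [h h0 hP] := cf r _ r0 cfr.
have [n nP] := grid_approx s0 rs h0.
have [k kn rk] := nP n (leqnn n).
have sk0 : 0 <= s * k%:R / n.+1%:R by rewrite !mulr_ge0 ?invr_ge0// ltW.
have := hP _ sk0 rk; rewrite ltr_norml => /andP[H1 _].
by have := H n k kn; rewrite leNgt; apply/negP; rewrite negbK; move: H1; lra.
Qed.

Lemma posev_gridP f s : 0 <= s -> cts_path f ->
  posev f s <-> exists j : nat, forall N k, (k <= N.+1)%N ->
    j.+1%:R^-1 <= f (s * k%:R / N.+1%:R).
Proof.
by move=> s0 cf; split => -[j H]; exists j; apply/(cts_grid_lb j.+1%:R^-1 s0 cf).
Qed.

End paths.

Section bounded_convergence.
Context {R : realType} {d : measure_display} {T : measurableType d}.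
Variable P : probability T R.
Local Open Scope ereal_scope.

Lemma bounded_cvg (f_ : nat -> T -> R) (f : T -> R) (C : R) :
  (forall n, measurable_fun setT (f_ n)) ->
  (forall w, (f_ n w @[n --> \oo] --> f w)%R) ->
  (forall n w, (`|f_ n w| <= C)%R) ->
  \int[P]_w (f_ n w)%:E @[n --> \oo] --> \int[P]_w (f w)%:E.
Proof.
move=> mf cf fC.
apply: (@dominated_cvg _ _ _ P setT measurableT (fun n w => (f_ n w)%:E)
  (fun w => (f w)%:E) (cst C%:E)) => //.
- by move=> n; exact/measurable_EFinP.
- by move=> w _; apply: cvg_EFin; [exact: nearW|exact: cf].
- apply/integrableP; split => //.
  under eq_integral do rewrite /=.
  have -> : \int[P]_w `|C%:E| = \int[P]_w (cst `|C|%R%:E) w by [].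
  by rewrite integral_prob_cst ltry.
- by move=> n w _; rewrite abse_EFin lee_fin.
Qed.

Lemma cvge_le_cst (u : nat -> \bar R) (l k : \bar R) :
  u n @[n --> \oo] --> l -> (forall n, u n <= k) -> l <= k.
Proof.
move=> ul uk; rewrite -(cvg_lim _ ul)//; apply: lime_le; last exact: nearW.
by apply/cvg_ex; exists l.
Qed.

Lemma cvge_ge_cst (u : nat -> \bar R) (l k : \bar R) :
  u n @[n --> \oo] --> l -> (forall n, k <= u n) -> k <= l.
Proof.
move=> ul uk; rewrite -(cvg_lim _ ul)//; apply: lime_ge; last exact: nearW.
by apply/cvg_ex; exists l.
Qed.

Lemma le_of_cvg0 (a b : \bar R) (u : nat -> \bar R) :
  u n @[n --> \oo] --> 0 -> (forall n, a <= b + u n) -> a <= b.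
Proof.
move=> u0 H; apply/lee_addgt0Pr => e e0.
have [n] : exists n, u n <= e%:E.
  have : \forall n \near \oo, u n < e%:E.
    apply: (u0 [set y | y < e%:E]); apply: open_nbhs_nbhs.
    by split; [exact: open_ereal_lt_ereal|rewrite /= lte_fin].
  by case=> n _ /(_ n (leqnn n)) /ltW; exists n.
by move=> un; apply: (le_trans (H n)); exact: leeD2l.
Qed.

End bounded_convergence.

Section killed_law.
Context {R : realType} {d : measure_display} {T : measurableType d}.
Context {P : probability T R}.
Variable W : R -> {RV P >-> R}.
Hypothesis HW : is_brownian_motion W.
Variables (rho x s : R).
Hypothesis s0 : 0 < s.
Local Notation mu := (@lebesgue_measure R).

Let X r w : R := x + (W r w - rho * r).

Lemma cts_bm_drift w : cts_path (fun r => X r w).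
Proof.
move=> r e r0 e0; have e20 : 0 < e / 2 by rewrite divr_gt0.
have [h h0 hP] := bm_cts HW w r0 e20.
pose M := `|rho| + 1; have M0 : 0 < M by rewrite ltr_wpDl.
exists (Num.min h (e / 2 / M)).
  by rewrite lt_min h0 !divr_gt0.
move=> r' r'0; rewrite lt_min => /andP[rr1 rr2].
rewrite /X (_ : _ - _ = (W r w - W r' w) + rho * (r' - r)); last by ring.
apply: (le_lt_trans (ler_normD _ _)).
rewrite [ltRHS](_ : e = e / 2 + e / 2); last by field.
apply: ltr_leD; first exact: hP.
rewrite normrM distrC; apply: (@le_trans _ _ (M * `|r - r'|)).
  by rewrite ler_wpM2r// lerDl.
by rewrite mulrC -ler_pdivlMr// ltW.
Qed.

Let mX r : measurable_fun setT (X r).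
Proof. by apply: measurable_funD => //; exact: measurable_funB. Qed.

Definition path_ge c : set T := [set w | forall r, 0 <= r <= s -> c <= X r w].

Lemma measurable_path_ge c : measurable (path_ge c).
Proof.
have -> : path_ge c = \bigcap_N \bigcap_(k in [set k | (k <= N.+1)%N])
    [set w | c <= X (s * k%:R / N.+1%:R) w].
  apply/seteqP; split => w.
    move=> /(cts_grid_lb c (ltW s0) (cts_bm_drift w)) H N _ k kN.
    exact: H.
  by move=> H; apply/(cts_grid_lb c (ltW s0) (cts_bm_drift w)) => N k kN; exact: H.
apply: bigcap_measurable => // N _; apply: bigcap_measurable => [|k _].
  by exists 0%N.
rewrite -[X in measurable X]setTI.
have : measurable_fun setT (fun w => c <= X (s * k%:R / N.+1%:R) w).
  exact: measurable_fun_ler.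
by move=> /(_ measurableT [set true]); rewrite /preimage/=; apply.
Qed.

Definition path_pos : set T := [set w | posev (fun r => X r w) s].

Lemma path_posE : path_pos = \bigcup_j path_ge j.+1%:R^-1.
Proof. by apply/seteqP; split => w [j]; exists j. Qed.

Lemma measurable_path_pos : measurable path_pos.
Proof. by rewrite path_posE; apply: bigcup_measurable => j _; exact: measurable_path_ge. Qed.

Section test_function.
Variables (G : R -> R) (a b K L : R).
Hypotheses (mG : measurable_fun setT G) (G0 : forall z, 0 <= G z <= K).
Hypotheses (L0 : 0 <= L) (GL : forall y z, `|G y - G z| <= L * `|y - z|).
Hypothesis Gsupp : forall z, ~~ (a <= z <= b) -> G z = 0.

Let phi := tphi rho G.
Let psi c := tpsi rho c G.
Let C := tC rho b K.
Let stay N c := stay W rho x s N.+1 c.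
Let terrs N c := terr_sum W rho x s N.+1 c b K L.

Let K0 : 0 <= K. Proof. by have /andP[/le_trans] := G0 0; apply. Qed.
Let C0 : 0 <= C. Proof. by rewrite /C /tC mulr_ge0 ?expR_ge0. Qed.

Section level.
Variable c : R.
Hypotheses (c0 : 0 < c) (c1 : c <= 1) (cx : c < x) (ca : c < a).

Let mphi : measurable_fun setT phi. Proof. exact: measurable_tphi. Qed.
Let mpsi : measurable_fun setT (psi c). Proof. exact: measurable_tpsi. Qed.

Let stay_eventually w : ~ path_ge c w ->
  exists n, forall N, (n <= N)%N -> stay N c N.+2 w = false.
Proof.
move=> /existsNP[r /not_implyP[rs]] /negP; rewrite -ltNge => Xr.
have r0 : 0 <= r by case/andP: rs.
have cX : 0 < c - X r w by rewrite subr_gt0.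
have [h h0 hP] := cts_bm_drift w r0 cX.
have [n nP] := grid_approx s0 rs h0.
exists n => N nN; have [k kN rk] := nP N nN.
apply/negP => /stayP /(_ k kN).
have sk0 : 0 <= s * k%:R / N.+1%:R by rewrite !mulr_ge0 ?invr_ge0// ltW.
have := hP _ sk0 rk; rewrite ltr_norml => /andP[H1 _].
by move/(lt_trans (lt_of_oppB_lt H1)); rewrite ltxx.
Qed.

(** Stopping occurs one mesh after a grid point where the path was above [c], so the overshoot is at
    most the oscillation of the path over one mesh, which tends to 0 by [heine]. *)
Let terrs_cvg w : terrs N c w @[N --> \oo] --> 0.
Proof.
apply/cvgrPdist_le => e e0.
(* Bounds the factor of the overshoot in [terr] as long as the stopped position is within 1 of [c];
   the added 1 keeps it positive. *)
pose M := expR (`|rho| * (c + 1)) * (2 * L) + 1.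
have M0 : 0 < M by rewrite ltr_wpDl// mulr_ge0 ?expR_ge0// mulr_ge0.
have d0 : 0 < Num.min 1 (e / M) by rewrite lt_min ltr01 divr_gt0.
have [h h0 hP] := heine s (cts_bm_drift w) d0.
have [n nP] : exists n, s / h < n%:R.
  by exists (Num.truncn (s / h)).+1; exact: truncnS_gt.
exists n => // N /= nN.
rewrite sub0r normrN ger0_norm; last by apply: (@terr_sum_ge0 _ _ _ _ W rho x s N.+1 c G).
apply: terr_sum_le; first exact: ltW.
move=> k kN /andP[sk]; rewrite -/(X _ _) => Xk.
(* Index 0 is excluded, since the path starts at [x > c]. *)
case: k kN sk Xk => [_ _|k kN sk Xk].
  rewrite mulr0 mul0r /X; case: HW => -> _ _ _; rewrite mulr0 subr0 addr0.
  by rewrite leNgt cx.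
have cXk : c < X (s * k%:R / N.+1%:R) w by move/stayP : sk => /(_ k (ltnSn k)).
have N0 : 0 < N.+1%:R :> R by rewrite ltr0n.
have sk0 (i : nat) : 0 <= s * i%:R / N.+1%:R by rewrite !mulr_ge0 ?invr_ge0// ltW.
have : `|X (s * k%:R / N.+1%:R) w - X (s * k.+1%:R / N.+1%:R) w| < Num.min 1 (e / M).
  apply: hP => //.
    rewrite sk0/= -mulrA ler_piMr//; first exact: ltW.
    by rewrite ler_pdivrMr// mul1r ler_nat ltnW.
  rewrite (_ : _ - _ = - (s / N.+1%:R)); last by rewrite -natr1; field; rewrite gt_eqF.
  rewrite normrN gtr0_norm ?divr_gt0// ltr_pdivrMr// mulrC -ltr_pdivrMr//.
  by apply: (lt_le_trans nP); rewrite ler_nat ltnW.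
rewrite lt_min => /andP[d1 d2].
have Xc : `|X (s * k.+1%:R / N.+1%:R) w - c| <= `|X (s * k%:R / N.+1%:R) w - X (s * k.+1%:R / N.+1%:R) w|.
  rewrite distrC ger0_norm ?subr_ge0// ger0_norm ?lerD2r ?(ltW cXk)//.
  by rewrite subr_ge0 (le_trans Xk)// ltW.
apply: (@le_trans _ _ (expR (rho * X (s * k.+1%:R / N.+1%:R) w) *
   (2 * L * `|X (s * k.+1%:R / N.+1%:R) w - c|))); first by rewrite /terr ge_min lexx.
apply: (@le_trans _ _ (M * (e / M))); last by rewrite mulrC divfK// gt_eqF.
rewrite mulrA ler_pM//.
- by rewrite mulr_ge0 ?expR_ge0// mulr_ge0.
- apply: (@le_trans _ _ (expR (`|rho| * (c + 1)) * (2 * L))); last by rewrite lerDl.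
  rewrite ler_wpM2r ?mulr_ge0// ler_expR (le_trans (ler_norm _))// normrM ler_wpM2l//.
  exact: (norm_le_of_near c0 (le_lt_trans Xc d1)).
- by apply: ltW; apply: le_lt_trans d2.
Qed.

Let mstay N k : measurable_fun setT (stay N c k).
Proof.
elim: k => [|k IH]; first exact: measurable_cst.
by apply: measurable_and => //; apply: measurable_fun_ltr => //; exact: mX.
Qed.

Let mbool : measurable_fun [set: bool] (fun b : bool => b%:R : R). Proof. by []. Qed.

Let pg w : R := \1_(path_ge c) w.

Let mpg : measurable_fun setT pg.
Proof. by apply: measurable_indic; exact: measurable_path_ge. Qed.

(** Marks the paths that look above [c] on the grid although they go below it in between. *)
Let rest N w : R := (stay N c N.+2 w)%:R * (1 - pg w).

Let mrest N : measurable_fun setT (rest N).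
Proof.
apply: measurable_funM; last exact: measurable_funB.
by apply: (measurableT_comp mbool); exact: mstay.
Qed.

Let rest01 N w : 0 <= rest N w <= 1.
Proof.
rewrite /rest /pg indicE; case: (stay _ _ _ _); case: (_ \in _) => /=;
  by rewrite !(mul0r, mul1r, subrr, subr0) ?lexx ?ler01.
Qed.

Let rest_cvg w : rest N w @[N --> \oo] --> 0.
Proof.
rewrite /rest /pg indicE; case: (boolP (w \in _)) => [_|].
  by under eq_fun do rewrite subrr mulr0; exact: cvg_cst.
rewrite notin_setE => /stay_eventually[n nP].
apply: cvg_near_cst; exists n => // N nN.
by have h := nP N nN; rewrite /= in h *; rewrite h mul0r.
Qed.

Let mterrs N : measurable_fun setT (terrs N c).
Proof. exact: measurable_terr_sum. Qed.

Let terrs_ge0 N w : 0 <= terrs N c w.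
Proof. exact: (@terr_sum_ge0 _ _ _ _ W rho x s N.+1 c G). Qed.

Let terrs_le N w : terrs N c w <= C.
Proof. by apply: terr_sum_le => // k _ _; rewrite /terr ge_min lexx orbT. Qed.

Let phi0 := tphi_ge0 rho G0.
Let psi0 := tpsi_ge0 rho c G0.
Let phiC z : phi z <= C. Proof. exact: tphi_le c0 ca z. Qed.

Local Open Scope ereal_scope.

Let mphiX : measurable_fun setT (fun w => phi (X s w)).
Proof. exact: (measurableT_comp mphi). Qed.
Lemma level_le : \int[P]_w (phi (X s w))%:E <=
  \int[P]_w (\1_(path_ge c) w * phi (X s w))%:E + \int[P]_w (psi c (X s w))%:E.
Proof.
apply: (@le_of_cvg0 _ _ _ (fun N => \int[P]_w (terrs N c w + C * rest N w)%:E)).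
  have -> : 0 = \int[P]_w (cst 0%R w)%:E by rewrite integral0_eq.
  apply: (@bounded_cvg _ _ _ P _ _ (C + C)%R).
  - by move=> N; apply: measurable_funD => //; exact: measurable_funM.
  - move=> w; rewrite -[X in _ --> X]/(0 : R)%R -[X in _ --> X]addr0 -[X in _ --> (_ + X)%R](mulr0 C).
    by apply: cvgD => //; apply: cvgM => //; exact: cvg_cst.
  - move=> N w; have /andP[r0 r1] := rest01 N w.
    rewrite ger0_norm; last by apply: addr_ge0 => //; exact: mulr_ge0.
    by apply: lerD => //; rewrite ler_piMr.
move=> N.
have mst : measurable_fun setT (fun w => (stay N c N.+2 w)%:R * phi (X s w))%R.
  by apply: measurable_funM => //; apply: (measurableT_comp mbool).
have := reflection_le HW rho x s0 (ltn0Sn N) mG G0 L0 GL Gsupp c0 ca.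
move/le_trans; apply.
have -> : \int[P]_w (terrs N c w + C * rest N w)%:E =
   \int[P]_w (terrs N c w)%:E + \int[P]_w (C * rest N w)%:E.
  rewrite -ge0_integralD//.
  - by move=> w _; rewrite lee_fin.
  - exact/measurable_EFinP.
  - move=> w _; rewrite lee_fin; apply: mulr_ge0 => //.
    by have /andP[] := rest01 N w.
  - by apply/measurable_EFinP; exact: measurable_funM.
rewrite [X in _ <= _ + X]addeC addeACA; apply: leeD2r.
rewrite -ge0_integralD//.
- apply: ge0_le_integral => //.
  + by move=> w _; rewrite lee_fin mulr_ge0// phi0.
  + exact/measurable_EFinP.
  + apply: emeasurable_funD; apply/measurable_EFinP; exact: measurable_funM.
  + move=> w _; rewrite -EFinD lee_fin.
    change ((stay N c N.+2 w)%:R * phi (X s w) <= pg w * phi (X s w) +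
      C * ((stay N c N.+2 w)%:R * (1 - pg w)))%R.
    have p0 : (0 <= phi (X s w))%R := phi0 _.
    have pC : (phi (X s w) <= C)%R := phiC _.
    rewrite /pg indicE; case: (stay _ _ _ _); case: (_ \in _) => /=;
      by rewrite !(mul0r, mul1r, mulr0, mulr1, subrr, subr0, addr0, add0r) ?lexx.
- by move=> w _; rewrite lee_fin mulr_ge0// phi0.
- by apply/measurable_EFinP; exact: measurable_funM.
- move=> w _; rewrite lee_fin; apply: mulr_ge0 => //.
  by have /andP[] := rest01 N w.
- by apply/measurable_EFinP; exact: measurable_funM.
Qed.

(** The strict gap [c < c'] serves to pass from a weak lower bound on the whole path to the strict
    inequalities of [stay] at the grid points. *)
Lemma level_ge (c' : R) : (c < c')%R ->
  \int[P]_w (\1_(path_ge c') w * phi (X s w))%:E + \int[P]_w (psi c (X s w))%:E <=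
  \int[P]_w (phi (X s w))%:E.
Proof.
move=> cc'.
apply: (@le_of_cvg0 _ _ _ (fun N => \int[P]_w (terrs N c w)%:E)).
  have -> : 0 = \int[P]_w (cst 0%R w)%:E by rewrite integral0_eq.
  apply: (@bounded_cvg _ _ _ P _ _ C) => // N w.
  by rewrite ger0_norm.
move=> N.
have := reflection_ge HW rho x s0 (ltn0Sn N) mG G0 L0 GL Gsupp c0 ca.
have mst : measurable_fun setT (fun w => (stay N c N.+2 w)%:R * phi (X s w))%R.
  by apply: measurable_funM => //; apply: (measurableT_comp mbool).
apply: le_trans; apply: leeD2r; apply: ge0_le_integral => //.
- by move=> w _; rewrite lee_fin mulr_ge0// phi0.
- apply/measurable_EFinP; apply: measurable_funM => //.
  by apply: measurable_indic; exact: measurable_path_ge.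
- exact/measurable_EFinP.
move=> w _; rewrite lee_fin.
change (\1_(path_ge c') w * phi (X s w) <= (stay N c N.+2 w)%:R * phi (X s w))%R.
rewrite ler_wpM2r// ?phi0// indicE.
case: (boolP (w \in _)) => // /[!inE] wc'.
suff -> : stay N c N.+2 w by [].
apply/stayP => k kN; apply: (lt_le_trans cc'); apply: wc'.
rewrite !mulr_ge0 ?invr_ge0// ?(ltW s0)//= -mulrA ler_piMr//; first exact: ltW.
by rewrite ler_pdivrMr ?ltr0n// mul1r ler_nat.
Qed.
End level.

Hypotheses (a0 : 0 < a) (x0 : 0 < x).
Local Open Scope ereal_scope.

(** The one-sided inequalities at positive levels meet when the level decreases to 0: the reflected
    test function depends continuously on the level, and the events [path_ge c] increase to
    [path_pos]. *)
Lemma reflection_principle :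
  \int[P]_w (\1_path_pos w * phi (X s w))%:E + \int[P]_w (psi 0%R (X s w))%:E =
  \int[P]_w (phi (X s w))%:E.
Proof.
have m0 : (0 < Num.min 1 (Num.min x a))%R by rewrite !lt_min ltr01 x0.
(* The shift by [m] puts every level below 1, below the starting point [x] and below the support of
   [G]. *)
have [m mP] : exists m : nat, (m.+1%:R^-1 < Num.min 1 (Num.min x a))%R.
  by have := @ltr_add_invr R 0 _ m0 => -[m]; rewrite add0r; exists m.
pose c_ (j : nat) : R := ((j + m).+1%:R^-1)%R.
have c_m j : (c_ j < Num.min 1 (Num.min x a))%R.
  by apply: le_lt_trans mP; rewrite lef_pV2 ?posrE// ler_nat ltnS leq_addl.
have cj0 j : (0 < c_ j)%R by rewrite invr_gt0.
have cj1 j : (c_ j <= 1)%R by apply: ltW; have := c_m j; rewrite !lt_min => /andP[].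
have cjx j : (c_ j < x)%R by have := c_m j; rewrite !lt_min => /and3P[].
have cja j : (c_ j < a)%R by have := c_m j; rewrite !lt_min => /and3P[].
have cS j : (c_ j.+1 < c_ j)%R by rewrite ltf_pV2 ?posrE// ltr_nat.
have c_cvg : (c_ j @[j --> \oo] --> (0 : R))%R.
  have -> : c_ = (fun n => harmonic (n + m)%N) by [].
  by rewrite cvg_shiftn; exact: cvg_harmonic.
have mphiX : measurable_fun setT (fun w => phi (X s w)).
  by apply: measurableT_comp => //; exact: measurable_tphi.
have phi0 z : (0 <= phi z)%R by exact: tphi_ge0.
have phiC z : (phi z <= C)%R by exact: (tphi_le rho G0 Gsupp (cj0 0%N) (cja 0%N)).
have A : \int[P]_w (\1_(path_ge (c_ j)) w * phi (X s w))%:E @[j --> \oo] -->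
    \int[P]_w (\1_path_pos w * phi (X s w))%:E.
  apply: (@bounded_cvg _ _ _ P _ _ C).
  - move=> j; apply: measurable_funM => //.
    by apply: measurable_indic; exact: measurable_path_ge.
  - move=> w; apply: cvgM; last exact: cvg_cst.
    rewrite !indicE; case: (boolP (w \in path_pos)) => [|wn].
      rewrite inE => -[j wj]; apply: cvg_near_cst; exists j => // i /= ji.
      rewrite indicE mem_set// => r rs; apply: le_trans (wj _ rs).
      by rewrite lef_pV2 ?posrE// ler_nat ltnS (leq_trans ji)// leq_addr.
    apply: cvg_near_cst; exists 0%N => // i _.
    rewrite indicE memNset// => wi; move: wn; rewrite notin_setE; apply.
    by exists (i + m)%N.
  - move=> j w; rewrite ger0_norm; last by apply: mulr_ge0 => //; exact: phi0.
    apply: (le_trans _ (phiC (X s w))); apply: ler_piMl; first exact: phi0.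
    by rewrite indicE; case: (_ \in _).
have B : \int[P]_w (psi (c_ j) (X s w))%:E @[j --> \oo] --> \int[P]_w (psi 0%R (X s w))%:E.
  apply: (@bounded_cvg _ _ _ P _ _ C).
  - by move=> j; apply: measurableT_comp => //; exact: measurable_tpsi.
  - move=> w; apply: cvgM; first exact: cvg_cst.
    apply/cvgrPdist_le => e e0.
    have Le : (0 < e / (2 * L + 1))%R by rewrite divr_gt0// ltr_wpDl// mulr_ge0.
    move/cvgrPdist_le : c_cvg => /(_ _ Le); apply: filterS => j.
    rewrite sub0r normrN gtr0_norm// => cjL.
    apply: (le_trans (GL _ _)).
    rewrite (_ : _ - _ = - (2 * c_ j))%R; last by ring.
    rewrite normrN gtr0_norm ?mulr_gt0// mulrA (mulrC L).
    apply: (@le_trans _ _ ((2 * L + 1) * (e / (2 * L + 1)))%R).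
      by apply: ler_pM => //; rewrite ?mulr_ge0// ?lerDl// ltW.
    by rewrite mulrC divfK// gt_eqF// ltr_wpDl// mulr_ge0.
  - move=> j w; rewrite ger0_norm; last exact: tpsi_ge0.
    exact: (tpsi_le rho G0 Gsupp (cj0 j) (cja j)).
have fin (f : T -> R) : (forall w, (0 <= f w <= C)%R) -> measurable_fun setT f ->
    \int[P]_w (f w)%:E \is a fin_num.
  move=> fC mf; rewrite ge0_fin_numE.
    exact: (le_lt_trans (integral_le_cst mf fC) (ltry _)).
  by apply: integral_ge0 => w _; rewrite lee_fin; have /andP[] := fC w.
have finB : \int[P]_w (psi 0%R (X s w))%:E \is a fin_num.
  apply: fin; last by apply: measurableT_comp => //; exact: measurable_tpsi.
  move=> w; rewrite (tpsi_ge0 rho 0 G0)/=.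
  rewrite /psi /tpsi mulr0 sub0r /C /tC.
  have [aXb|/Gsupp->] := boolP (a <= - X s w <= b)%R; last first.
    by rewrite mulr0 mulr_ge0 ?expR_ge0.
  rewrite mulrC ler_pM ?expR_ge0//.
  - by have /andP[] := G0 (- X s w).
  - by have /andP[] := G0 (- X s w).
  - rewrite ler_expR (le_trans (ler_norm _))// normrM ler_wpM2l//.
    case/andP: aXb => aX Xb; rewrite -normrN ger0_norm ?(le_trans (ltW a0))//.
    by rewrite (le_trans Xb)// (le_trans (ler_norm _))// lerDl.
(* [level_ge] compares the event at level [c_ j] with the reflection at the smaller level
   [c_ j.+1]. *)
have B' : \int[P]_w (psi (c_ j.+1) (X s w))%:E @[j --> \oo] -->
    \int[P]_w (psi 0%R (X s w))%:E.
  by rewrite -(cvg_shiftS (fun j => \int[P]_w (psi (c_ j) (X s w))%:E)) in B.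
apply/eqP; rewrite eq_le; apply/andP; split.
  apply: (cvge_le_cst (cvgeD (fin_num_adde_defl _ finB) A B')) => j.
  exact: level_ge.
apply: (cvge_ge_cst (cvgeD (fin_num_adde_defl _ finB) A B)) => j.
exact: level_le.
Qed.
End test_function.
End killed_law.

(** * The law of the killed Brownian motion *)

Section lipschitz.
Context {R : realType}.
Implicit Types f g : R -> R.

Definition lip (L : R) f := forall y z : R, `|f y - f z| <= L * `|y - z|.

Lemma lip_mul f g Kf Kg Lf Lg : 0 <= Lf -> 0 <= Lg -> lip Lf f -> lip Lg g ->
  (forall z, `|f z| <= Kf) -> (forall z, `|g z| <= Kg) ->
  lip (Kf * Lg + Kg * Lf) (fun z => f z * g z).
Proof.
move=> Lf0 Lg0 lf lg fK gK y z.
rewrite (_ : _ - _ = f y * (g y - g z) + g z * (f y - f z)); last by ring.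
rewrite (le_trans (ler_normD _ _))// mulrDl !normrM -!mulrA lerD//.
  by rewrite ler_pM.
by rewrite ler_pM.
Qed.

Definition clamp (a b u : R) : R := Num.max a (Num.min b u).

Lemma lip_clamp a b : a <= b -> lip 1 (clamp a b).
Proof.
move=> ab y z; rewrite mul1r /clamp.
rewrite ler_norml; have := ler_norm (y - z); have := ler_norm (- (y - z)); rewrite normrN.
set n := `|y - z|; move=> h1 h2.
have n0 : 0 <= n by exact: normr_ge0.
rewrite !maxEle !minEle.
case: (lerP b y) => hy; case: (lerP b z) => hz; rewrite ?ab;
  try (case: (lerP a y) => ay); try (case: (lerP a z) => az); apply/andP; split; lra.
Qed.

Lemma clamp_itv a b u : a <= b -> a <= clamp a b u <= b.
Proof.
by move=> ab; rewrite /clamp le_max lexx/= ge_max ab/= ge_min lexx.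
Qed.

(** The exponential is only locally Lipschitz; clamping its argument changes nothing in [test_fun],
    where [trap] vanishes outside the clamping range. *)
Lemma lip_expR k b : 0 <= b -> lip (expR (`|k| * b) * `|k|) (fun z => expR (k * clamp 0 b z)).
Proof.
move=> b0.
have key u v : u <= `|k| * b -> expR u - expR v <= expR (`|k| * b) * `|u - v|.
  move=> ub; have [uv|uv] := leP u v.
    apply: (@le_trans _ _ 0); first by rewrite subr_le0 ler_expR.
    by rewrite mulr_ge0 ?expR_ge0.
  have -> : `|u - v| = u - v by rewrite gtr0_norm// subr_gt0.
  apply: (@le_trans _ _ (expR u * (u - v))); last first.
    by rewrite ler_wpM2r ?ler_expR// subr_ge0 ltW.
  have -> : expR u - expR v = expR u * (1 - expR (v - u)).
    by rewrite mulrBr mulr1 -expRD; congr (_ - expR _); ring.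
  rewrite ler_wpM2l ?expR_ge0// lerBlDr.
  by have := expR_ge1Dx (v - u); lra.
have kc z : k * clamp 0 b z <= `|k| * b.
  have /andP[c0 cb] := clamp_itv z b0.
  apply: (le_trans (ler_norm _)); rewrite normrM ler_wpM2l// ger0_norm//.
move=> y z.
have E : `|k * clamp 0 b y - k * clamp 0 b z| <= `|k| * `|y - z|.
  by rewrite -mulrBr normrM ler_wpM2l//; have := lip_clamp b0 y z; rewrite mul1r.
rewrite -mulrA; apply: (@le_trans _ _ (expR (`|k| * b) * `|k * clamp 0 b y - k * clamp 0 b z|)).
  rewrite ler_norml key// andbT lerNl opprB.
  by rewrite distrC key.
by rewrite ler_wpM2l ?expR_ge0.
Qed.

Lemma lip_affine (p q b c : R) : b <= c -> lip `|p| (fun z => clamp b c (p * z + q)).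
Proof.
move=> bc y z; apply: (le_trans (lip_clamp bc _ _)).
by rewrite mul1r (_ : _ - _ = p * (y - z)) ?normrM//; ring.
Qed.

End lipschitz.

Section killed_kernel.
Context {R : realType} {d : measure_display} {T : measurableType d}.
Context {P : probability T R}.
Variable W : R -> {RV P >-> R}.
Hypothesis HW : is_brownian_motion W.
Variables (rho x s : R).
Hypotheses (s0 : 0 < s) (x0 : 0 < x).
Local Notation mu := (@lebesgue_measure R).

Let X r w : R := x + (W r w - rho * r).
Let pos := path_pos W rho x s.
Local Open Scope ereal_scope.

(** Once the drift is removed, both unrestricted expectations in the reflection principle are
    integrals of [G] against Gaussians centred at [x] and at [- x]. Their difference is integration
    against the two terms of [kp]. *)
Lemma test_law (G : R -> R) (a b K L : R) :
  measurable_fun setT G -> (forall z, (0 <= G z <= K)%R) -> (0 <= L)%R -> lip L G ->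
  (forall z, ~~ (a <= z <= b)%R -> G z = 0%R) -> (0 < a)%R ->
  \int[P]_w (\1_pos w * tphi rho G (X s w))%:E = Q rho s (EFin \o tphi rho G) x.
Proof.
move=> mG G0 L0 GL Gsupp a0.
have W0 w : W 0%R w = 0%R by case: HW.
have h := reflection_principle HW rho s0 mG G0 L0 GL Gsupp a0 x0.
pose E : R := (expR (rho * x) * expR (- (rho ^+ 2 * s / 2)))%R.
have E0 : (0 <= E)%R by rewrite mulr_ge0 ?expR_ge0.
have mGE : measurable_fun [set: R] (EFin \o G) by exact/measurable_EFinP.
have shift (y : R) : \int[P]_w (G (y + (W s w - W 0%R w)))%:E =
    \int[mu]_(z in `]0%R, +oo[) ((G z)%:E * (gauss s (z - y))%:E).
  have mF : measurable_fun [set: R] (fun u : R => (G (y + u)%R)%:E).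
    by apply: measurableT_comp => //; apply: measurableT_comp => //; exact: measurable_funD.
  rewrite (bm_law HW (lexx _) s0 mF); last first.
    by move=> z; rewrite lee_fin; have /andP[] := G0 (y + z)%R.
  rewrite subr0.
  pose F (z : R) := (G z)%:E * (gauss s (z - y))%:E.
  have mF' : measurable_fun [set: R] F.
    apply: emeasurable_funM => //; apply/measurable_EFinP; apply: measurable_gauss => //.
    exact: measurable_funB.
  have F0 (z : R) : 0 <= F z.
    by rewrite mule_ge0// lee_fin ?gauss_ge0//; have /andP[] := G0 z.
  transitivity (\int[mu]_z F z); last first.
    rewrite [RHS]integral_mkcond; apply: eq_integral => z _; rewrite patchE.
    case: ifPn => //; rewrite notin_setE/= in_itv/= andbT => /negP; rewrite -leNgt => z0.
    rewrite /F Gsupp ?mul0e//; apply/negP => /andP[az _].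
    by move: (lt_le_trans a0 az); rewrite ltNge z0.
  rewrite -(ge0_integral_shift y mF' F0); apply: eq_integral => z _.
  by rewrite /F addrK addrC.
have phiE : \int[P]_w (tphi rho G (X s w))%:E =
    E%:E * \int[mu]_(z in `]0%R, +oo[) ((G z)%:E * (gauss s (z - x))%:E).
  rewrite -shift; have := inner_tphi HW rho mG G0 x (lexx 0%R) (ltW s0).
  rewrite subr0 => <-; apply: eq_integral => w _.
  by rewrite W0 subr0.
have psiE : \int[P]_w (tpsi rho 0 G (X s w))%:E =
    E%:E * \int[mu]_(z in `]0%R, +oo[) ((G z)%:E * (gauss s (z - - x))%:E).
  have := inner_tpsi HW rho 0 mG G0 x (lexx 0%R) (ltW s0).
  rewrite subr0 mulr0 sub0r shift.
  move=> <-; apply: eq_integral => w _.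
  by rewrite W0 subr0.
have mGg (y : R) : measurable_fun [set: R] (fun z : R => (G z)%:E * (gauss s (z - y))%:E).
  apply: emeasurable_funM => //; apply/measurable_EFinP; apply: measurable_gauss => //.
  exact: measurable_funB.
have Gg0 (y z : R) : 0 <= (G z)%:E * (gauss s (z - y))%:E.
  by rewrite mule_ge0// lee_fin ?gauss_ge0//; have /andP[] := G0 z.
have mGgD (y : R) : measurable_fun (`]0%R, +oo[%classic : set R)
    (fun z : R => (G z)%:E * (gauss s (z - y))%:E).
  exact: (measurable_funTS (mGg y)).
have fshift (y : R) : \int[mu]_(z in `]0%R, +oo[) ((G z)%:E * (gauss s (z - y))%:E)
    \is a fin_num.
  rewrite ge0_fin_numE; last by apply: integral_ge0 => z _.
  rewrite -shift; apply: (le_lt_trans _ (ltry K)); apply: integral_le_cst => //.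
  by apply: measurableT_comp => //; apply: measurable_funD => //; exact: measurable_funB.
have fpsi : \int[P]_w (tpsi rho 0 G (X s w))%:E \is a fin_num.
  by rewrite psiE fin_numM.
have psiE' : \int[P]_w (tpsi rho 0 G (X s w))%:E =
    \int[mu]_(z in `]0%R, +oo[) (E%:E * ((G z)%:E * (gauss s (z - - x))%:E)).
  by rewrite psiE -ge0_integralZl//; exact: mGgD.
(* The identity is proved with the reflected term added on both sides; being finite, this term is
   cancelled afterwards. *)
have QphiE : Q rho s (EFin \o tphi rho G) x + \int[P]_w (tpsi rho 0 G (X s w))%:E =
    \int[P]_w (tphi rho G (X s w))%:E.
  pose D : set R := `]0%R, +oo[%classic.
  have mD : measurable D by exact: measurable_itv.
  pose f1 (z : R) := (kp rho s x z)%:E * (EFin \o tphi rho G) z.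
  pose f2 (z : R) := E%:E * ((G z)%:E * (gauss s (z - - x))%:E).
  pose f3 (z : R) := (G z)%:E * (gauss s (z - x))%:E.
  have m1 : measurable_fun D f1.
    apply: measurable_funTS; apply: measurable_kpM.
    by apply/measurable_EFinP; exact: measurable_tphi.
  have m2 : measurable_fun D f2.
    by apply: emeasurable_funM; [exact: measurable_cst|exact: mGgD].
  have p1 z : D z -> 0 <= f1 z.
    rewrite /D/= in_itv/= andbT => z0; apply: mule_ge0; rewrite lee_fin.
      by apply: kp_ge0; exact: ltW.
    exact: (tphi_ge0 rho G0).
  have p2 z : D z -> 0 <= f2 z.
    by move=> _; apply: mule_ge0; [rewrite lee_fin|exact: Gg0].
  have p3 z : D z -> 0 <= f3 z by move=> _; exact: Gg0.
  have E0' : 0 <= E%:E by rewrite lee_fin.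
  rewrite phiE psiE' -[LHS](ge0_integralD mu mD p1 m1 p2 m2).
  rewrite -[RHS](ge0_integralZl mu mD (mGgD x) p3 E0').
  apply: eq_integral => z _; rewrite /f1 /f2 /f3 /= -!EFinM -EFinD; congr EFin.
  have -> : gauss s (z - x) = gauss s (x - z) by rewrite -gaussN opprB.
  rewrite opprK (addrC z) /kp /tphi /E.
  have -> : expR (rho * (x - z) - rho ^+ 2 * s / 2) =
    (expR (rho * x) * expR (- (rho ^+ 2 * s / 2)) * expR (- (rho * z)))%R.
    by rewrite -!expRD; congr expR; ring.
  have e1 : (expR (- (rho * z)) * expR (rho * z) = 1)%R.
    by rewrite -expRD addNr expR0.
  transitivity (expR (rho * x) * expR (- (rho ^+ 2 * s / 2)) * (gauss s (x - z) - gauss s (x + z)) * G z *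
    (expR (- (rho * z)) * expR (rho * z)) + expR (rho * x) * expR (- (rho ^+ 2 * s / 2)) *
    (G z * gauss s (x + z)))%R; first by ring.
  by rewrite e1; ring.
have e : \int[P]_w (\1_pos w * tphi rho G (X s w))%:E + \int[P]_w (tpsi rho 0 G (X s w))%:E =
    Q rho s (EFin \o tphi rho G) x + \int[P]_w (tpsi rho 0 G (X s w))%:E.
  by rewrite QphiE; exact: h.
by rewrite -[LHS](@addeK _ _ _ fpsi) e addeK.
Qed.

Section ray.
Variable a : R.
Hypothesis a0 : (0 <= a)%R.

(* [trap] is a Lipschitz approximation, increasing in n, of the indicator of
   ]a, +oo[; [test_fun] removes the exponential factor of [tphi]. *)
Definition trap (n : nat) (z : R) : R :=
  (clamp 0 1 (n.+1%:R * z + (- (n.+1%:R * a) - 1)) *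
   clamp 0 1 (- n.+1%:R * z + n.+1%:R * n.+1%:R))%R.

Definition test_fun (n : nat) (z : R) : R :=
  (expR (- rho * clamp 0 n.+1%:R z) * trap n z)%R.

Lemma trap_itv n z : (0 <= trap n z <= 1)%R.
Proof.
have /andP[u0 u1] := clamp_itv (n.+1%:R * z + (- (n.+1%:R * a) - 1))%R (@ler01 R).
have /andP[v0 v1] := clamp_itv (- n.+1%:R * z + n.+1%:R * n.+1%:R)%R (@ler01 R).
by rewrite /trap mulr_ge0//= mulr_ile1.
Qed.

Lemma trap0 n z : ~~ (n.+1%:R^-1 <= z <= n.+1%:R)%R -> trap n z = 0%R.
Proof.
have N0 : (0 < n.+1%:R :> R)%R by rewrite ltr0n.
rewrite negb_and -!ltNge => /orP[zn|zn]; rewrite /trap /clamp.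
- rewrite [X in (X * _)%R]max_l ?mul0r// ge_min; apply/orP; right.
  have : (n.+1%:R * z < 1)%R by rewrite mulrC -ltr_pdivlMr// mul1r.
  have : (0 <= n.+1%:R * a)%R by rewrite mulr_ge0.
  lra.
- rewrite [X in (_ * X)%R]max_l ?mulr0// ge_min; apply/orP; right.
  by rewrite mulNr addrC subr_le0 ler_wpM2l// ltW.
Qed.

Lemma test_phi n z : tphi rho (test_fun n) z = trap n z.
Proof.
have [zn|/trap0 t0] := boolP (n.+1%:R^-1 <= z <= n.+1%:R)%R; last first.
  by rewrite /tphi /test_fun t0 !mulr0.
rewrite /tphi /test_fun mulrA -expRD /clamp.
case/andP: zn => z1 z2; rewrite min_r// max_r ?(le_trans _ z1) ?invr_ge0//.
by rewrite mulNr subrr expR0 mul1r.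
Qed.

Lemma trap_nd z : nondecreasing_seq (trap ^~ z).
Proof.
apply/nondecreasing_seqP => n; have [az|az] := leP z a.
  have t0 m : trap m z = 0%R.
    rewrite /trap /clamp [X in (X * _)%R]max_l ?mul0r// ge_min; apply/orP; right.
    have : (m.+1%:R * z <= m.+1%:R * a)%R by rewrite ler_wpM2l.
    lra.
  by rewrite !t0.
have mono (u v : R) : (u <= v)%R -> (clamp 0 1 u <= clamp 0 1 v)%R.
  by move=> uv; rewrite /clamp ge_max !le_max lexx/= le_min !ge_min lexx/= uv !orbT.
have c0 (u : R) : (0 <= clamp 0 1 u)%R by have /andP[] := clamp_itv u (@ler01 R).
rewrite /trap; apply: ler_pM => //.
- apply: mono; rewrite -[in leRHS]natr1; have : (0 < z - a)%R by rewrite subr_gt0.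
  by set m : R := n.+1%:R; lra.
(* Left of n + 1 the descending ramp grows with [n]; beyond n + 1 that ramp is 0 already. *)
- have [zm|zm] := leP z n.+1%:R.
    apply: mono; rewrite -[in leRHS]natr1; move: zm.
    have : (0 <= n.+1%:R :> R)%R by [].
    by set m : R := n.+1%:R; nra.
  rewrite [X in (X <= _)%R](_ : _ = 0%R)// /clamp max_l// ge_min; apply/orP; right.
  by rewrite mulNr addrC subr_le0 ler_wpM2l// ltW.
Qed.

Lemma trap_cvg z : (trap n z @[n --> \oo] --> (\1_`]a, +oo[ z : R))%R.
Proof.
rewrite indicE; case: (boolP (z \in _)); rewrite ?inE ?notin_setE/= in_itv/= andbT.
  move=> az; have za0 : (0 < z - a)%R by rewrite subr_gt0.
  have [n nP] : exists n, (2 / (z - a) + z + 1 < n%:R)%R.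
    by exists (Num.truncn (2 / (z - a) + z + 1)).+1; exact: truncnS_gt.
  have z0 : (0 < z)%R by exact: le_lt_trans az.
  have q0 : (0 < 2 / (z - a))%R by rewrite divr_gt0.
  apply: cvg_near_cst; exists n => // m /= nm.
  have mP : (2 / (z - a) + z + 1 < m.+1%:R)%R.
    by apply: (lt_le_trans nP); rewrite ler_nat leqW.
  have m1 : (1 <= m.+1%:R :> R)%R by rewrite ler1n.
  rewrite /trap /clamp !min_l ?max_r ?mulr1//.
  - by move: mP m1 z0 q0; set k : R := m.+1%:R; set q : R := (2 / _)%R; nra.
  - have : (2 <= m.+1%:R * (z - a))%R.
      by rewrite -ler_pdivrMr//; apply: ltW; apply: lt_trans mP; lra.
    lra.
move=> /negP; rewrite -leNgt => za; apply: cvg_near_cst; exists 0%N => // n _.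
rewrite /trap /clamp [X in (X * _)%R]max_l ?mul0r// ge_min; apply/orP; right.
have : (n.+1%:R * z <= n.+1%:R * a)%R by rewrite ler_wpM2l.
lra.
Qed.

Lemma measurable_clamp (p q : R) : measurable_fun [set: R] (fun z => clamp 0 1 (p * z + q))%R.
Proof.
apply: measurable_maxr => //; apply: measurable_minr => //.
by apply: measurable_funD => //; exact: measurable_funM.
Qed.

Lemma measurable_trap n : measurable_fun [set: R] (trap n).
Proof. by apply: measurable_funM; exact: measurable_clamp. Qed.

Lemma law_trap n : \int[P]_w (\1_pos w * trap n (X s w))%:E = Q rho s (EFin \o trap n) x.
Proof.
have te : tphi rho (test_fun n) = trap n by apply/funext => z; exact: test_phi.
have N0 : (0 < n.+1%:R :> R)%R by rewrite ltr0n.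
have Nge : (0 <= n.+1%:R :> R)%R by [].
have E0 z : (0 <= expR (- rho * clamp 0 n.+1%:R z) <= expR (`|- rho| * n.+1%:R))%R.
  rewrite expR_ge0 ler_expR/=; have /andP[c0 c1] := clamp_itv z Nge.
  apply: (le_trans (ler_norm _)); rewrite normrM ler_wpM2l// ger0_norm//.
have c1 (u : R) : (`|clamp 0 1 u| <= 1)%R.
  by have /andP[c0 c1] := clamp_itv u (@ler01 R); rewrite ger0_norm.
have nE z : (`|expR (- rho * clamp 0 n.+1%:R z)| <= expR (`|- rho| * n.+1%:R))%R.
  by rewrite ger0_norm ?expR_ge0//; have /andP[] := E0 z.
have nT z : (`|trap n z| <= 1)%R.
  by have /andP[t0 t1] := trap_itv n z; rewrite ger0_norm.
have lT := lip_mul (normr_ge0 _) (normr_ge0 _) (lip_affine n.+1%:R (- (n.+1%:R * a) - 1) (@ler01 R))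
  (lip_affine (- n.+1%:R) (n.+1%:R * n.+1%:R) (@ler01 R)) (fun z => c1 _) (fun z => c1 _).
have lE := lip_expR (- rho)%R Nge.
have LE0 : (0 <= expR (`|- rho| * n.+1%:R) * `|- rho|)%R by rewrite mulr_ge0 ?expR_ge0.
have LT0 : (0 <= 1 * `|- n.+1%:R| + 1 * `|n.+1%:R : R|)%R by rewrite addr_ge0 ?mulr_ge0.
have lG := lip_mul LE0 LT0 lE lT nE nT.
rewrite -te; apply: (test_law (a := n.+1%:R^-1%R) (b := n.+1%:R)
  (K := expR (`|- rho| * n.+1%:R)%R) _ _ _ lG).
- apply: measurable_funM; last exact: measurable_trap.
  apply: measurableT_comp => //; apply: measurable_funM => //.
  by apply: measurable_maxr => //; exact: measurable_minr.
- move=> z; rewrite mulr_ge0 ?expR_ge0//=; last by have /andP[] := trap_itv n z.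
  rewrite -[X in (_ <= X)%R]mulr1; apply: ler_pM; rewrite ?expR_ge0//.
  + by have /andP[] := trap_itv n z.
  + by have /andP[] := E0 z.
  + by have /andP[] := trap_itv n z.
- by rewrite addr_ge0// mulr_ge0 ?expR_ge0.
- by move=> z zn; rewrite -[LHS]/(test_fun n z) /test_fun trap0// mulr0.
- by rewrite invr_gt0.
Qed.

Lemma measurable_X : measurable_fun [set: T] (X s).
Proof.
by apply: measurable_funD => //; apply: measurable_funB => //; exact: measurable_funM.
Qed.

Lemma law_ray : \int[P]_w (\1_pos w * \1_(`]a, +oo[) (X s w))%:E =
  Q rho s (EFin \o \1_(`]a, +oo[)) x.
Proof.
have mX := measurable_X.
have mpos : measurable pos by exact: (measurable_path_pos HW rho x s0).
pose g n w := (\1_pos w * trap n (X s w))%:E.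
pose h n z := (kp rho s x z)%:E * (trap n z)%:E.
have mg n : measurable_fun [set: T] (g n).
  apply/measurable_EFinP; apply: measurable_funM; first exact: measurable_indic.
  by apply: measurableT_comp => //; exact: measurable_trap.
have g0 n w : setT w -> 0 <= g n w.
  by move=> _; rewrite lee_fin mulr_ge0//; have /andP[] := trap_itv n (X s w).
have gnd w : setT w -> nondecreasing_seq (g ^~ w).
  by move=> _ n m nm; rewrite lee_fin ler_wpM2l//; exact: trap_nd.
have mD : measurable (`]0%R, +oo[%classic : set R) by exact: measurable_itv.
have mh n : measurable_fun (`]0%R, +oo[%classic : set R) (h n).
  apply: measurable_funTS; apply: measurable_kpM.
  by apply/measurable_EFinP; exact: measurable_trap.
have h0 n z : (`]0%R, +oo[%classic : set R) z -> 0 <= h n z.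
  rewrite /= in_itv/= andbT => z0; apply: mule_ge0; rewrite lee_fin.
    by apply: kp_ge0; exact: ltW.
  by have /andP[] := trap_itv n z.
have hnd z : (`]0%R, +oo[%classic : set R) z -> nondecreasing_seq (h ^~ z).
  rewrite /= in_itv/= andbT => z0 n m nm; rewrite /h -!EFinM lee_fin ler_wpM2l//.
    by apply: kp_ge0; exact: ltW.
  exact: trap_nd.
have c1 := cvg_monotone_convergence (mu := P) measurableT mg g0 gnd.
have c2 := cvg_monotone_convergence (mu := mu) mD mh h0 hnd.
have ge : (fun n => \int[P]_w g n w) = (fun n => \int[mu]_(z in `]0%R, +oo[) h n z).
  by apply/funext => n; exact: law_trap.
transitivity (\int[P]_w (lim (g n w @[n --> \oo]))).
  apply: eq_integral => w _; apply/esym/cvg_lim => //.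
  apply: cvg_EFin; first by apply: nearW.
  by apply: cvgMr; exact: trap_cvg.
transitivity (\int[mu]_(z in `]0%R, +oo[) (lim (h n z @[n --> \oo]))); last first.
  apply: eq_integral => z _; apply/cvg_lim => //; rewrite /h.
  apply: cvgeZl => //; apply: cvg_EFin; first by apply: nearW.
  exact: trap_cvg.
apply: (cvg_unique _ c1); rewrite ?ge//.
Qed.

End ray.

(** The law of the end point on the event of no killing and the measure with density [kp] agree on
    rays by [law_ray]. Rays form a generating pi-system and the first measure is finite, so the two
    coincide. *)
Lemma killed_law (phi : R -> \bar R) : measurable_fun [set: R] phi ->
  (forall z, 0 <= phi z) ->
  \int[P]_w ((\1_pos w)%:E * phi (X s w)) = Q rho s phi x.
Proof.
move=> mphi phi0.
have mpos : measurable pos by exact: (measurable_path_pos HW rho x s0).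
have mX : measurable_fun [set: T] (X s : T -> measurableTypeR R) by exact: measurable_X.
have mXB B : measurable B -> measurable (X s @^-1` B).
  by move=> mB; rewrite -[X in measurable X]setTI; exact: mX.
pose nu1_ : {measure set (measurableTypeR R) -> \bar R} := pushforward (mrestr P mpos) (mfun_of mX).
pose nu1 := nu1_ mX.
pose D : set R := `]0%R, +oo[%classic.
have mD : measurable D by exact: measurable_itv.
pose g (z : R) : R := (\1_D z * kp rho s x z)%R.
have mg : measurable_fun [set: R] g.
  by apply: measurable_funM; [exact: measurable_indic|exact: measurable_kp].
have g0 z : (0 <= g z)%R.
  rewrite /g indicE; case: (boolP (z \in D)) => [|_]; last by rewrite mul0r.
  by rewrite inE /D/= in_itv/= andbT mul1r => z0; apply: kp_ge0; exact: ltW.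
have mgE : measurable_fun [set: R] (EFin \o g) by exact/measurable_EFinP.
have gE0 z : 0 <= (EFin \o g) z by rewrite lee_fin.
pose nu2f (A : set (measurableTypeR R)) : \bar R := \int[mu]_(z in A) (EFin \o g) z.
have nu20 : nu2f set0 = 0 by rewrite /nu2f integral_set0.
have nu2_ge0 A : 0 <= nu2f A by apply: integral_ge0.
have nu2s := semi_sigma_additive_nng_induced (mu := mu) mgE gE0.
pose nu2 : {measure set (measurableTypeR R) -> \bar R} :=
  HB.pack nu2f (isMeasure.Build _ (measurableTypeR R) R nu2f nu20 nu2_ge0 nu2s).
have nuray a : nu1 `]a, +oo[%classic = nu2 `]a, +oo[%classic.
  rewrite -[LHS]/(P (X s @^-1` `]a, +oo[%classic `&` pos)).
  rewrite -[RHS]/(\int[mu]_(z in `]a, +oo[) (g z)%:E).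
  (* Both measures live on the positive half-line, so a ray starting below 0 may be cut at 0. *)
  have aP : (0 <= Num.max 0 a)%R by rewrite le_max lexx.
  have := law_ray aP.
  have mS : measurable (X s @^-1` `]a, +oo[%classic `&` pos).
    by apply: measurableI => //; apply: mXB; exact: measurable_itv.
  rewrite (_ : \int[P]_w _ = P (X s @^-1` `]a, +oo[%classic `&` pos)); last first.
    rewrite -[X in _ = P X]setIT -integral_indic//; apply: eq_integral => w _; congr EFin.
    rewrite !indicE; have [wp|wp] := boolP (w \in pos); last first.
      by rewrite mul0r memNset// => -[_]; move: wp; rewrite notin_setE.
    rewrite mul1r; move: wp; rewrite inE => wp.
    have Xp : (0 < X s w)%R.
      have [j /(_ s)] := wp; rewrite lexx ltW// => /(_ isT).
      by apply: lt_le_trans; rewrite invr_gt0.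
    congr (nat_of_bool _ )%:R; apply/idP/idP; rewrite !inE/= !in_itv/= !andbT gt_max Xp//=.
    by move=> [].
  move=> ->; rewrite /Q [RHS]integral_mkcond [LHS]integral_mkcond.
  apply: eq_integral => z _; rewrite !patchE/= /g !indicE.
  rewrite !mem_setE/= !in_itv/= !andbT gt_max.
  case: (ltP 0%R z) => z0 /=; case: (ltP a z) => az/=;
    by rewrite ?mul0r ?mul1r ?mule1 ?mule0 ?mulr1.
have nuE (A : set (measurableTypeR R)) : measurable A -> nu1 A = nu2 A.
  move=> mA; refine (@measure_unique _ R (measurableTypeR R) (@RGenOInfty.G R)
    (fun n => `](- n%:R)%R, +oo[%classic) _ _ _ _ nu1 nu2 _ _ A mA).
  - exact: RGenOInfty.measurableE.
  - move=> _ _ [a ->] [b ->]; exists (Num.max a b).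
    apply/seteqP; split => z /=; rewrite !in_itv/= !andbT gt_max; first by case=> -> ->.
    by move=> /andP.
  - by move=> n; exists (- n%:R)%R.
  - apply/seteqP; split => // z _; exists (Num.truncn `|z|).+1 => //=.
    rewrite in_itv/= andbT ltrNl (le_lt_trans (ler_norm _))// normrN.
    exact: truncnS_gt.
  - by move=> _ [a ->]; exact: nuray.
  - move=> n; rewrite -[X in X < _]/(P (X s @^-1` `](- n%:R)%R, +oo[%classic `&` pos)).
    apply: (le_lt_trans _ (ltry 1)); apply: probability_le1; apply: measurableI => //.
    by apply: mXB; exact: measurable_itv.
have -> : \int[P]_w ((\1_pos w)%:E * phi (X s w)) = \int[nu1]_z phi z.
  rewrite /nu1 /nu1_ ge0_integral_pushforward//= preimage_setT.
  under eq_integral => w _ do rewrite muleC.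
  apply/esym; apply: (@integral_density R _ T P (mrestr P mpos) (\1_pos)) => //.
  - by move=> A mA; rewrite integral_indic// setIC.
  - exact: (measurableT_comp mphi mX).
rewrite (@integral_density R _ (measurableTypeR R) mu nu1 g mg g0)//.
rewrite /Q [RHS]integral_mkcond; apply: eq_integral => z _; rewrite patchE /g indicE.
by case: ifPn => _; [rewrite mul1r muleC|rewrite mul0r mule0].
Qed.

End killed_kernel.

(** * Subtrees of the initial particle *)

Section reindexing.
Context {R : realType} {d : measure_display} {T : measurableType d}.
Variable P : probability T R.

Lemma mutually_independent_reindex (I J : eqType) (F : I -> set_system T)
    (h : J -> I) (g : I -> J) : cancel h g ->
  mutually_independent P F -> mutually_independent P (F \o h).
Proof.
move=> hK indF K A uK FA.
have := indF (map h K) (A \o g); rewrite map_inj_uniq//; last exact: can_inj hK.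
move=> /(_ uK) H; rewrite big_map in H.
rewrite (_ : \bigcap_(i in _) _ = \bigcap_(i in [set` map h K]) (A \o g) i); last first.
  apply/seteqP; split => w /= Hw i /=.
    by move=> /mapP[j jK ->]; rewrite /= hK; exact: Hw.
  by move=> iK; have := Hw (h i); rewrite /= hK; apply; exact: map_f.
rewrite H.
  by apply: eq_bigr => j _; rewrite /= hK.
by move=> i /mapP[j jK ->]; rewrite /= hK; exact: FA.
Qed.

End reindexing.

Lemma half_le_of_le (R : realType) (a c : R) : 0 < c / 2 -> c <= a -> c / 2 <= a.
Proof. lra. Qed.

Lemma half_le_of_close (R : realType) (a b c : R) : c <= a -> a - b < c / 2 -> c / 2 <= b.
Proof. lra. Qed.

Lemma lt_of_half (R : realType) (s t l : R) : t < l -> s - t <= (l - t) / 2 -> s < l.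
Proof. lra. Qed.

Lemma lt_of_le_half (R : realType) (a b c h : R) :
  0 < h -> a - b <= h / 2 -> c <= a -> c - b < h.
Proof. lra. Qed.

Section subtree.
Context {R : realType} {d : measure_display} {T : measurableType d}.
Context {P : probability T R} {beta : R} {p : nat -> R}.

Definition source : Type := (seq nat + seq nat + seq nat)%type.

Definition map_source (h : label -> label) (j : source) : source :=
  match j with
  | inl (inl u) => inl (inl (h u))
  | inl (inr u) => inl (inr (h u))
  | inr u => inr (h u)
  end.

Definition source_label (j : source) : label :=
  match j with inl (inl u) => u | inl (inr u) => u | inr u => u end.

Definition source_sigma (Y : bbm P beta p) (j : source) : set_system T :=
  match j with
  | inl (inl u) => g_sigma_algebra_preimage (lifetime Y u)
  | inl (inr u) => g_sigma_algebra_preimage (offspring Y u)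
  | inr u => sigma_of_process (fun t => motion Y u t)
  end.

(** A label lists the particle's own index first and that of its first-generation ancestor last;
    hence the i-th subtree consists of the labels obtained by appending [i] at the end. This left
    inverse makes that relabelling injective. *)
Definition parent_rcons (u : label) : label := take (size u).-1 u.

Lemma rconsK i : cancel (fun u : label => rcons u i) parent_rcons.
Proof. by move=> u; rewrite /parent_rcons size_rcons/= -cats1 take_size_cat. Qed.

Section def.
Variables (Y : bbm P beta p) (i : nat).

Lemma sub_independent : mutually_independent P (fun j : source =>
  match j with
  | inl (inl u) => g_sigma_algebra_preimage (lifetime Y (rcons u i))
  | inl (inr u) => g_sigma_algebra_preimage (offspring Y (rcons u i))
  | inr u => sigma_of_process (fun t => motion Y (rcons u i) t)
  end).
Proof.
have ind : mutually_independent P (source_sigma Y) := @bbm_independent _ _ _ _ _ _ Y.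
rewrite (_ : (fun j => _) = source_sigma Y \o map_source (rcons^~ i)); last first.
  by apply/funext => -[[u|u]|u].
apply: (mutually_independent_reindex (g := map_source parent_rcons)) ind.
by move=> [[u|u]|u] /=; rewrite rconsK.
Qed.

(* The branching Brownian motion of the i-th child of the initial particle: its
   labels are the labels of [Y] that end in i. *)
Definition sub_bbm : bbm P beta p :=
  Bbm (fun u => lifetime_ge0 Y (rcons u i))
      (fun u A => @lifetime_law _ _ _ _ _ _ Y (rcons u i) A)
      (fun u k => offspring_law Y (rcons u i) k)
      (fun u => motion_law Y (rcons u i)) sub_independent.

End def.

Implicit Type Y : bbm P beta p.

Lemma birth_ge0 Y u w : 0 <= birth Y u w.
Proof. by elim: u => //= i v IH; rewrite addr_ge0 ?lifetime_ge0. Qed.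

Lemma in_tree_rcons Y v i w : in_tree Y (rcons v i) w <->
  (i < offspring Y [::] w)%N /\ in_tree (sub_bbm Y i) v w.
Proof. by elim: v => /= [|j v ->]; tauto. Qed.

Lemma birth_rcons Y v i w :
  birth Y (rcons v i) w = lifetime Y [::] w + birth (sub_bbm Y i) v w.
Proof.
by elim: v => /= [|j v ->]; [rewrite add0r addr0|rewrite addrA].
Qed.

Definition root_path Y rho x w (s : R) : R := x + (motion Y [::] s w - rho * s).

Lemma position_rcons Y rho x v i s w : position Y rho x (rcons v i) s w =
  if s < lifetime Y [::] w then root_path Y rho x w s
  else position (sub_bbm Y i) rho (root_path Y rho x w (lifetime Y [::] w)) v
         (s - lifetime Y [::] w) w.
Proof.
have bge v' : 0 <= birth (sub_bbm Y i) v' w by exact: birth_ge0.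
elim: v s => [|j v IH] s; first by rewrite /= add0r.
rewrite [LHS]/= birth_rcons -addrA.
have -> : birth (sub_bbm Y i) v w + lifetime Y (rcons v i) w = birth (sub_bbm Y i) (j :: v) w by [].
rewrite !IH; case: ifPn => sb.
  case: ifPn => // s0; rewrite [RHS]/=.
  rewrite ltrBlDl.
  have -> : birth (sub_bbm Y i) v w + lifetime (sub_bbm Y i) v w = birth (sub_bbm Y i) (j :: v) w by [].
  by rewrite sb.
have sl : (s < lifetime Y [::] w) = false.
  by apply/negbTE; rewrite -leNgt; move: sb; rewrite -leNgt; apply: le_trans; rewrite lerDl.
rewrite sl ifF; last by apply/negbTE; rewrite -leNgt lerDl.
rewrite [RHS]/= ltrBlDl.
have -> : birth (sub_bbm Y i) v w + lifetime (sub_bbm Y i) v w = birth (sub_bbm Y i) (j :: v) w by [].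
by rewrite (negbTE sb) -![in RHS](addrA s) -opprD (addrC (lifetime Y [::] w)) addrK.
Qed.

Lemma motion0 Y u w : motion Y u 0 w = 0.
Proof. by case: (motion_law Y u). Qed.

Lemma position0 Y rho x u w : position Y rho x u 0 w = x.
Proof.
elim: u => [|i v IH] /=; first by rewrite motion0 mulr0 subr0 addr0.
case: ifPn => // b0; have -> : birth Y v w + lifetime Y v w = 0.
  apply/eqP; rewrite eq_le leNgt b0/=; exact: (birth_ge0 Y (i :: v)).
by rewrite IH subrr motion0 mulr0 subrr addr0.
Qed.

Lemma alive_nil Y t w : alive Y t w [::] <-> 0 <= t < lifetime Y [::] w.
Proof. by rewrite /alive /death /= add0r; split => [[]|]. Qed.

Lemma alive_rcons Y v i t w : alive Y t w (rcons v i) <->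
  [/\ (i < offspring Y [::] w)%N, lifetime Y [::] w <= t
    & alive (sub_bbm Y i) (t - lifetime Y [::] w) w v].
Proof.
rewrite /alive /= in_tree_rcons /death birth_rcons.
have -> : lifetime Y (rcons v i) w = lifetime (sub_bbm Y i) v w by [].
rewrite -addrA lerBrDl ltrBlDl; have := birth_ge0 (sub_bbm Y i) v w.
set b := birth _ _ _; set l := lifetime Y _ _ => b0.
split; first by move=> [[-> ?] /andP[h ->]]; rewrite h; split => //; lra.
by move=> [-> _ [? ->]].
Qed.

Lemma alive_ge0 Y t w u : alive Y t w u -> 0 <= t.
Proof. by move=> [_ /andP[+ _]]; apply: le_trans; exact: birth_ge0. Qed.

Lemma killed_alive_nil Y rho x t w : killed_alive Y rho x t w [::] <->
  0 <= t < lifetime Y [::] w /\ posev (root_path Y rho x w) t.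
Proof.
rewrite /killed_alive /= alive_nil; split => -[/andP[t0 tl] h]; (split; first by rewrite t0);
  move: h; rewrite inf_gt0P//.
Qed.

(** The branching property, path by path: avoiding the origin splits at the death of the root into a
    condition on the root and one on the subtree. A common margin for the two is the smaller of
    theirs, hence [maxn j1 j2]. *)
Lemma killed_alive_rcons Y rho x v i t w : killed_alive Y rho x t w (rcons v i) <->
  [/\ (i < offspring Y [::] w)%N, lifetime Y [::] w <= t,
      posev (root_path Y rho x w) (lifetime Y [::] w)
    & killed_alive (sub_bbm Y i) rho (root_path Y rho x w (lifetime Y [::] w))
        (t - lifetime Y [::] w) w v].
Proof.
rewrite /killed_alive /= alive_rcons.
have l0 := lifetime_ge0 Y [::] w; set l := lifetime Y [::] w in l0 *.
split.
  move=> [[io lt al] h]; have t0 : 0 <= t by exact: le_trans lt.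
  move: h; rewrite inf_gt0P// => -[j hj].
  split => //.
    exists j => r /andP[r0 rl].
    have [rl'|rl'] := ltP r l.
      by have := hj r; rewrite r0 (le_trans rl)// position_rcons -/l rl'; apply.
    have -> : r = l by apply/eqP; rewrite eq_le rl rl'.
    have := hj l; rewrite l0 lt position_rcons -/l ltxx subrr => /(_ isT).
    by rewrite position0.
  split => //; rewrite inf_gt0P ?subr_ge0//; exists j => r /andP[r0 rt].
  have := hj (r + l); rewrite addr_ge0//= -lerBrDr rt => /(_ isT).
  by rewrite position_rcons -/l ltNge lerDr r0/= addrK.
move=> [io lt [j1 h1] [al h2]]; split => //.
have t0 : 0 <= t by exact: le_trans lt.
move: h2; rewrite inf_gt0P ?subr_ge0// inf_gt0P// => -[j2 h2].
exists (maxn j1 j2) => r /andP[r0 rt]; rewrite position_rcons -/l; case: ltP => rl.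
  apply: le_trans (h1 r _); last by rewrite r0 ltW.
  by rewrite lef_pV2 ?posrE// ler_nat ltnS leq_maxl.
apply: le_trans (h2 (r - l) _); last by rewrite subr_ge0 rl lerB.
by rewrite lef_pV2 ?posrE// ler_nat ltnS leq_maxr.
Qed.

Lemma cts_root_path Y rho x w : cts_path (root_path Y rho x w).
Proof. exact: (cts_bm_drift (motion_law Y [::])). Qed.

(** A population once empty therefore stays empty, so that the extinction time, an infimum, decides
    whether there are particles at a given time. *)
Lemma killed_alive_anc Y rho x t s w u : 0 <= s <= t ->
  killed_alive Y rho x t w u -> exists v, killed_alive Y rho x s w v.
Proof.
elim/last_ind: u Y x t s => [|u i IH] Y x t s /andP[s0 st].
  rewrite killed_alive_nil => -[/andP[_ tl] [j hj]]; exists [::].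
  rewrite killed_alive_nil s0 (le_lt_trans st tl); split => //; exists j => r /andP[r0 rs].
  by apply: hj; rewrite r0 (le_trans rs).
rewrite killed_alive_rcons => -[io lt [j hj] h].
have [sl|sl] := ltP s (lifetime Y [::] w).
  exists [::]; rewrite killed_alive_nil s0 sl; split => //; exists j => r /andP[r0 rs].
  by apply: hj; rewrite r0 ltW// (le_lt_trans rs).
have [|v hv] := IH _ _ _ (s - lifetime Y [::] w) _ h; first by rewrite subr_ge0 sl lerB.
by exists (rcons v i); rewrite killed_alive_rcons; split => //; exists j.
Qed.

Lemma alive_anc Y t s w u : 0 <= s <= t ->
  alive Y t w u -> exists v, alive Y s w v.
Proof.
elim/last_ind: u Y t s => [|u i IH] Y t s /andP[s0 st].
  by rewrite alive_nil => /andP[_ tl]; exists [::]; rewrite alive_nil s0 (le_lt_trans st tl).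
rewrite alive_rcons => -[io lt h].
have [sl|sl] := ltP s (lifetime Y [::] w).
  by exists [::]; rewrite alive_nil s0 sl.
have [|v hv] := IH _ _ (s - lifetime Y [::] w) _ h; first by rewrite subr_ge0 sl lerB.
by exists (rcons v i); rewrite alive_rcons.
Qed.

(** Right-continuity, needed for a strict inequality with the infimum in [killed_zeta_gt]: for a
    short time the particle neither dies nor loses more than half of its margin. *)
Lemma killed_alive_right Y rho x t w u : killed_alive Y rho x t w u ->
  exists2 e : R, 0 < e & forall s : R, t <= s <= t + e -> killed_alive Y rho x s w u.
Proof.
elim/last_ind: u Y x t => [|u i IH] Y x t.
  rewrite killed_alive_nil => -[/andP[t0 tl] [j hj]].
  have j0 : 0 < j.+1%:R^-1 / 2 :> R by rewrite divr_gt0 ?invr_gt0.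
  have [h h0 hP] := cts_root_path Y rho x w t0 j0.
  exists (Num.min (h / 2) ((lifetime Y [::] w - t) / 2)).
    by rewrite lt_min !divr_gt0// subr_gt0.
  move=> s /andP[ts]; rewrite -lerBlDl le_min => /andP[sh sl].
  rewrite killed_alive_nil (le_trans t0 ts)/=; split.
    exact: lt_of_half tl sl.
  exists (j.+1 * 2)%N => r /andP[r0 rs].
  have jj : (j.+1 * 2).+1%:R^-1 <= j.+1%:R^-1 / 2 :> R.
    by rewrite -invfM lef_pV2 ?posrE ?mulr_gt0// -natrM ler_nat leqnSn.
  apply: (le_trans jj); have [rt|rt] := leP r t.
    by have := hj r; rewrite r0 rt => /(_ isT); exact: half_le_of_le.
  have := hP r r0; have := hj t; rewrite t0 lexx => /(_ isT) H1 H2.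
  have /H2 : `|t - r| < h.
    by rewrite distrC ger0_norm ?subr_ge0 ?(ltW rt)//; exact: lt_of_le_half sh rs.
  by rewrite ltr_norml => /andP[_]; exact: half_le_of_close.
rewrite killed_alive_rcons => -[io lt h1 h2].
have [e e0 he] := IH _ _ _ h2; exists e => // s /andP[ts se].
rewrite killed_alive_rcons; split => //; first exact: le_trans ts.
by apply: he; rewrite lerB//=; move: se; set l := lifetime _ _ _; lra.
Qed.

Lemma alive_right Y t w u : alive Y t w u ->
  exists2 e : R, 0 < e & forall s : R, t <= s <= t + e -> alive Y s w u.
Proof.
move=> [iu /andP[bt td]]; exists ((death Y u w - t) / 2); first by rewrite divr_gt0// subr_gt0.
move=> s /andP[ts st]; split => //; rewrite (le_trans bt ts)/=.
by move: td st; set dd := death _ _ _; lra.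
Qed.

Lemma position_shift Y rho x c u s w :
  position Y rho (c + x) u s w = c + position Y rho x u s w.
Proof.
elim: u s => [|i v IH] s /=; first by rewrite -addrA.
by case: ifPn => _; rewrite IH// -addrA.
Qed.

Lemma killed_alive_mono Y rho x y t w u : x <= y ->
  killed_alive Y rho x t w u -> killed_alive Y rho y t w u.
Proof.
move=> xy [au h]; split => //; move: h; rewrite !inf_gt0P ?(alive_ge0 au)// => -[j hj].
exists j => r /hj; rewrite -[y](subrK x) position_shift => /le_trans; apply.
by rewrite lerDr subr_ge0.
Qed.

(** By uniform continuity each time step of length [h / 2] lowers the path by less than 1. *)
Lemma cts_path_lb (f : R -> R) t : cts_path f ->
  exists c, forall r, 0 <= r <= t -> c <= f r.
Proof.
move=> cf; have [h h0 hP] := heine t cf ltr01.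
have key n r : 0 <= r <= t -> r <= n%:R * (h / 2) -> f 0 - n%:R <= f r.
  elim: n r => [|n IH] r /andP[r0 rt].
    by rewrite mul0r => r0'; rewrite (_ : r = 0) ?subr0//; apply/eqP; rewrite eq_le r0' r0.
  move=> rn; pose r' := Num.max 0 (r - h / 2).
  have rr' : r' <= r by rewrite /r' ge_max r0/= gerBl divr_ge0// ltW.
  have r'0 : 0 <= r' by rewrite /r' le_max lexx.
  have := IH r'; rewrite r'0 (le_trans rr' rt) => /(_ isT); have -> : r' <= n%:R * (h / 2).
    by rewrite /r' ge_max mulr_ge0 ?divr_ge0 ?(ltW h0)//=; move: rn; rewrite -natr1 mulrDl mul1r; lra.
  move=> /(_ isT) H; have := hP r r'; rewrite r0 rt => /(_ isT r'0).
  have rh : `|r - r'| < h.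
    rewrite ger0_norm ?subr_ge0//; have : r - h / 2 <= r' by rewrite /r' le_max lexx orbT.
    by move: h0; lra.
  by move=> /(_ rh); rewrite ltr_norml -natr1 => /andP[]; move: H; lra.
exists (f 0 - (Num.truncn (t / (h / 2))).+1%:R) => r rt; apply: key => //.
have h20 : 0 < h / 2 by rewrite divr_gt0.
case/andP: rt => _ rt; apply: (le_trans rt); rewrite -ler_pdivrMr//.
exact/ltW/truncnS_gt.
Qed.

(** The finitely many ancestral paths are bounded below, so a high enough start lifts them all above
    0. This links [survival_prob] to the killed process as the starting point tends to infinity. *)
Lemma alive_killed Y rho t w u : alive Y t w u ->
  exists y, forall x, y <= x -> killed_alive Y rho x t w u.
Proof.
have posc v x c s' : 1 <= x + c -> (forall r, 0 <= r <= s' -> c <= root_path v rho 0 w r) ->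
    posev (root_path v rho x w) s'.
  move=> xc H; exists 0%N => r /H; rewrite invr1 /root_path add0r => h.
  by apply: (le_trans xc); rewrite lerD2l.
elim/last_ind: u Y t => [|u i IH] Y t.
  rewrite alive_nil => t0l; have [c hc] := cts_path_lb t (cts_root_path Y rho 0 w).
  exists (1 - c) => x xc; rewrite killed_alive_nil; split => //.
  by apply: (posc _ _ c) => //; rewrite -lerBlDr.
rewrite alive_rcons => -[io lt al].
have [y hy] := IH _ _ al; set l := lifetime Y [::] w.
have [c hc] := cts_path_lb l (cts_root_path Y rho 0 w).
exists (Num.max (1 - c) (y - root_path Y rho 0 w l)) => x.
rewrite ge_max => /andP[xc xy].
rewrite killed_alive_rcons; split => //.
  by apply: (posc _ _ c) => //; rewrite -lerBlDr.
by apply: hy; move: xy; rewrite lerBlDr /root_path add0r.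
Qed.

Lemma position_gt0 Y rho x t w u : killed_alive Y rho x t w u -> 0 < position Y rho x u t w.
Proof.
move=> [al h]; have t0 := alive_ge0 al; move: h; rewrite inf_gt0P// => -[j /(_ t)].
by rewrite t0 lexx => /(_ isT); apply: lt_le_trans; rewrite invr_gt0.
Qed.

Lemma killed_bbm_ray Y rho x t w :
  killed_bbm Y rho x t w `]0%R, +oo[ =
  (\esum_(u in [set: label]) (\1_[set w | killed_alive Y rho x t w u] w)%:E)%E.
Proof.
rewrite /killed_bbm esum_mkcond; apply: eq_esum => u _.
rewrite [in RHS]indicE; case: ifPn.
  rewrite inE => h; rewrite mem_set// diracE mem_set//=.
  by rewrite in_itv/= andbT; exact: position_gt0 h.
by rewrite notin_setE => h; rewrite memNset.
Qed.

Lemma killed_bbm_eq0 Y rho x t w :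
  killed_bbm Y rho x t w `]0%R, +oo[ = 0%E <-> forall u, ~ killed_alive Y rho x t w u.
Proof.
rewrite killed_bbm_ray; split => [E u h|h].
  suff : (1 <= 0 :> \bar R)%E by rewrite lee_fin ler10.
  rewrite -E; apply: esum_ge; exists [set u].
    by split => //; exact: finite_set1.
  rewrite fsbig_set1 indicE mem_set//.
by apply: esum1 => u _; rewrite indicE memNset//; exact: h.
Qed.

Lemma ereal_inf_gtP (A : set R) (t : R) :
  (forall s, A s -> t < s) -> (~ A t -> exists2 e, 0 < e & forall s, t < s <= t + e -> ~ A s) ->
  (t%:E < ereal_inf [set s%:E | s in A])%E.
Proof.
move=> At AC; have nA : ~ A t by move=> /At; rewrite ltxx.
have [e e0 he] := AC nA; apply: (@lt_le_trans _ _ (t + e)%:E); first by rewrite lte_fin ltrDl.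
apply: le_ereal_inf_tmp => _ [s As <-]; rewrite lee_fin leNgt; apply/negP => se.
by apply: (he s) => //; rewrite At//= ltW.
Qed.

Lemma killed_zeta_gt Y rho x t w : 0 <= t ->
  (t%:E < killed_zeta Y rho x w)%E <-> exists u, killed_alive Y rho x t w u.
Proof.
move=> t0; split => [tz|[u hu]].
  apply: contrapT => /forallNP h; move: tz; rewrite ltNge => /negP; apply.
  by apply: ereal_inf_lbound; exists t => //; split => //; apply/killed_bbm_eq0.
have E s : 0 <= s <= t -> ~ forall v, ~ killed_alive Y rho x s w v.
  by move=> st; have [v hv] := killed_alive_anc st hu; move=> /(_ v).
apply: ereal_inf_gtP => [s [s0 /killed_bbm_eq0 h]|_].
  by rewrite ltNge; apply/negP => st; apply: (E s) => //; rewrite s0.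
have [e e0 he] := killed_alive_right hu; exists e => // s /andP[ts se] [_ /killed_bbm_eq0 h].
by apply: (h u); apply: he; rewrite ltW.
Qed.

(** Unlike [killed_zeta], the infimum runs over positive times only, so time 0 is treated apart: a
    population empty at 0 is empty at all positive times, and these accumulate at 0. *)
Lemma zeta_gt Y t w : 0 <= t ->
  (t%:E < zeta Y w)%E <-> exists u, alive Y t w u.
Proof.
move=> t0; split => [tz|[u hu]].
  have [t0'|] := ltP 0 t.
    apply: contrapT => /forallNP h; move: tz; rewrite ltNge => /negP; apply.
    apply: ereal_inf_lbound; exists t => //; split => //.
    by apply/seteqP; split => // u /h.
  move=> t0'; have -> : t = 0 by apply/eqP; rewrite eq_le t0 t0'.
  apply: contrapT => /forallNP h.
  have h' s : 0 < s -> alive Y s w = set0.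
    move=> s0; apply/seteqP; split => // v hv.
    have [|v' hv'] := @alive_anc Y s 0 w v _ hv; first by rewrite lexx ltW.
    by case: (h v').
  move: tz; have -> : t = 0 by apply/eqP; rewrite eq_le t0 t0'.
  rewrite ltNge => /negP; apply; apply/lee_addgt0Pr => e e0; rewrite add0e.
  by apply: ereal_inf_lbound; exists e => //; split => //; exact: h'.
have E s : 0 <= s <= t -> alive Y s w <> set0.
  by move=> st; have [v hv] := alive_anc st hu => /seteqP[/(_ v hv)].
apply: ereal_inf_gtP => [s [s0 h]|_].
  by rewrite ltNge; apply/negP => st; apply: (E s) => //; rewrite ltW.
have [e e0 he] := alive_right hu; exists e => // s /andP[ts se] [_ /seteqP[/(_ u) h _]].
by apply: h; apply: he; rewrite ltW.
Qed.

End subtree.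

(** * Joint measurability *)

Section joint_measurability.
Context {R : realType} {d d' : measure_display}.
Context {T : measurableType d} {S : measurableType d'}.

Lemma measurable_set_ltr (f g : S -> R) : measurable_fun setT f -> measurable_fun setT g ->
  measurable [set z | f z < g z].
Proof.
move=> mf mg; have := measurable_fun_ltr mf mg => /(_ measurableT [set true] I).
by rewrite setTI; congr measurable; apply/seteqP; split => z.
Qed.

Lemma measurable_set_ler (f g : S -> R) : measurable_fun setT f -> measurable_fun setT g ->
  measurable [set z | f z <= g z].
Proof.
move=> mf mg; have := measurable_fun_ler mf mg => /(_ measurableT [set true] I).
by rewrite setTI; congr measurable; apply/seteqP; split => z.
Qed.

(** The random time is rounded down to a multiple of 1 / (n + 1), which leaves countably many cases,
    and path continuity gives the limit. *)
Lemma measurable_process (W : R -> S -> R) (f : S -> R) :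
  (forall r, 0 <= r -> measurable_fun setT (W r)) ->
  (forall z, cts_path (W ^~ z)) ->
  measurable_fun setT f -> (forall z, 0 <= f z) ->
  measurable_fun setT (fun z => W (f z) z).
Proof.
move=> mW cW mf f0.
pose k n z := Num.truncn (f z * n.+1%:R).
apply: (@measurable_fun_cvg _ _ _ _ (fun n z => W ((k n z)%:R / n.+1%:R) z)).
  move=> n _ B mB; rewrite setTI.
  rewrite (_ : _ @^-1` B = \bigcup_j ([set z | j%:R <= f z * n.+1%:R < j.+1%:R] `&`
      (W (j%:R / n.+1%:R) @^-1` B))); last first.
    apply/seteqP; split => z /=.
      by move=> Bz; exists (k n z) => //; split => //; apply: truncn_itv; rewrite mulr_ge0.
    by move=> [j _ [/= /truncn_def <-]].
  apply: bigcup_measurable => j _; apply: measurableI; last first.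
    by rewrite -[X in measurable X]setTI; apply: mW => //; rewrite divr_ge0.
  have mg : measurable_fun setT (fun z => f z * n.+1%:R) by exact: measurable_funM.
  rewrite (_ : [set z | _] = (fun z => f z * n.+1%:R) @^-1` `[j%:R, j.+1%:R[); last first.
    by apply/seteqP; split => z /=; rewrite in_itv.
  by rewrite -[X in measurable X]setTI; apply: mg.
move=> z _; apply/cvgrPdist_lt => e e0.
have [h h0 hP] := cW z (f z) e (f0 z) e0.
exists (Num.truncn h^-1).+1 => // n /= hn; apply: hP; first by rewrite divr_ge0.
have N0 : 0 < n.+1%:R :> R by rewrite ltr0n.
have /andP[k1 k2] : (k n z)%:R <= f z * n.+1%:R < (k n z).+1%:R.
  by apply: truncn_itv; rewrite mulr_ge0.
rewrite ger0_norm ?subr_ge0 ?ler_pdivrMr//.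
rewrite -(ltr_pM2r N0) mulrBl divfK ?gt_eqF//.
apply: (@lt_le_trans _ _ 1); first by rewrite ltrBlDl natr1.
rewrite -ler_pdivrMl// mulr1; apply: ltW; apply: (lt_le_trans (truncnS_gt _)).
by rewrite ler_nat ltnW.
Qed.

Lemma measurable_posev (W : R -> S -> R) rho (x s : S -> R) :
  (forall r, 0 <= r -> measurable_fun setT (W r)) ->
  (forall y z, cts_path (fun r => y + (W r z - rho * r))) ->
  (forall z, cts_path (W ^~ z)) ->
  measurable_fun setT x -> measurable_fun setT s -> (forall z, 0 <= s z) ->
  measurable [set z | posev (fun r => x z + (W r z - rho * r)) (s z)].
Proof.
move=> mW cD cW mx ms s0.
rewrite (_ : [set z | _] = \bigcup_j \bigcap_N \bigcap_(k in [set k | (k <= N.+1)%N])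
   [set z | j.+1%:R^-1 <= x z + (W (s z * k%:R / N.+1%:R) z - rho * (s z * k%:R / N.+1%:R))]); last first.
  apply/seteqP; split => z /=.
    by move=> /(posev_gridP (s0 z) (cD (x z) z))[j hj]; exists j => // N _ k /= kN; exact: hj.
  move=> [j _ hj]; apply/(posev_gridP (s0 z) (cD (x z) z)).
  by exists j => N k kN; exact: (hj N I k kN).
apply: bigcup_measurable => j _; apply: bigcapT_measurable => N.
apply: bigcap_measurableType => k _.
have mr : measurable_fun setT (fun z => s z * k%:R / N.+1%:R).
  by apply: measurable_funM => //; exact: measurable_funM.
have r0 z : 0 <= s z * k%:R / N.+1%:R by rewrite !mulr_ge0 ?invr_ge0.
have mY := measurable_process mW cW mr r0.
apply: measurable_set_ler => //.
by apply: measurable_funD => //; apply: measurable_funB => //; exact: measurable_funM.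
Qed.

Section adapted.
Context {P : probability T R} {beta : R} {p : nat -> R}.
Implicit Type Y : bbm P beta p.

(* The variables driving [Y] are measurable for the sigma-algebra of [S], to
   which the outcomes are mapped back by [g]. *)
Definition adapted Y (g : S -> T) := forall u,
  [/\ measurable_fun setT (lifetime Y u \o g), measurable_fun setT (offspring Y u \o g)
    & forall r, 0 <= r -> measurable_fun setT (motion Y u r \o g)].

Lemma adapted_sub Y g i : adapted Y g -> adapted (sub_bbm Y i) g.
Proof. by move=> aY u; exact: (aY (rcons u i)). Qed.

Lemma cts_motion Y u w : cts_path (fun r => motion Y u r w).
Proof. exact: bm_cts (motion_law Y u) w. Qed.

Lemma measurable_root_pos Y g rho (x s : S -> R) : (forall r, 0 <= r -> measurable_fun setT (motion Y [::] r \o g)) ->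
  measurable_fun setT x -> measurable_fun setT s -> (forall z, 0 <= s z) ->
  measurable [set z | posev (root_path Y rho (x z) (g z)) (s z)].
Proof.
move=> mW mx ms s0.
apply: (measurable_posev (W := fun r z => motion Y [::] r (g z))) => //.
- by move=> y z; exact: (cts_root_path Y rho y (g z)).
- by move=> z; exact: cts_motion.
Qed.

Lemma measurable_root_path Y g rho (x s : S -> R) : (forall r, 0 <= r -> measurable_fun setT (motion Y [::] r \o g)) ->
  measurable_fun setT x -> measurable_fun setT s -> (forall z, 0 <= s z) ->
  measurable_fun setT (fun z => root_path Y rho (x z) (g z) (s z)).
Proof.
move=> mW mx ms s0.
apply: measurable_funD => //; apply: measurable_funB; last exact: measurable_funM.
apply: (measurable_process (W := fun r z => motion Y [::] r (g z))) => // z.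
exact: cts_motion.
Qed.

Lemma measurable_killed_alive Y g rho (t x : S -> R) u : adapted Y g ->
  measurable_fun setT t -> measurable_fun setT x ->
  measurable [set z | killed_alive Y rho (x z) (t z) (g z) u].
Proof.
elim/last_ind: u Y t x => [|u i IH] Y t x aY mt mx; have [ml mo mW] := aY [::].
  pose t' z := Num.max 0 (t z).
  have mt' : measurable_fun setT t' by exact: measurable_maxr.
  have t'0 z : 0 <= t' z by rewrite /t' le_max lexx.
  rewrite (_ : [set z | _] = [set z | 0 <= t z] `&` [set z | t z < (lifetime Y [::] \o g) z] `&`
      [set z | posev (root_path Y rho (x z) (g z)) (t' z)]); last first.
    apply/seteqP; split => z /=.
      by rewrite killed_alive_nil => -[/andP[t0 tl] h]; rewrite /t' max_r.
    by rewrite killed_alive_nil /t' => -[[t0 tl]]; rewrite max_r// t0.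
  apply: measurableI; last exact: (measurable_root_pos _ mW).
  apply: measurableI; first by exact: measurable_set_ler.
  by exact: measurable_set_ltr.
pose l z := (lifetime Y [::] \o g) z.
have l0 z : 0 <= l z by exact: lifetime_ge0.
pose y z := root_path Y rho (x z) (g z) (l z).
rewrite (_ : [set z | _] = (offspring Y [::] \o g) @^-1` [set k | (i < k)%N] `&` [set z | l z <= t z] `&`
    [set z | posev (root_path Y rho (x z) (g z)) (l z)] `&`
    [set z | killed_alive (sub_bbm Y i) rho (y z) (t z - l z) (g z) u]); last first.
  apply/seteqP; split => z /=.
    by rewrite killed_alive_rcons => -[].
  by rewrite killed_alive_rcons => -[[[? ?] ?] ?].
apply: measurableI; last first.
  apply: IH; [exact: adapted_sub|exact: measurable_funB|exact: (measurable_root_path _ mW)].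
apply: measurableI; last exact: (measurable_root_pos _ mW).
apply: measurableI; last by exact: measurable_set_ler.
by rewrite -[X in measurable X]setTI; exact: mo.
Qed.

Definition some_killed_alive Y rho (A : set label) x t : set T :=
  [set w | exists2 u, A u & killed_alive Y rho x t w u].

Lemma measurable_some_killed_alive Y g rho A (t x : S -> R) : adapted Y g ->
  measurable_fun setT t -> measurable_fun setT x ->
  measurable [set z | some_killed_alive Y rho A (x z) (t z) (g z)].
Proof.
move=> aY mt mx.
have [enc [dec decK]] : exists (enc : label -> nat) (dec : nat -> option label), pcancel enc dec.
  by exists pickle, unpickle; exact: pickleK.
rewrite (_ : [set z | _] = \bigcup_n (if dec n is Some u then
    [set z | A u /\ killed_alive Y rho (x z) (t z) (g z) u] else set0)); last first.
  apply/seteqP; split => z /=.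
    by move=> [u Au hu]; exists (enc u) => //; rewrite decK.
  by move=> [n _]; case: (dec n) => [u [Au hu]|//]; exists u.
apply: bigcup_measurable => n _; case: (dec n) => [u|]; last exact: measurable0.
have [Au|nAu] := pselect (A u); last by rewrite (_ : [set z | _] = set0)//; apply/seteqP; split => z [].
rewrite (_ : [set z | _] = [set z | killed_alive Y rho (x z) (t z) (g z) u]); last first.
  by apply/seteqP; split => z /=; [case|].
exact: measurable_killed_alive.
Qed.

End adapted.
End joint_measurability.

(** * The renewal equation *)

Section renewal.
Context {R : realType} {d : measure_display} {T : measurableType d}.
Context {P : probability T R} {beta : R} {p : nat -> R}.
Implicit Type Y : bbm P beta p.
Local Notation mu := (@lebesgue_measure R).

Lemma source_sigma_measurable Y j : source_sigma Y j `<=` measurable.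
Proof.
have mpre d' (T' : measurableType d') (f : {mfun T >-> T'}) :
    g_sigma_algebra_preimage f `<=` (measurable : set_system T).
  by move=> _ [B mB <-]; exact: (measurable_funPT f).
case: j => [[u|u]|u] /=; [exact: mpre|exact: mpre|].
apply: smallest_sub; first exact: sigma_algebra_measurable.
by move=> A [t _]; exact: mpre.
Qed.

Lemma source_sigma_algebra Y j : sigma_algebra setT (source_sigma Y j).
Proof.
case: j => [[u|u]|u] /=; [exact: sigma_algebra_measurable_preimage|
  exact: sigma_algebra_measurable_preimage|exact: smallest_sigma_algebra].
Qed.

Definition source_on Y (K : set source) : set_system T := \bigcup_(j in K) source_sigma Y j.

Lemma source_on_measurable Y K : source_on Y K `<=` measurable.
Proof. by move=> A [j _]; exact: source_sigma_measurable. Qed.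

Lemma source_on_sigma Y K A : <<s source_on Y K >> A -> measurable A.
Proof. exact: (g_sigma_sub (@source_on_measurable Y K)). Qed.

Lemma source_indep Y (K L : set source) A B : K `&` L = set0 ->
  <<s source_on Y K >> A -> <<s source_on Y L >> B ->
  (P (A `&` B) = P A * P B)%E.
Proof.
move=> KL; apply: (mutually_independent_blocks (F := source_sigma Y)) => //.
- exact: source_sigma_measurable.
- exact: source_sigma_algebra.
- exact: (@bbm_independent _ _ _ _ _ _ Y).
Qed.

Section on.
Variables (Y : bbm P beta p) (K : set source).
Local Notation S := (g_sigma_algebraType (source_on Y K)).

Lemma source_on_sub j A : K j -> source_sigma Y j A -> <<s source_on Y K >> A.
Proof. by move=> Kj jA; apply: sub_sigma_algebra; exists j. Qed.

Lemma measurable_lifetime_on u : K (inl (inl u)) -> measurable_fun setT (lifetime Y u : S -> R).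
Proof. by move=> Ku _ B mB; apply: (source_on_sub Ku); exists B. Qed.

Lemma measurable_offspring_on u : K (inl (inr u)) -> measurable_fun setT (offspring Y u : S -> nat).
Proof. by move=> Ku _ B mB; apply: (source_on_sub Ku); exists B. Qed.

Lemma measurable_motion_on u r : K (inr u) -> 0 <= r -> measurable_fun setT (motion Y u r : S -> R).
Proof.
move=> Ku r0 _ B mB; apply: (source_on_sub Ku); apply: sub_sigma_algebra.
by exists r; [rewrite /= in_itv/= r0|exists B].
Qed.

Lemma adapted_on i d' (S' : measurableType d') (g : S' -> S) :
  (forall j u, source_label j = rcons u i -> K j) -> measurable_fun setT g ->
  adapted (sub_bbm Y i) (g : S' -> T).
Proof.
move=> Ki mg u; split.
- by apply: (measurableT_comp _ mg); apply: measurable_lifetime_on; exact: (Ki _ u).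
- by apply: (measurableT_comp _ mg); apply: measurable_offspring_on; exact: (Ki _ u).
- by move=> r r0; apply: (measurableT_comp _ mg); apply: measurable_motion_on => //; exact: (Ki _ u).
Qed.

End on.

Lemma adaptedT Y d' (S' : measurableType d') (g : S' -> T) : measurable_fun setT g ->
  adapted Y g.
Proof. by move=> mg u; split => [||r _]; apply: measurableT_comp. Qed.

Lemma measurable_some_killed_aliveT Y rho A x t : measurable (some_killed_alive Y rho A x t).
Proof.
exact: (measurable_some_killed_alive (g := idfun) rho A (adaptedT Y (@measurable_id _ T setT))
  (measurable_cst t) (measurable_cst x)).
Qed.

Definition surv Y rho A t x : R := fine (P (some_killed_alive Y rho A x t)).

Lemma survE Y rho A t x : ((surv Y rho A t x)%:E = P (some_killed_alive Y rho A x t))%E.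
Proof. by rewrite fineK// fin_num_measure//; exact: measurable_some_killed_aliveT. Qed.

Lemma surv_itv Y rho A t x : 0 <= surv Y rho A t x <= 1.
Proof.
rewrite -!lee_fin survE measure_ge0/=; apply: probability_le1.
exact: measurable_some_killed_aliveT.
Qed.

Definition child_labels (A : set label) i : set label := [set v | A (rcons v i)].

Definition offspring_killed_alive Y rho A y r : set T :=
  [set w | exists2 i, (i < offspring Y [::] w)%N &
     some_killed_alive (sub_bbm Y i) rho (child_labels A i) y r w].

Lemma some_killed_aliveE Y rho A x t w : some_killed_alive Y rho A x t w <->
  (A [::] /\ 0 <= t < lifetime Y [::] w /\ posev (root_path Y rho x w) t) \/
  [/\ lifetime Y [::] w <= t, posev (root_path Y rho x w) (lifetime Y [::] w) &
     offspring_killed_alive Y rho A (root_path Y rho x w (lifetime Y [::] w))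
        (t - lifetime Y [::] w) w].
Proof.
split.
  move=> [u]; case/lastP: u => [|u i] Au; rewrite ?killed_alive_nil ?killed_alive_rcons.
    by move=> h; left; case: h.
  by move=> [io lt h1 h2]; right; split => //; exists i => //; exists u.
move=> [[A0 h]|[lt h1 [i io [u Au h2]]]]; first by exists [::]; rewrite ?killed_alive_nil.
by exists (rcons u i); rewrite ?killed_alive_rcons.
Qed.

Lemma measurable_offspring_killed_alive Y rho A d' (S : measurableType d') (g : S -> T)
    (t x : S -> R) : measurable_fun setT (offspring Y [::] \o g) ->
  (forall i, adapted (sub_bbm Y i) g) ->
  measurable_fun setT t -> measurable_fun setT x ->
  measurable [set z | offspring_killed_alive Y rho A (x z) (t z) (g z)].
Proof.
move=> mo aY mt mx.
rewrite (_ : [set z | _] = \bigcup_i ((offspring Y [::] \o g) @^-1` [set k | (i < k)%N] `&`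
   [set z | some_killed_alive (sub_bbm Y i) rho (child_labels A i) (x z) (t z) (g z)])); last first.
  by apply/seteqP; split => z /=; [move=> [i io h]; exists i|move=> [i _ [io h]]; exists i].
apply: bigcup_measurable => i _; apply: measurableI.
  by rewrite -[X in measurable X]setTI; exact: mo.
exact: measurable_some_killed_alive.
Qed.

Local Open Scope ereal_scope.

(** Different subtrees are driven by disjoint sets of sources, so the complementary events are
    independent and their probabilities multiply. *)
Lemma prob_some_child Y rho A r y n :
  P [set w | exists2 i, (i < n)%N & some_killed_alive (sub_bbm Y i) rho (child_labels A i) y r w]
  = (1 - \prod_(i < n) (1 - surv (sub_bbm Y i) rho (child_labels A i) r y))%:E.
Proof.
pose a i : set T := some_killed_alive (sub_bbm Y i) rho (child_labels A i) y r.
pose B n : set T := [set w | exists2 i, (i < n)%N & a i w].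
pose K (N : set nat) : set source := [set j | exists2 i, N i & exists u, source_label j = rcons u i].
have ma (N : set nat) i : N i -> <<s source_on Y (K N) >> (a i).
  move=> Ni.
  have := @measurable_some_killed_alive _ _ _ T (g_sigma_algebraType (source_on Y (K N)))
     _ _ _ (sub_bbm Y i) idfun rho (child_labels A i) (cst r) (cst y).
  apply => //; apply: (adapted_on (Y := Y) (K := K N)); last exact: measurable_id.
  by move=> j u ju; exists i => //; exists u.
have mB (N : set nat) n' : (forall i, (i < n')%N -> N i) -> <<s source_on Y (K N) >> (B n').
  move=> Nn.
  have -> : B n' = \bigcup_(i in `I_n') a i.
    by apply/seteqP; split => w /=; [move=> [i ? ?]; exists i|move=> [i ? ?]; exists i].
  apply: (@bigcup_measurable _ (g_sigma_algebraType (source_on Y (K N)))) => i /= ik.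
  exact: (ma N i (Nn i ik)).
have mBT n' : measurable (B n') by apply: source_on_sigma; exact: (mB setT).
suff PC n' : P (~` B n') = (\prod_(i < n') (1 - surv (sub_bbm Y i) rho (child_labels A i) r y))%:E.
  have := probability_setC P (measurableC (mBT n)); rewrite setCK PC => ->.
  by rewrite EFinB.
elim: n' => [|m IH].
  rewrite big_ord0 (_ : B 0%N = set0) ?setC0 ?probability_setT//.
  by apply/seteqP; split => // w [].
rewrite big_ord_recr/= EFinM -IH.
have -> : ~` B m.+1 = ~` B m `&` ~` a m.
  apply/seteqP; split => w /=.
    by move=> h; split => [[i im ai]|am]; apply: h; [exists i => //; exact: ltnW|exists m].
  by move=> [h1 h2] [i]; rewrite ltnS leq_eqVlt => /orP[/eqP -> //|im ai]; apply: h1; exists i.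
rewrite (@source_indep Y (K `I_m) (K [set m])).
- have am : measurable (a m) by exact: measurable_some_killed_aliveT.
  by rewrite (probability_setC P am) EFinB survE.
- apply/seteqP; split => // j [[i /= im [u ju]] [k /= ->{k} [v]]].
  by rewrite ju => /eqP; rewrite eqseq_rcons => /andP[_ /eqP e]; move: im; rewrite e ltnn.
- apply: (@measurableC _ (g_sigma_algebraType (source_on Y (K `I_m)))).
  exact: mB.
- apply: (@measurableC _ (g_sigma_algebraType (source_on Y (K [set m])))).
  exact: ma.
Qed.

(** The offspring generating function in survival form. Each child [i] has its own [a i], since the
    subtrees and the label sets imposed on them may differ. *)
Definition gen_surv (a : nat -> R) : \bar R :=
  \sum_(k <oo) (p k * (1 - \prod_(i < k) (1 - a i)))%:E.

Lemma prob_offspring_killed_alive Y rho A r y :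
  P (offspring_killed_alive Y rho A y r) =
  gen_surv (fun i => surv (sub_bbm Y i) rho (child_labels A i) r y).
Proof.
pose a i : set T := some_killed_alive (sub_bbm Y i) rho (child_labels A i) y r.
pose B n : set T := [set w | exists2 i, (i < n)%N & a i w].
pose O k : set T := offspring Y [::] @^-1` [set k].
have mO k : measurable (O k) by rewrite -[X in measurable X]setTI; exact: measurable_funPT.
pose L : set source := [set j | exists i u, source_label j = rcons u i].
have sB n : <<s source_on Y L >> (B n).
  have -> : B n = \bigcup_(i in `I_n) a i.
    by apply/seteqP; split => w /=; [move=> [i ? ?]; exists i|move=> [i ? ?]; exists i].
  apply: (@bigcup_measurable _ (g_sigma_algebraType (source_on Y L))) => i /= ik.
  have := @measurable_some_killed_alive _ _ _ T (g_sigma_algebraType (source_on Y L))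
     _ _ _ (sub_bbm Y i) idfun rho (child_labels A i) (cst r) (cst y).
  apply => //; apply: (adapted_on (Y := Y) (K := L)); last exact: measurable_id.
  by move=> j u ju; exists i, u.
have mB n : measurable (B n) by apply: source_on_sigma; exact: sB.
rewrite (_ : offspring_killed_alive _ _ _ _ _ = \bigcup_k (O k `&` B k)); last first.
  apply/seteqP; split => w /=.
    by move=> [i io ai]; exists (offspring Y [::] w) => //; split => //; exists i.
  by move=> [k _ [/= <- [i io ai]]]; exists i.
rewrite measure_bigcup//.
- rewrite (@eq_eseriesl _ _ xpredT) => [|k]; last by rewrite in_setT.
  apply: eq_eseriesr => k _.
  transitivity (P (O k) * P (B k)).
    apply: (@source_indep Y [set inl (inr [::])] L).
    + apply/seteqP; split => // j [/= -> [i [u /= /eqP]]].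
      by case: u.
    + by apply: (source_on_sub (j := inl (inr [::]))) => //; exists [set k] => //; rewrite setTI.
    + exact: sB.
  by rewrite /O (offspring_law Y) prob_some_child EFinM.
- by move=> k _; exact: measurableI.
- by apply/trivIsetP => k l _ _ kl; apply/seteqP; split => // w [[/= ek _] [/= el _]];
    move: kl; rewrite -ek -el eqxx.
Qed.

Lemma gen_survE a : (forall k, 0 <= p k)%R -> (\sum_(0 <= k <oo) (p k)%:E = 1) ->
  (forall i, 0 <= a i <= 1)%R -> 0 <= gen_surv a <= 1.
Proof.
move=> p0 p1 a01.
have pr k : (0 <= \prod_(i < k) (1 - a i) <= 1)%R.
  apply/andP; split.
    by apply: prodr_ge0 => i _; have /andP[] := a01 i; rewrite subr_ge0.
  by apply: prodr_ile1 => i _; have /andP[] := a01 i; rewrite subr_ge0 gerBl => -> ->.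
rewrite nneseries_ge0/=; last first.
  by move=> k _ _; have /andP[h1 h2] := pr k; rewrite lee_fin mulr_ge0// subr_ge0.
rewrite -[leRHS]p1; apply: lee_nneseries => k.
  by move=> _; have /andP[h1 h2] := pr k; rewrite lee_fin mulr_ge0// subr_ge0.
by move=> _; have /andP[h1 h2] := pr k; rewrite lee_fin ler_piMr// gerBl.
Qed.

Definition offspring_surv Y rho A (t y : R) : \bar R := P (offspring_killed_alive Y rho A y t).

Lemma measurable_prob_xsection d' (S : measurableType d') (D : S -> set T) :
  measurable [set z : S * T | D z.1 z.2] -> measurable_fun setT (fun z => P (D z)).
Proof.
move=> mD; have := measurable_fun_xsection P mD.
by apply: eq_measurable_fun => z _; rewrite /= /xsection; congr (P _); apply/seteqP; split => w /=;
  rewrite inE.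
Qed.

Lemma measurable_offspring_surv Y rho A :
  measurable_fun setT (fun z : R * R => offspring_surv Y rho A z.1 z.2).
Proof.
apply: (measurable_prob_xsection (D := fun z : R * R => offspring_killed_alive Y rho A z.2 z.1)).
apply: (@measurable_offspring_killed_alive Y rho A _ (R * R * T)%type snd
  (fun z => z.1.1) (fun z => z.1.2)).
- exact: measurableT_comp.
- by move=> i; exact: adaptedT.
- exact: measurableT_comp.
- exact: measurableT_comp.
Qed.

Lemma measurable_surv Y rho A : measurable_fun setT (fun z : R * R => surv Y rho A z.1 z.2).
Proof.
apply/measurable_EFinP; rewrite (_ : _ \o _ =
  fun z : R * R => P (some_killed_alive Y rho A z.2 z.1)); last first.
  by apply/funext => z /=; rewrite survE.
apply: (measurable_prob_xsection (D := fun z : R * R => some_killed_alive Y rho A z.2 z.1)).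
apply: (@measurable_some_killed_alive _ _ _ _ (R * R * T)%type _ _ _ Y snd rho A
  (fun z => z.1.1) (fun z => z.1.2)).
- exact: adaptedT.
- exact: measurableT_comp.
- exact: measurableT_comp.
Qed.

Section decomposition.
Variables (Y : bbm P beta p) (rho : R) (A : set label) (t x : R).
Hypotheses (beta0 : (0 < beta)%R) (t0 : (0 < t)%R) (x0 : (0 < x)%R).
Local Notation sigma := (lifetime Y [::]).

Lemma root_pos_law s : (0 < s)%R ->
  P [set w | posev (root_path Y rho x w) s] = Q rho s (cst 1) x.
Proof.
move=> s0; rewrite -(killed_law (motion_law Y [::]) rho s0 x0 (phi := cst 1))//.
have mp := measurable_path_pos (motion_law Y [::]) rho x s0.
rewrite -[X in P X]setIT -integral_indic//; apply: eq_integral => w _.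
by rewrite mule1.
Qed.

(** Lifetime and motion of the root are independent; the first gives the exponential, the second [Q]
    applied to 1. *)
Lemma prob_root : P [set w | A [::] /\ (0 <= t < sigma w)%R /\ posev (root_path Y rho x w) t] =
  (\1_A [::])%:E * ((expR (- beta * t))%:E * Q rho t (cst 1) x).
Proof.
rewrite indicE; have [A0|A0] := boolP ([::] \in A); last first.
  rewrite mul0e (_ : [set w | _] = set0) ?measure0//.
  by apply/seteqP; split => // w [h]; move: A0; rewrite notin_setE.
rewrite mul1e.
rewrite (_ : [set w | _] = sigma @^-1` (~` `[0%R, t]) `&` [set w | posev (root_path Y rho x w) t]); last first.
  apply/seteqP; split => w /=; rewrite in_itv/= lifetime_ge0/=.
    by move=> [_ [/andP[_ tl] h]]; split => //; rewrite leNgt tl.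
  move=> [/negP]; rewrite -ltNge => tl h; split; first by move: A0; rewrite inE.
  by rewrite (ltW t0) tl.
have mS : measurable (~` `[0%R, t]%classic : set R) by apply: measurableC; exact: measurable_itv.
rewrite (@source_indep Y [set inl (inl [::])] [set inr [::]]).
- congr (_ * _); last exact: root_pos_law.
  have mI : measurable (sigma @^-1` `[0%R, t]%classic).
    by rewrite -[X in measurable X]setTI; apply: (measurable_funPT sigma).
  have pI : P (sigma @^-1` `[0%R, t]%classic) = 1 - (expR (- beta * t))%:E.
    by rewrite (lifetime_law Y) ?exponential_prob_itv0c//; exact: measurable_itv.
  rewrite preimage_setC (probability_setC P mI) pI.
  by rewrite -!EFinB opprB addrC subrK.
- by apply/seteqP; split => // j [/= ->].
- by apply: (source_on_sub (j := inl (inl [::]))) => //; exists (~` `[0%R, t]%classic) => //; rewrite setTI.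
- have := @measurable_posev _ _ (g_sigma_algebraType (source_on Y [set inr [::]]))
    (fun r z => motion Y [::] r z) rho (cst x) (cst t).
  apply.
  + by move=> r r0; exact: measurable_motion_on.
  + by move=> y z; exact: (cts_root_path Y rho y z).
  + by move=> z; exact: cts_motion.
  + exact: measurable_cst.
  + exact: measurable_cst.
  + by move=> z; exact: ltW.
Qed.

Let E2 : set T := [set w | [/\ (sigma w <= t)%R, posev (root_path Y rho x w) (sigma w) &
  offspring_killed_alive Y rho A (root_path Y rho x w (sigma w)) (t - sigma w)%R w]].

(** The lifetime and the motion of the root fix the time and place of the first branching. Its
    offspring number is left out, as it acts together with the subtrees afterwards. *)
Let root_sources : set source := [set j | source_label j = [::] /\ j <> inl (inr [::])].

Lemma prob_offspring_freeze : P E2 =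
  \int[P]_w ((\1_[set w | (sigma w <= t)%R /\ posev (root_path Y rho x w) (sigma w)] w)%:E *
    offspring_surv Y rho A (t - sigma w) (root_path Y rho x w (sigma w))).
Proof.
pose S1 := g_sigma_algebraType (source_on Y root_sources).
pose S2 := g_sigma_algebraType (source_on Y (~` root_sources)).
have mZ1 : measurable_fun setT (idfun : T -> S1).
  by apply: measurable_idtype; exact: source_on_measurable.
have mZ2 : measurable_fun setT (idfun : T -> S2).
  by apply: measurable_idtype; exact: source_on_measurable.
have ind (B : set S1) (C : set S2) : measurable B -> measurable C ->
    P ((idfun : T -> S1) @^-1` B `&` (idfun : T -> S2) @^-1` C) =
    P ((idfun : T -> S1) @^-1` B) * P ((idfun : T -> S2) @^-1` C).
  by move=> mB mC; rewrite !preimage_id; apply: (source_indep _ mB mC); rewrite setICr.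
have r1 : root_sources (inl (inl [::])) by split.
have r2 : root_sources (inr [::]) by split.
have mf : measurable_fun setT (fst : S1 * S2 -> S1) by exact: measurable_fst.
have mg : measurable_fun setT (snd : S1 * S2 -> S2) by exact: measurable_snd.
have ml : measurable_fun setT (fun z : S1 * S2 => sigma (z.1 : T)).
  exact: (measurableT_comp (measurable_lifetime_on r1) mf).
have mW r : (0 <= r)%R -> measurable_fun setT (motion Y [::] r \o (fst : S1 * S2 -> T)).
  by move=> r0; exact: (measurableT_comp (measurable_motion_on r2 r0) mf).
have l0 (z : S1 * S2) : (0 <= sigma (z.1 : T))%R by exact: lifetime_ge0.
pose C : set (S1 * S2) := [set z | (sigma (z.1 : T) <= t)%R] `&`
  [set z | posev (root_path Y rho x (z.1 : T)) (sigma (z.1 : T))] `&`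
  [set z | offspring_killed_alive Y rho A (root_path Y rho x (z.1 : T) (sigma (z.1 : T)))
     (t - sigma (z.1 : T))%R (z.2 : T)].
have mC : measurable C.
  apply: measurableI; first apply: measurableI.
  - exact: measurable_set_ler.
  - exact: (@measurable_root_pos _ _ _ T (S1 * S2)%type _ _ _ Y fst rho (cst x) _ mW).
  - apply: (@measurable_offspring_killed_alive Y rho A _ (S1 * S2)%type snd).
    + apply: (measurableT_comp _ mg); apply: measurable_offspring_on.
      by move=> [_].
    + move=> i; apply: adapted_on mg => j u ju [].
      by rewrite ju; case: u {ju}.
    + exact: measurable_funB.
    + exact: (@measurable_root_path _ _ _ T (S1 * S2)%type _ _ _ Y fst rho (cst x) _ mW).
have := measure_indep mZ1 mZ2 ind mC.
rewrite (_ : [set w | _] = E2); last first.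
  by apply/seteqP; split => w; [case=> [[? ?] ?]|case].
move=> ->; apply: eq_integral => w _; rewrite indicE.
have [|h] := boolP (w \in _).
  rewrite inE/= => -[h1 h2]; rewrite mul1e; congr (P _).
  by apply/seteqP; split => w' /=; [case|].
rewrite mul0e (_ : [set w' | _] = set0) ?measure0//.
by apply/seteqP; split => // w' [[h1 h2] _]; move: h; rewrite notin_setE/=; apply.
Qed.

(** A second freezing, now of the lifetime against the motion: the lifetime contributes its
    exponential density, and at a fixed time [killed_law] turns the motion into [Q]. *)
Lemma prob_offspring : P E2 = \int[mu]_(s in `]0%R, t])
  ((beta * expR (- beta * s))%:E * Q rho s (fun y => offspring_surv Y rho A (t - s) y) x).
Proof.
rewrite prob_offspring_freeze.
pose S2 := g_sigma_algebraType (source_on Y [set inr [::]]).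
have mZ1 : measurable_fun setT (sigma : T -> measurableTypeR R) by exact: (measurable_funPT sigma).
have mZ2 : measurable_fun setT (idfun : T -> S2).
  by apply: measurable_idtype; exact: source_on_measurable.
have ind (B : set (measurableTypeR R)) (C : set S2) : measurable B -> measurable C ->
    P (sigma @^-1` B `&` (idfun : T -> S2) @^-1` C) =
    P (sigma @^-1` B) * P ((idfun : T -> S2) @^-1` C).
  move=> mB mC; rewrite preimage_id.
  apply: (@source_indep Y [set inl (inl [::])] _ _ _ _ _ mC).
    by apply/seteqP; split => // j [/= ->].
  by apply: (source_on_sub (j := inl (inl [::]))) => //; exists B => //; rewrite setTI.
have mg : measurable_fun setT (snd : measurableTypeR R * S2 -> S2) by exact: measurable_snd.
(* The lifetime is never negative, but measurability is required over all real values of the first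
   coordinate. *)
pose m0 (z : measurableTypeR R * S2) : R := Num.max 0%R (z.1 : R).
have mm0 : measurable_fun setT m0 by apply: measurable_maxr => //; exact: measurable_fst.
have m00 z : (0 <= m0 z)%R by rewrite /m0 le_max lexx.
have mW r : (0 <= r)%R ->
    measurable_fun setT (motion Y [::] r \o (snd : measurableTypeR R * S2 -> T)).
  move=> r0; have r1 : [set inr [::] : source] (inr [::]) by [].
  exact: (measurableT_comp (measurable_motion_on (Y := Y) r1 r0) mg).
pose C : set (measurableTypeR R * S2) := [set z | (z.1 : R) <= t]%R `&`
  [set z | posev (root_path Y rho x (z.2 : T)) (m0 z)].
have CE (s : R) w (B : set T) : (0 <= s)%R ->
    (B w <-> (s <= t)%R /\ posev (root_path Y rho x w) s) -> (\1_B w = \1_C (s, w) :> R).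
  move=> s0 h; rewrite !indicE; congr (nat_of_bool _)%:R.
  by apply/idP/idP; rewrite !in_setE h /C/= /m0/= max_r.
pose F (z : measurableTypeR R * S2) : \bar R := (\1_C z)%:E *
  offspring_surv Y rho A (t - (z.1 : R)) (root_path Y rho x (z.2 : T) (m0 z)).
have mC : measurable C.
  apply: measurableI; first by apply: measurable_set_ler => //; exact: measurable_fst.
  refine (@measurable_root_pos _ _ _ T (measurableTypeR R * S2)%type _ _ _ Y (snd : measurableTypeR R * S2 -> T) rho (cst x) m0 mW (measurable_cst x) mm0 m00).
have mF : measurable_fun setT F.
  apply: emeasurable_funM; first by apply/measurable_EFinP; exact: measurable_indic.
  have mt : measurable_fun setT (fun z : measurableTypeR R * S2 => (t - (z.1 : R))%R).
    by apply: measurable_funB => //; exact: measurable_fst.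
  have mr : measurable_fun setT (fun z : measurableTypeR R * S2 => root_path Y rho x (z.2 : T) (m0 z)).
    exact: (@measurable_root_path _ _ _ T (measurableTypeR R * S2)%type _ _ _ Y (snd : measurableTypeR R * S2 -> T) rho (cst x) m0 mW (measurable_cst x) mm0 m00).
  exact: (measurableT_comp (measurable_offspring_surv Y rho A) (measurable_fun_pair mt mr)).
have F0 z : 0 <= F z by rewrite mule_ge0// lee_fin.
have := integral_indep mZ1 mZ2 ind mF F0 => H.
rewrite [LHS](_ : _ = \int[P]_w F (sigma w, w)); last first.
  apply: eq_integral => w _; rewrite /F /= /m0/= max_r ?lifetime_ge0//.
  by congr (_%:E * _); apply: CE => //; exact: lifetime_ge0.
rewrite H.
pose G (s : measurableTypeR R) : \bar R := \int[P]_w' F (s, w').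
have mG : measurable_fun setT G.
  have mZ : measurable_fun setT (fun z : measurableTypeR R * T => F (z.1, z.2)).
    have m1 : measurable_fun setT (fst : measurableTypeR R * T -> measurableTypeR R) by exact: measurable_fst.
    have m2 : measurable_fun setT (snd : measurableTypeR R * T -> T) by exact: measurable_snd.
    exact: (measurableT_comp mF (measurable_fun_pair m1 (measurableT_comp mZ2 m2))).
  exact: (@measurable_fun_fubini_tonelli_F _ _ _ _ _ P _ mZ (fun z => F0 _)).
have G0 s : 0 <= G s by apply: integral_ge0.
transitivity (\int[distribution P (mfun_of mZ1)]_s G s).
  by rewrite /distribution ge0_integral_pushforward.
rewrite (@integral_density R _ (measurableTypeR R) mu (distribution P (mfun_of mZ1)) _
  (measurable_exponential_pdf beta) (exponential_pdf_ge0 (ltW beta0)))//; last first.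
  by move=> B mB; exact: (lifetime_law Y).
transitivity (\int[mu]_(s in `[0%R, t]) (G s * (exponential_pdf beta s)%:E)).
  rewrite [RHS]integral_mkcond; apply: eq_integral => s _; rewrite patchE; case: ifPn => //.
  rewrite notin_setE/= in_itv/= => /negP; rewrite negb_and -!ltNge => /orP[s0|ts].
    by rewrite lt0_exponential_pdf// mule0.
  rewrite /G integral0_eq ?mul0e// => w _; rewrite /F indicE memNset ?mul0e// => -[/=].
  by rewrite leNgt ts.
have mGe : measurable_fun setT (fun s : R => G s * (exponential_pdf beta s)%:E).
  by apply: emeasurable_funM => //; apply/measurable_EFinP; exact: measurable_exponential_pdf.
rewrite -integral_itv_obnd_cbnd; last exact: measurable_funTS.
apply: eq_integral => s; rewrite inE/= in_itv/= => /andP[s0 st].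
rewrite muleC exponential_pdfE; last exact: ltW.
congr (_ * _); rewrite -(killed_law (motion_law Y [::]) rho s0 x0).
- apply: eq_integral => w _; rewrite /F /m0/= max_r ?(ltW s0)//.
  congr (_%:E * _); apply/esym/CE; first exact: ltW.
  by split => [|[]].
- exact: (measurableT_comp (measurable_offspring_surv Y rho A)
    (measurable_fun_pair (measurable_cst (t - s)%R) (@measurable_id _ R setT))).
- by move=> z; exact: measure_ge0.
Qed.

Lemma renewal : (surv Y rho A t x)%:E =
  (\1_A [::])%:E * ((expR (- beta * t))%:E * Q rho t (cst 1) x) +
  \int[mu]_(s in `]0%R, t])
    ((beta * expR (- beta * s))%:E * Q rho s (fun y => offspring_surv Y rho A (t - s) y) x).
Proof.
rewrite survE (_ : some_killed_alive _ _ _ _ _ =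
  [set w | A [::] /\ (0 <= t < sigma w)%R /\ posev (root_path Y rho x w) t] `|` E2); last first.
  by apply/seteqP; split => w; rewrite /= -some_killed_aliveE.
rewrite measureU; last 3 first.
- have aY : adapted Y idfun by apply: adaptedT; exact: measurable_id.
  have [ml _ mW] := aY [::].
  have [A0|A0] := pselect (A [::]); last first.
    by rewrite (_ : [set w | _] = set0)//; apply/seteqP; split => // w [].
  rewrite (_ : [set w | _] = [set w | (t < sigma w)%R] `&` [set w | posev (root_path Y rho x w) t]).
    apply: measurableI; first exact: measurable_set_ltr.
    by apply: (measurable_root_pos rho mW (measurable_cst x) (measurable_cst t)) => z; exact: ltW.
  by apply/seteqP; split => w /=; rewrite (ltW t0)/=; [case=> _ []|case].
- rewrite /E2 (_ : [set w | _] = [set w | sigma w <= t]%R `&`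
    [set w | posev (root_path Y rho x w) (sigma w)] `&`
    [set w | offspring_killed_alive Y rho A (root_path Y rho x w (sigma w)) (t - sigma w)%R w]).
    have aY : adapted Y idfun by apply: adaptedT; exact: measurable_id.
    have [ml mo mW] := aY [::]; have l0 := lifetime_ge0 Y [::].
    apply: measurableI; first apply: measurableI.
    + exact: measurable_set_ler.
    + exact: (measurable_root_pos rho mW (measurable_cst x) ml l0).
    + apply: (@measurable_offspring_killed_alive Y rho A _ T idfun) => //.
      * exact: measurable_funB.
      * exact: (measurable_root_path rho mW (measurable_cst x) ml l0).
  by apply/seteqP; split => w /=; [case|case=> [[? ?] ?]].
- apply/seteqP; split => // w [[_ [/andP[_ h1] _]] [h2 _ _]].
  by move: h1; rewrite ltNge h2.
exact: (f_equal2 adde prob_root prob_offspring).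
Qed.

End decomposition.
End renewal.

(** * Expectations *)

Section label_sums.
Context {R : realType}.
Local Open Scope ereal_scope.

(** Numbering the labels turns the sum into a series, which can be exchanged with an integral and
    with a constant factor. *)
Lemma label_esum (a : label -> \bar R) : (forall u, 0 <= a u) ->
  \esum_(u in [set: label]) a u = \sum_(0 <= n <oo) oapp a 0 (pickle_inv n : option label).
Proof.
move=> a0; have a0' (n : nat) : 0 <= oapp a 0 (pickle_inv n : option label).
  by case: (pickle_inv n : option label) => //= u.
rewrite nneseries_esumT//.
transitivity (\esum_(n in (@pickle label) @` setT) oapp a 0 (pickle_inv n : option label)).
  rewrite (esum_image setT (@pickle label)); last first.
    by move=> u v _ _; exact: (pcan_inj pickleK).
  by apply: eq_esum => u _; rewrite pickleK_inv.
rewrite esum_mkcond; apply: eq_esum => n _; case: ifPn => //; rewrite notin_setE => /= h.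
have := pickle_invK (n : nat) : oapp (@pickle label) n (pickle_inv n) = n.
case: (pickle_inv n : option label) => //= u un.
by exfalso; apply: h; exists u.
Qed.

Lemma label_esumZ (A : set label) (c : R) (a : label -> \bar R) : (forall u, 0 <= a u) -> (0 <= c)%R ->
  \esum_(u in A) (c%:E * a u) = c%:E * \esum_(u in A) a u.
Proof.
move=> a0 c0; rewrite !(esum_mkcond A) !label_esum; last 2 first.
- by move=> u; case: ifP.
- by move=> u; case: ifP => // _; rewrite mule_ge0.
rewrite -nneseriesZl; last first.
  by move=> n _; case: (pickle_inv n : option label) => //= u; case: ifP.
apply: eq_eseriesr => n _; case: (pickle_inv n : option label) => [u|] /=; last by rewrite mule0.
by case: ifP => // _; rewrite mule0.
Qed.

Lemma label_esum_size (c : nat -> \bar R) (a : label -> R) :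
  (forall n, 0 <= c n) -> (forall u, 0 <= a u)%R ->
  \esum_(u in [set: label]) (c (size u) * (a u)%:E) =
  \esum_(n in [set: nat]) \esum_(u in [set u | size u = n]) (c n * (a u)%:E).
Proof.
move=> c0 a0.
have -> : [set: label] = \bigcup_(n in [set: nat]) [set u | size u = n].
  by apply/seteqP; split => // u _; exists (size u).
rewrite esum_bigcupT.
- by apply: eq_esum => n _; apply: eq_esum => u /= ->.
- by apply/trivIsetP => i j _ _ ij; apply/seteqP; split => // u [/= iu /= ju]; move: ij; rewrite -iu -ju eqxx.
- by move=> u; rewrite mule_ge0// lee_fin.
Qed.

(** Splitting off the first index factors the sum over labels of length n + 1 into the sum over one
    index and the sum over length n. *)
Lemma esum_size_prod (f : nat -> R) (m : R) n : (forall i, 0 <= f i)%R ->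
  \sum_(0 <= i <oo) (f i)%:E = m%:E ->
  \esum_(u in [set u : label | size u = n]) (\prod_(i <- u) f i)%:E = (m ^+ n)%:E.
Proof.
move=> f0 fm; have p0 (u : label) : (0 <= \prod_(i <- u) f i)%R by apply: prodr_ge0.
have m0 : (0 <= m)%R by rewrite -lee_fin -fm nneseries_ge0// => i _ _; rewrite lee_fin.
elim: n => [|n IH].
  rewrite (_ : [set u | _] = [set [::]]); last by apply/seteqP; split => u /=; [move=> /size0nil|move=> ->].
  by rewrite esum_set1 ?lee_fin// big_nil expr0.
pose J (i : nat) := [set u : label | size u = n].
transitivity (\esum_(k in [set: nat] `*`` J) (f k.1 * \prod_(i <- k.2) f i)%:E).
  rewrite (@reindex_esum R (nat * label)%type label ([set: nat] `*`` J) _ (fun k => k.1 :: k.2)).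
    by apply: eq_esum => k _; rewrite big_cons.
  split.
  - by move=> [i u] [_ /= un]; rewrite un.
  - by move=> [i u] [j v] _ _ /= [-> ->].
  - by move=> [|i u] //= [un]; exists (i, u).
rewrite -(@esum_esum R nat label setT J (fun i u => (f i * \prod_(j <- u) f j)%:E)); last first.
  by move=> i u _ _; rewrite lee_fin mulr_ge0.
transitivity (\esum_(i in [set: nat]) ((m ^+ n)%:E * (f i)%:E)).
  apply: eq_esum => i _; rewrite -IH muleC -label_esumZ//.
rewrite -nneseries_esumT => [|i]; last by rewrite mule_ge0// lee_fin// exprn_ge0.
rewrite nneseriesZl; last by move=> i _; rewrite lee_fin.
by rewrite fm -EFinM exprSr.
Qed.

End label_sums.

Section power_integral.
Context {R : realType}.
Local Notation mu := (@lebesgue_measure R).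

Lemma integral_subX (t : R) n : 0 < t ->
  (\int[mu]_(s in `]0%R, t[) ((t - s) ^+ n)%:E = (t ^+ n.+1 / n.+1%:R)%:E)%E.
Proof.
move=> t0; pose f (s : R) := (t - s) ^+ n.
pose F : R -> R := (- n.+1%:R^-1) *: ((cst t - id) ^+ n.+1).
have FE s : F s = - n.+1%:R^-1 * (t - s) ^+ n.+1.
  by rewrite /F/= exprfctE.
have dF (s : R) : is_derive s 1 F (f s).
  rewrite /F; apply: is_derive_eq.
  transitivity (- n.+1%:R^-1 * ((n.+1%:R * (t - s) ^+ n) * (0 - 1))); first by [].
  by rewrite sub0r mulrN1 mulrN mulNr opprK mulrA mulVf ?mul1r// pnatr_eq0.
have cf : continuous f.
  move=> s; apply: (@continuous_comp _ _ _ (fun s => t - s) (fun z => z ^+ n)).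
    by apply: cvgB; [exact: cvg_cst|exact: cvg_id].
  exact: exprn_continuous.
have cF : continuous F.
  by move=> s; apply: differentiable_continuous; apply/derivable1_diffP; case: (dF s).
have mf : measurable_fun setT f by exact: continuous_measurable_fun.
rewrite -[LHS]/(\int[mu]_(s in `]0%R, t[) (EFin \o f) s)%E.
rewrite -(integral_itv_bndoo true false); last first.
  by apply: measurable_funTS; exact/measurable_EFinP.
rewrite (@continuous_FTC2 _ f F 0 t t0).
- by rewrite -EFinB !FE subrr subr0 expr0n/= mulr0 sub0r mulNr opprK mulrC.
- exact: continuous_subspaceT.
- split.
  + by move=> s _; case: (dF s).
  + exact/cvg_at_right_filter/cF.
  + exact/cvg_at_left_filter/cF.
- by move=> s _; rewrite derive1E; exact: derive_val.
Qed.

End power_integral.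

Section generations.
Context {R : realType} {d : measure_display} {T : measurableType d}.
Context {P : probability T R} {beta : R} {p : nat -> R}.
Implicit Type Y : bbm P beta p.
Local Notation mu := (@lebesgue_measure R).
Hypotheses (beta0 : 0 < beta) (pd : offspring_distribution p).
Variable rho : R.
Local Open Scope ereal_scope.

Let p0 k : (0 <= p k)%R. Proof. by case: pd. Qed.
Let p1 : \sum_(0 <= k <oo) (p k)%:E = 1. Proof. by case: pd. Qed.

Lemma offspring_survE Y A t y : offspring_surv Y rho A t y =
  gen_surv (p := p) (fun i => surv (sub_bbm Y i) rho (child_labels A i) t y).
Proof. exact: prob_offspring_killed_alive. Qed.

(** The interval is open at [t], so that the remaining time [t - s] is positive wherever the
    integrand is evaluated. *)
Definition renewal_int (g : R -> R -> \bar R) t x : \bar R :=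
  \int[mu]_(s in `]0%R, t[) ((beta * expR (- beta * s))%:E * Q rho s (g (t - s)%R) x).

Lemma eq_renewal_int (g h : R -> R -> \bar R) t x :
  (forall s y, (0 < s)%R -> (0 < y)%R -> g s y = h s y) ->
  renewal_int g t x = renewal_int h t x.
Proof.
move=> gh; apply: eq_integral => s; rewrite inE/= in_itv/= => /andP[s0 st].
by congr (_ * _); apply: eq_Q => y y0; apply: gh => //; rewrite subr_gt0.
Qed.

Lemma measurable_rate : measurable_fun setT (fun s : R => (beta * expR (- beta * s))%:E).
Proof. by apply/measurable_EFinP; apply: measurable_funM => //; apply: measurableT_comp. Qed.

Lemma measurable_renewal_integrand (g : R -> R -> \bar R) t x : (0 <= x)%R ->
  measurable_fun setT (fun z : R * R => g z.1 z.2) ->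
  (forall s y, (0 < y)%R -> 0 <= g s y) ->
  measurable_fun setT (fun s => (beta * expR (- beta * s))%:E * Q rho s (g (t - s)%R) x).
Proof.
move=> x0 mg g0; apply: emeasurable_funM; first exact: measurable_rate.
have h : measurable_fun setT (fun z : R * R => ((t - z.1)%R, z.2)).
  apply: measurable_fun_pair; last exact: measurable_snd.
  by apply: measurable_funB => //; exact: measurable_fst.
exact: (@measurable_Q R _ R rho idfun (cst x) (fun z => g (t - z.1)%R z.2) (@measurable_id _ _ _)
  (measurable_cst x) (measurableT_comp mg h) (fun s y => @g0 (t - s)%R y) (fun=> x0)).
Qed.

(** The kernel has no definite sign for negative starting points. Taking the positive part of [y]
    gives a function that is nonnegative and measurable on the whole line, and changes nothing for
    [y > 0]. *)
Lemma measurable_Qmax s (phi : R -> \bar R) : measurable_fun setT phi ->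
  (forall y, (0 < y)%R -> 0 <= phi y) ->
  measurable_fun setT (fun y : R => Q rho s phi (Num.max 0%R y)).
Proof.
move=> mphi p0'; have mm : measurable_fun setT (fun y : R => Num.max 0%R y) by exact: measurable_maxr.
have m0 (y : R) : (0 <= Num.max 0 y)%R by rewrite le_max lexx.
exact: (@measurable_Q R _ R rho (cst s) _ (fun z => phi z.2) (measurable_cst s)
  mm (measurableT_comp mphi (@measurable_snd _ _ R R)) (fun _ y => @p0' y) m0).
Qed.

Lemma renewal_open Y A t x : (0 < t)%R -> (0 < x)%R -> (surv Y rho A t x)%:E =
  (\1_A [::])%:E * ((expR (- beta * t))%:E * Q rho t (cst 1) x) +
  renewal_int (offspring_surv Y rho A) t x.
Proof.
move=> t0 x0; rewrite renewal//; congr (_ + _).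
rewrite /renewal_int integral_itv_bndo_bndc//; apply: measurable_funTS.
apply: measurable_renewal_integrand; first exact: ltW.
  exact: measurable_offspring_surv.
by move=> s y _; exact: measure_ge0.
Qed.

Lemma surv0 Y t x : surv Y rho set0 t x = 0%R.
Proof.
rewrite /surv (_ : some_killed_alive _ _ _ _ _ = set0) ?measure0//.
by apply/seteqP; split => // w [].
Qed.

Definition labels_upto n : set label := [set u | (size u < n)%N].

(** The renewal equation expresses survival within n + 1 generations through survival of the
    subtrees within n, and by induction the latter is the same for every [bbm]. *)
Lemma surv_upto n Y Y' t x : (0 < t)%R -> (0 < x)%R ->
  surv Y rho (labels_upto n) t x = surv Y' rho (labels_upto n) t x.
Proof.
elim: n Y Y' t x => [|n IH] Y Y' t x t0 x0.
  by rewrite (_ : labels_upto 0 = set0) ?surv0//; apply/seteqP; split.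
apply: EFin_inj; rewrite (renewal_open Y _ t0 x0) (renewal_open Y' _ t0 x0).
rewrite (@eq_renewal_int (offspring_surv Y rho (labels_upto n.+1))
  (offspring_surv Y' rho (labels_upto n.+1)))// => s y s0 y0.
rewrite !offspring_survE; congr gen_surv.
have cl i : child_labels (labels_upto n.+1) i = labels_upto n.
  by apply/seteqP; split => u /=; rewrite /labels_upto/child_labels/= size_rcons.
by apply/funext => i; rewrite cl; exact: IH.
Qed.

Lemma surv_upto_cvg Y t x : surv Y rho (labels_upto n) t x @[n --> \oo] --> surv Y rho setT t x.
Proof.
apply: fine_cvg; rewrite (survE Y rho setT) (_ : some_killed_alive Y rho setT x t =
   \bigcup_n some_killed_alive Y rho (labels_upto n) x t); last first.
  apply/seteqP; split => w /=.
    by move=> [u _ h]; exists (size u).+1 => //; exists u => //; rewrite /labels_upto/=.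
  by move=> [n _ [u _ h]]; exists u.
apply: nondecreasing_cvg_mu.
- by move=> n; exact: measurable_some_killed_aliveT.
- by apply: bigcup_measurable => n _; exact: measurable_some_killed_aliveT.
- move=> n m nm; apply/subsetPset => w [u un h]; exists u => //.
  exact: (leq_trans un nm).
Qed.

(** Identifies the survival function of a subtree with that of the whole tree, so that the renewal
    equation closes on a single unknown; it is the limit of [surv_upto] over the generations. *)
Lemma surv_universal Y Y' t x : (0 < t)%R -> (0 < x)%R ->
  surv Y rho setT t x = surv Y' rho setT t x.
Proof.
move=> t0 x0; have := @surv_upto_cvg Y t x.
rewrite (_ : (fun n => _) = (fun n => surv Y' rho (labels_upto n) t x)); last first.
  by apply/funext => n; exact: surv_upto.
by move=> /cvg_unique; apply => //; exact: surv_upto_cvg.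
Qed.

Definition off_gen (v : R) : \bar R := gen_surv (p := p) (fun=> v).

Lemma renewalT Y t x : (0 < t)%R -> (0 < x)%R -> (surv Y rho setT t x)%:E =
  (expR (- beta * t))%:E * Q rho t (cst 1) x +
  renewal_int (fun s y => off_gen (surv Y rho setT s y)) t x.
Proof.
move=> t0 x0; have i1 : \1_[set: label] [::] = 1%R :> R by rewrite indicE mem_set.
rewrite (renewal_open Y _ t0 x0) i1 mul1e.
rewrite (@eq_renewal_int (offspring_surv Y rho setT) (fun s y => off_gen (surv Y rho setT s y)))//.
move=> s y s0 y0; rewrite offspring_survE; congr gen_surv.
by apply/funext => i; rewrite -(surv_universal Y (sub_bbm Y i))//.
Qed.

(** The probability that a particle has a child number [i], counted from 0. *)
Definition tail_prob i : R := fine (\sum_(0 <= k <oo) ((p k)%:E * ((i < k)%N%:R)%:E)).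

Let tail_term0 i k : 0 <= (p k)%:E * ((i < k)%N%:R)%:E :> \bar R.
Proof. by rewrite mule_ge0// lee_fin. Qed.

Lemma tail_probE i : (tail_prob i)%:E = \sum_(0 <= k <oo) ((p k)%:E * ((i < k)%N%:R)%:E).
Proof.
rewrite fineK// ge0_fin_numE ?nneseries_ge0//.
apply: (@le_lt_trans _ _ 1); last by rewrite ltry.
rewrite -p1; apply: lee_nneseries => // k _.
by rewrite -EFinM lee_fin ler_piMr// lern1 leq_b1.
Qed.

Lemma tail_prob_ge0 i : (0 <= tail_prob i)%R.
Proof. by rewrite -lee_fin tail_probE nneseries_ge0. Qed.

Lemma sum_tail_prob : \sum_(0 <= i <oo) (tail_prob i)%:E = mean_offspring p.
Proof.
under eq_eseriesr do rewrite tail_probE.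
rewrite nneseries_interchange//.
apply: eq_eseriesr => k _.
rewrite nneseriesZl; last by move=> i _; rewrite lee_fin.
rewrite mulrC EFinM; congr (_ * _).
rewrite (nneseries_split 0 k)//.
rewrite add0n [X in _ + X]eseries0 ?adde0; last first.
  by move=> i ki _; rewrite ltnNge ki.
rewrite (eq_big_nat _ _ (F2 := fun=> 1)); last by move=> i /= ik; rewrite ik.
by rewrite sumEFin big_const_nat subn0 iter_addr addr0.
Qed.

(** The line of descent of [u] exists with the product of the [tail_prob], the number of its
    branchings up to [t] equals [size u] with a Poisson weight, and along it the motion is one
    killed Brownian motion. The proof reaches this by induction through the renewal equation. *)
Lemma surv_single u Y t x : (0 < t)%R -> (0 < x)%R -> (surv Y rho [set u] t x)%:E =
  ((\prod_(i <- u) tail_prob i) * (expR (- beta * t) * ((beta * t) ^+ size u / (size u)`!%:R)))%:E *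
  Q rho t (cst 1) x.
Proof.
have gs0 Y' A t' y' : (forall i, child_labels A i = set0) -> offspring_surv Y' rho A t' y' = 0.
  move=> A0; rewrite offspring_survE; apply: eseries0 => k _ _ /=.
  by rewrite big1 ?subrr ?mulr0// => j _; rewrite A0 surv0 subr0.
elim/last_ind: u Y t x => [|u i IH] Y t x t0 x0; rewrite (renewal_open Y _ t0 x0).
  rewrite indicE mem_set// mul1e big_nil mul1r/= expr0 fact0 divr1 mulr1.
  rewrite (@eq_renewal_int _ (fun _ => cst 0)); last first.
    by move=> s y _ _; apply: gs0 => j; apply/seteqP; split => // v /=; rewrite /child_labels/=; case: v.
  rewrite /renewal_int integral0_eq ?adde0// => s _.
  by rewrite (_ : Q _ _ _ _ = 0) ?mule0//; apply: integral0_eq => y _; rewrite mule0.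
rewrite indicE memNset; last by case: u {IH}.
rewrite mul0e add0e.
pose c := (\prod_(j <- rcons u i) tail_prob j)%R.
have c0 : (0 <= c)%R by apply: prodr_ge0 => j _; exact: tail_prob_ge0.
pose q := Q rho t (cst 1) x.
have q0 : 0 <= q by apply: Q_ge0 => //; exact: ltW.
have q1 : q \is a fin_num.
  by rewrite ge0_fin_numE// (le_lt_trans (Q_cst_le rho t _ (ltW x0)))// ltry.
pose n := size u.
pose b s : R := (c * (expR (- beta * s) * ((beta * s) ^+ n / n`!%:R)))%R.
have b0 s : (0 < s)%R -> (0 <= b s)%R.
  by move=> s0; rewrite mulr_ge0// mulr_ge0 ?expR_ge0// divr_ge0// exprn_ge0// mulr_ge0 ?ltW.
rewrite (@eq_renewal_int _ (fun s y => (b s)%:E * Q rho s (cst 1) (Num.max 0%R y))); last first.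
  move=> s y s0 y0; rewrite max_r ?(ltW y0)//.
  transitivity ((tail_prob i)%:E * (surv (sub_bbm Y i) rho [set u] s y)%:E); last first.
    by rewrite IH// muleA -EFinM; congr (_%:E * _); rewrite /b /c -cats1 big_cat big_seq1/=; ring.
  rewrite offspring_survE tail_probE muleC -nneseriesZl//; apply: eq_eseriesr => k _.
  rewrite EFinM muleCA; congr (_ * _); rewrite -EFinM; congr EFin.
  have cl j : child_labels [set rcons u i] j = if j == i then [set u] else set0.
    apply/seteqP; split => v; rewrite /child_labels/=.
      by move=> /eqP; rewrite eqseq_rcons => /andP[/eqP -> /eqP ->]; rewrite eqxx.
    by case: eqP => // -> /= ->.
  have [ik|ik] := ltnP i k; last first.
    rewrite mulr0 big1 ?subrr// => j _; rewrite cl ifF ?surv0 ?subr0//.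
    by apply/negbTE; rewrite neq_ltn (leq_trans (ltn_ord j) ik).
  rewrite mulr1 (bigD1 (Ordinal ik))//= cl eqxx big1 ?mulr1 ?subKr// => j ji.
  rewrite cl ifF ?surv0 ?subr0//; apply/negbTE; apply: contra ji => /eqP e.
  by apply/eqP/val_inj.
pose K : R := (c * (expR (- beta * t) * (beta ^+ n.+1 / n`!%:R)))%R.
(* By the semigroup property the motions before and after the first branching join to [q], which
   does not depend on [s]; only a power of [t - s] is left to integrate. *)
have step s : (0 < s)%R -> (s < t)%R -> (beta * expR (- beta * s))%:E *
    Q rho s (fun y => (b (t - s))%:E * Q rho (t - s) (cst 1) (Num.max 0%R y)) x
   = K%:E * ((t - s) ^+ n)%:E * q.
  move=> s0 st; have ts : (0 < t - s)%R by rewrite subr_gt0.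
  have m1 : measurable_fun [set: R] (cst (1 : \bar R)) by exact: measurable_cst.
  have mQ := measurable_Qmax (t - s) m1 (fun _ _ => lee01).
  rewrite (QZ _ _ mQ (b0 _ ts) _ (ltW x0)); last first.
    by move=> y y0; apply: Q_ge0 => //; rewrite le_max lexx.
  rewrite (@eq_Q _ _ _ _ (Q rho (t - s) (cst 1))); last by move=> y y0; rewrite max_r ?(ltW y0).
  rewrite Q_semigroup//.
  rewrite (addrC s) subrK -/q !muleA -!EFinM; congr (_%:E * _).
  rewrite /K /b.
  have -> : expR (- beta * t) = (expR (- beta * s) * expR (- beta * (t - s)))%R.
    by rewrite -expRD; congr expR; ring.
  by rewrite exprMn exprS; ring.
rewrite /renewal_int.
transitivity (\int[mu]_(s in `]0%R, t[) (K%:E * ((t - s) ^+ n)%:E * q)).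
  by apply: eq_integral => s; rewrite inE/= in_itv/= => /andP[s0 st]; exact: step.
have K0 : (0 <= K)%R.
  by rewrite mulr_ge0// mulr_ge0 ?expR_ge0// divr_ge0// exprn_ge0// ltW.
have mX : measurable_fun (`]0%R, t[%classic : set R) (fun s : R => ((t - s) ^+ n)%:E).
  apply: measurable_funTS; apply/measurable_EFinP; apply: measurable_funX; exact: measurable_funB.
have X0 s : (`]0%R, t[%classic : set R) s -> 0 <= ((t - s) ^+ n)%:E.
  by rewrite /= in_itv/= => /andP[_ st]; rewrite lee_fin exprn_ge0// subr_ge0 ltW.
rewrite ge0_integralZr//; last 2 first.
- exact: emeasurable_funM.
- by move=> s hs; rewrite mule_ge0// ?lee_fin// -lee_fin X0.
rewrite ge0_integralZl//.
rewrite integral_subX// -EFinM; congr (_%:E * _).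
rewrite size_rcons -/n -/c /K factS natrM exprMn exprS; field.
by rewrite pnatr_eq0 -lt0n fact_gt0/= nat1r pnatr_eq0.
Qed.

Definition mean_real : R := fine (mean_offspring p).

Section mean.
Hypotheses (m_gt0 : 0 < mean_offspring p) (m_lt1 : mean_offspring p < 1).

Lemma mean_realE : mean_offspring p = mean_real%:E.
Proof. by rewrite fineK// ge0_fin_numE ?ltW// (lt_trans m_lt1)// ltry. Qed.

(** The many-to-one formula. Summing [surv_single] over the labels of size n gives a Poisson weight
    times m^n, and the exponential series turns e^(-beta t) into e^(-beta (1 - m) t). *)
Lemma killed_mean_eq Y t x : (0 < t)%R -> (0 < x)%R ->
  killed_mean Y rho x t = (expR (- decay_rate beta p * t))%:E * Q rho t (cst 1) x.
Proof.
move=> t0 x0; rewrite /killed_mean.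
have ma u : measurable [set w | killed_alive Y rho x t w u].
  have aY := adaptedT Y (@measurable_id _ T setT).
  exact: (measurable_killed_alive rho u aY (measurable_cst t) (measurable_cst x)).
pose a u (w : T) : \bar R := (\1_[set w | killed_alive Y rho x t w u] w)%:E.
have ga0 n w : 0 <= oapp (a ^~ w) 0 (pickle_inv n : option label).
  by case: (pickle_inv n : option label) => //= u; rewrite lee_fin.
transitivity (\int[P]_w \sum_(0 <= n <oo) oapp (a ^~ w) 0 (pickle_inv n : option label)).
  by apply: eq_integral => w _; rewrite killed_bbm_ray label_esum// => u; rewrite lee_fin.
rewrite integral_nneseries//; last first.
  move=> n; case: (pickle_inv n : option label) => [u|] /=; last exact: measurable_cst.
  by apply/measurable_EFinP; exact: measurable_indic.
pose q := Q rho t (cst 1) x.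
have q0 : 0 <= q by apply: Q_ge0 => //; exact: ltW.
pose c n : R := (expR (- beta * t) * ((beta * t) ^+ n / n`!%:R))%R.
have c0 n : (0 <= c n)%R.
  by rewrite mulr_ge0 ?expR_ge0// divr_ge0// exprn_ge0// mulr_ge0 ?ltW.
have pt0 u : (0 <= \prod_(i <- u) tail_prob i)%R by apply: prodr_ge0 => i _; exact: tail_prob_ge0.
have qE : q = (fine q)%:E.
  by rewrite fineK// ge0_fin_numE// (le_lt_trans (Q_cst_le rho t _ (ltW x0)))// ltry.
have qr0 : (0 <= fine q)%R by rewrite fine_ge0.
pose c' n : R := (c n * fine q)%R.
have c'0 n : (0 <= c' n)%R by rewrite mulr_ge0.
pose b (u : label) : \bar R := (c' (size u))%:E * (\prod_(i <- u) tail_prob i)%:E.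
have b0 u : 0 <= b u by rewrite !mule_ge0// lee_fin.
transitivity (\sum_(0 <= n <oo) oapp b 0 (pickle_inv n : option label)).
  apply: eq_eseriesr => n _; case: (pickle_inv n : option label) => [u|] /=; last by rewrite integral0.
  rewrite integral_indic// setIT.
  rewrite (_ : [set w | _] = some_killed_alive Y rho [set u] x t); last first.
    by apply/seteqP; split => w /=; [move=> h; exists u|move=> [v ->]].
  apply: (etrans (esym (survE Y rho [set u] t x))).
  by rewrite surv_single// -/q qE -!EFinM; congr EFin; rewrite /c' /c; ring.
rewrite -label_esum//.
rewrite (label_esum_size (c := fun n => (c' n)%:E) (a := fun u => \prod_(i <- u) tail_prob i)%R)//.
transitivity (\esum_(n in [set: nat]) ((expR (- beta * t) * fine q)%:E *
    (exp_coeff (beta * mean_real * t) n)%:E)).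
  apply: eq_esum => n _; rewrite label_esumZ//.
  rewrite (@esum_size_prod R _ mean_real)//; last by rewrite sum_tail_prob mean_realE.
    by rewrite -!EFinM; congr EFin; rewrite /c' /c /exp_coeff/= !exprMn; ring.
  by move=> i; exact: tail_prob_ge0.
have mr0 : (0 <= mean_real)%R by rewrite fine_ge0// ltW.
have e0 n : 0 <= (exp_coeff (beta * mean_real * t) n)%:E.
  by rewrite lee_fin exp_coeff_ge0// !mulr_ge0// ltW.
have C0 : (0 <= expR (- beta * t) * fine q)%R by rewrite mulr_ge0 ?expR_ge0.
rewrite -nneseries_esumT; last by move=> n; rewrite mule_ge0.
rewrite nneseriesZl//.
have -> : \sum_(0 <= n <oo) (exp_coeff (beta * mean_real * t) n)%:E = (expR (beta * mean_real * t))%:E.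
  apply/cvg_lim => //.
  rewrite (_ : (fun n => _) = EFin \o series (exp_coeff (beta * mean_real * t))); last first.
    by apply/funext => n /=; rewrite sumEFin.
  apply: cvg_EFin; first by apply: nearW.
  exact: is_cvg_series_exp_coeff.
rewrite -/q qE -!EFinM; congr EFin; rewrite mulrAC -expRD; congr (expR _ * _)%R.
by rewrite /decay_rate -/mean_real; ring.
Qed.

End mean.
End generations.

(** * Comparison for the renewal equation *)

Section renewal_operator.
Context {R : realType}.
Variables (beta rho : R).
Hypothesis beta0 : 0 < beta.
Local Notation mu := (@lebesgue_measure R).
Local Notation RI := (@renewal_int R beta rho).
Local Open Scope ereal_scope.
Implicit Types g h : R -> R -> \bar R.

(** Nonnegativity is asked only for [y > 0], where the killed process lives. *)
Definition mnn g := measurable_fun setT (fun z : R * R => g z.1 z.2) /\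
  (forall s y, (0 < y)%R -> 0 <= g s y).

Lemma mnn_slice g s : mnn g -> measurable_fun setT (g s) /\ (forall y, (0 < y)%R -> 0 <= g s y).
Proof.
move=> [mg g0]; split => [|y]; last exact: g0.
exact: (measurableT_comp mg (measurable_fun_pair (measurable_cst s) (@measurable_id _ R setT))).
Qed.

Lemma mnn_cst (c : R) : (0 <= c)%R -> mnn (fun _ _ => c%:E).
Proof. by move=> c0; split => [|s y _]; [exact: measurable_cst|rewrite lee_fin]. Qed.

Lemma mnnD g h : mnn g -> mnn h -> mnn (fun s y => g s y + h s y).
Proof. by move=> [mg g0] [mh h0]; split => [|s y y0]; [exact: emeasurable_funD|rewrite adde_ge0// ?g0 ?h0]. Qed.

Lemma mnnZ (c : R) g : (0 <= c)%R -> mnn g -> mnn (fun s y => c%:E * g s y).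
Proof. by move=> c0 [mg g0]; split => [|s y y0]; [exact: measurable_funeM|rewrite mule_ge0 ?lee_fin// g0]. Qed.

Lemma mnn_shift N g : mnn g -> mnn (fun s => g (N + s)%R).
Proof.
move=> [mg g0]; split => [|s y]; last exact: g0.
have m1 : measurable_fun setT (fun z : R * R => (N + z.1)%R) by apply: measurable_funD => //; exact: measurable_fst.
exact: (measurableT_comp mg (measurable_fun_pair m1 (@measurable_snd _ _ R R))).
Qed.

Lemma rate_ge0 s : 0 <= (beta * expR (- beta * s))%:E.
Proof. by rewrite lee_fin mulr_ge0 ?expR_ge0// ltW. Qed.

Lemma integrand_ge0 g t x s : mnn g -> (0 <= x)%R ->
  0 <= (beta * expR (- beta * s))%:E * Q rho s (g (t - s)%R) x.
Proof.
move=> mg x0; apply: mule_ge0; first exact: rate_ge0.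
by apply: Q_ge0 => // y y0; have [_ g0] := mg; exact: g0.
Qed.

Lemma measurable_integrand g t x D : mnn g -> (0 <= x)%R ->
  measurable_fun D (fun s => (beta * expR (- beta * s))%:E * Q rho s (g (t - s)%R) x).
Proof. by move=> [mg g0] x0; apply: measurable_funTS; exact: measurable_renewal_integrand. Qed.

Lemma RI_ge0 g t x : mnn g -> (0 <= x)%R -> 0 <= RI g t x.
Proof. by move=> mg x0; apply: integral_ge0 => s _; exact: integrand_ge0. Qed.

Lemma le_RI g h t x : mnn g -> mnn h -> (0 <= x)%R ->
  (forall s y, (0 < s < t)%R -> (0 < y)%R -> g s y <= h s y) -> RI g t x <= RI h t x.
Proof.
move=> mg mh x0 gh; apply: ge0_le_integral => //.
- by move=> s _; exact: integrand_ge0.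
- exact: measurable_integrand.
- exact: measurable_integrand.
- move=> s /=; rewrite in_itv/= => /andP[s0 st]; apply: lee_wpmul2l; first exact: rate_ge0.
  have [mgs gs0] := mnn_slice (t - s)%R mg; have [mhs hs0] := mnn_slice (t - s)%R mh.
  by apply: le_Q => // y y0; apply: gh => //; rewrite subr_gt0 st/= gtrBl.
Qed.

Lemma RID g h t x : mnn g -> mnn h -> (0 <= x)%R ->
  RI (fun s y => g s y + h s y) t x = RI g t x + RI h t x.
Proof.
move=> mg mh x0; rewrite /renewal_int -ge0_integralD//.
- apply: eq_integral => s _.
  have [mgs gs0] := mnn_slice (t - s)%R mg; have [mhs hs0] := mnn_slice (t - s)%R mh.
  by rewrite QD// ge0_muleDr//; apply: Q_ge0.
- by move=> s _; exact: integrand_ge0.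
- exact: measurable_integrand.
- by move=> s _; exact: integrand_ge0.
- exact: measurable_integrand.
Qed.

Lemma integral_rate b t : (0 < b)%R -> (0 < t)%R ->
  \int[mu]_(s in `]0%R, t[) (b * expR (- b * s))%:E = (1 - expR (- b * t))%:E.
Proof.
move=> b0 t0; rewrite EFinB -exponential_prob_itv0c// /exponential_prob.
have mp := @measurable_exponential_pdf R b.
rewrite -(integral_itv_bndoo true false); last first.
  by apply/measurable_EFinP; apply: measurable_funTS; apply: measurable_funM => //; exact: measurableT_comp.
by apply: eq_integral => s; rewrite inE/= in_itv/= => /andP[s0 _]; rewrite exponential_pdfE.
Qed.

(** The density of the branching time has mass at most 1 and [Q] is sub-Markov. With a factor
    [gam < 1] the operator is thus a contraction, as used in [comparison]. *)
Lemma RI_cst (c : R) t x : (0 <= c)%R -> (0 < t)%R -> (0 <= x)%R -> RI (fun _ _ => c%:E) t x <= c%:E.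
Proof.
move=> c0 t0 x0.
apply: (@le_trans _ _ (\int[mu]_(s in `]0%R, t[) ((beta * expR (- beta * s))%:E * c%:E))).
  apply: ge0_le_integral => //.
  - by move=> s _; exact: (@integrand_ge0 (fun _ _ => c%:E) t x s (mnn_cst c0) x0).
  - exact: (@measurable_integrand (fun _ _ => c%:E) t x _ (mnn_cst c0) x0).
  - by apply: emeasurable_funM => //; apply: measurable_funTS; exact: measurable_rate.
  - by move=> s _; rewrite lee_wpmul2l ?rate_ge0//; exact: (Q_cst_le rho s (k := c%:E)).
rewrite ge0_integralZr//; last 2 first.
- by apply: measurable_funTS; exact: measurable_rate.
- by move=> s _; exact: rate_ge0.
by rewrite integral_rate// -EFinM lee_fin ler_piMl// gerBl expR_ge0.
Qed.

(* Iterating the two inequalities n times leaves a gap of at most gam ^ n. *)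
Lemma comparison (A1 A2 h : R -> R -> \bar R) (gam S : R) : mnn A1 -> mnn A2 ->
  (forall s y, (0 < y)%R -> A1 s y <= 1) -> (0 <= gam < 1)%R ->
  (forall s y, (0 < s <= S)%R -> (0 < y)%R ->
    A1 s y <= h s y + RI (fun s y => gam%:E * A1 s y) s y) ->
  (forall s y, (0 < s <= S)%R -> (0 < y)%R ->
    h s y + RI (fun s y => gam%:E * A2 s y) s y <= A2 s y) ->
  forall s y, (0 < s <= S)%R -> (0 < y)%R -> A1 s y <= A2 s y.
Proof.
move=> m1 m2 A11 /andP[g0 g1] sub sup.
have key n s y : (0 < s <= S)%R -> (0 < y)%R -> A1 s y <= A2 s y + (gam ^+ n)%:E.
  elim: n s y => [|n IH] s y /andP[s0 sS] y0.
    rewrite expr0; apply: (le_trans (A11 s y y0)); rewrite leeDr//.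
    by have [_ h2] := m2; exact: h2.
  have gn0 : (0 <= gam ^+ n.+1)%R by rewrite exprn_ge0.
  have y0' := ltW y0.
  apply: (@le_trans _ _ (h s y + RI (fun s y => gam%:E * A2 s y + (gam ^+ n.+1)%:E) s y)).
    apply: (le_trans (sub s y _ y0)); first by rewrite s0.
    apply: leeD2l; apply: le_RI => //; first exact: mnnZ.
      by apply: mnnD; [exact: mnnZ|exact: mnn_cst].
    move=> r z /andP[r0 rs] z0; rewrite exprS EFinM -muleDr//; last first.
      by rewrite ge0_adde_def// inE ?lee_fin ?exprn_ge0//; have [_ h2] := m2; exact: h2.
    apply: lee_wpmul2l; first by rewrite lee_fin.
    by apply: IH => //; rewrite r0/= (le_trans (ltW rs)).
  rewrite RID; [|exact: mnnZ|exact: mnn_cst|exact: y0'].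
  rewrite addeA; apply: leeD; first by apply: sup => //; rewrite s0.
  exact: RI_cst.
move=> s y sS y0; apply/lee_addgt0Pr => e e0.
have : (gam ^+ n @[n --> \oo] --> (0 : R))%R by apply: cvg_expr; rewrite ger0_norm.
move=> /cvgrPdist_lt /(_ _ e0) [n _ /(_ n (leqnn n))].
rewrite sub0r normrN ger0_norm ?exprn_ge0// => ne.
by apply: (le_trans (key n s y sS y0)); rewrite leeD2l// lee_fin ltW.
Qed.

Section linear.
Variable psi : R -> \bar R.
Hypotheses (mpsi : measurable_fun setT psi) (psi0 : forall y, (0 < y)%R -> 0 <= psi y).

(* [linear_sol gam] solves the linear equation A = source_term + RI (gam * A). *)
Definition source_term s y : \bar R := (expR (- beta * s))%:E * Q rho s psi (Num.max 0%R y).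
Definition linear_sol (gam : R) s y : \bar R :=
  (expR (- (beta * (1 - gam)) * s))%:E * Q rho s psi (Num.max 0%R y).

Lemma mnn_linear_sol gam : mnn (linear_sol gam).
Proof.
have m0 (z : R * R) : (0 <= Num.max 0 z.2)%R by rewrite le_max lexx.
split => [|s y y0]; last first.
  by rewrite mule_ge0 ?lee_fin ?expR_ge0//; apply: Q_ge0 => //; exact: (m0 (s, y)).
have mm : measurable_fun setT (fun z : R * R => Num.max 0%R z.2).
  by apply: measurable_maxr => //; exact: measurable_snd.
apply: emeasurable_funM.
  apply/measurable_EFinP; apply: measurableT_comp => //; apply: measurable_funM => //.
exact: (@measurable_Q R _ (R * R)%type rho fst _ (fun z => psi z.2) (@measurable_fst _ _ R R) mm
  (measurableT_comp mpsi (@measurable_snd _ _ (R * R)%type R)) (fun _ y => @psi0 y) m0).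
Qed.

(** Variation of constants: under the integral Q_r Q_(s - r) psi equals Q_s psi for every r, so what
    remains is the scalar identity e^(-beta s) + e^(-beta (1 - gam) s) (1 - e^(-beta gam s)) =
    e^(-beta (1 - gam) s). *)
Lemma linear_solE gam s y : (0 < gam)%R -> (0 < s)%R -> (0 < y)%R ->
  source_term s y + RI (fun s y => gam%:E * linear_sol gam s y) s y = linear_sol gam s y.
Proof.
move=> g0 s0 y0; have y0' := ltW y0; rewrite /source_term/linear_sol max_r//.
pose q := Q rho s psi y; have q0 : 0 <= q by exact: Q_ge0.
have bg : (0 < beta * gam)%R by rewrite mulr_gt0.
transitivity ((expR (- beta * s))%:E * q + (expR (- (beta * (1 - gam)) * s))%:E *
    ((1 - expR (- (beta * gam) * s))%:E * q)); last first.
  rewrite !muleA -EFinM -ge0_muleDl ?lee_fin ?expR_ge0//; last first.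
    rewrite mulr_ge0 ?expR_ge0// subr_ge0 -[leRHS]expR0 ler_expR mulNr oppr_le0.
    by rewrite mulr_ge0 ?ltW.
  congr (_ * _); rewrite -EFinD mulrBr mulr1 -expRD; congr EFin.
  by rewrite [X in (expR X + _)%R](_ : _ = - (beta * (1 - gam)) * s + - (beta * gam) * s)%R; ring.
congr (_ + _); rewrite -integral_rate//.
rewrite -ge0_integralZr//; last 2 first.
- apply/measurable_EFinP; apply: measurable_funTS; apply: measurable_funM => //.
  by apply: measurableT_comp => //; exact: measurable_funM.
- by move=> r _; rewrite lee_fin mulr_ge0 ?expR_ge0// ltW.
rewrite -ge0_integralZl//; last 2 first.
- apply: emeasurable_funM => //; apply/measurable_EFinP; apply: measurable_funTS.
  by apply: measurable_funM => //; apply: measurableT_comp => //; exact: measurable_funM.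
- by move=> r _; rewrite mule_ge0// lee_fin mulr_ge0 ?expR_ge0// ltW.
apply: eq_integral => r; rewrite inE/= in_itv/= => /andP[r0 rs].
have sr : (0 < s - r)%R by rewrite subr_gt0.
rewrite (@eq_Q _ _ _ _ (fun z => (gam * expR (- (beta * (1 - gam)) * (s - r)))%:E *
    Q rho (s - r) psi (Num.max 0%R z))); last by move=> z z0; rewrite EFinM muleA.
have mQ := measurable_Qmax rho (s - r)%R mpsi psi0.
have c0 : (0 <= gam * expR (- (beta * (1 - gam)) * (s - r)))%R by rewrite mulr_ge0 ?expR_ge0// ltW.
have Q0 z : (0 < z)%R -> 0 <= Q rho (s - r)%R psi (Num.max 0%R z).
  by move=> _; apply: Q_ge0 => //; rewrite le_max lexx.
rewrite (QZ rho r mQ c0 Q0 y0').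
rewrite (@eq_Q _ _ _ _ (Q rho (s - r) psi)); last by move=> z z0; rewrite max_r ?(ltW z0).
rewrite (Q_semigroup rho mpsi psi0 r0 sr y0) (addrC r) subrK -/q !muleA -!EFinM; congr (_%:E * _).
have -> : (expR (- (beta * (1 - gam)) * (s - r)) = expR (- (beta * (1 - gam)) * s) *
    expR ((beta * (1 - gam)) * r))%R by rewrite -expRD; congr expR; ring.
have -> : (expR (- beta * r) = expR (- (beta * gam) * r) * expR (- (beta * (1 - gam)) * r))%R.
  by rewrite -expRD; congr expR; ring.
have e : (expR (- (beta * (1 - gam)) * r) * expR (beta * (1 - gam) * r) = 1)%R.
  by rewrite -expRD mulNr addNr expR0.
transitivity (beta * gam * expR (- (beta * gam) * r) * expR (- (beta * (1 - gam)) * s) *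
   (expR (- (beta * (1 - gam)) * r) * expR (beta * (1 - gam) * r)))%R; first by ring.
by rewrite e; ring.
Qed.

Variables (A G : R -> R -> \bar R).
Hypotheses (mA : mnn A) (mG : mnn G).
Hypothesis AE : forall s y, (0 < s)%R -> (0 < y)%R -> A s y = source_term s y + RI G s y.

(** With the nonlinear term at most [gam * A], the function [A] is a subsolution of the linear
    equation, and [comparison] puts it below the solution. *)
Lemma linear_upper gam s y : (0 < gam < 1)%R -> (forall s y, (0 < y)%R -> A s y <= 1) ->
  (forall s y, (0 < s)%R -> (0 < y)%R -> G s y <= gam%:E * A s y) ->
  (0 < s)%R -> (0 < y)%R -> A s y <= linear_sol gam s y.
Proof.
move=> /andP[g0 g1] A1 GA s0 y0.
apply: (comparison (h := source_term) (gam := gam) (S := s)) => //.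
- exact: mnn_linear_sol.
- by rewrite (ltW g0).
- move=> r z /andP[r0 _] z0; rewrite (AE r0 z0); apply: leeD2l.
  apply: le_RI; [exact: mG|by apply: mnnZ; [exact: ltW|]|exact: ltW|].
  by move=> r' z' /andP[r'0 _] z'0; exact: GA.
- by move=> r z /andP[r0 _] z0; rewrite linear_solE.
- by rewrite s0 lexx.
Qed.

Lemma linear_lower gam S s y : (0 < gam < 1)%R -> (forall y, (0 < y)%R -> psi y <= 1) ->
  (forall s y, (0 < s <= S)%R -> (0 < y)%R -> gam%:E * A s y <= G s y) ->
  (0 < s <= S)%R -> (0 < y)%R -> linear_sol gam s y <= A s y.
Proof.
move=> /andP[g0 g1] psi1 GA sS y0; have /andP[s0 sS'] := sS.
(* [comparison] asks for a bound by 1 at all times; the indicator settles the nonpositive ones,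
   which the equation never reads. *)
pose I : R -> R := \1_(`]0%R, +oo[%classic).
have I01 r : (0 <= I r <= 1)%R by rewrite /I indicE; case: (_ \in _); rewrite ?lexx ?ler01.
pose B r z := (I r)%:E * linear_sol gam r z.
have BE r : (0 < r)%R -> B r = linear_sol gam r.
  by move=> r0; apply/funext => z; rewrite /B /I indicE mem_set/= ?mul1e// in_itv/= r0.
have [mL L0] := mnn_linear_sol gam.
have mB : mnn B.
  split => [|r z z0]; last by rewrite mule_ge0// ?L0// lee_fin; have /andP[] := I01 r.
  apply: emeasurable_funM => //; apply/measurable_EFinP.
  by apply: (measurableT_comp _ (@measurable_fst _ _ R R)); exact: measurable_indic.
rewrite -BE//; apply: (comparison (h := source_term) (gam := gam) (S := S)) => //.
- move=> r z z0; have [r0|r0] := ltP 0%R r; last first.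
    by rewrite /B /I indicE memNset ?mul0e//= in_itv/= andbT; apply/negP; rewrite -leNgt.
  rewrite BE//.
  apply: (@le_trans _ _ (1 * 1)); last by rewrite mule1.
  apply: lee_pmul.
  + by rewrite lee_fin expR_ge0.
  + by apply: Q_ge0 => //; rewrite le_max lexx.
  + rewrite lee_fin -[leRHS]expR0 ler_expR mulNr oppr_le0 !mulr_ge0 ?(ltW beta0) ?(ltW r0)//.
    by rewrite subr_ge0 ltW.
  + have mz : (0 <= Num.max 0 z)%R by rewrite le_max lexx.
    apply: (@le_trans _ _ (Q rho r (cst 1) (Num.max 0%R z))); first exact: le_Q.
    exact: Q_cst_le.
- by rewrite (ltW g0).
- move=> r z /andP[r0 _] z0; rewrite BE//.
  rewrite (@eq_renewal_int _ _ _ _ (fun s y => gam%:E * linear_sol gam s y)); last first.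
    by move=> s' y' s'0 y'0; rewrite BE.
  by rewrite linear_solE.
- move=> r z /andP[r0 rS] z0; rewrite (AE r0 z0); apply: leeD2l.
  apply: le_RI; [by apply: mnnZ; [exact: ltW|]|exact: mG|exact: ltW|].
  move=> r' z' /andP[r'0 r'r] z'0; apply: GA => //.
  by rewrite r'0 (le_trans (ltW r'r)).
Qed.

End linear.

(** Branching within the first [s] units leaves a remaining time of at least [N] and gives the first
    term. For a later branching, the memoryless exponential and the semigroup property split off the
    first [s] units. *)
Lemma RI_shift g N s x : mnn g -> (0 < N)%R -> (0 < s)%R -> (0 < x)%R ->
  RI g (N + s)%R x = RI (fun r => g (N + r)%R) s x +
    (expR (- beta * s))%:E * Q rho s (fun y => RI g N (Num.max 0%R y)) x.
Proof.
move=> mg N0 s0 x0; have x0' := ltW x0; have [mg' g0] := mg.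
pose K r := (beta * expR (- beta * r))%:E * Q rho r (g (N + s - r)%R) x.
have mK : measurable_fun setT K by exact: measurable_integrand.
have K0 r : 0 <= K r by exact: integrand_ge0.
have -> : RI g (N + s)%R x = \int[mu]_(r in `]0%R, s]) K r + \int[mu]_(r in `]s, (N + s)%R[) K r.
  rewrite -(@ge0_integral_setU _ _ R mu `]0%R, s]%classic `]s, (N + s)%R[%classic)//.
  - congr (integral mu _ _); apply/seteqP; split => r /=; rewrite !in_itv/=.
      by move=> /andP[r0 rN]; case: (leP r s) => rs; [left; rewrite r0|right].
    by move=> [/andP[r0 rs]|/andP[sr rN]]; [rewrite r0 (le_lt_trans rs)// ltrDr|rewrite rN (lt_trans s0)].
  - exact: measurable_funTS.
  - by apply/disj_setPS => r /=; rewrite !in_itv/= => -[/andP[_ rs] /andP[sr _]]; move: sr; rewrite ltNge rs.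
have -> : \int[mu]_(r in `]0%R, s]) K r = RI (fun r => g (N + r)%R) s x.
  rewrite -integral_itv_bndo_bndc; last exact: measurable_funTS.
  by apply: eq_integral => r _; rewrite /K addrA.
suff -> : \int[mu]_(r in `]s, (N + s)%R[) K r =
  (expR (- beta * s))%:E * Q rho s (fun y => RI g N (Num.max 0%R y)) x by [].
(* The substitution r = s + r' is made on the whole line, hence the restriction by an indicator. *)
rewrite [LHS]integral_mkcond -(@ge0_integral_shift _ s); last 2 first.
- by apply/(measurable_restrictT _ (measurable_itv _)); exact: measurable_funTS.
- by move=> r; rewrite patchE; case: ifP.
pose I1 : R -> R := \1_(`]0%R, +oo[%classic).
pose I2 : R -> R := \1_(`]0%R, N[%classic).
have mx (y : R) : (0 <= Num.max 0 y)%R by rewrite le_max lexx.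
pose H y r : \bar R := (beta * expR (- beta * r))%:E * Q rho r (g (N - r)%R) (Num.max 0%R y).
have H0 y r : 0 <= H y r by exact: integrand_ge0.
pose F (z : R * R) : \bar R := (I1 z.1 * kp rho s x z.1)%:E * ((I2 z.2)%:E * H z.1 z.2).
have I10 y : (0 <= I1 y * kp rho s x y)%R.
  rewrite /I1 indicE; case: (boolP (_ \in _)) => [|_]; last by rewrite mul0r.
  by rewrite inE/= in_itv/= andbT mul1r => y0; apply: kp_ge0 => //; exact: ltW.
have F0 z : 0 <= F z.
  apply: mule_ge0; first by rewrite lee_fin; exact: I10.
  by apply: mule_ge0; [rewrite lee_fin /I2 indicE|exact: H0].
have mF : measurable_fun setT F.
  apply: emeasurable_funM.
    apply/measurable_EFinP; apply: measurable_funM.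
      by apply: (measurableT_comp _ (@measurable_fst _ _ R R)); exact: measurable_indic.
    by apply: measurable_kp => //; exact: measurable_fst.
  apply: emeasurable_funM.
    apply/measurable_EFinP; apply: (measurableT_comp _ (@measurable_snd _ _ R R)).
    exact: measurable_indic.
  apply: emeasurable_funM; first exact: (measurableT_comp measurable_rate (@measurable_snd _ _ R R)).
  have m3 : measurable_fun setT (fun u : (R * R) * R => ((N - u.1.2)%R, u.2)).
    apply: measurable_fun_pair; last exact: measurable_snd.
    apply: measurable_funB => //; apply: measurableT_comp; first exact: measurable_snd.
    exact: measurable_fst.
  have mm : measurable_fun setT (fun z : R * R => Num.max 0%R z.1).
    by apply: measurable_maxr => //; exact: measurable_fst.
  exact: (@measurable_Q R _ (R * R)%type rho snd _ (fun u => g (N - u.1.2)%R u.2)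
    (@measurable_snd _ _ R R) mm (measurableT_comp mg' m3) (fun z y => @g0 (N - z.2)%R y)
    (fun z => mx z.1)).
transitivity ((expR (- beta * s))%:E * \int[mu]_r \int[mu]_y F (y, r)).
  rewrite -ge0_integralZl//; last 2 first.
  - have mF' := measurableT_comp mF (measurable_fun_pair (@measurable_snd _ _ R R) (@measurable_fst _ _ R R)).
    exact: (@measurable_fun_fubini_tonelli_F _ _ _ _ _ mu _ mF' (fun z => F0 (z.2, z.1))).
  - by move=> r _; apply: integral_ge0 => y _; exact: F0.
  apply: eq_integral => r _; rewrite patchE mem_setE in_itv/= ltrDr ltrD2r.
  case: ifPn => [/andP[r0 rN]|rN]; last first.
    rewrite integral0_eq ?mule0// => y _; rewrite /F /I2 indicE/= mem_setE in_itv/= (negbTE rN).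
    by rewrite mul0e mule0.
  have Nr : (0 < N - r)%R by rewrite subr_gt0.
  have [mgs gs0] := mnn_slice (N - r)%R mg.
  rewrite /K (_ : N + s - (r + s) = N - r)%R; last by ring.
  rewrite (addrC r s) -(Q_semigroup rho mgs gs0 s0 r0 x0).
  transitivity ((expR (- beta * s))%:E * ((beta * expR (- beta * r))%:E * Q rho s (Q rho r (g (N - r)%R)) x)).
    by rewrite muleA -EFinM; congr (_%:E * _); rewrite mulrDr expRD; ring.
  congr (_ * _); rewrite (@eq_Q _ _ _ _ (fun y => Q rho r (g (N - r)%R) (Num.max 0%R y))); last first.
    by move=> y y0; rewrite max_r ?(ltW y0).
  have mQ := measurable_Qmax rho r mgs gs0.
  have c0 : (0 <= beta * expR (- beta * r))%R by rewrite mulr_ge0 ?expR_ge0// ltW.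
  have Q0 z : (0 < z)%R -> 0 <= Q rho r (g (N - r)%R) (Num.max 0%R z) by move=> _; exact: Q_ge0.
  rewrite -(QZ rho s mQ c0 Q0 x0').
  rewrite /Q integral_mkcond; apply: eq_integral => y _.
  rewrite patchE /F /I1 /I2 !indicE !mem_setE/= !in_itv/= r0 rN andbT mul1e.
  by case: ifP; rewrite ?mul1r ?mul0r ?mul0e.
have FT : \int[mu]_y \int[mu]_r F (y, r) = \int[mu]_r \int[mu]_y F (y, r).
  exact: (@fubini_tonelli _ _ _ _ _ mu mu F mF F0).
rewrite -FT; congr (_ * _); rewrite /Q [RHS]integral_mkcond.
apply: eq_integral => y _; rewrite patchE mem_setE/= in_itv/= andbT.
case: ifPn => y0; last first.
  have F00 r : F (y, r) = 0 by rewrite /F /I1 indicE mem_setE in_itv/= andbT (negbTE y0) mul0r mul0e.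
  by apply: integral0_eq => r _; exact: F00.
have k0 : 0 <= (kp rho s x y)%:E.
  have y0' : (0 <= y)%R by exact: ltW.
  by rewrite lee_fin; apply: kp_ge0.
have mH : measurable_fun (`]0%R, N[%classic : set R) (H y) by exact: measurable_integrand.
rewrite -[RHS](ge0_integralZl mu (measurable_itv _) mH (fun r _ => H0 y r) k0).
rewrite [RHS]integral_mkcond; apply: eq_integral => r _.
rewrite patchE /F /I1 /I2 !indicE !mem_setE/= !in_itv/= y0 mul1r.
by case: ifP; rewrite ?mul1e ?mul0e ?mule0.
Qed.

End renewal_operator.

(** * Bounds for the survival probability *)

Section binomial_bounds.
Context {R : realType}.
Variable v : R.
Hypothesis v01 : 0 <= v <= 1.

Lemma bernoulli_le k : 1 - k%:R * v <= (1 - v) ^+ k.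
Proof.
case/andP: v01 => v0 v1; elim: k => [|k IH]; first by rewrite mul0r subr0 expr0.
rewrite exprS; apply: (@le_trans _ _ ((1 - v) * (1 - k%:R * v))); last by rewrite ler_wpM2l// subr_ge0.
rewrite -natr1 (_ : (1 - v) * (1 - k%:R * v) = 1 - (k%:R + 1) * v + k%:R * v * v); last by ring.
by rewrite lerDl !mulr_ge0.
Qed.

(** Bonferroni's inequality for [k] independent events, with k^2 in place of the binomial
    coefficient. *)
Lemma bonferroni_le k : (1 - v) ^+ k <= 1 - k%:R * v + (k%:R * v) ^+ 2.
Proof.
case/andP: v01 => v0 v1; elim: k => [|k IH]; first by rewrite mul0r expr0n/= subr0 addr0 expr0.
rewrite exprS; apply: (@le_trans _ _ ((1 - v) * (1 - k%:R * v + (k%:R * v) ^+ 2))).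
  by rewrite ler_wpM2l// subr_ge0.
rewrite -natr1; set x : R := k%:R; have x0 : 0 <= x by [].
have h1 : 0 <= x * x * v * v * v by rewrite !mulr_ge0.
have h2 : 0 <= x * v * v by rewrite !mulr_ge0.
have h3 : 0 <= v * v by rewrite mulr_ge0.
rewrite !expr2; nra.
Qed.

Lemma pow_gap_le k : 1 - (1 - v) ^+ k <= k%:R * v.
Proof. by have := bernoulli_le k; lra. Qed.

(** If [1 <= k * v0], the correction term alone equals [k * v]; otherwise [bonferroni_le] applies,
    and its error (k v)^2 is at most (k v) (k v0). *)
Lemma pow_gap_ge k v0 : v <= v0 ->
  k%:R * v <= (1 - (1 - v) ^+ k) + k%:R * Num.min 1 (k%:R * v0) * v.
Proof.
case/andP: v01 => vge v1 vv0; have x0 : 0 <= k%:R :> R by [].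
have [h|h] := leP 1 (k%:R * v0); first rewrite mulr1.
  have : (1 - v) ^+ k <= 1 by rewrite exprn_ile1// ?subr_ge0// gerBl.
  lra.
have := bonferroni_le k; move: x0 h; set x : R := k%:R => x0 h.
have : x * v * (x * v) <= x * (x * v0) * v.
  rewrite (_ : x * (x * v0) * v = x * v * (x * v0)); last by ring.
  by rewrite ler_wpM2l ?mulr_ge0// ler_wpM2l.
by rewrite expr2; lra.
Qed.

End binomial_bounds.

(** * The offspring generating function and its linear defect *)

Section offspring_bounds.
Context {R : realType} {p : nat -> R}.
Variable alpha : R.
Hypotheses (pd : offspring_distribution p) (alpha0 : 0 < alpha).
Hypotheses (m_gt0 : (0 < mean_offspring p)%E) (m_lt1 : (mean_offspring p < 1)%E).
Hypothesis LlogL : (\sum_(1 <= k <oo) (k%:R * ln k%:R * p k)%:E < +oo)%E.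
Local Open Scope ereal_scope.
Local Notation m := (@mean_real R p).
Local Notation off_gen := (@off_gen R p).
Implicit Types u v : R.

Let p0 k : (0 <= p k)%R. Proof. by case: pd. Qed.

Lemma off_genE v : off_gen v = \sum_(0 <= k <oo) (p k * (1 - (1 - v) ^+ k))%:E.
Proof. by apply: eq_eseriesr => k _; rewrite prodr_const card_ord. Qed.

Let pow_itv v k : (0 <= v <= 1)%R -> (0 <= 1 - (1 - v) ^+ k <= 1)%R.
Proof.
move=> /andP[v0 v1]; rewrite subr_ge0 exprn_ile1 ?subr_ge0 ?gerBl//=.
by rewrite exprn_ge0// subr_ge0.
Qed.

Lemma off_gen_itv v : (0 <= v <= 1)%R -> 0 <= off_gen v <= 1.
Proof. by move=> v01; case: pd => _ p1; exact: gen_survE. Qed.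

Lemma off_gen_le v : (0 <= v <= 1)%R -> off_gen v <= (m * v)%:E.
Proof.
move=> v01; rewrite off_genE EFinM -mean_realE// muleC -nneseriesZl//; last first.
  by move=> k _; rewrite lee_fin mulr_ge0.
apply: lee_nneseries => k.
  by move=> *; rewrite lee_fin mulr_ge0//; have /andP[] := pow_itv k v01.
move=> _; rewrite -EFinM lee_fin (_ : v * _ = p k * (k%:R * v))%R; last by ring.
by rewrite ler_wpM2l// pow_gap_le.
Qed.

(* [loss v] bounds the defect (m v - off_gen v) / v by Bonferroni; the k log k
   moment condition is exactly the summability of loss (e^(- alpha n)). *)
Definition loss v : \bar R := \sum_(0 <= k <oo) (p k * (k%:R * Num.min 1 (k%:R * v)))%:E.

Let loss_term0 v k : (0 <= v)%R -> 0 <= (p k * (k%:R * Num.min 1 (k%:R * v)))%:E.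
Proof. by move=> v0; rewrite lee_fin !mulr_ge0// le_min ler01 mulr_ge0. Qed.

Lemma loss_ge0 v : (0 <= v)%R -> 0 <= loss v.
Proof. by move=> v0; apply: nneseries_ge0 => k _ _; exact: loss_term0. Qed.

Lemma loss_fin v : (0 <= v)%R -> loss v = (fine (loss v))%:E.
Proof.
move=> v0; rewrite fineK// ge0_fin_numE ?loss_ge0//.
apply: (@le_lt_trans _ _ (mean_offspring p)); last by rewrite (lt_trans m_lt1)// ltry.
apply: lee_nneseries => k; first by move=> *; exact: loss_term0.
move=> _; rewrite lee_fin mulrC ler_wpM2r// ler_piMr// ge_min lexx.
by [].
Qed.

Lemma le_loss u v : (0 <= u)%R -> (u <= v)%R -> loss u <= loss v.
Proof.
move=> u0 uv; apply: lee_nneseries => k; first by move=> *; exact: loss_term0.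
move=> _; rewrite lee_fin !ler_wpM2l// le_min !ge_min lexx/=.
by rewrite ler_wpM2l// orbT.
Qed.

Lemma off_gen_ge v v0 : (0 <= v <= 1)%R -> (v <= v0)%R ->
  ((m - fine (loss v0)) * v)%:E <= off_gen v.
Proof.
move=> v01 vv0; have /andP[vge v1] := v01.
have v00 : (0 <= v0)%R by exact: le_trans vv0.
suff : (m * v)%:E <= off_gen v + (fine (loss v0) * v)%:E.
  have /andP[g0 g1] := off_gen_itv v01.
  have gf : off_gen v \is a fin_num by rewrite ge0_fin_numE// (le_lt_trans g1)// ltry.
  by rewrite -(fineK gf) -EFinD !lee_fin; lra.
rewrite (EFinM m) -mean_realE// muleC -nneseriesZl//; last first.
  by move=> k _; rewrite lee_fin mulr_ge0.
rewrite mulrC EFinM -(loss_fin v00) /loss -nneseriesZl//; last first.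
  by move=> k _; exact: loss_term0.
rewrite off_genE -nneseriesD; last 2 first.
- by move=> k _ _; rewrite lee_fin mulr_ge0//; have /andP[] := pow_itv k v01.
- by move=> k _ _; rewrite mule_ge0 ?lee_fin// -lee_fin; exact: loss_term0.
apply: lee_nneseries => k; first by move=> *; rewrite mule_ge0 ?lee_fin ?mulr_ge0//; case/andP: v01.
move=> _; rewrite -!EFinM -EFinD lee_fin.
have := ler_wpM2l (p0 k) (pow_gap_ge v01 k vv0); set mn := Num.min _ _; lra.
Qed.

Let q : R := expR (- alpha).

Let q01 : (0 < q < 1)%R.
Proof. by rewrite expR_gt0 -expR0 ltr_expR oppr_lt0. Qed.

Let expRn n : expR (- alpha * n%:R) = (q ^+ n)%R.
Proof. by rewrite -expRM_natr. Qed.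

(** The terms are at most 1 up to about n = ln k / alpha and decay geometrically afterwards; this is
    where the logarithm of the moment condition arises. *)
Lemma sum_min_exp k : (1 <= k)%N ->
  \sum_(0 <= n <oo) (Num.min 1 (k%:R * expR (- alpha * n%:R)))%:E <=
  (ln k%:R / alpha + (1 + (1 - q)^-1))%:E.
Proof.
move=> k1; have kp : (0 < k%:R :> R)%R by rewrite ltr0n.
have lk0 : (0 <= ln k%:R :> R)%R by rewrite ln_ge0// ler1n.
have /andP[q0 q1] := q01.
have t0 n : 0 <= (Num.min 1 (k%:R * expR (- alpha * n%:R)))%:E.
  by rewrite lee_fin le_min ler01 mulr_ge0 ?expR_ge0.
pose M := (Num.truncn (ln k%:R / alpha)).+1.
have M1 : (M%:R <= ln k%:R / alpha + 1 :> R)%R.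
  by rewrite /M -natr1 lerD2r truncn_le// divr_ge0// ltW.
have M2 : (ln k%:R <= alpha * M%:R :> R)%R.
  by rewrite mulrC -ler_pdivrMr//; exact/ltW/truncnS_gt.
rewrite (nneseries_split 0 M)// add0n addrA EFinD; apply: leeD.
  apply: (@le_trans _ _ M%:R%:E); last by rewrite lee_fin.
  rewrite sumEFin lee_fin; apply: (@le_trans _ _ (\sum_(0 <= n < M) 1)%R).
    by apply: ler_sum => n _; rewrite ge_min lexx.
  by rewrite big_const_nat subn0 iter_addr addr0.
rewrite -nneseries_addn//.
have -> : ((1 - q)^-1)%:E = \sum_(0 <= n <oo) (q ^+ n)%:E.
  apply/esym/cvg_lim => //.
  rewrite (_ : (fun n => _) = EFin \o series (geometric 1 q)); last first.
    by apply/funext => n /=; rewrite sumEFin; congr EFin; apply: eq_bigr => i _; rewrite /= mul1r.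
  apply: cvg_EFin; first by apply: nearW.
  rewrite -[X in _ --> X]mul1r; apply: cvg_geometric_series.
  by rewrite ger0_norm// ltW.
apply: lee_nneseries => // n _; rewrite lee_fin ge_min; apply/orP; right.
rewrite natrD mulrDr expRD expRn mulrCA ler_piMr ?exprn_ge0 ?(ltW q0)//.
rewrite -[X in (X * _)%R](lnK (x := k%:R)) ?posrE// -expRD -[leRHS]expR0 ler_expR mulNr subr_le0//.
Qed.

(** Exchanging the sums over [n] and [k] leaves at most p_k k (ln k / alpha + C), which is summable
    by the k log k condition and the finite mean. *)
Lemma sum_loss : \sum_(0 <= n <oo) loss (expR (- alpha * n%:R)) < +oo.
Proof.
have e0 n : (0 <= expR (- alpha * n%:R))%R by exact: expR_ge0.
rewrite /loss nneseries_interchange; last by move=> n k; exact: loss_term0.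
pose C : R := (1 + (1 - q)^-1)%R.
have C0 : (0 <= C)%R by have /andP[_ q1] := q01; rewrite addr_ge0// invr_ge0 subr_ge0 ltW.
have u0 k : 0 <= (k%:R * ln k%:R * p k)%:E.
  case: k => [|k]; first by rewrite mul0r mul0r.
  by rewrite lee_fin !mulr_ge0// ln_ge0// ler1n.
have v0 k : 0 <= (k%:R * p k)%:E by rewrite lee_fin mulr_ge0.
apply: (@le_lt_trans _ _ (\sum_(0 <= k <oo) ((alpha^-1)%:E * (k%:R * ln k%:R * p k)%:E +
    C%:E * (k%:R * p k)%:E))).
  apply: lee_nneseries => k; first by move=> *; apply: nneseries_ge0 => n _ _; exact: loss_term0.
  move=> _; case: k => [|k].
    rewrite eseries0; last by move=> n _ _; rewrite mul0r mulr0.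
    by rewrite !mul0r !mule0 adde0.
  under eq_eseriesr do rewrite mulrA EFinM.
  rewrite nneseriesZl; last by move=> n _; rewrite lee_fin le_min ler01 mulr_ge0.
  apply: (@le_trans _ _ ((p k.+1 * k.+1%:R)%:E * (ln k.+1%:R / alpha + C)%:E)).
    by apply: lee_wpmul2l; [rewrite lee_fin mulr_ge0|exact: sum_min_exp].
  rewrite -!EFinM -EFinD lee_fin le_eqVlt; apply/orP; left; apply/eqP; ring.
rewrite nneseriesD; last 2 first.
- by move=> k _ _; rewrite mule_ge0// lee_fin invr_ge0 ltW.
- by move=> k _ _; rewrite mule_ge0.
rewrite !nneseriesZl//; apply: lte_add_pinfty.
  apply: lte_mul_pinfty; rewrite ?lee_fin ?invr_ge0 ?(ltW alpha0)//.
  by rewrite nneseries_recl//= mul0r mul0r add0e.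
apply: lte_mul_pinfty; rewrite ?lee_fin//.
by rewrite (_ : \sum_(0 <= k <oo) _ = mean_offspring p)// (lt_trans m_lt1)// ltry.
Qed.

Definition loss_tail n : R := fine (\sum_(n <= i <oo) loss (expR (- alpha * i%:R))).

Let loss_exp0 i : 0 <= loss (expR (- alpha * i%:R)).
Proof. exact/loss_ge0/expR_ge0. Qed.

Lemma loss_tail_cvg : (loss_tail n @[n --> \oo] --> (0 : R))%R.
Proof. by apply: fine_cvg; apply: nneseries_tail_cvg => //; exact: sum_loss. Qed.

(** [loss] is nondecreasing, so a sum along N + i is at most the one along n + i; the bound is the
    same for every number [j] of terms. *)
Lemma loss_tail_ge n j (N : R) : (n%:R <= N)%R ->
  (\sum_(i < j) fine (loss (expR (- alpha * (N + i%:R)))) <= loss_tail n)%R.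
Proof.
move=> nN; have fin : \sum_(n <= i <oo) loss (expR (- alpha * i%:R)) \is a fin_num.
  rewrite ge0_fin_numE ?nneseries_ge0//; apply: le_lt_trans sum_loss.
  by rewrite (nneseries_split 0 n)// add0n leeDr// sume_ge0.
rewrite -lee_fin fineK// -sumEFin -nneseries_addn//.
apply: (@le_trans _ _ (\sum_(0 <= i < j) loss (expR (- alpha * (i + n)%:R)))); last first.
  by apply: nneseries_lim_ge.
rewrite big_mkord; apply: lee_sum => i _.
rewrite -loss_fin ?expR_ge0//; apply: le_loss; first exact: expR_ge0.
by rewrite ler_expR !mulNr lerN2 ler_wpM2l ?(ltW alpha0)// natrD addrC lerD2r.
Qed.

(** Keeps the reduced mean, [m] minus the loss, positive, as [linear_lower] requires of its
    parameter. *)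
Lemma loss_small : exists N0 : R, (0 < N0)%R /\
  forall N, (N0 <= N)%R -> (fine (loss (expR (- alpha * N))) < m)%R.
Proof.
have m0 : (0 < m)%R by rewrite -lte_fin -mean_realE.
have [n _ /(_ n (leqnn n))] := (cvgrPdist_lt _ _).1 loss_tail_cvg _ m0.
rewrite sub0r normrN => /(le_lt_trans (ler_norm _)) tn.
exists n.+1%:R; split => // N nN; apply: le_lt_trans tn.
have := @loss_tail_ge n 1 N (le_trans _ nN); rewrite big_ord1 addr0; apply.
by rewrite ler_nat.
Qed.

End offspring_bounds.

(** * Bounds by the linear semigroup *)

Section survival_bounds.
Context {R : realType} {d : measure_display} {T : measurableType d}.
Context {P : probability T R} {beta : R} {p : nat -> R}.
Variables (Y : bbm P beta p) (rho : R).
Hypotheses (beta0 : 0 < beta) (pd : offspring_distribution p).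
Hypotheses (m_gt0 : (0 < mean_offspring p)%E) (m_lt1 : (mean_offspring p < 1)%E).
Hypothesis LlogL : (\sum_(1 <= k <oo) (k%:R * ln k%:R * p k)%:E < +oo)%E.
Local Open Scope ereal_scope.
Local Notation m := (@mean_real R p).
Local Notation alpha := (decay_rate beta p).
Local Notation off_gen := (@off_gen R p).
Local Notation V := (surv Y rho setT).
Local Notation RI := (@renewal_int R beta rho).

Let p0 k : (0 <= p k)%R. Proof. by case: pd. Qed.

Lemma mean_real_gt0 : (0 < m)%R. Proof. by rewrite -lte_fin -mean_realE. Qed.
Lemma mean_real_lt1 : (m < 1)%R. Proof. by rewrite -lte_fin -mean_realE. Qed.

Lemma decay_rate_gt0 : (0 < alpha)%R.
Proof. by rewrite /decay_rate mulr_gt0// subr_gt0; exact: mean_real_lt1. Qed.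

Let VE s y : \bar R := (V s y)%:E.
Let G s y : \bar R := off_gen (V s y).

Let V01 s y : (0 <= V s y <= 1)%R. Proof. exact: surv_itv. Qed.

Let mV : mnn VE.
Proof.
split => [|s y _]; first by apply/measurable_EFinP; exact: measurable_surv.
by rewrite lee_fin; have /andP[] := V01 s y.
Qed.

Let mG : mnn G.
Proof.
split => [|s y _]; last by have /andP[] := off_gen_itv pd (V01 s y).
rewrite (_ : (fun z => _) = (fun z : R * R => \sum_(0 <= k <oo) (p k * (1 - (1 - V z.1 z.2) ^+ k))%:E)); last first.
  by apply/funext => z; exact: off_genE.
apply: ge0_emeasurable_sum => [k z _ _|k _].
  have /andP[v0 v1] := V01 z.1 z.2.
  by rewrite lee_fin mulr_ge0// subr_ge0 exprn_ile1 ?subr_ge0 ?gerBl.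
apply/measurable_EFinP; apply: measurable_funM => //; apply: measurable_funB => //.
by apply: measurable_funX; apply: measurable_funB => //; exact: measurable_surv.
Qed.

Let mVN N : measurable_fun setT (VE N) /\ (forall y, (0 < y)%R -> 0 <= VE N y).
Proof. exact: mnn_slice. Qed.

Lemma surv_source s y : (0 < s)%R -> (0 < y)%R ->
  VE s y = source_term beta rho (cst 1) s y + RI G s y.
Proof.
by move=> s0 y0; rewrite /VE (renewalT beta0 rho Y s0 y0) /source_term max_r ?(ltW y0).
Qed.

(** The Markov property at time [N], read off the renewal equation: the survival function at [N]
    takes over as initial datum. The second term of [RI_shift] combines with the no-branching term
    into the new source. *)
Lemma surv_shift N s y : (0 < N)%R -> (0 < s)%R -> (0 < y)%R ->
  VE (N + s)%R y = source_term beta rho (VE N) s y + RI (fun r => G (N + r)%R) s y.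
Proof.
move=> N0 s0 y0; have Ns0 : (0 < N + s)%R by rewrite addr_gt0.
have y0' := ltW y0.
suff SE : source_term beta rho (cst 1) (N + s)%R y +
    (expR (- beta * s))%:E * Q rho s (fun z => RI G N (Num.max 0%R z)) y =
    source_term beta rho (VE N) s y.
  rewrite (surv_source Ns0 y0) (@RI_shift _ _ rho beta0 G N s y mG N0 s0 y0) -SE.
  by rewrite (addeC (RI (fun r => G (N + r)%R) s y)) addeA.
have m1 : measurable_fun [set: R] (cst (1 : \bar R)) by exact: measurable_cst.
have mQ := measurable_Qmax rho N m1 (fun _ _ => lee01).
have Q0 z : (0 < z)%R -> 0 <= Q rho N (cst 1) (Num.max 0%R z).
  by move=> _; apply: Q_ge0 => //; rewrite le_max lexx.
have mR : measurable_fun setT (fun z : R => RI G N (Num.max 0%R z)).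
  pose F (z : R * R) := (\1_(`]0%R, N[%classic) z.2)%:E * ((beta * expR (- beta * z.2))%:E *
     Q rho z.2 (G (N - z.2)%R) (Num.max 0%R z.1)).
  have mx (z : R) : (0 <= Num.max 0 z)%R by rewrite le_max lexx.
  have F0 z : 0 <= F z.
    by apply: mule_ge0; [rewrite lee_fin indicE|exact: (@integrand_ge0 _ _ rho beta0 G N (Num.max 0%R z.1) z.2 mG (mx z.1))].
  have mF : measurable_fun setT F.
    apply: emeasurable_funM.
      apply/measurable_EFinP; apply: (measurableT_comp _ (@measurable_snd _ _ R R)).
      exact: measurable_indic.
    apply: emeasurable_funM; first exact: (measurableT_comp measurable_rate (@measurable_snd _ _ R R)).
    have m3 : measurable_fun setT (fun u : (R * R) * R => ((N - u.1.2)%R, u.2)).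
      apply: measurable_fun_pair; last exact: measurable_snd.
      apply: measurable_funB => //; apply: measurableT_comp; first exact: measurable_snd.
      exact: measurable_fst.
    have mm : measurable_fun setT (fun z : R * R => Num.max 0%R z.1).
      by apply: measurable_maxr => //; exact: measurable_fst.
    have [mg' g0] := mG.
    exact: (@measurable_Q R _ (R * R)%type rho snd _ (fun u => G (N - u.1.2)%R u.2)
      (@measurable_snd _ _ R R) mm (measurableT_comp mg' m3) (fun z y => @g0 (N - z.2)%R y)
      (fun z => mx z.1)).
  have := @measurable_fun_fubini_tonelli_F _ _ _ _ _ (@lebesgue_measure R) F mF F0.
  apply: eq_measurable_fun => z _; rewrite /fubini_F /renewal_int [RHS]integral_mkcond.
  apply: eq_integral => r _; rewrite patchE /F/= indicE mem_setE.
  by case: ifP; rewrite ?mul1e ?mul0e.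
have R0 z : (0 < z)%R -> 0 <= RI G N (Num.max 0%R z).
  by move=> _; apply: (@RI_ge0 _ _ rho beta0 G N _ mG); rewrite le_max lexx.
have e0 : (0 <= expR (- beta * N))%R by exact: expR_ge0.
rewrite /source_term !max_r//.
rewrite (@eq_Q _ _ _ (VE N) (fun z => (expR (- beta * N))%:E * Q rho N (cst 1) (Num.max 0%R z) +
  RI G N (Num.max 0%R z))); last first.
  move=> z z0; have zE : Num.max 0%R z = z by rewrite max_r ?(ltW z0).
  by rewrite zE (surv_source N0 z0) /source_term zE.
have mEQ := measurable_funeM (expR (- beta * N))%:E mQ.
rewrite (QD rho s mEQ mR _ R0 y0'); last by move=> z z0; rewrite mule_ge0 ?lee_fin// Q0.
rewrite (QZ rho s mQ e0 Q0 y0').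
rewrite (@eq_Q R rho s (fun z => Q rho N (cst 1) (Num.max 0%R z)) (Q rho N (cst 1)) y); last by move=> z z0; rewrite max_r ?(ltW z0).
rewrite (Q_semigroup rho m1 (fun _ _ => lee01) s0 N0 y0) (addrC s N).
set A := (expR (- beta * N))%:E * Q rho (N + s) (cst 1) y.
set B := Q rho s (fun z => RI G N (Num.max 0%R z)) y.
have A0 : 0 <= A by apply: mule_ge0; [rewrite lee_fin|exact: Q_ge0].
have B0 : 0 <= B by exact: Q_ge0.
rewrite (ge0_muleDr _ A0 B0); congr (_ + _).
by rewrite /A muleA -EFinM -expRD; congr ((expR _)%:E * _); ring.
Qed.

Let G_le s y : G s y <= m%:E * VE s y.
Proof. by rewrite -EFinM; exact: off_gen_le. Qed.

Let m01 : (0 < m < 1)%R. Proof. by rewrite mean_real_gt0 mean_real_lt1. Qed.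

Let V1 s y : VE s y <= 1. Proof. by rewrite lee_fin; have /andP[] := V01 s y. Qed.

Lemma surv_le s y : (0 < s)%R -> (0 < y)%R ->
  VE s y <= (expR (- alpha * s))%:E * Q rho s (cst 1) y.
Proof.
move=> s0 y0; have m1 : measurable_fun [set: R] (cst (1 : \bar R)) by exact: measurable_cst.
have := @linear_upper _ _ rho beta0 (cst 1) m1 (fun _ _ => lee01) VE G mV mG
  (fun s y => @surv_source s y) m s y m01 (fun s y _ => V1 s y) (fun s y _ _ => G_le s y) s0 y0.
by rewrite /linear_sol max_r ?(ltW y0).
Qed.

(** Uniform in the starting point; this is the bound on [v] at which [loss] is evaluated. *)
Lemma surv_le_exp s y : (0 < s)%R -> (0 < y)%R -> (V s y <= expR (- alpha * s))%R.
Proof.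
move=> s0 y0; rewrite -lee_fin; apply: (le_trans (surv_le s0 y0)).
rewrite -[leRHS]mule1 lee_wpmul2l ?lee_fin ?expR_ge0//.
exact: (Q_cst_le rho s lee01 (ltW y0)).
Qed.

(** Keeps only the event that the first particle has not branched by time [s]. *)
Lemma surv_ge s y : (0 < s)%R -> (0 < y)%R ->
  (expR (- beta * s))%:E * Q rho s (cst 1) y <= VE s y.
Proof.
move=> s0 y0; rewrite surv_source// /source_term max_r ?(ltW y0)// leeDl//.
exact: (@RI_ge0 _ _ rho beta0 G s y mG (ltW y0)).
Qed.

Lemma surv_shift_le N s y : (0 < N)%R -> (0 < s)%R -> (0 < y)%R ->
  VE (N + s)%R y <= (expR (- alpha * s))%:E * Q rho s (VE N) y.
Proof.
move=> N0 s0 y0; have [mv v0] := mVN N.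
have := @linear_upper _ _ rho beta0 (VE N) mv v0 (fun r => VE (N + r)%R) (fun r => G (N + r)%R)
  (mnn_shift N mV) (mnn_shift N mG) (fun s y => @surv_shift N s y N0) m s y m01
  (fun s y _ => V1 _ y) (fun s y _ _ => G_le _ y) s0 y0.
by rewrite /linear_sol max_r ?(ltW y0).
Qed.

Let h N : R := fine (@loss R p (expR (- alpha * N))).

Let h0 N : (0 <= h N)%R.
Proof. by rewrite fine_ge0// loss_ge0 ?expR_ge0. Qed.

(** After time [N] the survival probability is at most e^(-alpha N), so [off_gen_ge] gives a linear
    lower bound with mean [m - h N]. This raises the decay rate by [beta * h N], and [s <= 1] bounds
    the effect on the exponent. *)
Lemma surv_shift_ge N s y : (0 < N)%R -> (h N < m)%R -> (0 < s <= 1)%R -> (0 < y)%R ->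
  (expR (- alpha * s - beta * h N))%:E * Q rho s (VE N) y <= VE (N + s)%R y.
Proof.
move=> N0 hm s01 y0; have [mv v0] := mVN N; have /andP[s0 s1] := s01.
have mh01 : (0 < m - h N < 1)%R.
  by rewrite subr_gt0 hm/=; have := mean_real_lt1; have := h0 N; lra.
have GA (r z : R) : (0 < r <= 1)%R -> (0 < z)%R -> (m - h N)%:E * VE (N + r)%R z <= G (N + r)%R z.
  move=> /andP[r0 _] z0; rewrite -EFinM; apply: off_gen_ge => //.
  have Nr0 : (0 < N + r)%R by rewrite addr_gt0.
  apply: (le_trans (surv_le_exp Nr0 z0)).
  by rewrite ler_expR !mulNr lerN2 ler_wpM2l ?(ltW decay_rate_gt0)// lerDl ltW.
have := @linear_lower _ _ rho beta0 (VE N) mv v0 (fun r => VE (N + r)%R) (fun r => G (N + r)%R)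
  (mnn_shift N mV) (mnn_shift N mG) (fun s y => @surv_shift N s y N0) (m - h N)%R 1%R s y mh01
  (fun y _ => V1 N y) GA s01 y0.
rewrite /linear_sol max_r ?(ltW y0)//; apply: le_trans.
apply: lee_wpmul2r; first by apply: Q_ge0 => //; exact: ltW.
rewrite lee_fin ler_expR /decay_rate -/m.
rewrite (_ : - (beta * (1 - (m - h N))) * s = - (beta * (1 - m)) * s - beta * h N * s)%R; last by ring.
by rewrite lerD2l lerN2 ler_piMr// mulr_ge0// ltW.
Qed.

(** The one-step bounds at N, N + 1, ... are chained by the semigroup property; each uses the loss
    at its own starting time, so the exponents add up to a partial sum of a convergent series. *)
Lemma surv_iter N j s y : (0 < N)%R -> (forall M, (N <= M)%R -> (h M < m)%R) ->
  (0 < s <= 1)%R -> (0 < y)%R ->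
  (expR (- alpha * (j%:R + s) - beta * \sum_(i < j.+1) h (N + i%:R)))%:E *
    Q rho (j%:R + s) (VE N) y <= VE (N + (j%:R + s))%R y.
Proof.
move=> N0 hN; elim: j s y => [|j IH] s y s01 y0.
  by rewrite big_ord1 addr0 add0r; apply: surv_shift_ge => //; exact: hN.
have /andP[s0 s1] := s01; have [mv v0] := mVN N; have y0' := ltW y0.
pose M := (N + j.+1%:R)%R; have M0 : (0 < M)%R by rewrite addr_gt0// ltr0n.
have NM : (N <= M)%R by rewrite lerDl.
rewrite (_ : N + (j.+1%:R + s) = M + s)%R; last by rewrite addrA.
apply: le_trans (surv_shift_ge M0 (hN _ NM) s01 y0).
pose c : R := expR (- alpha * (j%:R + 1) - beta * \sum_(i < j.+1) h (N + i%:R)).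
have c0 : (0 <= c)%R by exact: expR_ge0.
have j10 : (0 < j%:R + 1 :> R)%R by rewrite natr1 ltr0n.
have mQ := measurable_Qmax rho (j%:R + 1)%R mv v0.
have Q0 z : (0 < z)%R -> 0 <= Q rho (j%:R + 1)%R (VE N) (Num.max 0%R z).
  by move=> _; apply: Q_ge0 => //; rewrite le_max lexx.
have [mM M0'] := mVN M.
have key : Q rho s (fun z => c%:E * Q rho (j%:R + 1)%R (VE N) (Num.max 0%R z)) y <= Q rho s (VE M) y.
  apply: le_Q => //.
  - exact: measurable_funeM.
  - by move=> z z0; rewrite mule_ge0 ?Q0.
  - move=> z z0; rewrite max_r ?(ltW z0)//.
    have H1 : (0 < (1 : R) <= 1)%R by rewrite ltr01 lexx.
    by have := IH _ z H1 z0; rewrite -/c (_ : N + (j%:R + 1) = M)%R ?natr1.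
rewrite (QZ rho s mQ c0 Q0 y0') in key.
rewrite (@eq_Q _ _ _ _ (Q rho (j%:R + 1)%R (VE N))) in key; last by move=> z z0; rewrite max_r ?(ltW z0).
rewrite (Q_semigroup rho mv v0 s0 j10 y0) in key.
have e0 : 0 <= (expR (- alpha * s - beta * h M))%:E by rewrite lee_fin expR_ge0.
apply: le_trans (lee_wpmul2l e0 key).
rewrite muleA -EFinM /c -expRD (_ : s + (j%:R + 1) = j.+1%:R + s)%R; last by rewrite natr1 addrC.
rewrite [X in (expR (_ - beta * X))%:E]big_ord_recr/= -/M.
rewrite le_eqVlt; apply/orP; left; apply/eqP; congr ((expR _)%:E * _).
by rewrite -natr1; ring.
Qed.

(* Each unit time step after N costs a factor exp (- beta * loss). *)
Definition theta (N : R) : R := expR (- beta * @loss_tail R p alpha (Num.truncn N)).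

Lemma theta_cvg : (theta N @[N --> +oo] --> (1 : R))%R.
Proof.
have lt := loss_tail_cvg pd decay_rate_gt0 m_lt1 LlogL.
have H : ((fun N : R => - beta * @loss_tail R p alpha (Num.truncn N)) N @[N --> +oo] --> - beta * 0)%R.
  apply: cvgMr; apply: (cvg_comp (fun N : R => Num.truncn N) _ _ lt).
  move=> A [n _ nA]; exists n%:R; split; first by rewrite num_real.
  by move=> x nx; apply: nA => /=; rewrite truncn_ge_nat// ltW// (le_lt_trans _ nx).
by have := cvg_comp _ _ H (@continuous_expR R _); rewrite mulr0 expR0.
Qed.

Lemma surv_sandwich : exists N0 : R, (0 < N0)%R /\ forall N t y, (N0 <= N)%R -> (N < t)%R -> (0 < y)%R ->
  (theta N * expR (- alpha * (t - N)))%:E * Q rho (t - N) (VE N) y <= VE t y /\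
  VE t y <= (expR (- alpha * (t - N)))%:E * Q rho (t - N) (VE N) y.
Proof.
have [N0 [N00 hN0]] := loss_small pd decay_rate_gt0 m_gt0 m_lt1 LlogL.
exists N0; split => // N t y N0N Nt y0; have Npos : (0 < N)%R by exact: lt_le_trans N0N.
have tN : (0 < t - N)%R by rewrite subr_gt0.
split; last by have := surv_shift_le Npos tN y0; rewrite addrC subrK.
have [mv v0] := mVN N.
(* The fractional part is taken in ]0, 1], as the one-step bound needs a positive time. *)
have [j [s [s01 jsE]]] : exists j : nat, exists s : R, (0 < s <= 1)%R /\ (t - N = j%:R + s)%R.
  have := tN; have [k kP] : exists k : nat, (t - N <= k%:R)%R.
    by exists (Num.truncn (t - N)).+1; exact/ltW/truncnS_gt.
  elim: k kP => [|k IH] kP tN'; first by move: (lt_le_trans tN' kP); rewrite ltxx.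
  have [tk|tk] := leP (t - N)%R k%:R; first exact: IH.
  exists k, (t - N - k%:R)%R; rewrite subr_gt0 tk lerBlDr nat1r kP; split => //.
  by rewrite [RHS]addrC subrK.
have := @surv_iter N j s y Npos _ s01 y0; rewrite -jsE (addrC N) subrK => H.
apply: le_trans (H _); last by move=> M NM; apply: hN0; exact: le_trans NM.
apply: lee_wpmul2r; first by apply: Q_ge0 => //; exact: ltW.
rewrite lee_fin /theta -expRD ler_expR addrC lerD2l mulNr lerN2 ler_wpM2l ?(ltW beta0)//.
apply: (loss_tail_ge pd decay_rate_gt0 m_lt1 LlogL).
by rewrite truncn_le// ltW.
Qed.

End survival_bounds.

(** * Asymptotics of the killed semigroup *)

Section exp_difference.
Context {R : realType}.

(** Both bounds come from 1 + u <= e^u. The middle term tends to [b - a], with an explicit error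
    that can be integrated later. *)
Lemma exp_diff_bounds (t a b : R) : 0 < t -> 0 <= a <= b ->
  (b - a) * (1 - b / t) <= t * (expR (- a / t) - expR (- b / t)) <= b - a.
Proof.
move=> t0 /andP[a0 ab]; have ti : 0 < t^-1 by rewrite invr_gt0.
set A := a / t; set B := b / t.
have A0 : 0 <= A by rewrite divr_ge0// ltW.
have AB : A <= B by rewrite ler_pM2r.
have -> : - a / t = - A by rewrite mulNr.
have -> : - b / t = - B by rewrite mulNr.
have -> : b - a = t * (B - A) by rewrite /A /B -mulrBl mulrCA divff ?gt_eqF// mulr1.
rewrite -mulrA !ler_pM2l//; apply/andP; split.
  have -> : expR (- A) = expR (- B) * expR (B - A) by rewrite -expRD; congr expR; ring.
  have := expR_ge1Dx (B - A); have := expR_ge1Dx (- B); have := expR_ge0 (- B).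
  set u := expR (- B); set w := expR (B - A) => u0 h1 h2.
  have h3 : u * (1 + (B - A)) <= u * w by rewrite ler_wpM2l.
  have h4 : (1 - B) * (B - A) <= u * (B - A) by rewrite ler_wpM2r ?subr_ge0//; lra.
  lra.
have -> : expR (- B) = expR (- A) * expR (A - B) by rewrite -expRD; congr expR; ring.
have := expR_ge1Dx (A - B); have := expR_gt0 (- A).
have : expR (- A) <= 1 by rewrite -[leRHS]expR0 ler_expR oppr_le0.
set u := expR (- A); set w := expR (A - B) => u1 u0 h2.
have h3 : u * (1 - w) <= u * (B - A) by rewrite ler_pM2l//; lra.
have h4 : u * (B - A) <= B - A by rewrite ler_piMl// subr_ge0.
lra.
Qed.

Lemma powR_three_half (t : R) : 0 < t -> t `^ (3 / 2) = t * Num.sqrt t.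
Proof.
move=> t0; rewrite (_ : 3 / 2 = 1 + 2^-1); last by field.
by rewrite powRD ?gt_eqF ?implybT// powRr1 ?ltW// powR12_sqrt// ltW.
Qed.

End exp_difference.

Section heat.
Context {R : realType}.
Variables (rho x : R).
Hypothesis x0 : 0 < x.
Local Notation mu := (@lebesgue_measure R).

Definition bounded_fun (phi : R -> R) := measurable_fun setT phi /\
  exists2 K, 0 <= K & forall y, 0 <= phi y <= K.

Definition Qr t (phi : R -> R) : R := fine (Q rho t (EFin \o phi) x).

Let x0' : 0 <= x. Proof. exact: ltW. Qed.

Let bfun phi : bounded_fun phi -> measurable_fun setT (EFin \o phi) /\
  (forall y : R, 0 < y -> (0 <= (EFin \o phi) y)%E).
Proof.
move=> [mphi [K K0 phiK]]; split; first exact/measurable_EFinP.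
by move=> y _; rewrite /= lee_fin; have /andP[] := phiK y.
Qed.

Lemma QrE t phi : bounded_fun phi -> ((Qr t phi)%:E = Q rho t (EFin \o phi) x)%E.
Proof.
move=> bp; have [mp p0] := bfun bp; rewrite fineK// ge0_fin_numE; last exact: Q_ge0.
case: bp => _ [K K0 phiK]; apply: (@le_lt_trans _ _ K%:E); last exact: ltry.
apply: le_trans (Q_cst_le rho t _ x0'); last by rewrite lee_fin.
apply: le_Q => //= y _; rewrite lee_fin; by have /andP[] := phiK y.
Qed.

Lemma bounded_cst c : 0 <= c -> bounded_fun (cst c).
Proof. by move=> c0; split => //; exists c => // y; rewrite c0 lexx. Qed.

Lemma bounded_indic (A : set R) : measurable A -> bounded_fun (\1_A).
Proof.
move=> mA; split; first exact: measurable_indic.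
by exists 1 => // y; rewrite indicE; case: (_ \in _); rewrite ?lexx ?ler01.
Qed.

Lemma boundedD f g : bounded_fun f -> bounded_fun g -> bounded_fun (fun y => f y + g y).
Proof.
move=> [mf [K K0 fK]] [mg [L L0 gL]]; split; first exact: measurable_funD.
exists (K + L); first exact: addr_ge0.
by move=> y; have /andP[f0 f1] := fK y; have /andP[g0 g1] := gL y; rewrite addr_ge0// lerD.
Qed.

Lemma boundedZ c f : 0 <= c -> bounded_fun f -> bounded_fun (fun y => c * f y).
Proof.
move=> c0 [mf [K K0 fK]]; split; first exact: measurable_funM.
exists (c * K); first exact: mulr_ge0.
by move=> y; have /andP[f0 f1] := fK y; rewrite mulr_ge0// ler_wpM2l.
Qed.

Lemma Qr_ge0 t f : bounded_fun f -> 0 <= Qr t f.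
Proof. by move=> bf; have [mf f0] := bfun bf; rewrite -lee_fin QrE//; exact: Q_ge0. Qed.

Lemma QrD t f g : bounded_fun f -> bounded_fun g -> Qr t (fun y => f y + g y) = Qr t f + Qr t g.
Proof.
move=> bf bg; have [mf f0] := bfun bf; have [mg g0] := bfun bg.
apply: EFin_inj; rewrite EFinD (QrE _ bf) (QrE _ bg) (QrE _ (boundedD bf bg)).
by rewrite -(QD rho t mf mg f0 g0 x0').
Qed.

Lemma QrZ t c f : 0 <= c -> bounded_fun f -> Qr t (fun y => c * f y) = c * Qr t f.
Proof.
move=> c0 bf; have [mf f0] := bfun bf.
apply: EFin_inj; rewrite EFinM (QrE _ bf) (QrE _ (boundedZ c0 bf)).
by rewrite -(QZ rho t mf c0 f0 x0').
Qed.

Lemma le_Qr t f g : bounded_fun f -> bounded_fun g -> (forall y : R, 0 < y -> f y <= g y) ->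
  Qr t f <= Qr t g.
Proof.
move=> bf bg fg; have [mf f0] := bfun bf; have [mg g0] := bfun bg.
rewrite -lee_fin (QrE _ bf) (QrE _ bg); by apply: le_Q => //.
Qed.

(* As the mass of the killed kernel escapes to infinity, only the limit of [phi]
   there matters. *)
Lemma Qr_limit (c : R -> R) (kap : R) phi (l : R) : bounded_fun phi -> 0 <= l <= 1 ->
  phi y @[y --> +oo] --> l -> (\forall t \near +oo, 0 <= c t) ->
  c t * Qr t (cst 1) @[t --> +oo] --> kap ->
  (forall M, 0 < M -> c t * Qr t (\1_(`]-oo, M])) @[t --> +oo] --> (0 : R)) ->
  c t * Qr t phi @[t --> +oo] --> kap * l.
Proof.
move=> bp /andP[l0 l1] phil c0 c1 cM; apply/cvgrPdist_le => eps eps0.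
have K0 : 0 < `|kap| + 1 by rewrite ltr_wpDl.
pose e := eps / 3 / (`|kap| + 1); have e0 : 0 < e by rewrite !divr_gt0.
have e3 : 0 < eps / 3 by rewrite divr_gt0.
have [M0 [_ M0P]] := (cvgrPdist_le _ _).1 phil _ e0.
pose M := Num.max 1 (M0 + 1); have Mpos : 0 < M by rewrite lt_max ltr01.
have b1 : bounded_fun (cst 1) by exact: bounded_cst.
have bM : bounded_fun (\1_(`]-oo, M])) by apply: bounded_indic; exact: measurable_itv.
have [K K1 phiK] := bp.2.
have far y : M < y -> `|l - phi y| <= e.
  by move=> My; apply: M0P; apply: lt_trans My; rewrite lt_max ltrDl ltr01 orbT.
have i1 y : ~ (M < y) -> (\1_(`]-oo, M]) y : R) = 1.
  by move=> /negP; rewrite -leNgt => yM; rewrite indicE mem_set//= in_itv.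
have iM y : (0 : R) <= \1_(`]-oo, M]) y by rewrite indicE.
pose B := Num.max 1 K.
have B1 : 1 <= B by rewrite le_max lexx.
have KB : K <= B by rewrite le_max lexx orbT.
have B0 : 0 <= B by exact: le_trans B1.
have le0 : 0 <= l + e by rewrite addr_ge0// ltW.
(* Beyond [M] the function is within [e] of [l]; up to [M] it is at most [B]. *)
have up t : Qr t phi <= B * Qr t (\1_(`]-oo, M])) + (l + e) * Qr t (cst 1).
  rewrite -!QrZ// -QrD//; [|exact: boundedZ..].
  apply: le_Qr => //; first by apply: boundedD; exact: boundedZ.
  move=> y y0; rewrite mulr1; have [yM|/i1 ->] := pselect (M < y).
    by have := far y yM; rewrite ler_norml => /andP[h _]; have := mulr_ge0 B0 (iM y); lra.
  by have /andP[_ h] := phiK y; lra.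
have lo t : l * Qr t (cst 1) <= Qr t phi + B * Qr t (\1_(`]-oo, M])) + e * Qr t (cst 1).
  rewrite -!QrZ//; last exact: ltW.
  rewrite -QrD//; last exact: boundedZ.
  rewrite -QrD//; [|by apply: boundedD => //; exact: boundedZ|by apply: boundedZ => //; exact: ltW].
  apply: le_Qr; [exact: boundedZ|apply: boundedD; [by apply: boundedD => //; exact: boundedZ|by apply: boundedZ => //; exact: ltW]|].
  move=> y y0; rewrite !mulr1; have [yM|/i1 ->] := pselect (M < y).
    by have := far y yM; rewrite ler_norml => /andP[_ h]; have := mulr_ge0 B0 (iM y); lra.
  by have /andP[h _] := phiK y; lra.
have n1 : \forall t \near +oo, `|kap - c t * Qr t (cst 1)| <= Num.min 1 (eps / 3).
  by apply: (cvgrPdist_le _ _).1 c1 _ _; rewrite lt_min ltr01.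
have n2 : \forall t \near +oo, `|0 - c t * Qr t (\1_(`]-oo, M]))| <= eps / 3 / B.
  by apply: (cvgrPdist_le _ _).1 (cM M Mpos) _ _; rewrite divr_gt0// (lt_le_trans ltr01).
near=> t.
have ct : 0 <= c t by near: t; exact: c0.
have : `|kap - c t * Qr t (cst 1)| <= Num.min 1 (eps / 3) by near: t; exact: n1.
have : `|0 - c t * Qr t (\1_(`]-oo, M]))| <= eps / 3 / B by near: t; exact: n2.
rewrite sub0r normrN ger0_norm ?mulr_ge0 ?Qr_ge0// ler_pdivlMr ?(lt_le_trans ltr01)// => hM.
rewrite le_min => /andP[h1 h2].
have q1 : c t * Qr t (cst 1) <= `|kap| + 1.
  rewrite -lerBlDl; apply: le_trans h1; rewrite distrC; apply: le_trans (ler_norm _).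
  by rewrite lerB// ler_norm.
have eq1 : e * (c t * Qr t (cst 1)) <= eps / 3 by rewrite /e mulrAC ler_pdivrMr// ler_wpM2l// ltW.
have U := ler_wpM2l ct (up t); have L := ler_wpM2l ct (lo t).
have lk : `|l * (kap - c t * Qr t (cst 1))| <= eps / 3.
  by rewrite normrM (ger0_norm l0); apply: le_trans h2; rewrite ler_piMl.
move: lk hM eq1 U L; rewrite !mulrDr mulrN ler_norml.
rewrite [c t * (B * _)]mulrCA [c t * (e * _)]mulrCA [c t * (l * _)]mulrCA.
rewrite [c t * ((l + e) * _)]mulrCA mulrDl.
set q := c t * Qr t (cst 1); set qM := c t * Qr t _; set qp := c t * Qr t phi.
move=> /andP[lk1 lk2] hM eq1 U L; rewrite ler_norml; apply/andP; split; lra.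
Unshelve. all: by end_near. Qed.

(* The limit of t ^ (3/2) e^(rho^2 t / 2) times the killed kernel. *)
Definition kp_bound y : R := Num.sqrt (2 / pi) * x * expR (rho * x) * (y * expR (- rho * y)).

(** The Gaussian difference in [kp] is a difference of exponentials to which [exp_diff_bounds]
    applies with b - a = 2 x y, and the factor e^(-rho^2 t / 2) cancels. The upper bound holds for
    all positive [t]. *)
Lemma kp_bounds t y : 0 < t -> 0 < y ->
  kp_bound y * (1 - (x + y) ^+ 2 / (2 * t)) <=
    t * Num.sqrt t * expR (rho ^+ 2 / 2 * t) * kp rho t x y <= kp_bound y.
Proof.
move=> t0 y0; rewrite /kp gauss_sub.
have s2 : 0 < Num.sqrt (2 * pi : R) by rewrite sqrtr_gt0 mulr_gt0// pi_gt0.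
have st : 0 < Num.sqrt t by rewrite sqrtr_gt0.
have -> : (Num.sqrt (2 * pi * t))^-1 = (Num.sqrt (2 * pi))^-1 * (Num.sqrt t)^-1.
  by rewrite sqrtrM ?mulr_ge0 ?pi_ge0// invfM.
pose a := (x - y) ^+ 2 / 2; pose b := (x + y) ^+ 2 / 2.
have aE : - (x - y) ^+ 2 / (2 * t) = - a / t by rewrite /a; field; rewrite gt_eqF.
have bE : - (x + y) ^+ 2 / (2 * t) = - b / t by rewrite /b; field; rewrite gt_eqF.
rewrite aE bE.
have baE : b - a = 2 * x * y by rewrite /a /b; field.
have ab : 0 <= a <= b.
  rewrite divr_ge0 ?sqr_ge0//= -subr_ge0 baE !mulr_ge0// ltW//.
have /andP[lo hi] := exp_diff_bounds t0 ab.
pose K := (Num.sqrt (2 * pi))^-1 * (expR (rho * x) * expR (- rho * y)).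
have K0 : 0 <= K by rewrite !mulr_ge0 ?invr_ge0 ?sqrtr_ge0 ?expR_ge0.
have kE : kp_bound y = K * (b - a).
  rewrite /kp_bound baE /K; suff -> : Num.sqrt (2 / pi) = 2 * (Num.sqrt (2 * pi))^-1 :> R by ring.
  have p0 : 0 < (pi : R) by exact: pi_gt0.
  rewrite (_ : 2 / pi = 2 ^+ 2 * (2 * pi)^-1 :> R); last by rewrite invfM mulrA expr2 mulfK.
  by rewrite sqrtrM ?sqr_ge0// sqrtr_sqr ger0_norm// sqrtrV// mulr_ge0// ltW.
have -> : t * Num.sqrt t * expR (rho ^+ 2 / 2 * t) * (expR (rho * (x - y) - rho ^+ 2 * t / 2) *
   ((Num.sqrt (2 * pi))^-1 / Num.sqrt t * (expR (- a / t) - expR (- b / t)))) =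
   K * (t * (expR (- a / t) - expR (- b / t))).
  have -> : expR (rho * (x - y) - rho ^+ 2 * t / 2) =
      expR (rho * x) * expR (- rho * y) * expR (- (rho ^+ 2 / 2 * t)).
    by rewrite -!expRD; congr expR; ring.
  have e1 : expR (rho ^+ 2 / 2 * t) * expR (- (rho ^+ 2 / 2 * t)) = 1 by rewrite -expRD addrN expR0.
  have e2 : Num.sqrt t * (Num.sqrt t)^-1 = 1 by rewrite divff// gt_eqF.
  rewrite /K; set E1 := expR (rho ^+ 2 / 2 * t) in e1 *; set E2 := expR (- (rho ^+ 2 / 2 * t)) in e1 *.
  transitivity ((Num.sqrt t * (Num.sqrt t)^-1) * (E1 * E2) * ((Num.sqrt (2 * pi))^-1 *
    (expR (rho * x) * expR (- rho * y)) * (t * (expR (- a / t) - expR (- b / t))))); first by ring.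
  by rewrite e1 e2 !mul1r.
rewrite kE; apply/andP; split; last by rewrite ler_wpM2l.
rewrite -mulrA ler_wpM2l//; apply: le_trans lo.
by rewrite (_ : (x + y) ^+ 2 / (2 * t) = b / t)// /b; field; rewrite gt_eqF.
Qed.

Lemma Qr_indic_le t M B : 0 <= B -> 0 < M -> (forall y, 0 < y -> y <= M -> kp rho t x y <= B) ->
  Qr t (\1_(`]-oo, M])) <= B * M.
Proof.
move=> B0 M0 kB; have bM : bounded_fun (\1_(`]-oo, M])) by apply: bounded_indic; exact: measurable_itv.
rewrite -lee_fin (QrE _ bM) /Q.
apply: (@le_trans _ _ (\int[mu]_(y in `]0%R, M]) (cst B%:E y))%E); last first.
  have mM : mu `]0%R, M] = M%:E by rewrite lebesgue_measure_itv/= lte_fin M0 sube0.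
  have -> : (\int[mu]_(y in `]0%R, M]) (cst B%:E y) = B%:E * mu `]0%R, M])%E by exact: integral_cst.
  by rewrite mM.
rewrite integral_mkcond [leRHS]integral_mkcond; apply: ge0_le_integral => //.
- move=> y _; rewrite patchE; case: ifPn => //; rewrite inE/= in_itv/= andbT => y0.
  by rewrite mule_ge0 ?lee_fin ?indicE// kp_ge0// ltW.
- apply/(measurable_restrictT _ (measurable_itv _)); apply: measurable_funTS; apply: measurable_kpM.
  by apply/measurable_EFinP; exact: measurable_indic.
- by apply/(measurable_restrictT _ (measurable_itv _)); exact: measurable_cst.
- move=> y _; rewrite !patchE !mem_setE/= !in_itv/= andbT.
  case: (ltP 0 y) => y0 /=; last by [].
  case: (leP y M) => yM /=; rewrite indicE mem_setE in_itv/=.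
    by rewrite yM mule1 lee_fin; exact: kB.
  by rewrite (_ : (y <= M) = false) ?mule0//; apply/negbTE; rewrite -ltNge.
Qed.

Section positive_drift.
Hypothesis rho0 : 0 < rho.

Lemma integral_exp_half : (\int[mu]_(y in `]0%R, +oo[) (expR (- (rho / 2) * y))%:E = (2 / rho)%:E)%E.
Proof.
have r2 : 0 < rho / 2 by rewrite divr_gt0.
have mp := @measurable_exponential_pdf R (rho / 2).
have e0 (y : R) : (0 <= (exponential_pdf (rho / 2) y)%:E)%E by rewrite lee_fin exponential_pdf_ge0// ltW.
have := integral_exponential_pdf r2.
rewrite -(@setUv _ (`[0%R, +oo[%classic : set R)) ge0_integral_setU//=; last 3 first.
- exact: measurableC.
- by rewrite setUv; exact/measurable_EFinP.
- by apply/disj_setPS => y [].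
rewrite [X in (_ + X)%E]integral0_eq ?adde0; last first.
  move=> y /=; rewrite in_itv/= andbT => /negP; rewrite -ltNge => y0.
  by rewrite lt0_exponential_pdf.
rewrite -integral_itv_obnd_cbnd; last by apply: measurable_funTS; exact/measurable_EFinP.
move=> H; have : ((2 / rho)%:E * (\int[mu]_(x in `]0%R, +oo[) (exponential_pdf (rho / 2) x)%:E) = (2 / rho)%:E)%E.
  by rewrite H mule1.
move=> <-; rewrite -ge0_integralZl//; last 2 first.
- by apply: measurable_funTS; exact/measurable_EFinP.
- by rewrite lee_fin divr_ge0// ltW.
apply: eq_integral => y; rewrite inE/= in_itv/= andbT => y0.
rewrite exponential_pdfE ?(ltW y0)// -EFinM; congr EFin; field.
by rewrite gt_eqF.
Qed.

(** Half of the exponential decay is spent on the polynomial; the 6 is 3!, from u^3 / 3! <= e^u at u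
    = rho (x + y) / 2. *)
Lemma kp_bound_moment : exists2 C, 0 <= C &
  forall y, 0 < y -> kp_bound y * (x + y) ^+ 2 <= C * expR (- (rho / 2) * y).
Proof.
have r2 : 0 < rho / 2 by rewrite divr_gt0.
pose A := Num.sqrt (2 / pi) * x * expR (rho * x).
have A0 : 0 <= A by rewrite !mulr_ge0 ?sqrtr_ge0 ?expR_ge0.
exists (A * (6 / (rho / 2) ^+ 3 * expR (rho / 2 * x))).
  by rewrite mulr_ge0// mulr_ge0 ?expR_ge0// divr_ge0// exprn_ge0// ltW.
move=> y y0; have z0 : 0 <= rho / 2 * (x + y) by rewrite mulr_ge0 ?addr_ge0 ?ltW.
have e3 := expR_ge1Dxn 2 z0.
have h : (x + y) ^+ 3 <= 6 / (rho / 2) ^+ 3 * expR (rho / 2 * (x + y)).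
  rewrite mulrAC ler_pdivlMr ?exprn_gt0// mulrC -exprMn.
  move: e3; rewrite (_ : 3`!%:R = 6 :> R)//; set u := _ ^+ 3; set v := expR _ => e3.
  have : u / 6 <= v by lra.
  by rewrite ler_pdivrMr// mulrC.
rewrite /kp_bound -/A -!(mulrA A) ler_wpM2l//.
have -> : expR (- rho * y) = expR (- (rho / 2) * y) * expR (- (rho / 2) * y).
  by rewrite -expRD; congr expR; field.
have hh : y * (x + y) ^+ 2 <= 6 / (rho / 2) ^+ 3 * expR (rho / 2 * (x + y)).
  apply: le_trans h; rewrite exprS ler_wpM2r ?sqr_ge0// lerDr//.
set E := expR (- (rho / 2) * y).
have EE : expR (rho / 2 * (x + y)) * E = expR (rho / 2 * x) by rewrite /E -expRD; congr expR; ring.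
have E0 : 0 <= E * E by rewrite mulr_ge0 ?expR_ge0.
rewrite (_ : y * (E * E) * (x + y) ^+ 2 = y * (x + y) ^+ 2 * (E * E)); last by ring.
apply: (le_trans (ler_wpM2r E0 hh)).
by rewrite -EE le_eqVlt; apply/orP; left; apply/eqP; ring.
Qed.

Lemma measurable_kp_bound : measurable_fun setT kp_bound.
Proof.
apply: measurable_funM => //; apply: measurable_funM => //; apply: measurableT_comp => //.
Qed.

Lemma kp_bound_ge0 y : 0 < y -> 0 <= kp_bound y.
Proof. by move=> y0; rewrite !mulr_ge0 ?sqrtr_ge0 ?expR_ge0// ltW. Qed.

(** The error term of [kp_bounds] integrates to O(1 / t) thanks to [kp_bound_moment], so the limit
    is squeezed between two explicit bounds. *)
Lemma Qr_pos_cvg phi : bounded_fun phi ->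
  t * Num.sqrt t * expR (rho ^+ 2 / 2 * t) * Qr t phi @[t --> +oo] -->
    fine (\int[mu]_(y in `]0%R, +oo[) (kp_bound y * phi y)%:E)%E /\
  (\int[mu]_(y in `]0%R, +oo[) (kp_bound y * phi y)%:E < +oo)%E.
Proof.
move=> bp; have [mphi [K K0 phiK]] := bp; have [mp p0] := bfun bp.
pose D : set R := `]0%R, +oo[%classic.
have mD : measurable D by exact: measurable_itv.
pose c t := t * Num.sqrt t * expR (rho ^+ 2 / 2 * t).
have c0 t : 0 < t -> 0 <= c t by move=> t0; rewrite !mulr_ge0 ?sqrtr_ge0 ?expR_ge0 ?ltW.
pose I := (\int[mu]_(y in D) (kp_bound y * phi y)%:E)%E.
have [C C0 hC] := kp_bound_moment.
have mkp : measurable_fun D (fun y => (kp_bound y * phi y)%:E).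
  by apply: measurable_funTS; apply/measurable_EFinP; apply: measurable_funM => //; exact: measurable_kp_bound.
have kp0 y : D y -> (0%E <= (kp_bound y * phi y)%:E)%E.
  rewrite /D/= in_itv/= andbT => y0; rewrite lee_fin mulr_ge0 ?kp_bound_ge0//.
  by have /andP[] := phiK y.
have mQ t : measurable_fun D (fun y => (kp rho t x y)%:E * (EFin \o phi) y)%E.
  by apply: measurable_funTS; exact: measurable_kpM.
have Q0 t y : D y -> (0 <= (kp rho t x y)%:E * (EFin \o phi) y)%E.
  rewrite /D/= in_itv/= andbT => y0; rewrite -EFinM lee_fin mulr_ge0//; first by apply: kp_ge0 => //; exact: ltW.
  by have /andP[] := phiK y.
have cQ t : 0 < t -> ((c t * Qr t phi)%:E = \int[mu]_(y in D) ((c t)%:E * ((kp rho t x y)%:E * (EFin \o phi) y)))%E.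
  move=> t0; rewrite EFinM (QrE _ bp) /Q -ge0_integralZl//; [exact: mQ|exact: Q0|by rewrite lee_fin c0].
have up t : 0 < t -> ((c t * Qr t phi)%:E <= I)%E.
  move=> t0; rewrite cQ//; apply: ge0_le_integral => //.
  - by move=> y Dy; apply: mule_ge0; [rewrite lee_fin c0|exact: Q0].
  - by apply: measurable_funeM; exact: mQ.
  - move=> y; rewrite /D/= in_itv/= andbT => y0; rewrite -!EFinM lee_fin mulrA.
    by apply: ler_wpM2r; [have /andP[] := phiK y|have /andP[] := kp_bounds t0 y0].
pose E (y : R) : \bar R := (expR (- (rho / 2) * y))%:E.
have mE : measurable_fun D E.
  by apply: measurable_funTS; apply/measurable_EFinP; apply: measurableT_comp.
have lo t : 0 < t -> (I <= (c t * Qr t phi)%:E + (K * C / (2 * t) * (2 / rho))%:E)%E.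
  move=> t0; have Kt : 0 <= K * C / (2 * t) by rewrite divr_ge0 ?mulr_ge0// ltW.
  rewrite (EFinM (K * C / (2 * t))) -integral_exp_half cQ// -[X in (_ + X)%E]ge0_integralZl//.
  rewrite -ge0_integralD//; last 4 first.
  - by move=> y Dy; apply: mule_ge0; [rewrite lee_fin c0|exact: Q0].
  - by apply: measurable_funeM; exact: mQ.
  - by move=> y Dy; rewrite -EFinM lee_fin mulr_ge0 ?expR_ge0.
  - by apply: measurable_funeM.
  apply: ge0_le_integral => //.
  - by apply: emeasurable_funD; apply: measurable_funeM => //; exact: mQ.
  - move=> y; rewrite /D/= in_itv/= andbT => y0; rewrite -!EFinM -EFinD lee_fin.
    have /andP[f0 f1] := phiK y; have /andP[h _] := kp_bounds t0 y0; have hc := hC y y0.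
    rewrite -/(c t) in h; have kb := kp_bound_ge0 y0.
    have h1 := ler_wpM2r f0 h.
    have h2 : kp_bound y * ((x + y) ^+ 2 / (2 * t)) * phi y <= K * C / (2 * t) * expR (- (rho / 2) * y).
      rewrite (_ : kp_bound y * ((x + y) ^+ 2 / (2 * t)) * phi y = (kp_bound y * (x + y) ^+ 2) * phi y / (2 * t)); last by ring.
      rewrite (_ : K * C / (2 * t) * expR (- (rho / 2) * y) = C * expR (- (rho / 2) * y) * K / (2 * t)); last by ring.
      by rewrite ler_pM2r ?invr_gt0 ?mulr_gt0// ler_pM// mulr_ge0 ?sqr_ge0.
    rewrite (mulrA (c t)); apply: le_trans (lerD h1 h2).
    by rewrite le_eqVlt; apply/orP; left; apply/eqP; ring.
have I0 : (0 <= I)%E by apply: integral_ge0.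
(* The lower estimate at time 1 bounds the limiting integral by finite quantities. *)
have Ifin : (I < +oo)%E.
  by apply: (le_lt_trans (lo 1 ltr01)); rewrite -EFinD ltry.
have IE : I = (fine I)%:E by rewrite fineK// ge0_fin_numE.
split => //.
have ev : \forall t \near +oo, fine I - K * C / rho / t <= c t * Qr t phi <= fine I.
  exists 0; split => // t t0.
  have := up t t0; have := lo t t0; rewrite IE -EFinD !lee_fin => h1 h2; rewrite h2 andbT.
  rewrite lerBlDr; apply: (le_trans h1); rewrite lerD2l le_eqVlt; apply/orP; left; apply/eqP.
  by field; rewrite !gt_eqF.
apply: (squeeze_cvgr ev); last exact: cvg_cst.
rewrite -[X in _ --> X]subr0 -[X in _ --> _ - X](mulr0 (K * C / rho)).
apply: cvgB; first exact: cvg_cst.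
apply: cvgMr; apply/gtr0_cvgV0; [by exists 0; split => // t|exact: cvg_id].
Qed.

(** Up to a factor depending on [x], this is the limit in [Qr_pos_cvg] for the constant 1; dividing
    by it produces the [rho ^+ 2] of [Gamma]. *)
Lemma integral_y_exp : (\int[mu]_(y in `]0%R, +oo[) (y * expR (- rho * y))%:E = (rho ^- 2)%:E)%E.
Proof.
pose f (y : R) := y * expR (- rho * y).
pose F (y : R) := - (y / rho + rho ^- 2) * expR (- rho * y).
have cE : continuous (fun y : R => expR (- rho * y)).
  move=> y; apply: (@continuous_comp _ _ _ (fun y => - rho * y) expR); last exact: continuous_expR.
  by apply: cvgMr; exact: cvg_id.
have cf : continuous f by move=> y; apply: cvgM; [exact: cvg_id|exact: cE].
have dF (y : R) : is_derive y 1 F (f y).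
  rewrite /F; apply: is_derive_eq.
  by rewrite /f /GRing.scale/=; field; rewrite gt_eqF.
have cF : continuous F.
  move=> y; apply: differentiable_continuous; apply/derivable1_diffP; by case: (dF y).
(* The bound e^u >= 1 + u^2 / 2 at u = rho y gives y^2 e^(-rho y) <= 2 / rho^2, so F is O(1 / y). *)
have F0 : F y @[y --> +oo] --> (0 : R).
  have ev : \forall y \near +oo, - (2 / rho ^+ 3 + 2 / rho ^+ 4) / y <= F y <= 0.
    exists 1; split => // y y1; have y0 : 0 < y by exact: lt_trans y1.
    have z0 : 0 <= rho * y by rewrite mulr_ge0 ?ltW.
    have h := expR_ge1Dxn 1 z0; rewrite (_ : 2`!%:R = 2 :> R) in h => //.
    pose G := expR (- rho * y); have G0 : 0 < G by exact: expR_gt0.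
    have eG : expR (rho * y) * G = 1 by rewrite -expRD mulNr addrN expR0.
    have zG : (rho * y) ^+ 2 * G <= 2.
      have := ler_wpM2r (ltW G0) h; rewrite eG mulrDl mul1r => h'.
      by set u := (rho * y) ^+ 2 in h' *; lra.
    have r2 : 0 < rho ^+ 2 by rewrite exprn_gt0.
    have yG2 : y ^+ 2 * G <= 2 / rho ^+ 2.
      by rewrite ler_pdivlMr// (_ : y ^+ 2 * G * rho ^+ 2 = (rho * y) ^+ 2 * G)//; ring.
    have yG : y * G <= 2 / rho ^+ 2.
      by apply: le_trans yG2; rewrite ler_pM2r// expr2; apply: ler_peMr; exact: ltW.
    have Fn : F y = - ((y / rho + rho ^- 2) * G) by rewrite /F mulNr.
    rewrite Fn; apply/andP; split; last first.
      by rewrite oppr_le0 mulr_ge0 ?(ltW G0)// addr_ge0 ?divr_ge0 ?invr_ge0 ?(ltW y0) ?(ltW rho0) ?(ltW r2).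
    rewrite mulNr lerN2 ler_pdivlMr//.
    have -> : (y / rho + rho ^- 2) * G * y = (y ^+ 2 * G) / rho + (y * G) / rho ^+ 2 by ring.
    have -> : 2 / rho ^+ 3 = 2 / rho ^+ 2 / rho :> R by field; rewrite gt_eqF.
    have -> : 2 / rho ^+ 4 = 2 / rho ^+ 2 / rho ^+ 2 :> R by field; rewrite gt_eqF.
    by apply: lerD; rewrite ler_pM2r ?invr_gt0.
  apply: (squeeze_cvgr ev); last exact: cvg_cst.
  rewrite -[X in _ --> X](mulr0 (- (2 / rho ^+ 3 + 2 / rho ^+ 4))).
  apply: cvgMr; apply/gtr0_cvgV0; [by exists 0; split => // t|exact: cvg_id].
rewrite -[LHS]/(\int[mu]_(y in `]0%R, +oo[) (EFin \o f) y)%E integral_itv_obnd_cbnd; last first.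
  by apply: measurable_funTS; apply/measurable_EFinP; exact: continuous_measurable_fun.
rewrite (@ge0_continuous_FTC2y _ f F 0 0)//.
- by rewrite -EFinB sub0r /F mul0r add0r mulr0 expR0 mulr1 opprK.
- by move=> y y0; rewrite mulr_ge0 ?expR_ge0.
- exact: continuous_subspaceT.
- exact: (cvg_at_right_filter (cF 0)).
- by move=> y _; rewrite derive1E; exact: derive_val.
Qed.

End positive_drift.
End heat.

Lemma divr_cvg0 {R : realType} (K : R) : K / t @[t --> +oo] --> (0 : R).
Proof.
rewrite -[X in _ --> X](mulr0 K).
by apply: cvgMr; apply/gtr0_cvgV0; [exists 0; split => // t|exact: cvg_id].
Qed.

Section nonpositive_drift.
Context {R : realType}.
Variables (rho x : R).
Hypothesis x0 : 0 < x.
Local Notation mu := (@lebesgue_measure R).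
Local Notation Qr := (Qr rho x).

(** By [kp_bounds] the kernel is O(t^(-3/2)) on a bounded interval, so the mass there tends to 0
    even after multiplication by [Num.sqrt t]; [rho <= 0] bounds the exponential in [y] by its value
    at [M]. *)
Lemma Qr_indic_cvg0 M : rho <= 0 -> 0 < M ->
  Num.sqrt t * Qr t (\1_(`]-oo, M])) @[t --> +oo] --> (0 : R).
Proof.
move=> rho0 M0.
pose C := Num.sqrt (2 / pi) * x * expR (rho * x) * (M * expR (- rho * M)).
have C0 : 0 <= C by rewrite !mulr_ge0 ?sqrtr_ge0 ?expR_ge0// ltW.
have bM : bounded_fun (\1_(`]-oo, M]) : R -> R) by apply: bounded_indic; exact: measurable_itv.
have ev : \forall t \near +oo, 0 <= Num.sqrt t * Qr t (\1_(`]-oo, M])) <= C * M / t.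
  exists 0; split => // t t0; have st : 0 < Num.sqrt t by rewrite sqrtr_gt0.
  rewrite mulr_ge0 ?sqrtr_ge0 ?Qr_ge0//= mulrC -ler_pdivlMr//.
  rewrite (_ : C * M / t / Num.sqrt t = C / (t * Num.sqrt t) * M); last first.
    by rewrite invfM; ring.
  apply: Qr_indic_le => //; first by rewrite divr_ge0// mulr_ge0// ltW.
  move=> y y0 yM; have /andP[_ h] := kp_bounds rho x0 t0 y0.
  have c0 : 0 < t * Num.sqrt t by rewrite mulr_gt0.
  rewrite ler_pdivlMr//; apply: (@le_trans _ _ (kp_bound rho x y)).
    apply: le_trans h; rewrite mulrC ler_wpM2r//; first by apply: kp_ge0; exact: ltW.
    by apply: ler_peMr; [exact: ltW|rewrite -[leLHS]expR0 ler_expR mulr_ge0 ?(ltW t0)// divr_ge0 ?sqr_ge0].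
  apply: ler_wpM2l; first by rewrite !mulr_ge0 ?sqrtr_ge0 ?expR_ge0// ltW.
  apply: ler_pM => //; [exact: ltW|].
  by rewrite ler_expR ler_wpM2l// oppr_ge0.
by apply: (squeeze_cvgr ev); [exact: cvg_cst|exact: divr_cvg0].
Qed.

(** Completing both squares: the killed kernel is the drifted Gaussian started at [x] minus e^(2 rho
    x) times the one started at [- x]. *)
Lemma kp_split t y : 0 < t ->
  kp rho t x y + expR (2 * rho * x) * gauss t (y + (x + rho * t)) = gauss t (y + (rho * t - x)).
Proof.
move=> t0; rewrite /kp /gauss; set s := (Num.sqrt _)^-1.
have A : expR (rho * (x - y) - rho ^+ 2 * t / 2) * expR (- (x - y) ^+ 2 / (2 * t)) =
    expR (- (y + (rho * t - x)) ^+ 2 / (2 * t)).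
  by rewrite -expRD; congr expR; field; rewrite gt_eqF.
have B : expR (rho * (x - y) - rho ^+ 2 * t / 2) * expR (- (x + y) ^+ 2 / (2 * t)) =
    expR (2 * rho * x) * expR (- (y + (x + rho * t)) ^+ 2 / (2 * t)).
  by rewrite -!expRD; congr expR; field; rewrite gt_eqF.
by rewrite mulrBr !(mulrCA _ s) A B subrK.
Qed.

Definition gauss_tail t b : \bar R := (\int[mu]_(y in `]0%R, +oo[) (gauss t (y + b))%:E)%E.

Let mg t b (D : set R) : measurable_fun D (fun y : R => (gauss t (y + b))%:E).
Proof.
apply: measurable_funTS.
by apply/measurable_EFinP; apply: measurable_gauss => //; exact: measurable_funD.
Qed.

Let g0 t b (y : R) : (0 <= (gauss t (y + b))%:E)%E.
Proof. by rewrite lee_fin gauss_ge0. Qed.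

Let integral_shift t b : 0 < t -> (\int[mu]_y (gauss t (y + b))%:E = 1)%E.
Proof. by move=> t0; rewrite -[b]opprK; exact: integral_gaussB. Qed.

Lemma gauss_tail_itv t b : 0 < t -> (0 <= gauss_tail t b <= 1)%E.
Proof.
move=> t0; apply/andP; split; first by apply: integral_ge0.
rewrite -(integral_shift b t0); apply: ge0_subset_integral => //; exact: mg.
Qed.

Lemma Qr1_split t : 0 < t ->
  ((Qr t (cst 1))%:E + (expR (2 * rho * x))%:E * gauss_tail t (x + rho * t) = gauss_tail t (rho * t - x))%E.
Proof.
move=> t0; have b1 : bounded_fun (cst 1 : R -> R) by exact: bounded_cst.
rewrite (QrE rho x0 t b1) /Q /gauss_tail.
have mD : measurable (`]0%R, +oo[%classic : set R) by exact: measurable_itv.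
rewrite -ge0_integralZl//; last by first [exact: mg|rewrite lee_fin expR_ge0].
rewrite -ge0_integralD//.
- by apply: eq_integral => y _; rewrite mule1 -EFinM -EFinD kp_split.
- move=> y; rewrite /= in_itv/= andbT => y0; rewrite mule1 lee_fin kp_ge0// ltW//.
- by apply: measurable_funTS; apply: measurable_kpM; apply/measurable_EFinP; exact: measurable_cst.
- by move=> y _; rewrite -EFinM lee_fin mulr_ge0 ?expR_ge0 ?gauss_ge0.
- by apply: measurable_funeM; exact: mg.
Qed.

(* Chernoff bound for the complementary probability. *)
Lemma gauss_tail_ge t b lam : 0 < t -> 0 <= lam ->
  ((1 - expR (lam * b + lam ^+ 2 * t / 2))%:E <= gauss_tail t b)%E.
Proof.
move=> t0 l0; set e := expR _; pose D : set R := `]0%R, +oo[%classic.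
have mD : measurable D by exact: measurable_itv.
have H : (gauss_tail t b + \int[mu]_(y in ~` D) (gauss t (y + b))%:E = 1)%E.
  rewrite -(integral_shift b t0) -(setUv D) ge0_integral_setU//=.
  - exact: measurableC.
  - exact: mg.
  - by apply/disj_setPS => y [].
have L : (\int[mu]_(y in ~` D) (gauss t (y + b))%:E <= e%:E)%E.
  apply: (@le_trans _ _ (\int[mu]_(y in ~` D) (e%:E * (gauss t (y + (b + lam * t)))%:E))%E).
    apply: ge0_le_integral => //.
    - exact: measurableC.
    - exact: mg.
    - by apply: measurable_funeM; exact: mg.
    - move=> y; rewrite /D/= in_itv/= andbT => /negP; rewrite -leNgt => y0.
      rewrite -EFinM lee_fin /gauss mulrCA ler_wpM2l ?invr_ge0 ?sqrtr_ge0// /e -expRD ler_expR.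
      rewrite (_ : _ + - _ ^+ 2 / _ = - (y + b) ^+ 2 / (2 * t) - lam * y); last by field; rewrite gt_eqF.
      by rewrite lerDl oppr_ge0 mulr_ge0_le0.
  rewrite ge0_integralZl//; [|exact: measurableC|exact: mg|by rewrite lee_fin expR_ge0].
  rewrite -[leRHS]mule1; apply: lee_wpmul2l; first by rewrite lee_fin expR_ge0.
  rewrite -(integral_shift (b + lam * t) t0); apply: ge0_subset_integral => //; [exact: measurableC|exact: mg].
by rewrite EFinB leeBlDr// -H leeD2l.
Qed.

(** The drift [- rho] is positive, so both Gaussian tails of [Qr1_split] tend to 1, and e^(2 rho x)
    is the probability of ever hitting 0. With Chernoff parameter [- rho] both remainders, the first
    weighted by e^(2 rho x), equal the same [F]. *)
Lemma Qr1_neg_cvg : rho < 0 -> Qr t (cst 1) @[t --> +oo] --> 1 - expR (2 * rho * x).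
Proof.
move=> rho0; set E := expR (2 * rho * x).
pose C := expR (rho * x) * 2 / rho ^+ 2.
have r2 : 0 < rho ^+ 2 by rewrite exprn_even_gt0//= lt_eqF.
have ev : \forall t \near +oo, 1 - E - C / t <= Qr t (cst 1) <= 1 - E + C / t.
  exists 0; split => // t t0.
  have nr : 0 <= - rho by rewrite oppr_ge0 ltW.
  have := Qr1_split t0.
  have /andP[a0 a1] := gauss_tail_itv (x + rho * t) t0; have a2 := gauss_tail_ge (x + rho * t) t0 nr.
  have /andP[b0 b1] := gauss_tail_itv (rho * t - x) t0; have b2 := gauss_tail_ge (rho * t - x) t0 nr.
  move: a0 a1 a2 b0 b1 b2.
  case: (gauss_tail t (x + rho * t)) => // a; rewrite !lee_fin => a0 a1 a2.
  case: (gauss_tail t (rho * t - x)) => // b; rewrite !lee_fin => b0 b1 b2.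
  rewrite -/E -EFinM -EFinD => -[].
  pose F := expR (rho * x) * expR (- (rho ^+ 2 * t / 2)).
  (* From e^u >= u at u = rho^2 t / 2; the rate 1 / t is enough. *)
  have FC : F <= C / t.
    have u0 : 0 < rho ^+ 2 * t / 2 by rewrite divr_gt0// mulr_gt0.
    rewrite (_ : C / t = expR (rho * x) * (rho ^+ 2 * t / 2)^-1); last first.
      by rewrite /C; field; rewrite (lt_eqF rho0) (gt_eqF t0).
    rewrite /F ler_wpM2l ?expR_ge0// expRN lef_pV2 ?posrE ?expR_gt0//.
    by apply: le_trans (expR_ge1Dx _); rewrite lerDr.
  have aF : E * expR (- rho * (x + rho * t) + (- rho) ^+ 2 * t / 2) = F.
    by rewrite /E /F -!expRD; congr expR; field.
  have bF : expR (- rho * (rho * t - x) + (- rho) ^+ 2 * t / 2) = F.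
    by rewrite /F -expRD; congr expR; field.
  have E0 : 0 <= E by exact: expR_ge0.
  have ea1 := ler_wpM2l E0 a1; have ea2 := ler_wpM2l E0 a2.
  move: ea2 b2; rewrite mulrBr mulr1 aF bF; rewrite mulr1 in ea1.
  by move=> ea2 b2 qe; apply/andP; split; lra.
apply: (squeeze_cvgr ev).
  rewrite -[X in _ --> X]subr0; apply: cvgB; [exact: cvg_cst|exact: divr_cvg0].
rewrite -[X in _ --> X]addr0; apply: cvgD; [exact: cvg_cst|exact: divr_cvg0].
Qed.

Lemma gauss_tailE t b : gauss_tail t b = (\int[mu]_(z in `]b, +oo[) (gauss t z)%:E)%E.
Proof.
rewrite /gauss_tail integral_mkcond [RHS]integral_mkcond.
pose f (z : R) := ((fun z => (gauss t z)%:E) \_ `]b, +oo[) z.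
have mf : measurable_fun setT f.
  by apply/(measurable_restrictT _ (measurable_itv _)); apply: measurable_funTS;
    apply/measurable_EFinP; apply: measurable_gauss.
rewrite -[RHS](@ge0_integral_shift _ b f mf); last first.
  by move=> y; rewrite /f patchE; case: ifP => // _; rewrite lee_fin gauss_ge0.
apply: eq_integral => y _; rewrite /f !patchE !mem_setE/= !in_itv/= !andbT.
by rewrite -ltrBlDr subrr.
Qed.

(** Without drift the two tails of [Qr1_split] differ by the Gaussian mass of []- x, x]]. On it the
    density lies between its values at [x] and at 0, whose ratio is at least 1 - x^2 / (2 t). *)
Lemma Qr1_zero_cvg : rho = 0 ->
  Num.sqrt t * Qr t (cst 1) @[t --> +oo] --> Num.sqrt (2 / pi) * x.
Proof.
move=> rho0; set S := Num.sqrt (2 / pi).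
have p0 : 0 < (pi : R) by exact: pi_gt0.
have SE : S = 2 * (Num.sqrt (2 * pi))^-1.
  rewrite /S (_ : 2 / pi = 2 ^+ 2 * (2 * pi)^-1 :> R); last by rewrite invfM mulrA expr2 mulfK.
  by rewrite sqrtrM ?sqr_ge0// sqrtr_sqr ger0_norm// sqrtrV// mulr_ge0// ltW.
have ev : \forall t \near +oo, S * x - S * x * (x ^+ 2 / 2) / t <= Num.sqrt t * Qr t (cst 1) <= S * x.
  exists 0; split => // t t0; have st : 0 < Num.sqrt t by rewrite sqrtr_gt0.
  have mI : measurable (`]- x, x]%classic : set R) by exact: measurable_itv.
  have nx : - x < x by apply: lt_trans x0; rewrite oppr_lt0.
  have mux : mu `]- x, x] = (2 * x)%:E.
    by rewrite lebesgue_measure_itv/= lte_fin nx -EFinB; congr EFin; ring.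
  have Q1 : ((Qr t (cst 1))%:E = \int[mu]_(z in `](- x)%R, x%R]) (gauss t z)%:E)%E.
    have := Qr1_split t0; rewrite rho0 mulr0 mul0r expR0 mul1e mul0r addr0 sub0r.
    rewrite (gauss_tailE t (- x)).
    rewrite (_ : (`]- x, +oo[%classic : set R) = `]- x, x] `|` `]x, +oo[); last first.
      apply/seteqP; split => z /=; rewrite !in_itv/= !andbT.
        by move=> xz; case: (leP z x) => zx; [left; rewrite xz|right].
      by case=> [/andP[]//|xz]; apply: lt_trans xz.
    rewrite ge0_integral_setU//=; last 3 first.
    - by apply: measurable_funTS; apply/measurable_EFinP; apply: measurable_gauss.
    - by move=> z _; rewrite lee_fin gauss_ge0.
    - by apply/disj_setPS => z []/=; rewrite !in_itv/= andbT => /andP[_ h1] h2; move: (le_lt_trans h1 h2); rewrite ltxx.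
    rewrite -gauss_tailE; have /andP[a0 a1] := gauss_tail_itv x t0.
    move: a0 a1; case: (gauss_tail t x) => // a _ _ /(congr1 (fun u => u - a%:E)%E); rewrite !addeK //.
  have [lo hi] : (\int[mu]_(z in `](- x)%R, x%R]) (cst (gauss t x)%:E z) <= (Qr t (cst 1))%:E)%E /\
      ((Qr t (cst 1))%:E <= \int[mu]_(z in `](- x)%R, x%R]) (cst (gauss t 0)%:E z))%E.
    rewrite Q1; split; (apply: ge0_le_integral => //; [by move=> z _; rewrite lee_fin gauss_ge0| |]).
    + by apply: measurable_funTS; apply/measurable_EFinP; apply: measurable_gauss.
    + move=> z; rewrite /= in_itv/= => /andP[z1 z2]; rewrite lee_fin ler_wpM2l ?invr_ge0 ?sqrtr_ge0//.
      rewrite ler_expR ler_pM2r ?invr_gt0 ?mulr_gt0// lerN2 -subr_ge0 subr_sqr.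
      by rewrite mulr_ge0 ?subr_ge0//; lra.
    + by apply: measurable_funTS; apply/measurable_EFinP; apply: measurable_gauss.
    + move=> z _; rewrite lee_fin ler_wpM2l ?invr_ge0 ?sqrtr_ge0// ler_expR.
      by rewrite ler_pM2r ?invr_gt0 ?mulr_gt0// lerN2 expr0n/= sqr_ge0.
  have IC k : (\int[mu]_(z in `](- x)%R, x%R]) (cst k%:E z) = (k * (2 * x))%:E)%E.
    by rewrite EFinM -mux; exact: integral_cst.
  move: lo hi; rewrite !IC !lee_fin => lo hi.
  have gE z : Num.sqrt t * (gauss t z * (2 * x)) = S * x * expR (- z ^+ 2 / (2 * t)).
    rewrite /gauss sqrtrM ?mulr_ge0 ?pi_ge0// invfM SE.
    set E := expR _; set s := (Num.sqrt (2 * pi))^-1.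
    transitivity (Num.sqrt t * (Num.sqrt t)^-1 * (2 * s * x * E)); first by ring.
    by rewrite divff ?gt_eqF// mul1r.
  have := ler_wpM2l (ltW st) lo; have := ler_wpM2l (ltW st) hi; rewrite !gE.
  rewrite expr0n/= oppr0 mul0r expR0 mulr1 => h2 h1; rewrite h2 andbT; apply: le_trans h1.
  rewrite -[X in X - _]mulr1 -[X in _ - X]mulrA -mulrBr ler_wpM2l//.
    by rewrite mulr_ge0 ?sqrtr_ge0// ltW.
  apply: le_trans (expR_ge1Dx _); rewrite lerD2l le_eqVlt; apply/orP; left; apply/eqP.
  by field; rewrite gt_eqF.
apply: (squeeze_cvgr ev); last exact: cvg_cst.
rewrite -[X in _ --> X]subr0; apply: cvgB; [exact: cvg_cst|exact: divr_cvg0].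
Qed.

End nonpositive_drift.

(** * Convergence of the survival probability *)

Lemma near_pinfty_gt {R : realType} (N : R) : \forall t \near +oo, N < t.
Proof. by exists N; split => //; rewrite num_real. Qed.

Section sandwich_limit.
Context {R : realType}.
Variables (r theta l : R -> R) (a : R -> R -> R) (N0 : R).
Hypothesis theta1 : theta N @[N --> +oo] --> (1 : R).
Hypothesis r1 : \forall t \near +oo, r t <= 1.
Hypothesis ra : forall N, N0 <= N -> \forall t \near +oo, theta N * a N t <= r t <= a N t.
Hypothesis al : forall N, N0 <= N -> a N t @[t --> +oo] --> l N.
Hypothesis l0 : forall N, N0 <= N -> 0 < l N.

(** Comparing the bounds on [r t] for [N] and for [M] and letting [t] grow gives theta(N) l(N) <=
    l(M). So theta(N) l(N) <= G <= l(N) for the infimum [G] of all l(M), and both [l] and [r]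
    converge to [G]; [r t <= 1] keeps [l] bounded where theta is at least 1/2. *)
Lemma sandwich_limit : exists2 G : R, 0 < G & l N @[N --> +oo] --> G /\ r t @[t --> +oo] --> G.
Proof.
have tal N : N0 <= N -> theta N * a N t @[t --> +oo] --> theta N * l N.
  by move=> hN; apply: cvgMr; exact: al.
have cross N M : N0 <= N -> N0 <= M -> theta N * l N <= l M.
  move=> hN hM; apply: (ler_cvg_to (tal N hN) (al hM)).
  near=> t.
  have /andP[h _] : theta N * a N t <= r t <= a N t by near: t; exact: ra.
  have /andP[_ h'] : theta M * a M t <= r t <= a M t by near: t; exact: ra.
  exact: le_trans h h'.
have le1 N : N0 <= N -> theta N * l N <= 1.
  move=> hN; apply: (ler_cvg_to (tal N hN) (cvg_cst (1 : R))).
  near=> t.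
  have /andP[h _] : theta N * a N t <= r t <= a N t by near: t; exact: ra.
  by apply: (le_trans h); near: t.
pose S := [set l N | N in [set N | N0 <= N]].
have S0 : S !=set0 by exists (l N0); exists N0 => /=.
have lbS : has_lbound S by exists 0 => _ [N hN <-]; exact/ltW/l0.
pose G := inf S.
have Gle N : N0 <= N -> G <= l N by move=> hN; apply: ge_inf => //; exists N.
have Gge N : N0 <= N -> theta N * l N <= G.
  by move=> hN; apply: lb_le_inf => // _ [M hM <-]; exact: cross.
have close N e : N0 <= N -> 1 / 2 <= theta N -> `|1 - theta N| <= e -> l N - theta N * l N <= 2 * e.
  move=> hN t2 te; have lN := l0 hN.
  have h : 1 / 2 * l N <= theta N * l N by rewrite ler_pM2r.
  have l2 : l N <= 2 by have := le1 N hN; lra.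
  have h1 : l N * (1 - theta N) <= l N * `|1 - theta N| by rewrite ler_pM2l// ler_norm.
  have h2 : l N * `|1 - theta N| <= 2 * e by apply: ler_pM => //; exact: ltW.
  lra.
have ev e : 0 < e -> \forall N \near +oo, [/\ N0 <= N, 1 / 2 <= theta N & `|1 - theta N| <= e].
  move=> e0; have m0 : 0 < Num.min e (1 / 2) by rewrite lt_min e0 divr_gt0.
  have H := (cvgrPdist_le _ _).1 theta1 _ m0.
  near=> N; have : `|1 - theta N| <= Num.min e (1 / 2) by near: N; exact: H.
  rewrite le_min => /andP[h1 h2]; split => //; last by move: h2; rewrite ler_norml => /andP[]; lra.
exists G.
  have [N [hN tN _]] := filter_ex (ev 1 ltr01).
  by apply: (lt_le_trans _ (Gge N hN)); rewrite mulr_gt0 ?l0//; lra.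
split; apply/cvgrPdist_le => e e0.
  near=> N.
  have [hN tN te] : [/\ N0 <= N, 1 / 2 <= theta N & `|1 - theta N| <= e / 2].
    by near: N; apply: ev; rewrite divr_gt0.
  have := close N _ hN tN te; have := Gle N hN; have := Gge N hN.
  by rewrite ler_norml => h1 h2 h3; apply/andP; split; lra.
have e4 : 0 < e / 4 by rewrite divr_gt0.
have e2 : 0 < e / 2 by rewrite divr_gt0.
have [N [hN tN te]] := filter_ex (ev _ e4).
have A1 := (cvgrPdist_le _ _).1 (al hN) _ e2.
have A2 := (cvgrPdist_le _ _).1 (tal N hN) _ e2.
near=> t.
have /andP[h1 h2] : theta N * a N t <= r t <= a N t by near: t; exact: ra.
have : `|l N - a N t| <= e / 2 by near: t; exact: A1.
have : `|theta N * l N - theta N * a N t| <= e / 2 by near: t; exact: A2.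
rewrite !ler_norml => /andP[b1 b2] /andP[b3 b4].
have := close N _ hN tN te; have := Gle N hN; have := Gge N hN => g1 g2 g3.
by apply/andP; split; lra.
Unshelve. all: by end_near. Qed.

End sandwich_limit.

(** The semigroup runs for [t - N] while the normalisation is taken at [t]; [del] records the ratio,
    which is 1 for a slowly varying [c] and e^(rho^2 N / 2) for positive drift. *)
Lemma cvg_shift_normalizer {R : realType} (c f : R -> R) (N del L : R) :
  (forall t, 0 < t -> 0 < c t) ->
  c (t + N) / c t @[t --> +oo] --> del -> c t * f t @[t --> +oo] --> L ->
  c t * f (t - N) @[t --> +oo] --> del * L.
Proof.
move=> c0 cd cf.
have H : c (t + N) * f t @[t --> +oo] --> del * L.
  apply: cvg_trans (cvgM cd cf); apply: near_eq_cvg; near=> t.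
  have t0 : 0 < t by near: t; exact: near_pinfty_gt.
  by rewrite /= mulrA divfK// gt_eqF// c0.
have := @cvg_comp _ _ _ (fun t : R => t - N) (fun t => c (t + N) * f t) _ _ _ (cvg_addrr (- N)) H.
by rewrite (_ : _ \o _ = fun t => c t * f (t - N))//; apply/funext => t /=; rewrite subrK.
Unshelve. all: by end_near. Qed.

Section extinction_limits.
Context {R : realType} {d : measure_display} {T : measurableType d}.
Context {P : probability T R} {beta : R} {p : nat -> R}.
Variables (Y : bbm P beta p) (rho x : R).
Hypotheses (beta0 : 0 < beta) (pd : offspring_distribution p).
Hypotheses (m_gt0 : (0 < mean_offspring p)%E) (m_lt1 : (mean_offspring p < 1)%E).
Hypothesis LlogL : (\sum_(1 <= k <oo) (k%:R * ln k%:R * p k)%:E < +oo)%E.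
Hypothesis x0 : 0 < x.
Local Notation alpha := (decay_rate beta p).
Local Notation V := (surv Y rho setT).
Local Notation Qr := (Qr rho x).

Lemma bounded_surv N : bounded_fun (V N).
Proof.
split; last by exists 1 => // y; exact: surv_itv.
apply: (measurableT_comp (measurable_surv Y rho setT) (_ : measurable_fun setT (fun y : R => (N, y)))).
by apply: measurable_fun_pair; [exact: measurable_cst|exact: measurable_id].
Qed.

Definition scaled_surv N y : R := expR (alpha * N) * V N y.

Lemma bounded_scaled_surv N : bounded_fun (scaled_surv N).
Proof. by apply: boundedZ; [exact: expR_ge0|exact: bounded_surv]. Qed.

Lemma Qr_scaled_surv s N : Qr s (scaled_surv N) = expR (alpha * N) * Qr s (V N).
Proof. by apply: QrZ => //; exact: bounded_surv. Qed.

Let b1 : bounded_fun (cst 1 : R -> R). Proof. exact: bounded_cst. Qed.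

Lemma scaled_surv_le1 N y : 0 < N -> 0 < y -> scaled_surv N y <= 1.
Proof.
move=> N0 y0; rewrite /scaled_surv mulrC -ler_pdivlMr ?expR_gt0// mul1r -expRN -mulNr.
exact: surv_le_exp.
Qed.

Lemma scaled_surv_le_Qr t : 0 < t -> scaled_surv t x <= Qr t (cst 1).
Proof.
move=> t0; rewrite /scaled_surv mulrC -ler_pdivlMr ?expR_gt0// mulrC -expRN -mulNr -lee_fin EFinM.
by rewrite (QrE rho x0 t b1); exact: surv_le.
Qed.

(** V(N) is bounded below by the event of no branching before [N], and the semigroup recombines to
    time [t]. This makes every l(N) strictly positive. *)
Lemma Qr_scaled_surv_ge N t : 0 < N -> N < t ->
  expR (alpha * N) * expR (- beta * N) * Qr t (cst 1) <= Qr (t - N) (scaled_surv N).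
Proof.
move=> N0 Nt; rewrite Qr_scaled_surv -mulrA ler_wpM2l ?expR_ge0//.
have tN : 0 < t - N by rewrite subr_gt0.
have m1 : measurable_fun [set: R] (EFin \o cst 1 : R -> \bar R).
  by apply/measurable_EFinP; exact: measurable_cst.
have p1 (y : R) : 0 < y -> ((0 : \bar R) <= (EFin \o (cst 1%R : R -> R)) y)%E by move=> _; rewrite lee_fin.
rewrite -lee_fin EFinM (QrE rho x0 t b1) (QrE rho x0 (t - N) (bounded_surv N)).
pose F y := Q rho N (EFin \o cst 1) (Num.max y 0).
have -> : Q rho t (EFin \o cst 1) x = Q rho (t - N) F x.
  have := Q_semigroup rho m1 p1 tN N0 x0; rewrite subrK => <-.
  by apply: eq_Q => y y0; rewrite /F max_l// ltW.
have mQ : measurable_fun [set: R] F.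
  apply: (@measurable_Q _ _ R rho (cst N) (fun y => Num.max y 0) (fun _ => 1%:E)) => //.
  - exact: measurable_maxr.
  - by move=> y; rewrite le_max lexx orbT.
have Q0 (y : R) : 0 < y -> (0 <= F y)%E.
  by move=> y0; apply: Q_ge0; [exact: p1|rewrite le_max lexx orbT].
rewrite -(QZ rho (t - N) mQ (expR_ge0 _) Q0 (ltW x0)).
apply: le_Q; last exact: ltW.
- by apply: measurable_funeM.
- by apply/measurable_EFinP; have [] := bounded_surv N.
- by move=> y y0; apply: mule_ge0; [rewrite lee_fin expR_ge0|exact: Q0].
- by move=> y y0; rewrite /F max_l ?(ltW y0)//; exact: surv_ge.
Qed.

(** The part common to all signs of the drift: [c] normalises Q_t 1, and [l N] is the limit for the
    datum at time [N] relative to that for the constant 1. *)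
Lemma survival_limit (c : R -> R) (kap : R) (l : R -> R) : 0 < kap -> (forall t, 0 < t -> 0 < c t) ->
  c t * Qr t (cst 1) @[t --> +oo] --> kap ->
  (forall N, 0 < N -> c t * Qr (t - N) (scaled_surv N) @[t --> +oo] --> kap * l N) ->
  exists2 G : R, 0 < G & [/\ l N @[N --> +oo] --> G,
    c t * scaled_surv t x @[t --> +oo] --> kap * G &
    scaled_surv t x / Qr t (cst 1) @[t --> +oo] --> G].
Proof.
move=> kap0 c0 c1 cl.
have [N0 [N00 sand]] := surv_sandwich Y rho beta0 pd m_gt0 m_lt1 LlogL.
have q0 t : 0 <= Qr t (cst 1) by exact: Qr_ge0.
have qpos : \forall t \near +oo, 0 < Qr t (cst 1).
  have H := cvgr_gt _ c1 _ kap0.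
  near=> t; have : 0 < c t * Qr t (cst 1) by near: t; exact: H.
  have t0 : 0 < t by near: t; exact: near_pinfty_gt.
  by rewrite pmulr_rgt0// c0.
have aE N t : 0 < t -> Qr (t - N) (scaled_surv N) / Qr t (cst 1) =
    (c t * Qr (t - N) (scaled_surv N)) / (c t * Qr t (cst 1)).
  by move=> t0; rewrite -mulf_div divff ?mul1r// gt_eqF// c0.
have al N : 0 < N -> Qr (t - N) (scaled_surv N) / Qr t (cst 1) @[t --> +oo] --> l N.
  move=> hN; rewrite (_ : l N = kap * l N / kap); last by rewrite mulrC mulKf// gt_eqF.
  apply: cvg_trans (cvgM (cl N hN) (cvgV _ c1)); last by rewrite gt_eqF.
  apply: near_eq_cvg; near=> t; have t0 : 0 < t by near: t; exact: near_pinfty_gt.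
  by rewrite /= aE.
have [||||G G0 [lG rG]] := @sandwich_limit R (fun t => scaled_surv t x / Qr t (cst 1))
  (@theta R beta p) l (fun N t => Qr (t - N) (scaled_surv N) / Qr t (cst 1)) N0
  (theta_cvg beta0 pd m_gt0 m_lt1 LlogL).
- near=> t; have t0 : 0 < t by near: t; exact: near_pinfty_gt.
  have qt : 0 < Qr t (cst 1) by near: t.
  by rewrite ler_pdivrMr// mul1r scaled_surv_le_Qr.
- move=> N hN; near=> t.
  have Nt : N < t by near: t; exact: near_pinfty_gt.
  have [lo hi] := sand N t x hN Nt x0.
  move: lo hi; rewrite -(QrE rho x0 (t - N) (bounded_surv N)) -!EFinM !lee_fin => lo hi.
  have eE : expR (alpha * t) * expR (- alpha * (t - N)) = expR (alpha * N).
    by rewrite -expRD; congr expR; ring.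
  have et := expR_ge0 (alpha * t).
  rewrite mulrA !ler_wpM2r ?invr_ge0// Qr_scaled_surv -eE /scaled_surv.
    by have := ler_wpM2l et hi; rewrite mulrA.
  have := ler_wpM2l et lo; set th := @theta _ _ _ N; set A := expR (alpha * t); set B := expR _.
  by rewrite (_ : A * (th * B * _) = th * (A * B * Qr (t - N) (V N))); last ring.
- by move=> N hN; apply: al; exact: lt_le_trans hN.
- move=> N hN; have N1 : 0 < N by exact: lt_le_trans hN.
  have e0 : 0 < expR (alpha * N) * expR (- beta * N) by rewrite mulr_gt0 ?expR_gt0.
  rewrite -(pmulr_rgt0 _ kap0); apply: (lt_le_trans (mulr_gt0 e0 kap0)).
  apply: (ler_cvg_to (_ : (expR (alpha * N) * expR (- beta * N)) * (c t * Qr t (cst 1)) @[t --> +oo] --> _) (cl N N1)).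
    by apply: cvgMr.
  near=> t; have Nt : N < t by near: t; exact: near_pinfty_gt.
  have t0 : 0 < t by exact: lt_trans Nt.
  by rewrite mulrCA ler_wpM2l ?(ltW (c0 _ t0))//; exact: Qr_scaled_surv_ge.
exists G => //; split => //.
apply: cvg_trans (cvgM c1 rG); apply: near_eq_cvg; near=> t.
have qt : 0 < Qr t (cst 1) by near: t.
by rewrite /= -mulrA [Qr t _ * _]mulrC divfK ?gt_eqF.
Unshelve. all: by end_near. Qed.

(** V(N, y) increases with y, and by [alive_killed] the events for integer starting points exhaust
    survival without killing. Through this limit at infinity [C_sub] enters. *)
Lemma surv_cvg_pinfty N : 0 <= N -> V N y @[y --> +oo] --> survival_prob Y N.
Proof.
move=> N0; pose F (n : nat) := some_killed_alive Y rho setT n%:R N.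
pose Z := [set w | (N%:E < zeta Y w)%E].
have mF n : measurable (F n) by exact: measurable_some_killed_aliveT.
have ZE : Z = \bigcup_n F n.
  apply/seteqP; split => w.
    move=> /(zeta_gt Y w N0)[u /(alive_killed rho)[y hy]]; exists (Num.truncn y).+1 => //.
    by exists u => //; apply: hy; rewrite ltW// truncnS_gt.
  by move=> [n _ [u _ [au _]]]; apply/(zeta_gt Y w N0); exists u.
have mZ : measurable Z by rewrite ZE; apply: bigcup_measurable.
have ZP : ((survival_prob Y N)%:E = P Z)%E by rewrite /survival_prob fineK// fin_num_measure.
have ndF : nondecreasing_seq F.
  move=> n m nm; apply/subsetPset => w [u _ hu]; exists u => //; apply: killed_alive_mono hu.
  by rewrite ler_nat.
have up y : V N y <= survival_prob Y N.
  rewrite -lee_fin ZP survE; apply: le_measure; rewrite ?inE//; first exact: measurable_some_killed_aliveT.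
  by move=> w [u _ [au _]]; apply/(zeta_gt Y w N0); exists u.
have mono y z : y <= z -> V N y <= V N z.
  move=> yz; rewrite -lee_fin !survE; apply: le_measure; rewrite ?inE; try exact: measurable_some_killed_aliveT.
  by move=> w [u _ hu]; exists u => //; exact: killed_alive_mono hu.
have H : V N n%:R @[n --> \oo] --> survival_prob Y N.
  have H : P (F n) @[n --> \oo] --> P Z.
    by rewrite ZE; exact: (nondecreasing_cvg_mu mF (bigcup_measurable (fun n _ => mF n)) ndF).
  by rewrite -ZP in H; exact: (fine_cvg H).
apply/cvgrPdist_le => e e0.
have [n _ hn] := (cvgrPdist_le _ _).1 H _ e0.
have {hn} := hn n (leqnn n); rewrite ler_norml => /andP[_ hn].
exists n%:R; split => [|y ny]; first by rewrite num_real.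
have := mono _ _ (ltW ny); have := up y => h1 h2.
by rewrite ger0_norm ?subr_ge0//; apply: le_trans hn; rewrite lerD2l lerN2.
Qed.

Lemma killed_survival_probE y t : 0 <= t -> killed_survival_prob Y rho y t = V t y.
Proof.
move=> t0; rewrite /killed_survival_prob /surv; congr (fine (P _)).
apply/seteqP; split => w.
  by move=> /(killed_zeta_gt Y rho y w t0)[u hu]; exists u.
by move=> [u _ hu]; apply/(killed_zeta_gt Y rho y w t0); exists u.
Qed.

Lemma killed_mean_fineE t : 0 < t ->
  fine (killed_mean Y rho x t) = expR (- alpha * t) * Qr t (cst 1).
Proof. by move=> t0; rewrite killed_mean_eq// -[Q _ _ _ _](QrE rho x0 t b1) -EFinM. Qed.

(** By [killed_mean_eq] the mean is e^(-alpha t) Q_t 1, so the ratio in question is the one in the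
    hypothesis divided by [G]. *)
Lemma asymp_equiv_killed_mean (G : R) : 0 < G ->
  scaled_surv t x / Qr t (cst 1) @[t --> +oo] --> G ->
  asymp_equiv (killed_survival_prob Y rho x) (fun t => G * fine (killed_mean Y rho x t)).
Proof.
move=> G0 H; rewrite /asymp_equiv -[X in _ --> X](mulVf (negbT (gt_eqF G0))).
have H' : G^-1 * (scaled_surv t x / Qr t (cst 1)) @[t --> +oo] --> G^-1 * G by apply: cvgMr.
apply: cvg_trans H'; apply: near_eq_cvg; near=> t.
have t0 : 0 < t by near: t; exact: near_pinfty_gt.
rewrite killed_mean_fineE// killed_survival_probE ?ltW// /scaled_surv !invfM mulNr expRN invrK.
ring.
Unshelve. all: by end_near. Qed.

Lemma scaled_survival_cvg N : 0 < N ->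
  scaled_surv N y @[y --> +oo] --> expR (alpha * N) * survival_prob Y N /\
  0 <= expR (alpha * N) * survival_prob Y N <= 1.
Proof.
move=> N0; have H : scaled_surv N y @[y --> +oo] --> expR (alpha * N) * survival_prob Y N.
  by apply: cvgMr; apply: surv_cvg_pinfty; exact: ltW.
split=> //; apply/andP; split.
  by rewrite mulr_ge0 ?expR_ge0// fine_ge0.
apply: (ler_cvg_to H (cvg_cst (1 : R))).
near=> y; apply: scaled_surv_le1 => //; near: y; exact: near_pinfty_gt.
Unshelve. all: by end_near. Qed.

(* The normalisations c = sqrt (rho = 0) and c = 1 (rho < 0) vary slowly. *)
Lemma nonpositive_drift_limit (c : R -> R) (kap : R) : rho <= 0 -> 0 < kap ->
  (forall t, 0 < t -> 0 < c t) -> (\forall t \near +oo, c t <= Num.sqrt t) ->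
  (forall N, 0 < N -> c (t + N) / c t @[t --> +oo] --> (1 : R)) ->
  c t * Qr t (cst 1) @[t --> +oo] --> kap ->
  [/\ 0 < C_sub Y, c t * scaled_surv t x @[t --> +oo] --> kap * C_sub Y &
    scaled_surv t x / Qr t (cst 1) @[t --> +oo] --> C_sub Y].
Proof.
move=> rho0 kap0 c0 csqrt cN c1.
have c0' : \forall t \near +oo, 0 <= c t.
  by near=> t; apply/ltW/c0; near: t; exact: near_pinfty_gt.
have small M : 0 < M -> c t * Qr t (\1_(`]-oo, M])) @[t --> +oo] --> (0 : R).
  move=> M0; have bM : bounded_fun (\1_(`]-oo, M]) : R -> R) by apply: bounded_indic; exact: measurable_itv.
  have ev : \forall t \near +oo, 0 <= c t * Qr t (\1_(`]-oo, M])) <= Num.sqrt t * Qr t (\1_(`]-oo, M])).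
    near=> t; have ct : 0 <= c t by near: t.
    rewrite mulr_ge0 ?Qr_ge0//= ler_wpM2r ?Qr_ge0//; by near: t.
  by apply: (squeeze_cvgr ev); [exact: cvg_cst|exact: Qr_indic_cvg0].
have [|G G0 [lG cG rG]] := survival_limit (l := fun N => expR (alpha * N) * survival_prob Y N) kap0 c0 c1.
  move=> N N0; have [sN sN1] := scaled_survival_cvg N0.
  rewrite -[X in _ --> X]mul1r; apply: (@cvg_shift_normalizer R c (fun t => Qr t (scaled_surv N)) N 1 _ c0 (cN N N0)).
  exact: (Qr_limit x0 (bounded_scaled_surv N) sN1 sN c0' c1 small).
(* The existence of the limit that defines [C_sub] is obtained here, as the convergence of [l]. *)
have CG : C_sub Y = G by apply: cvg_lim.
by rewrite CG.
Unshelve. all: by end_near. Qed.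

End extinction_limits.

Section shift_ratios.
Context {R : realType}.

Lemma shift_ratio_cvg (N : R) : (t + N) / t @[t --> +oo] --> (1 : R).
Proof.
rewrite -[X in _ --> X]addr0; apply: cvg_trans (cvgD (cvg_cst (1 : R)) (divr_cvg0 N)).
apply: near_eq_cvg; near=> t; have t0 : 0 < t by near: t; exact: near_pinfty_gt.
by rewrite /= mulrDl divff// gt_eqF.
Unshelve. all: by end_near. Qed.

Lemma shift_ratio_sqrt_cvg (N : R) : Num.sqrt (t + N) / Num.sqrt t @[t --> +oo] --> (1 : R).
Proof.
have := @cvg_comp _ _ _ (fun t : R => (t + N) / t) Num.sqrt _ _ _ (shift_ratio_cvg N) (@sqrt_continuous R 1).
rewrite sqrtr1; apply: cvg_trans; apply: near_eq_cvg; near=> t.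
have t0 : 0 < t by near: t; exact: near_pinfty_gt.
have tN : 0 <= t + N by rewrite -lerBlDr sub0r ltW//; near: t; exact: near_pinfty_gt.
by rewrite /= sqrtrM// sqrtrV// ltW.
Unshelve. all: by end_near. Qed.

End shift_ratios.

Section positive_drift_limit.
Context {R : realType} {d : measure_display} {T : measurableType d}.
Context {P : probability T R} {beta : R} {p : nat -> R}.
Variables (Y : bbm P beta p) (rho x : R).
Hypotheses (beta0 : 0 < beta) (pd : offspring_distribution p).
Hypotheses (m_gt0 : (0 < mean_offspring p)%E) (m_lt1 : (mean_offspring p < 1)%E).
Hypothesis LlogL : (\sum_(1 <= k <oo) (k%:R * ln k%:R * p k)%:E < +oo)%E.
Hypotheses (x0 : 0 < x) (rho0 : 0 < rho).
Local Notation mu := (@lebesgue_measure R).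
Local Notation alpha := (decay_rate beta p).
Local Notation A := (Num.sqrt (2 / pi) * x * expR (rho * x)).
Local Notation c := (fun t => t * Num.sqrt t * expR (rho ^+ 2 / 2 * t)).

Let A0 : 0 < A.
Proof. by rewrite !mulr_gt0 ?expR_gt0// sqrtr_gt0 divr_gt0// pi_gt0. Qed.

Lemma moment_scaleZ (k : R) (phi : R -> R) : 0 < k -> bounded_fun phi ->
  fine (\int[mu]_(y in `]0%R, +oo[) (y * expR (- rho * y) * (k * phi y))%:E)%E =
  k * fine (\int[mu]_(y in `]0%R, +oo[) (y * expR (- rho * y) * phi y)%:E)%E.
Proof.
move=> k0 [mp [K K0 phiK]].
rewrite (_ : (\int[mu]_(y in _) (_ * (k * _))%:E = k%:E * (\int[mu]_(y in `]0%R, +oo[)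
  (y * expR (- rho * y) * phi y)%:E))%E).
  (* [fine] sends infinite values to 0, so it commutes with the scaling in every case. *)
  by case: (integral _ _ _) => [r||]; rewrite ?gt0_muley ?gt0_muleNy ?lte_fin//= ?mulr0.
rewrite -ge0_integralZl//.
- by apply: eq_integral => y _; rewrite -EFinM; congr EFin; ring.
- apply: measurable_funTS; apply/measurable_EFinP; apply: measurable_funM => //.
  by apply: measurable_funM => //; apply: measurableT_comp.
- move=> y; rewrite /= in_itv/= andbT => y0; have /andP[h _] := phiK y.
  by rewrite lee_fin !mulr_ge0 ?expR_ge0// ltW.
- by rewrite lee_fin ltW.
Qed.

Lemma moment_kp_bound (phi : R -> R) : bounded_fun phi ->
  fine (\int[mu]_(y in `]0%R, +oo[) (kp_bound rho x y * phi y)%:E)%E =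
  A * fine (\int[mu]_(y in `]0%R, +oo[) (y * expR (- rho * y) * phi y)%:E)%E.
Proof.
move=> bp; rewrite -moment_scaleZ//; congr fine.
by apply: eq_integral => y _; rewrite /kp_bound; congr EFin; ring.
Qed.

Lemma C_0_approxE N : 0 <= N -> C_0_approx Y rho N = expR ((alpha + rho ^+ 2 / 2) * N) *
  fine (\int[mu]_(y in `]0%R, +oo[) (y * expR (- rho * y) * surv Y rho setT N y)%:E)%E.
Proof.
move=> N0; rewrite /C_0_approx /Rintegral; congr (_ * fine _).
by apply: eq_integral => y _; rewrite killed_survival_probE.
Qed.

(** The normalised kernel converges to an integrable function of [y], so the datum enters through
    its integral and not through its value at infinity. Relative to the constant 1 this is
    [rho ^+ 2 * C_0_approx], whose limit is [G]. *)
Lemma positive_drift_limit : exists2 G : R, 0 < G &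
  [/\ C_0_approx Y rho N @[N --> +oo] --> rho ^- 2 * G,
    c t * scaled_surv Y rho t x @[t --> +oo] --> A * (rho ^- 2 * G) &
    scaled_surv Y rho t x / Qr rho x t (cst 1) @[t --> +oo] --> G].
Proof.
have r2 : 0 < rho ^- 2 by rewrite invr_gt0 exprn_gt0.
have c0 t : 0 < t -> 0 < c t by move=> t0; rewrite !mulr_gt0 ?expR_gt0 ?sqrtr_gt0.
have b1 : bounded_fun (cst 1 : R -> R) by exact: bounded_cst.
have c1 : c t * Qr rho x t (cst 1) @[t --> +oo] --> A * rho ^- 2.
  have [H _] := Qr_pos_cvg x0 rho0 b1; move: H; rewrite moment_kp_bound//.
  under eq_integral do rewrite mulr1.
  by rewrite integral_y_exp.
(* The normalisation is not slowly varying; its ratio supplies the factor e^(rho^2 N / 2) of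
   [C_0_approx]. *)
have cN N : c (t + N) / c t @[t --> +oo] --> expR (rho ^+ 2 / 2 * N).
  rewrite (_ : expR (rho ^+ 2 / 2 * N) = 1 * 1 * expR (rho ^+ 2 / 2 * N)); last by rewrite !mul1r.
  have H : (t + N) / t * (Num.sqrt (t + N) / Num.sqrt t) * expR (rho ^+ 2 / 2 * N) @[t --> +oo] -->
      1 * 1 * expR (rho ^+ 2 / 2 * N).
    apply: cvgM; last exact: cvg_cst.
    by apply: cvgM; [exact: shift_ratio_cvg|exact: shift_ratio_sqrt_cvg].
  apply: cvg_trans H; apply: near_eq_cvg; near=> t.
  have t0 : 0 < t by near: t; exact: near_pinfty_gt.
  rewrite /= mulrDr expRD !invfM.
  have e1 : expR (rho ^+ 2 / 2 * t) / expR (rho ^+ 2 / 2 * t) = 1 by rewrite divff// gt_eqF ?expR_gt0.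
  set E := expR _ in e1 *; set F := expR _.
  by rewrite -[LHS]mulr1 -e1; ring.
have cl N : 0 < N -> c t * Qr rho x (t - N) (scaled_surv Y rho N) @[t --> +oo] -->
    A * rho ^- 2 * (rho ^+ 2 * C_0_approx Y rho N).
  move=> N0; have bV := bounded_surv Y rho N.
  have [H _] := Qr_pos_cvg x0 rho0 (bounded_scaled_surv Y rho N).
  have := cvg_shift_normalizer (f := fun t => Qr rho x t (scaled_surv Y rho N)) c0 (cN N) H.
  suff -> : expR (rho ^+ 2 / 2 * N) * fine (\int[mu]_(y in `]0%R, +oo[)
      (kp_bound rho x y * scaled_surv Y rho N y)%:E)%E = A * rho ^- 2 * (rho ^+ 2 * C_0_approx Y rho N) by [].
  rewrite moment_kp_bound; last exact: bounded_scaled_surv.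
  have -> : fine (\int[mu]_(y in `]0%R, +oo[) (y * expR (- rho * y) * scaled_surv Y rho N y)%:E)%E =
      expR (alpha * N) * fine (\int[mu]_(y in `]0%R, +oo[) (y * expR (- rho * y) * surv Y rho setT N y)%:E)%E.
    by apply: moment_scaleZ => //; exact: expR_gt0.
  rewrite C_0_approxE ?ltW// (mulrDl alpha) expRD; set I := fine _.
  rewrite (_ : A * rho ^- 2 * (rho ^+ 2 * _) = (rho ^- 2 * rho ^+ 2) * (A *
    (expR (alpha * N) * expR (rho ^+ 2 / 2 * N) * I))); last by ring.
  by rewrite mulVf ?mul1r ?sqrf_eq0 ?gt_eqF//; ring.
have [G G0 [lG cG rG]] := survival_limit beta0 pd m_gt0 m_lt1 LlogL x0
  (mulr_gt0 A0 r2) c0 c1 (l := fun N => rho ^+ 2 * C_0_approx Y rho N) cl.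
exists G => //; split => //; last by rewrite mulrA.
have H : rho ^- 2 * (rho ^+ 2 * C_0_approx Y rho N) @[N --> +oo] --> rho ^- 2 * G by apply: cvgMr.
apply: cvg_trans H; apply: near_eq_cvg; apply: nearW => N.
by rewrite mulKf// sqrf_eq0 gt_eqF.
Unshelve. all: by end_near. Qed.

End positive_drift_limit.

Theorem theorem1p1 (R : realType) (d : measure_display) (T : measurableType d)
    (P : probability T R) (beta : R) (p : nat -> R) (Y : bbm P beta p)
    (rho x : R)
    (beta_gt0 : 0 < beta)
    (p_distr : offspring_distribution p)
    (m_gt0 : (0 < mean_offspring p)%E)
    (m_lt1 : (mean_offspring p < 1)%E)
    (LlogL : (\sum_(1 <= k <oo) (k%:R * ln k%:R * p k)%:E < +oo)%E)
    (x_gt0 : 0 < x) :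
  let alpha := decay_rate beta p in
  let q := killed_survival_prob Y rho x in
  [/\ rho = 0 ->
        Num.sqrt t * expR (alpha * t) * q t @[t --> +oo]
          --> Num.sqrt (2 / pi) * C_sub Y * x,
      rho < 0 ->
        expR (alpha * t) * q t @[t --> +oo]
          --> C_sub Y * (1 - expR (2 * rho * x)),
      0 < rho ->
        [/\ C_0_approx Y rho N @[N --> +oo] --> C_0 Y rho,
            0 < C_0 Y rho
          & t `^ (3 / 2) * expR ((alpha + rho ^+ 2 / 2) * t) * q t @[t --> +oo]
              --> Num.sqrt (2 / pi) * C_0 Y rho * x * expR (rho * x)]
    & asymp_equiv q
        (fun t => Gamma Y rho * fine (killed_mean Y rho x t))].
Proof.
move=> alpha q.
have asymp (G : R) : 0 < G -> scaled_surv Y rho t x / Qr rho x t (cst 1) @[t --> +oo] --> G ->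
    asymp_equiv q (fun t => G * fine (killed_mean Y rho x t)).
  exact: asymp_equiv_killed_mean.
(* Q_t 1 is normalised by 1 for negative [rho], by t^(3/2) e^(rho^2 t / 2) for positive [rho], and
   by the square root of t for [rho = 0]. *)
have [rho0|rho0|rho0] := ltgtP rho 0.
- have e0 : 0 < 1 - expR (2 * rho * x).
    by rewrite subr_gt0 expR_lt1 -mulrA pmulr_rlt0// nmulr_rlt0.
  have [||N N0||C0 cG rG] := @nonpositive_drift_limit _ _ _ _ _ _ Y rho x beta_gt0 p_distr m_gt0 m_lt1
    LlogL x_gt0 (cst 1) _ (ltW rho0) e0.
  + by [].
  + near=> t; rewrite /= -[leLHS]sqrtr1 ler_wsqrtr// ltW//; near: t; exact: near_pinfty_gt.
  + by rewrite /= divr1; exact: cvg_cst.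
  + by under eq_fun do rewrite mul1r; exact: Qr1_neg_cvg.
  split => [r0|_|//|]; first by move: rho0; rewrite r0 ltxx.
    rewrite mulrC; apply: cvg_trans cG; apply: near_eq_cvg; near=> t.
    have t0 : 0 < t by near: t; exact: near_pinfty_gt.
    by rewrite mul1r /scaled_surv /q killed_survival_probE// ltW.
  by rewrite /Gamma (ltW rho0); exact: asymp.
- have [G G0 [aG cG rG]] := positive_drift_limit Y beta_gt0 p_distr m_gt0 m_lt1 LlogL x_gt0 rho0.
  have CE : C_0 Y rho = rho ^- 2 * G by apply: cvg_lim.
  split => [r0|//|_|]; first by move: rho0; rewrite r0 ltxx.
    rewrite CE; split => //; first by rewrite mulr_gt0// invr_gt0 exprn_gt0.
    rewrite (_ : Num.sqrt (2 / pi) * _ * x * _ = Num.sqrt (2 / pi) * x * expR (rho * x) * (rho ^- 2 * G)); last by ring.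
    apply: cvg_trans cG; apply: near_eq_cvg; near=> t.
    have t0 : 0 < t by near: t; exact: near_pinfty_gt.
    rewrite powR_three_half// /q killed_survival_probE ?ltW// /scaled_surv -/alpha mulrDl expRD.
    ring.
  (* As [C_0] is [rho ^- 2 * G], the constant [Gamma] is [G] itself. *)
  rewrite /Gamma leNgt rho0 /= CE mulrA divff ?mul1r; last by rewrite sqrf_eq0 gt_eqF.
  exact: asymp.
- have k0 : 0 < Num.sqrt (2 / pi) * x by rewrite mulr_gt0// sqrtr_gt0 divr_gt0// pi_gt0.
  have r0 : rho <= 0 by rewrite rho0.
  have [||N N0||C0 cG rG] := @nonpositive_drift_limit _ _ _ _ _ _ Y rho x beta_gt0 p_distr m_gt0 m_lt1
    LlogL x_gt0 Num.sqrt _ r0 k0.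
  + by move=> t t0; rewrite sqrtr_gt0.
  + by apply: nearW.
  + exact: shift_ratio_sqrt_cvg.
  + exact: Qr1_zero_cvg.
  split => [_|//|//|].
    rewrite mulrAC; apply: cvg_trans cG; apply: near_eq_cvg; near=> t.
    have t0 : 0 < t by near: t; exact: near_pinfty_gt.
    by rewrite /scaled_surv /q killed_survival_probE ?ltW// mulrA.
  by rewrite /Gamma r0; exact: asymp.
Unshelve. all: by end_near. Qed.
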